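(* Assume that (A1), (A2), (A3) hold and that $\xi$ drifts to $-\infty$. Let $K\ge1$ be an integer such that $\{1,\dots,K\}$ is accessible by $X_n$ for every $n\ge1$. (i) $A^{(K)}_n/a_n$ converges in distribution to $\int_0^\infty e^{\gamma\xi(s)}ds$ as $n\to\infty$, and this holds jointly with the convergence in distribution of $\left(X^\dagger_n(\lfloor a_nt\rfloor)/n;\ t\ge0\right)$ to $(Y(t);t\ge0)$ in $\mathbb D(\mathbb R_+,\mathbb R)$ (the limits $Y$ and $\int_0^\infty e^{\gamma\xi(s)}ds$ being built from the same $\xi$). (ii) If moreover (A4) holds with some $\beta_0$, and $\sum_{k\ge1}k^{\beta_0}p_{n,k}<\infty$ for every $n\ge K+1$, then $\mathbb E[A^{(K)}_n]/a_n\to 1/|\Psi(\gamma)|$ as $n\to\infty$.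
   Context: Let $\mathbb N=\{1,2,\dots\}$. For every $n\ge1$ let $(p_{n,k})_{k\ge1}$ be nonnegative reals with $\sum_{k\ge1}p_{n,k}=1$, and let $(X_n(k))_{k\ge0}$ be the discrete-time Markov chain on $\mathbb N$ with $X_n(0)=n$ and $\mathbb P(X_n(k+1)=j\mid X_n(k)=i)=p_{i,j}$. Let $\Pi_n^*(dx)=\sum_{k\ge1}p_{n,k}\,\delta_{\ln k-\ln n}(dx)$. Let $(a_n)_{n\ge0}$ be positive reals, regularly varying with index $\gamma>0$, i.e. $a_{\lfloor xn\rfloor}/a_n\to x^\gamma$ for every $x>0$. Let $\Pi$ be a measure on $\mathbb R\setminus\{0\}$ with $\Pi(\{-1,1\})=0$ and $\int(1\wedge x^2)\,\Pi(dx)<\infty$. (A1): for every continuous $f$ with compact support in $[0,\infty]\setminus\{1\}$, $a_n\,\mathbb E[f(X_n(1)/n)]\to\int_{\mathbb R}f(e^x)\,\Pi(dx)$. (A2): there exist $b\in\mathbb R$, $\sigma^2\ge0$ with $a_n\int_{-1}^1x\,\Pi_n^*(dx)\to b$ and $a_n\int_{-1}^1x^2\,\Pi_n^*(dx)\to\sigma^2+\int_{-1}^1x^2\,\Pi(dx)$. (A3): there exists $\beta>0$ with $\limsup_{n}a_n\int_1^\infty e^{\beta x}\,\Pi_n^*(dx)<\infty$. Let $\Psi(\lambda)=\frac12\sigma^2\lambda^2+b\lambda+\int(e^{\lambda x}-1-\lambda x\mathbb 1_{|x|\le1})\,\Pi(dx)$ for those $\lambda$ where this is finite. (A4): there exists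 $\beta_0>\gamma$ with $\limsup_n a_n\int_1^\infty e^{\beta_0x}\,\Pi_n^*(dx)<\infty$ and $\Psi(\beta_0)<0$. Let $\xi$ be the Lévy process with $\xi(0)=0$ and $\mathbb E[e^{i\lambda\xi(t)}]=e^{t\Phi(\lambda)}$, $\Phi(\lambda)=-\frac12\sigma^2\lambda^2+ib\lambda+\int(e^{i\lambda x}-1-i\lambda x\mathbb 1_{|x|\le1})\,\Pi(dx)$ (so $\mathbb E[e^{\lambda\xi(t)}]=e^{t\Psi(\lambda)}$ when finite); $\xi$ drifts to $-\infty$ if $\xi(t)\to-\infty$ a.s. Let $I_\infty=\int_0^\infty e^{\gamma\xi(s)}ds$, $\tau(t)=\inf\{u\ge0:\int_0^ue^{\gamma\xi(s)}ds>t\}$, $Y(t)=e^{\xi(\tau(t))}$ for $t<I_\infty$ and $Y(t)=0$ for $t\ge I_\infty$. $\{1,\dots,K\}$ is accessible by $X_n$ if with positive probability $X_n(i)\le K$ for some $i\ge0$. $A^{(K)}_n=\inf\{k\ge1:X_n(k)\le K\}$ ($\inf\emptyset=\infty$), $X^\dagger_n(k)=X_n(k\wedge A^{(K)}_n)$. $\mathbb D(\mathbb R_+,\mathbb R)$ carries the Skorokhod $J_1$ topology. *)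

(* Defs.v *)
From HB Require Import structures.
From mathcomp Require Import all_boot all_order all_algebra.
From mathcomp Require Import all_classical all_reals all_analysis.
Set Implicit Arguments. Unset Strict Implicit. Unset Printing Implicit Defensive.
Import Order.TTheory GRing.Theory Num.Theory.
Import numFieldNormedType.Exports.
Local Open Scope classical_set_scope.
Local Open Scope ring_scope.

Section Defs.
Variable R : realType.

Definition is_kernel (p : nat -> nat -> R) : Prop :=
  forall n, (1 <= n)%N ->
    p n 0%N = 0 /\ (forall k, 0 <= p n k) /\
    series (fun k => p n k) @ \oo --> (1 : R).

(* real-valued sum  \int g dPi_n^*  = sum_k p_{n,k} g(ln k - ln n)
   (used only for integrands making the series absolutely convergent) *)
Definition Pistar (p : nat -> nat -> R) (n : nat) (g : R -> R) : R :=
  limn (series (fun k => p n k * g (ln k%:R - ln n%:R))).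

Definition ePistar (p : nat -> nat -> R) (n : nat) (g : R -> R) : \bar R :=
  (\sum_(0 <= k <oo) ((p n k * g (ln k%:R - ln n%:R))%:E))%E.

Definition Estep (p : nat -> nat -> R) (n : nat) (f : R -> R) : R :=
  limn (series (fun k => p n k * f (k%:R / n%:R))).

Definition reg_var (a : nat -> R) (gamma : R) : Prop :=
  (forall n, 0 < a n) /\
  forall x : R, 0 < x ->
    (fun n => a (Num.truncn (x * n%:R)) / a n) @ \oo --> x `^ gamma.

(* continuous functions with compact support in [0,+oo] \ {1}
   (continuous on [0,+oo), with a finite limit at +oo, vanishing near 1);
   values on (-oo,0) are irrelevant *)
Definition test_fun (f : R -> R) : Prop :=
  {within [set x : R | 0 <= x], continuous f} /\
  cvg (f @ +oo) /\
  exists2 d : R, 0 < d & forall x, `|x - 1| < d -> f x = 0.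

(* Levy measure: measure on R with Pi{0} = 0 (i.e. on R \ {0}) *)
Definition levy_measure (Pi : {measure set R -> \bar R}) : Prop :=
  Pi [set 0] = 0%E /\ Pi [set x | x = -1 \/ x = 1] = 0%E /\
  (\int[Pi]_x (Num.min 1 (x ^+ 2))%:E < +oo)%E.

Definition ind (b : bool) : R := if b then 1 else 0.

Definition A1 (p : nat -> nat -> R) (a : nat -> R)
   (Pi : {measure set R -> \bar R}) : Prop :=
  forall f, test_fun f ->
    (fun n => a n * Estep p n f) @ \oo -->
      Rintegral Pi setT (fun x => f (expR x)).

Definition A2 (p : nat -> nat -> R) (a : nat -> R)
   (Pi : {measure set R -> \bar R}) (b sigma2 : R) : Prop :=
  (fun n => a n * Pistar p n (fun x => ind (`|x| <= 1) * x)) @ \oo --> b /\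
  (fun n => a n * Pistar p n (fun x => ind (`|x| <= 1) * x ^+ 2)) @ \oo -->
     sigma2 + Rintegral Pi `[-1, 1] (fun x => x ^+ 2).

Definition exp_moment_bound (p : nat -> nat -> R) (a : nat -> R) (beta : R) :=
  (limn_esup (fun n => (a n)%:E *
      ePistar p n (fun x => (ind (1 < x) * expR (beta * x))%R)) < +oo)%E.

Definition A3 p a : Prop := exists2 beta : R, 0 < beta & exp_moment_bound p a beta.

Definition psi_integrand (lam : R) (x : R) : R :=
  expR (lam * x) - 1 - lam * x * ind (`|x| <= 1).

Definition Psi (Pi : {measure set R -> \bar R}) (b sigma2 lam : R) : R :=
  sigma2 * lam ^+ 2 / 2 + b * lam + Rintegral Pi setT (psi_integrand lam).

Definition Psi_finite (Pi : {measure set R -> \bar R}) (lam : R) : Prop :=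
  Pi.-integrable setT (fun x => (psi_integrand lam x)%:E).

Definition A4 p a (Pi : {measure set R -> \bar R}) b sigma2 gamma beta0 : Prop :=
  gamma < beta0 /\ exp_moment_bound p a beta0 /\
  Psi_finite Pi beta0 /\ Psi Pi b sigma2 beta0 < 0.

Definition RePhi (Pi : {measure set R -> \bar R}) (sigma2 lam : R) : R :=
  - (sigma2 * lam ^+ 2 / 2) + Rintegral Pi setT (fun x => cos (lam * x) - 1).
Definition ImPhi (Pi : {measure set R -> \bar R}) (b lam : R) : R :=
  b * lam + Rintegral Pi setT (fun x => sin (lam * x) - lam * x * ind (`|x| <= 1)).

Definition cadlag (x : R -> R) : Prop :=
  (forall t, 0 <= t -> x @ at_right t --> x t) /\
  (forall t, 0 < t -> cvg (x @ at_left t)).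

Definition time_change (l : R -> R) : Prop :=
  l 0 = 0 /\ {within [set t : R | 0 <= t], continuous l} /\
  (forall s t, 0 <= s -> s < t -> l s < l t) /\
  (forall M, exists t, 0 <= t /\ M < l t).

(* J1 convergence in D(R_+, R) (Jacod-Shiryaev, Thm VI.1.14) *)
Definition J1_cvg (x : nat -> R -> R) (y : R -> R) : Prop :=
  exists l : nat -> R -> R, (forall k, time_change (l k)) /\
   (forall e : R, 0 < e -> \forall k \near \oo,
        forall t, 0 <= t -> `|l k t - t| <= e) /\
   (forall T : R, 0 < T -> forall e : R, 0 < e -> \forall k \near \oo,
        forall t, 0 <= t <= T -> `|x k (l k t) - y t| <= e).

(* bounded continuous functionals on D(R_+,R) x [0,+oo]
   (D x [0,+oo] is metrizable, so continuity = sequential continuity) *)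
Definition bcont_functional (F : (R -> R) -> \bar R -> R) : Prop :=
  (exists M : R, forall x r, `|F x r| <= M) /\
  forall (xs : nat -> R -> R) (x : R -> R) (rs : nat -> \bar R) (r : \bar R),
    (forall k, cadlag (xs k)) -> cadlag x ->
    (forall k, (0 <= rs k)%E) -> (0 <= r)%E ->
    J1_cvg xs x -> rs @ \oo --> r ->
    (fun k => F (xs k) (rs k)) @ \oo --> F x r.

Definition markov_chain d (T : measurableType d) (P : probability T R)
   (p : nat -> nat -> R) (n : nat) (X : nat -> T -> nat) : Prop :=
  (forall k i, measurable [set w | X k w = i]) /\
  forall (k : nat) (i : nat -> nat),
    P [set w | forall j, (j <= k)%N -> X j w = i j] =
    ((ind (i 0%N == n) * \prod_(0 <= j < k) p (i j) (i j.+1))%:E).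

Definition hit_time (K : nat) (X : nat -> nat) : \bar R :=
  ereal_inf [set (k%:R)%:E | k in [set k | (1 <= k)%N /\ (X k <= K)%N]].

(* X^dagger(k) = X(k /\ A^{(K)}) *)
Definition stopped (K : nat) (X : nat -> nat) (k : nat) : nat :=
  X (head k [seq j <- iota 1 k | (X j <= K)%N]).

Definition levy_process d (O : measurableType d) (P : probability O R)
   (Pi : {measure set R -> \bar R}) (b sigma2 : R) (xi : R -> O -> R) : Prop :=
  (forall t, measurable_fun setT (xi t)) /\
  (forall w, xi 0 w = 0) /\
  (forall w, cadlag (fun t => xi t w)) /\
  (forall (m : nat) (t : nat -> R) (B : nat -> set R),
     0 <= t 0%N -> (forall j, t j <= t j.+1) -> (forall j, measurable (B j)) ->
     P (\bigcap_(j in [set j | (j < m)%N])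
          [set w | xi (t j.+1) w - xi (t j) w \in B j]) =
     (\prod_(0 <= j < m) P [set w | (xi (t j.+1) w - xi (t j) w)%R \in B j])%E) /\
  (* stationary increments with E[exp(i lam (xi(s+h)-xi(s)))] = exp(h Phi(lam)) *)
  (forall s h lam, 0 <= s -> 0 <= h ->
     Rintegral P setT (fun w => cos (lam * (xi (s + h) w - xi s w))) =
       expR (h * RePhi Pi sigma2 lam) * cos (h * ImPhi Pi b lam) /\
     Rintegral P setT (fun w => sin (lam * (xi (s + h) w - xi s w))) =
       expR (h * RePhi Pi sigma2 lam) * sin (h * ImPhi Pi b lam)).

Definition drifts_to_minus_infty d (O : measurableType d) (P : probability O R)
   (xi : R -> O -> R) : Prop :=
  {ae P, forall w, (fun t => xi t w) @ +oo --> -oo}.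

Definition I_infty (gamma : R) (path : R -> R) : \bar R :=
  (\int[@lebesgue_measure R]_(s in `[0%R, +oo[%classic) (expR (gamma * path s))%:E)%E.

Definition I_upto (gamma : R) (path : R -> R) (u : R) : R :=
  fine (\int[@lebesgue_measure R]_(s in `[0%R, u]%classic) (expR (gamma * path s))%:E)%E.

Definition tau (gamma : R) (path : R -> R) (t : R) : R :=
  inf [set u | 0 <= u /\ t < I_upto gamma path u].

Definition Yproc (gamma : R) (path : R -> R) (t : R) : R :=
  if (t%:E < I_infty gamma path)%E then expR (path (tau gamma path t)) else 0.

End Defs.

Arguments hit_time {R}.
Arguments ind {R}.

(* Main.v *)
Require Import Defs.
From HB Require Import structures.
From mathcomp Require Import all_boot all_order all_algebra.
From mathcomp Require Import all_classical all_reals all_analysis measurable_realfun.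
From mathcomp Require Import ring lra zify.
Set Implicit Arguments. Unset Strict Implicit. Unset Printing Implicit Defensive.
Import Order.TTheory GRing.Theory Num.Theory.
Import numFieldNormedType.Exports.
Local Open Scope classical_set_scope.
Local Open Scope ring_scope.

(* Read on the clock sum_j 1/a_{X_j}, the log-chain ln(X_k/n) has asymptotically
   stationary independent increments: (A1)-(A2) give a_x E[g(ln(X_1/x))] -> the
   Levy exponent of g for g = cos(lam u) - 1 and sin(lam u), and an exponentially
   corrected trigonometric supermartingale turns this into convergence of the
   finite-dimensional laws of the increments over a grid of clock steps ep.
   Both (X_n/n, A_n/a_n) and (Y, I_oo) are, up to a small J1-type error and a set of
   small probability, the same functional of these grid increments, since real time
   is recovered from the clock by a_x/a_n ~ (x/n)^gamma.  The part of the trajectory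
   after a large clock time is negligible: drift to -oo forces Psi(th) < 0 for some
   small th > 0 (otherwise a Paley-Zygmund bound for e^(th xi) contradicts the
   drift), so x^th is a Lyapunov function, and accessibility of
   {1..K} is used below its range of validity.  A bounded continuous functional is
   the increasing limit of Lipschitz ones (inf-convolution), which handles F and -F.
   For the mean, (x/n)^gamma is almost harmonic with drift Psi(gamma) per clock unit,
   so E[A_n] = E[sum_j a_{X_j} (1/a_{X_j})] lies between the bounds given by super-
   and submartingales; (x/n)^(gamma - d), (x/n)^(gamma + d) and Potter's bounds
   control a_x/a_n - (x/n)^gamma. *)

(** One-sided estimates suffice almost everywhere: a nonnegative function with nonpositive drift can
    be stopped in the extended reals without any integrability check, and the missing side comes
    from a symmetry (a phase shift by pi for cosines, a sign change for [F]). Two obstacles shape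
    the passage to the limit. [F] is only sequentially continuous, so its values on the limit pair
    are not known to be measurable; functions of finitely many increments are used instead, and
    integrals are compared off a null set. And the grid size from which a path of xi is well
    reconstructed depends on the path, so lower limits of grid functionals replace uniformity.
    Constants are fixed in this order: accuracy, Lipschitz index k, clock horizon S, grid size M',
    range B of |ln(x/n)|, then n, and last the number N of chain steps, which only has to exceed the
    deterministic number of steps in which a path staying in range uses up the clock. *)

Notation Int mu f := (Rintegral mu setT f) (only parsing).
Notation via y := (@le_trans _ _ y) (only parsing).
Notation ld x n := (ln x%:R - ln n%:R) (only parsing).
Notation leND := (ler_normD _ _) (only parsing).
Notation cmf := continuous_measurable_fun (only parsing).
Notation hd0 := (head 0%N) (only parsing).
Notation trunc := Num.truncn (only parsing).
Notation meas f := (measurable_fun setT f) (only parsing).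

Ltac pos := lazymatch goal with
 | |- is_true (_ <= GRing.add _ _) => apply: addr_ge0; pos
 | |- is_true (_ <= GRing.mul _ _) => apply: mulr_ge0; pos
 | |- is_true (_ <= GRing.exp _ 2) => apply: sqr_ge0
 | |- is_true (_ <= GRing.exp _ _) => apply: exprn_ge0; pos
 | |- is_true (_ <= GRing.inv _) => rewrite invr_ge0; pos
 | |- is_true (_ < GRing.mul _ _) => apply: mulr_gt0; pos
 | |- is_true (_ < GRing.inv _) => rewrite invr_gt0; pos
 | |- is_true (_ < GRing.add _ _) => apply: addr_gt0; pos
 | |- is_true (_ < GRing.exp _ _) => apply: exprn_gt0; pos
 | |- is_true (_ < expR _) => exact: expR_gt0
 | |- _ => first [assumption | exact: expR_ge0 | exact: normr_ge0 | exact: ler01 | exact: ltr01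
   | exact: ler0n | by rewrite ltr0n | by apply: ltW; assumption | by apply: ler0n | idtac]
 end.

(** * Eventual properties, continuity by composition, real-valued integrals *)

Definition ev (Q : nat -> Prop) := exists N, forall n, (N <= n)%N -> Q n.
Lemma ev_and Q1 Q2 : ev Q1 -> ev Q2 -> ev (fun n => Q1 n /\ Q2 n).
Proof.
move=> [N1 H1] [N2 H2]; exists (maxn N1 N2) => n; rewrite geq_max => /andP[n1 n2].
by split; [exact: H1|exact: H2].
Qed.

Lemma ev_imp (Q1 Q2 : nat -> Prop) : (forall n, Q1 n -> Q2 n) -> ev Q1 -> ev Q2.
Proof. by move=> H [N HN]; exists N => n /HN /H. Qed.
Lemma ev_ge N0 : ev (fun n => (N0 <= n)%N).
Proof. by exists N0. Qed.
Lemma ev_all (Q : nat -> Prop) : (forall n, Q n) -> ev Q.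
Proof. by move=> H; exists 0%N. Qed.

Section Calc.
Context {R : realType}.
Implicit Types (f g : R -> R).

Lemma cvgnE (u : nat -> R) l : (u @ \oo --> l) <->
 (forall e, 0 < e -> ev (fun n => `|u n - l| <= e)).
Proof.
split=> [/cvgrPdist_le H e e0|H].
 by have [N _ HN] := H _ e0; exists N => n Nn; rewrite distrC; apply: HN.
apply/cvgrPdist_le => e e0; have [N HN] := H _ e0; exists N => // n Nn.
by rewrite /= distrC; apply: HN.
Qed.

Lemma ev_ger (x : R) : ev (fun n => x <= n%:R).
Proof.
exists (trunc `|x|).+1 => n h.
apply: (le_trans (ler_norm _)); apply: ltW; apply: (lt_le_trans (truncnS_gt _)).
by rewrite ler_nat.
Qed.

Lemma contD f g : continuous f -> continuous g -> continuous (fun u => f u + g u).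
Proof. by move=> cf cg x; apply: cvgD; [exact: cf|exact: cg]. Qed.
Lemma contM f g : continuous f -> continuous g -> continuous (fun u => f u * g u).
Proof. by move=> cf cg x; apply: cvgM; [exact: cf|exact: cg]. Qed.
Lemma contN f : continuous f -> continuous (fun u => - f u).
Proof. by move=> cf x; apply: cvgN; exact: cf. Qed.
Lemma contB f g : continuous f -> continuous g -> continuous (fun u => f u - g u).
Proof. by move=> cf cg; apply: contD => //; exact: contN. Qed.
Lemma cont_cst (c : R) : continuous (fun _ : R => c).
Proof. by move=> x; exact: cvg_cst. Qed.
Lemma cont_id : continuous (fun x : R => x).
Proof. by move=> x; exact: cvg_id. Qed.
Lemma contnorm f : continuous f -> continuous (fun u => `|f u|).
Proof. by move=> cf x; apply: cvg_norm; exact: cf. Qed.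
Lemma contcomp f g : continuous f -> continuous g -> continuous (fun u => f (g u)).
Proof. by move=> cf cg x; apply: (cvg_comp _ _ (cg x)); exact: cf. Qed.
Lemma contexp f : continuous f -> continuous (fun u => expR (f u)).
Proof. by move=> cf; apply: (contcomp _ cf); exact: continuous_expR. Qed.
Lemma contcos f : continuous f -> continuous (fun u => cos (f u)).
Proof. by move=> cf; apply: (contcomp _ cf); exact: continuous_cos. Qed.
Lemma contsin f : continuous f -> continuous (fun u => sin (f u)).
Proof. by move=> cf; apply: (contcomp _ cf); exact: continuous_sin. Qed.
(** The clamp of t to [0,1]. Absolute values make its continuity a matter of composition. *)
Definition cl (t : R) : R := (`|t| + 1 - `|t - 1|) / 2.
Lemma cl_bnd t : 0 <= cl t <= 1.
Proof.
have [t0|t0] := lerP 0 t; have [t1|t1] := lerP 0 (t - 1);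
 by rewrite /cl ?(ger0_norm t0) ?(ltr0_norm t0) ?(ger0_norm t1) ?(ltr0_norm t1); apply/andP; split; lra.
Qed.

Lemma cl_eq0 t : t <= 0 -> cl t = 0.
Proof. by move=> t0; rewrite /cl ler0_norm// ler0_norm; lra. Qed.
Lemma cl_eq1 t : 1 <= t -> cl t = 1.
Proof. by move=> t0; rewrite /cl ger0_norm ?ger0_norm; lra. Qed.
Lemma cont_cl f : continuous f -> continuous (fun u => cl (f u)).
Proof.
move=> cf; apply: contM; last exact: cont_cst.
apply: contB; last by apply: contnorm; apply: contB => //; exact: cont_cst.
by apply: contD; [exact: contnorm|exact: cont_cst].
Qed.

(** The maximum of y and c, written for the same reason as [cl]. *)
Definition mx (y c : R) : R := (y + c + `|y - c|) / 2.
Lemma mxl y c : c <= y -> mx y c = y.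
Proof. by move=> h; rewrite /mx ger0_norm; lra. Qed.
Lemma mxr y c : y <= c -> mx y c = c.
Proof. by move=> h; rewrite /mx ler0_norm; lra. Qed.
Lemma mx_ge y c : c <= mx y c.
Proof. by have [h|h] := leP y c; [rewrite mxr|rewrite mxl// ltW]. Qed.
Lemma cont_mx f c : continuous f -> continuous (fun u => mx (f u) c).
Proof.
move=> cf; apply: contM; last exact: cont_cst.
by apply: contD; [apply: contD => //; exact: cont_cst|apply: contnorm; apply: contB => //; exact: cont_cst].
Qed.

End Calc.

Section Rint.
Context {R : realType} d (T : measurableType d) (mu : {measure set T -> \bar R}).
Implicit Types f g h : T -> R.

Definition intg f := mu.-integrable setT (EFin \o f).
Lemma intg_mf f : intg f -> meas f.
Proof. by move=> /integrableP[/measurable_EFinP]. Qed.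
Lemma intg_le f g : meas f -> (forall x, `|f x| <= g x) -> intg g -> intg f.
Proof.
move=> mf fg ig; apply: le_integrable ig => //; first exact/measurable_EFinP.
by move=> x _ /=; rewrite lee_fin (le_trans (fg x)) ?ler_norm.
Qed.

Lemma intgD f g : intg f -> intg g -> intg (fun x => f x + g x).
Proof. by move=> i1 i2; have := integrableD measurableT i1 i2; apply: eq_integrable. Qed.
Lemma intgB f g : intg f -> intg g -> intg (fun x => f x - g x).
Proof. by move=> i1 i2; have := integrableB measurableT i1 i2; apply: eq_integrable. Qed.
Lemma intgZ f c : intg f -> intg (fun x => c * f x).
Proof. by move=> i1; have := integrableZl measurableT c i1; apply: eq_integrable. Qed.
Lemma intg_norm f : intg f -> intg (fun x => `|f x|).
Proof. by move=> H; exact: integrable_norm. Qed.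
Lemma Rint_le f g : intg f -> intg g -> (forall x, f x <= g x) ->
 Int mu f <= Int mu g.
Proof. by move=> i1 i2 H; apply: le_Rintegral. Qed.
Lemma Rint_norm_le f g : intg f -> intg g -> (forall x, `|f x| <= g x) ->
 `|Int mu f| <= Int mu g.
Proof.
move=> i1 i2 H; apply: (le_trans (le_normr_Rintegral measurableT i1)).
by apply: Rint_le => //; exact: intg_norm.
Qed.

Lemma RintD f g : intg f -> intg g ->
 Int mu (fun x => f x + g x) = Int mu f + Int mu g.
Proof. by move=> *; apply: RintegralD. Qed.
Lemma RintB f g : intg f -> intg g ->
 Int mu (fun x => f x - g x) = Int mu f - Int mu g.
Proof. by move=> *; apply: RintegralB. Qed.
Lemma RintZ f c : intg f ->
 Int mu (fun x => c * f x) = c * Int mu f.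
Proof. by move=> *; apply: RintegralZl. Qed.
Lemma Rint_fin f : intg f -> (Int mu f)%:E = (\int[mu]_x (f x)%:E)%E.
Proof. by move=> H; rewrite /Rintegral fineK//; apply: integrable_fin_num. Qed.
(** The exceptional set is explicit because it is concrete in each use: {-1,1} for the Levy measure,
    and the null set of paths that do not drift for the Levy process. *)
Lemma Rint_dct (fn : nat -> T -> R) f h (N : set T) :
 (forall n, meas (fn n)) -> meas f ->
 measurable N -> mu N = 0%E ->
 (forall x, ~ N x -> fn ^~ x @ \oo --> f x) ->
 intg h -> (forall n x, ~ N x -> `|fn n x| <= h x) ->
 intg f /\ (fun n => Int mu (fn n)) @ \oo --> Int mu f.
Proof.
move=> mfn mf mN N0 cv ih dom.
have [] := @dominated_convergence _ T R mu setT measurableT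
 (fun n => EFin \o fn n) (EFin \o f) (EFin \o h)
 (fun n => (measurable_EFinP _ _).2 (mfn n)) ((measurable_EFinP _ _).2 mf) _ ih _.
- exists N; split => // x /= H; apply: contrapT => Nx; apply: H => _.
 by apply/cvg_EFin; [near=> k|exact: cv].
- by exists N; split => // x /= H; apply: contrapT => Nx; apply: H => k _ /=; rewrite lee_fin dom.
move=> i1 _ i3; split => //; apply: fine_cvg; rewrite -(Rint_fin i1) in i3 *.
exact: i3.
Unshelve. all: by end_near. Qed.

Lemma Rint_dctT (fn : nat -> T -> R) f h :
 (forall n, meas (fn n)) -> meas f ->
 (forall x, fn ^~ x @ \oo --> f x) ->
 intg h -> (forall n x, `|fn n x| <= h x) ->
 intg f /\ (fun n => Int mu (fn n)) @ \oo --> Int mu f.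
Proof.
by move=> ? ? H ? H'; apply: (@Rint_dct fn f h set0); rewrite ?measure0 // => x _; exact: H.
Qed.

End Rint.

Arguments intg {R d T} mu f.

Section CalcMore.
Context {R : realType}.

Lemma cvg_le_ev (u : nat -> R) (l C : R) : u @ \oo --> l -> ev (fun n => u n <= C) -> l <= C.
Proof.
move=> /cvgnE ul uC; rewrite leNgt; apply/negP => Cl.
have [N HN] := ev_and (ul ((l - C) / 2) ltac:(lra)) uC.
have [h1 h2] := HN N (leqnn N); move: h1; rewrite ler_norml => /andP[]; lra.
Qed.

Lemma cvg_near_ev (u v : nat -> R) (l : R) : u @ \oo --> l -> ev (fun n => u n = v n) -> v @ \oo --> l.
Proof.
move=> /cvgnE ul uv; apply/cvgnE => e e0; apply: ev_imp (ev_and (ul e e0) uv).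
by move=> n [h1 <-].
Qed.

Definition mn (y c : R) := y + c - mx y c.
Lemma mnl y c : y <= c -> mn y c = y.
Proof. by move=> h; rewrite /mn mxr//; lra. Qed.
Lemma mnr y c : c <= y -> mn y c = c.
Proof. by move=> h; rewrite /mn mxl//; lra. Qed.
Lemma expNc_small (c C e : R) : 0 < c -> 0 <= C -> 0 < e -> ev (fun j => C * expR (- (c * j%:R)) <= e).
Proof.
move=> c0 C0 e0; apply: ev_imp (ev_and (ev_ger (C / (e * c))) (ev_ge 1)) => j [h j1].
rewrite expRN ler_pdivrMr ?expR_gt0//.
have cj : 0 < c * j%:R by pos.
have := expR_ge1Dx (c * j%:R); rewrite ler_pdivrMr ?mulr_gt0// in h; nra.
Qed.

End CalcMore.

(** * Expectations under one row of the kernel *)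

Section OneStep.
Variable R : realType.
Implicit Types (q g h : nat -> R).

(** A row p_x with x >= 1. The condition q 0 = 0 lets every comparison of summands be restricted to
    k > 0, where ln k has its usual meaning. *)
Definition prob_seq q := q 0%N = 0 /\ (forall k, 0 <= q k) /\ series q @ \oo --> (1 : R).
Definition Esum q g : R := limn (series (fun k => q k * g k)).
Definition summ q g := cvgn (series (fun k => q k * `|g k|)).
Lemma summ_cvg q g : (forall k, 0 <= q k) -> summ q g ->
 cvgn (series (fun k => q k * g k)).
Proof.
move=> q0 H; apply: normed_cvg.
rewrite /= (_ : [normed _] = series (fun k => q k * `|g k|))//.
by apply/funext => n; apply: eq_bigr => k _ /=; rewrite normrM ger0_norm.
Qed.

Lemma summ_le q g h : (forall k, 0 <= q k) -> q 0%N = 0 ->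
 (forall k, (0 < k)%N -> `|g k| <= h k) -> summ q h -> summ q g.
Proof.
move=> q0 q00 gh; apply: series_le_cvg => k //.
- by apply: mulr_ge0.
- by apply: mulr_ge0.
- case: k => [|k]; first by rewrite q00 !mul0r.
 by apply: ler_wpM2l => //; apply: (le_trans (gh _ _)) => //; apply: ler_norm.
Qed.

Lemma summZ q g c : summ q g -> summ q (fun k => c * g k).
Proof.
move=> H; rewrite /summ (_ : (fun k => _) = `|c| *: (fun k => q k * `|g k|)).
 exact: is_cvg_seriesZ.
by apply/funext => k; rewrite /= normrM mulrCA.
Qed.

Lemma summN q g : summ q g -> summ q (fun k => - g k).
Proof.
move=> H; rewrite /summ (_ : (fun k => _) = (fun k => q k * `|g k|)) //.
by apply/funext => k; rewrite normrN.
Qed.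

Lemma summD q g h : (forall k, 0 <= q k) -> q 0%N = 0 ->
 summ q g -> summ q h -> summ q (fun k => g k + h k).
Proof.
move=> q0 q00 Hg Hh; have : summ q (fun k => `|g k| + `|h k|).
 rewrite /summ (_ : (fun k => _) = (fun k => q k * `|g k|) + (fun k => q k * `|h k|)).
  exact: is_cvg_seriesD.
 by apply/funext => k /=; rewrite ger0_norm ?addr_ge0// mulrDr.
by apply: summ_le => // k _; apply: ler_normD.
Qed.

Lemma summB q g h : (forall k, 0 <= q k) -> q 0%N = 0 ->
 summ q g -> summ q h -> summ q (fun k => g k - h k).
Proof. by move=> q0 q00 Hg Hh; apply: summD => //; apply: summN. Qed.
Lemma EsumD q g h : (forall k, 0 <= q k) -> summ q g -> summ q h ->
 Esum q (fun k => g k + h k) = Esum q g + Esum q h.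
Proof.
move=> q0 Hg Hh; rewrite /Esum -lim_seriesD; try exact: summ_cvg.
by congr (limn (series _)); apply/funext => k /=; rewrite mulrDr.
Qed.

Lemma EsumZ q g c : (forall k, 0 <= q k) -> summ q g ->
 Esum q (fun k => c * g k) = c * Esum q g.
Proof.
move=> q0 Hg; rewrite /Esum -[c * _]/(c *: _) -lim_seriesZ; last exact: summ_cvg.
by congr (limn (series _)); apply/funext => k /=; rewrite mulrCA.
Qed.

Lemma EsumN q g : (forall k, 0 <= q k) -> summ q g ->
 Esum q (fun k => - g k) = - Esum q g.
Proof.
move=> q0 Hg; rewrite -mulN1r -EsumZ//; congr Esum.
by apply/funext => k; rewrite mulN1r.
Qed.

Lemma EsumB q g h : (forall k, 0 <= q k) -> summ q g -> summ q h ->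
 Esum q (fun k => g k - h k) = Esum q g - Esum q h.
Proof.
by move=> q0 Hg Hh; rewrite EsumD ?EsumN //; apply: summN.
Qed.

Lemma le_Esum q g h : (forall k, 0 <= q k) -> q 0%N = 0 -> summ q g -> summ q h ->
 (forall k, (0 < k)%N -> g k <= h k) -> Esum q g <= Esum q h.
Proof.
move=> q0 q00 Hg Hh gh; apply: lim_series_le; try exact: summ_cvg.
by move=> [|k]; rewrite ?q00 ?mul0r//; apply: ler_wpM2l => //; apply: gh.
Qed.

Lemma eq_Esum q g h : q 0%N = 0 ->
 (forall k, (0 < k)%N -> g k = h k) -> Esum q g = Esum q h.
Proof.
move=> q00 gh; congr (limn (series _)); apply/funext => -[|k]; rewrite ?q00 ?mul0r//.
by rewrite gh.
Qed.

Lemma norm_Esum q g h : (forall k, 0 <= q k) -> q 0%N = 0 -> summ q h ->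
 (forall k, (0 < k)%N -> `|g k| <= h k) -> `|Esum q g| <= Esum q h.
Proof.
move=> q0 q00 Hh gh; have Hg := summ_le q0 q00 gh Hh.
rewrite ler_norml -EsumN//; apply/andP; split.
 apply: le_Esum => //; first exact: summN.
 by move=> k k0; have := gh _ k0; rewrite ler_norml => /andP[].
by apply: le_Esum => // k k0; have := gh _ k0; rewrite ler_norml => /andP[].
Qed.

Lemma Esum_cst q c : prob_seq q -> Esum q (fun=> c) = c.
Proof.
move=> [q00 [q0 q1]]; have H : (series (fun k => q k * c)) @ \oo --> c.
 rewrite (_ : series _ = fun n => series q n * c); last first.
  by apply/funext => n; rewrite /series/= mulr_suml.
 by rewrite -[X in _ --> X]mul1r; apply: cvgMl.
exact: (cvg_lim _ H).
Qed.

Lemma summ_cst q c : prob_seq q -> summ q (fun=> c).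
Proof.
move=> [q00 [q0 q1]]; have H : (series (fun k => q k * `|c|)) @ \oo --> `|c|.
 rewrite (_ : series _ = fun n => series q n * `|c|); last first.
  by apply/funext => n; rewrite /series/= mulr_suml.
 by rewrite -[X in _ --> X]mul1r; apply: cvgMl.
by apply/cvg_ex; exists `|c|.
Qed.

Lemma summ_bnd q g M : prob_seq q -> (forall k, (0 < k)%N -> `|g k| <= M) -> summ q g.
Proof.
by move=> Q; have [q00 [q0 q1]] := Q => gM; apply: (summ_le (h:=fun=>M)) => //; apply: summ_cst.
Qed.

Lemma Esum_ge0 q g : prob_seq q -> summ q g -> (forall k, (0 < k)%N -> 0 <= g k) -> 0 <= Esum q g.
Proof.
move=> Q Hg g0; have [q00 [q0 q1]] := Q; rewrite -(Esum_cst 0 Q).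
by apply: le_Esum => //; apply: summ_cst.
Qed.

Lemma eEsum q g : (forall k, 0 <= q k) -> summ q g -> (forall k, 0 <= g k) ->
 (\sum_(0 <= k <oo) (q k * g k)%:E)%E = (Esum q g)%:E.
Proof.
move=> q0 Hg g0; rewrite /Esum -EFin_lim; last exact: summ_cvg.
congr (limn _); apply/funext => n /=; rewrite /series/= sumEFin //.
Qed.

Lemma eEsum_summ q g : (forall k, 0 <= q k) -> (forall k, 0 <= g k) ->
 (\sum_(0 <= k <oo) (q k * g k)%:E < +oo)%E -> summ q g.
Proof.
move=> q0 g0 H; rewrite /summ; under eq_fun do rewrite ger0_norm //.
have := @nnseries_is_cvg R (fun k => q k * g k) (fun k => mulr_ge0 (q0 k) (g0 k)).
by apply.
Qed.

End OneStep.

(* Histories are stored newest state first. *)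
Fixpoint hist (x : nat -> nat) (k : nat) : seq nat :=
 if k is k'.+1 then x k :: hist x k' else [:: x 0%N].

(** The history stopped at the first time [act] fails: once the stopped history violates [act],
    newer states are dropped for ever. The state that causes the violation is kept, and the initial
    state is never dropped. *)
Fixpoint sth (act : pred (seq nat)) (h : seq nat) : seq nat :=
 if h is y :: h' then
  (if h' is _ :: _ then let s := sth act h' in if act s then y :: s else s else [:: y])
 else [::].

Lemma size_hist x k : size (hist x k) = k.+1.
Proof. by elim: k => //= k ->. Qed.
Lemma sthS act x k : sth act (hist x k.+1) =
 let s := sth act (hist x k) in if act s then x k.+1 :: s else s.
Proof. by case: k. Qed.
Lemma sth_cons act y z h : sth act (y :: z :: h) =
 if act (sth act (z :: h)) then y :: sth act (z :: h) else sth act (z :: h).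
Proof. by []. Qed.
Lemma sth_id act h : act (sth act h) -> sth act h = h.
Proof.
elim: h => // y [|z h] IH //.
rewrite sth_cons; case: ifPn => [/IH -> //|] /negbTE.
by move=> ->.
Qed.

Lemma hist_eq x k h : size h = k.+1 ->
 (hist x k = h) <-> (forall j, (j <= k)%N -> x j = nth 0%N h (k - j)).
Proof.
elim: k h => [|k IH] [|y h] //=.
 by case: h => [|//] _; split => [[xy] [|//] _|/(_ 0%N (leqnn _)) /= ->] //.
move=> [hk]; split.
 move=> [<- hh] j; rewrite leq_eqVlt => /orP[/eqP ->|jk]; first by rewrite subnn.
 by rewrite subSn//; apply: (IH _ hk).1.
move=> H; rewrite (H k.+1)// subnn /=; congr cons; apply/(IH _ hk).2 => j jk.
by rewrite H ?subSn//; exact: leqW.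
Qed.

Section Discrete.
Context {R : realType} {d} {T : measurableType d} (D : countType) (H : T -> D).
Hypothesis mH : forall h, measurable [set w | H w = h].

Lemma measurable_discrete (A : set D) : measurable [set w | A (H w)].
Proof.
rewrite (_ : [set w | _] = \bigcup_i (if pickle_inv i is Some h then
  if `[< A h >] then [set w | H w = h] else set0 else set0)).
 apply: bigcup_measurable => i _; case: pickle_inv => // h.
 by case: ifP.
apply/seteqP; split => [w Aw|w [i _]].
 by exists (pickle (H w)) => //; rewrite pickleK_inv asboolT.
by case: pickle_inv => // h; case: asboolP => //= Ah ->.
Qed.

Lemma measurable_fun_discrete d' (T' : measurableType d') (f : D -> T') :
 meas (f \o H).
Proof.
move=> _ Y mY; rewrite setTI.
exact: (measurable_discrete (f @^-1` Y)).
Qed.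

Lemma ge0_integral_discrete (mu : {measure set T -> \bar R}) (A : set T) (f : T -> \bar R) :
 measurable A -> measurable_fun A f -> (forall w, A w -> 0 <= f w)%E ->
 (\int[mu]_(w in A) f w = \sum_(i <oo) \int[mu]_(w in A `&` [set w | pickle (H w) = i]) f w)%E.
Proof.
move=> mA mf f0.
have mF i : measurable (A `&` [set w | pickle (H w) = i]).
 apply: measurableI => //; exact: (measurable_discrete [set h | pickle h = i]).
have E : \bigcup_i (A `&` [set w | pickle (H w) = i]) = A.
 by apply/seteqP; split => [w [i _ []]//|w Aw]; exists (pickle (H w)).
rewrite -{1}E ge0_integral_bigcup ?E//.
by apply: ltn_trivIset => j i ij; rewrite -subset0 => w /= [[_ Ei] [_ Ej]]; rewrite -Ei -Ej ltnn in ij.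
Qed.

End Discrete.

(** * Histories of the chain *)

Section Chain.
Context {R : realType} (p : nat -> nat -> R) {d} {T : measurableType d}
 (P : probability T R) (n : nat) (X : nat -> T -> nat).
Hypotheses (kp : is_kernel p) (n1 : (1 <= n)%N) (mc : markov_chain P p n X).
Implicit Types (f : seq nat -> R).

Lemma int_cst (A : set T) (r : \bar R) : measurable A -> (\int[P]_(w in A) cst r w = r * P A)%E.
Proof. by move=> mA; exact: integral_cst. Qed.
Definition Hk k (w : T) := hist (X ^~ w) k.
Lemma Hk_cyl k h : size h = k.+1 ->
 P [set w | Hk k w = h] =
 ((ind (last 0%N h == n) * \prod_(0 <= j < k) p (nth 0%N h (k - j)) (nth 0%N h (k - j.+1)))%:E).
Proof.
move=> hk; have := mc.2 k (fun j => nth 0%N h (k - j)).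
rewrite subn0 (_ : nth 0%N h k = last 0%N h) => [<-|]; last by rewrite -nth_last hk.
congr (P _); apply/seteqP; split => w /=; first by move=> /(hist_eq _ hk).
by move=> ?; apply/(hist_eq _ hk).
Qed.

Lemma mHk k h : measurable [set w | Hk k w = h].
Proof.
elim: k h => [|k IH] h; rewrite /Hk /=.
 case: h => [|y [|]].
 - by rewrite (_ : [set _ | _] = set0)//; apply/seteqP; split.
 - rewrite (_ : [set _ | _] = [set w | X 0%N w = y]); first exact: mc.1.
  by apply/seteqP; split => w /= [->].
 - by move=> *; rewrite (_ : [set _ | _] = set0)//; apply/seteqP; split.
case: h => [|y h].
 by rewrite (_ : [set _ | _] = set0)//; apply/seteqP; split.
rewrite (_ : [set _ | _] = [set w | X k.+1 w = y] `&` [set w | Hk k w = h]).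
 by apply: measurableI => //; exact: mc.1.
by apply/seteqP; split => w /= [-> <-].
Qed.

(** The last factor of the cylinder probability splits off; this is the Markov property for
    histories. A list of the wrong length gives 0 on both sides. *)
Lemma Hk_step k h y : P [set w | Hk k w = h /\ X k.+1 w = y] =
  (P [set w | Hk k w = h] * (p (hd0 h) y)%:E)%E.
Proof.
have [hk|hk] := eqVneq (size h) k.+1; last first.
 rewrite (_ : [set _ | _ /\ _] = set0); last first.
  by apply/seteqP; split => w //= -[hw _]; rewrite -hw /Hk size_hist eqxx in hk.
 rewrite (_ : [set _ | _] = set0) ?measure0 ?mul0e//.
 by apply/seteqP; split => w //= hw; rewrite -hw /Hk size_hist eqxx in hk.
rewrite (_ : [set _ | _ /\ _] = [set w | Hk k.+1 w = y :: h]); last first.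
 by apply/seteqP; split => w /=; rewrite /Hk /= => -[-> ->].
rewrite !Hk_cyl//=; last by rewrite hk.
rewrite -EFinM; congr EFin; rewrite big_nat_recr//= subSnn subnn mulrA.
congr (_ * _ * _).
- by case: (h) hk.
- apply: eq_big_nat => j /andP[_ jk]; congr (p _ _).
 + by rewrite subSn // ltnW.
 + by rewrite subSn.
Qed.

(** Nothing is assumed about row 0 of [p], so the state 0 has to be excluded almost surely before
    any one-step formula is used. *)
Lemma Hk_pos k h : hd0 h = 0%N -> P [set w | Hk k w = h] = 0%E.
Proof.
elim: k h => [|k IH] [|y h] /=.
- move=> _; rewrite (_ : [set _ | _] = set0) ?measure0//.
 by apply/seteqP; split => w.
- move=> ->; have [h0|h0] := eqVneq h [::]; last first.
  rewrite (_ : [set _ | _] = set0) ?measure0//.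
  by apply/seteqP; split => w //= [_ hw]; rewrite -hw eqxx in h0.
 rewrite h0 Hk_cyl//= /ind big_geq// mulr1.
 by case: eqP => // E0; move: n1; rewrite -E0.
- move=> _; rewrite (_ : [set _ | _] = set0) ?measure0//.
 by apply/seteqP; split => w.
move=> ->; rewrite (_ : [set _ | _] = [set w | Hk k w = h /\ X k.+1 w = 0%N]); last first.
 by apply/seteqP; split => w /=; rewrite /Hk /= => -[-> ->].
rewrite Hk_step.
have [h0|h0] := posnP (hd0 h); first by rewrite IH// mul0e.
by rewrite (kp h0).1 mule0.
Qed.

Lemma mfHk d' (T' : measurableType d') k (f : seq nat -> T') : meas (fun w => f (Hk k w)).
Proof. exact: (measurable_fun_discrete (mHk k)). Qed.
(** The transition operator of the chain of histories. Extended sums spare all summability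
    conditions for nonnegative f. *)
Definition Qe (f : seq nat -> \bar R) (h : seq nat) : \bar R :=
 (\sum_(0 <= y <oo) (p (hd0 h) y)%:E * f (y :: h))%E.

Lemma pickle_set k i : [set w | pickle (Hk k w) = i] = set0 \/
 exists h : seq nat, i = pickle h /\ [set w | pickle (Hk k w) = i] = [set w | Hk k w = h].
Proof.
case: (pselect (exists w, pickle (Hk k w) = i)) => [[w hw]|H]; [right|left].
 exists (Hk k w); split => //; apply/seteqP; split => w' /=; rewrite -hw.
  by apply: pcan_inj; exact: pickleK_inv.
 by move=> ->.
by apply/seteqP; split => w //= hw; apply: H; exists w.
Qed.

(** Both integrals are split according to the countably many histories. The test on the newest state
    discards the rows of [p] about which nothing is known; these histories are null by [Hk_pos]. *)
Lemma Qe_step k (f : seq nat -> \bar R) : (forall h, 0 <= f h)%E ->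
 (\int[P]_w f (Hk k.+1 w) = \int[P]_w (if (0 < hd0 (Hk k w))%N then Qe f (Hk k w) else 0))%E.
Proof.
move=> f0.
have Qf0 h : (0 < hd0 h)%N -> (0 <= Qe f h)%E.
 by move=> h0; apply: nneseries_ge0 => y _ _; rewrite mule_ge0// lee_fin (kp h0).2.1.
rewrite (ge0_integral_discrete (mHk k))//; last exact: mfHk.
rewrite [RHS](ge0_integral_discrete (mHk k))//; last first.
- by move=> w _; case: ifP => // /Qf0.
- exact: (mfHk k (fun h => if (0 < head 0 h)%N then Qe f h else 0%E)).
apply: eq_eseriesr => i _; rewrite !setTI.
have [->|[h [_ ->]]] := pickle_set k i; first by rewrite !integral_set0.
have mA := mHk k h.
rewrite [RHS](eq_integral (cst (if (0 < head 0 h)%N then Qe f h else 0%E))); last first.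
 by move=> w /set_mem /= ->.
rewrite int_cst//.
rewrite (@ge0_integral_discrete _ _ _ _ (X k.+1)) //; [|exact: mc.1|exact/measurable_funTS/mfHk].
rewrite (eq_eseriesr (g := fun y => P [set w | Hk k w = h] * ((p (hd0 h) y)%:E * f (y :: h)))%E); last first.
 move=> y _; rewrite -[pickle]/(fun x : nat => x) /=.
 rewrite (eq_integral (cst (f (y :: h)))); last first.
  by move=> w /set_mem /= [hw yw]; rewrite /Hk /= yw -/(Hk k w) hw.
 rewrite int_cst; last first.
  apply: measurableI => //; exact: mc.1.
 rewrite (_ : _ `&` _ = [set w | Hk k w = h /\ X k.+1 w = y])// Hk_step.
 by rewrite muleC muleA.
have [h0|h0] := posnP (hd0 h).
 by rewrite Hk_pos// mul0e eseries0// => y _ _; rewrite mul0e.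
have Pf : P [set w | Hk k w = h] \is a fin_num by apply: fin_num_measure.
rewrite -(fineK Pf) nneseriesZl //; first by rewrite muleC.
by move=> y _; rewrite mule_ge0// lee_fin (kp h0).2.1.
Qed.

Lemma le_integral_Hk k (f g : seq nat -> \bar R) : (forall h, 0 <= f h)%E -> (forall h, 0 <= g h)%E ->
 (forall h, (0 < hd0 h)%N -> f h <= g h)%E ->
 (\int[P]_w f (Hk k w) <= \int[P]_w g (Hk k w))%E.
Proof.
move=> f0 g0 fg.
rewrite (ge0_integral_discrete (mHk k))//; last exact: mfHk.
rewrite [leRHS](ge0_integral_discrete (mHk k))//; last exact: mfHk.
apply: lee_nneseries => i _; first by move=> _; apply: integral_ge0.
rewrite !setTI; have [->|[h [_ ->]]] := pickle_set k i; first by rewrite !integral_set0.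
rewrite (eq_integral (cst (f h))) ?[leRHS](eq_integral (cst (g h))) ?int_cst//; try exact: mHk.
- have [h0|h0] := posnP (hd0 h); first by rewrite Hk_pos// !mule0.
 by apply: lee_wpmul2r => //; exact: fg.
- by move=> w /set_mem /= ->.
- by move=> w /set_mem /= ->.
Qed.

Lemma Hk0 (f : seq nat -> \bar R) : (forall h, 0 <= f h)%E ->
 (\int[P]_w f (Hk 0 w) = f [:: n])%E.
Proof.
move=> f0.
have H h : P [set w | Hk 0 w = h] = (ind (h == [:: n]))%:E.
 case: h => [|y [|z h]] /=.
 - by rewrite (_ : [set _ | _] = set0) ?measure0//; apply/seteqP; split.
 - rewrite Hk_cyl//= big_geq// mulr1 eqseq_cons /= andbT //.
 - by rewrite (_ : [set _ | _] = set0) ?measure0 //= ?eqseq_cons ?andbF//; apply/seteqP; split.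
rewrite (ge0_integral_discrete (mHk 0))//; last exact: mfHk.
rewrite (@nneseriesD1 _ _ (pickle [:: n]))//; last by move=> *; apply: integral_ge0.
rewrite setTI (_ : [set w | _] = [set w | Hk 0 w = [:: n]]); last first.
 apply/seteqP; split => w /= => [|-> //]; apply: pcan_inj; exact: pickleK_inv.
rewrite (eq_integral (cst (f [:: n]))); last by move=> w /set_mem ->.
rewrite int_cst; last exact: mHk.
rewrite (_ : P _ = 1%E); last by rewrite H eqxx.
rewrite mule1 eseries0 ?adde0// => i _ ij.
rewrite setTI; have [->|[h [ih ->]]] := pickle_set 0 i; first by rewrite !integral_set0.
rewrite (eq_integral (cst (f h))); last by move=> w /set_mem ->.
rewrite int_cst; last exact: mHk.
have [hn|hn] := eqVneq h [:: n]; first by rewrite ih hn eqxx in ij.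
by rewrite (_ : P _ = 0%E) ?mule0// H (negbTE hn).
Qed.

Lemma Qe_sth (act : pred (seq nat)) f h : (0 < hd0 h)%N ->
 Qe (fun h => (f (sth act h))%:E) h =
 if act (sth act h) then Qe (fun h => (f h)%:E) h else (f (sth act h))%:E.
Proof.
move=> h0; case: h h0 => // x h h0; rewrite /Qe.
case: ifPn => ac; first last.
 rewrite (eq_eseriesr (g := fun y => (f (sth act (x :: h)))%:E * (p x y)%:E)%E); last first.
  by move=> y _; rewrite sth_cons (negbTE ac) muleC.
 rewrite nneseriesZl; last by move=> y _; rewrite lee_fin (kp h0).2.1.
 rewrite [X in (_ * X)%E](_ : _ = 1%E) ?mule1//.
 apply/cvg_lim => //; rewrite (_ : (fun n => _) = EFin \o series (p x)).
  by apply/cvg_EFin; [near=> k|exact: (kp h0).2.2].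
 by apply/funext => k /=; rewrite /series/= sumEFin.
apply: eq_eseriesr => y _.
by rewrite sth_cons ac (sth_id ac).
Unshelve. all: by end_near. Qed.

(** Optional stopping by induction on the number of steps. The drift inequality is asked only of
    active histories, since a stopped history no longer moves; nonnegativity replaces
    integrability. *)
Lemma supermart (act : pred (seq nat)) f : (forall h, 0 <= f h) ->
 (forall h, act h -> (0 < hd0 h)%N -> Qe (fun h => (f h)%:E) h <= (f h)%:E)%E ->
 forall N, (\int[P]_w (f (sth act (Hk N w)))%:E <= (f [:: n])%:E)%E.
Proof.
move=> f0 Qf; elim => [|N IH].
 by rewrite (Hk0 (f := fun h => (f (sth act h))%:E)) // => h; rewrite lee_fin.
apply: le_trans IH; rewrite (Qe_step _ (f := fun h => (f (sth act h))%:E)); last by move=> h; rewrite lee_fin.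
apply: (le_integral_Hk N (f := fun h => if (0 < head 0 h)%N then Qe (fun h => (f (sth act h))%:E) h else 0%E)
 (g := fun h => (f (sth act h))%:E)) => // h.
- case: ifP => // h0; apply: nneseries_ge0 => y _ _; rewrite mule_ge0// lee_fin ?(kp h0).2.1//.
- by rewrite lee_fin.
- move=> h0; rewrite h0 Qe_sth//; case: ifPn => ac //; rewrite (sth_id ac); apply: Qf => //.
 by rewrite -(sth_id ac).
Qed.

Lemma submart (act : pred (seq nat)) f : (forall h, 0 <= f h) ->
 (forall h, act h -> (0 < hd0 h)%N -> (f h)%:E <= Qe (fun h => (f h)%:E) h)%E ->
 forall N, ((f [:: n])%:E <= \int[P]_w (f (sth act (Hk N w)))%:E)%E.
Proof.
move=> f0 Qf; elim => [|N IH].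
 by rewrite (Hk0 (f := fun h => (f (sth act h))%:E)) // => h; rewrite lee_fin.
apply: (le_trans IH); rewrite (Qe_step _ (f := fun h => (f (sth act h))%:E)); last by move=> h; rewrite lee_fin.
apply: (le_integral_Hk N (g := fun h => if (0 < head 0 h)%N then Qe (fun h => (f (sth act h))%:E) h else 0%E)
 (f := fun h => (f (sth act h))%:E)) => // h.
- by rewrite lee_fin.
- case: ifP => // h0; apply: nneseries_ge0 => y _ _; rewrite mule_ge0// lee_fin ?(kp h0).2.1//.
- move=> h0; rewrite h0 Qe_sth//; case: ifPn => ac //; rewrite (sth_id ac); apply: Qf => //.
 by rewrite -(sth_id ac).
Qed.

End Chain.

(** * Convergence of generators *)

Section Gen.
Context {R : realType} (p : nat -> nat -> R) (a : nat -> R).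
Hypotheses (kp : is_kernel p) (a0 : forall n, 0 < a n).

Lemma kern x : (0 < x)%N -> prob_seq (p x).
Proof. by move=> x0; have [h1 [h2 h3]] := kp x0. Qed.
Definition lr (x k : nat) : R := ln k%:R - ln x%:R.
(** A step from x lasts 1/a_x on the clock, so this is the drift of g per unit of clock time. *)
Definition mm x (g : R -> R) := a x * Esum (p x) (fun k => g (lr x k)).
Definition sm x (g : R -> R) := summ (p x) (fun k => g (lr x k)).
Lemma smD x f g : (0 < x)%N -> sm x f -> sm x g -> sm x (fun u => f u + g u).
Proof. by move=> /kern[h1 [h2 h3]] ? ?; apply: summD. Qed.
Lemma smB x f g : (0 < x)%N -> sm x f -> sm x g -> sm x (fun u => f u - g u).
Proof. by move=> /kern[h1 [h2 h3]] ? ?; apply: summB. Qed.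
Lemma smZ x f c : sm x f -> sm x (fun u => c * f u).
Proof. by move=> ?; apply: summZ. Qed.
Lemma sm_le x f g : (0 < x)%N -> (forall u, `|f u| <= g u) -> sm x g -> sm x f.
Proof. by move=> /kern[h1 [h2 h3]] fg ?; apply: (summ_le (h := fun k => g (lr x k))) => // k _; apply: fg. Qed.
Lemma sm_bnd x f M : (0 < x)%N -> (forall u, `|f u| <= M) -> sm x f.
Proof. by move=> x0 fM; apply: (@summ_bnd _ _ _ M) => //; exact: kern. Qed.
Lemma mmD x f g : (0 < x)%N -> sm x f -> sm x g -> mm x (fun u => f u + g u) = mm x f + mm x g.
Proof. by move=> /kern[h1 [h2 h3]] ? ?; rewrite /mm EsumD// mulrDr. Qed.
Lemma mmB x f g : (0 < x)%N -> sm x f -> sm x g -> mm x (fun u => f u - g u) = mm x f - mm x g.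
Proof. by move=> /kern[h1 [h2 h3]] ? ?; rewrite /mm EsumB// mulrBr. Qed.
Lemma mmZ x f c : (0 < x)%N -> sm x f -> mm x (fun u => c * f u) = c * mm x f.
Proof. by move=> /kern[h1 [h2 h3]] ?; rewrite /mm EsumZ// mulrCA. Qed.
Lemma mm_le x f g : (0 < x)%N -> sm x f -> sm x g -> (forall u, f u <= g u) -> mm x f <= mm x g.
Proof.
move=> /kern[h1 [h2 h3]] ? ? fg; rewrite /mm; apply: ler_wpM2l; first exact/ltW.
by apply: le_Esum => //.
Qed.

Lemma mm_norm x f g : (0 < x)%N -> sm x g -> (forall u, `|f u| <= g u) -> `|mm x f| <= mm x g.
Proof.
move=> /kern[h1 [h2 h3]] ? fg; rewrite /mm normrM gtr0_norm//.
by apply: ler_wpM2l; [exact/ltW|apply: norm_Esum].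
Qed.

Definition E1 (be : R) (u : R) : R := ind (1 < u) * expR (be * u).
Definition sq1 (u : R) : R := ind (`|u| <= 1) * u ^+ 2.
Definition id1 (u : R) : R := ind (`|u| <= 1) * u.
Lemma ind_ge0 c : 0 <= ind c :> R.
Proof. by case: c. Qed.
Lemma ind_le1 c : ind c <= 1 :> R.
Proof. by case: c. Qed.
Lemma E1_ge0 be u : 0 <= E1 be u.
Proof. by rewrite mulr_ge0 ?ind_ge0 ?expR_ge0. Qed.
Lemma sq1_ge0 u : 0 <= sq1 u.
Proof. by rewrite mulr_ge0 ?ind_ge0 ?sqr_ge0. Qed.
Lemma sq1_le1 u : sq1 u <= 1.
Proof.
rewrite /sq1; case: (lerP `|u| 1) => /= h; last by rewrite mul0r.
by rewrite mul1r -real_normK ?num_real// -[leRHS](expr1n _ 2) lerXn2r// nnegrE.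
Qed.
Lemma sm_sq1 x : (0 < x)%N -> sm x sq1.
Proof. by move=> x0; apply: (@sm_bnd _ _ 1) => // u; rewrite ger0_norm ?sq1_ge0 ?sq1_le1. Qed.
Lemma sm_id1 x : (0 < x)%N -> sm x id1.
Proof.
move=> x0; apply: (@sm_bnd _ _ 1) => // u; rewrite /id1.
by case: (lerP `|u| 1) => /= h; rewrite ?mul0r ?normr0 ?mul1r.
Qed.

(** The limsup is the infimum of the tail suprema; if it is finite, one tail supremum is finite, and
    that single tail yields both the bound and the summability. *)
Lemma emb be : exp_moment_bound p a be -> exists C, 0 <= C /\
 ev (fun x => (0 < x)%N /\ sm x (E1 be) /\ mm x (E1 be) <= C).
Proof.
rewrite /exp_moment_bound; set u := (X in limn_esup X) => H.
have : (ereal_inf (range (esups u)) < +oo)%E.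
 by rewrite -(cvg_lim _ (@cvg_esups_inf _ u))// -limn_esup_lim.
move=> /ereal_inf_lt [y [N _ <-]] HN.
have u0 n : (0 < n)%N -> (0 <= u n)%E.
 move=> n0; rewrite /u mule_ge0 ?lee_fin ?(ltW (a0 n))//.
 by apply: nneseries_ge0 => k _ _; rewrite lee_fin mulr_ge0 ?(kp n0).2.1// E1_ge0.
have uN n : (N <= n)%N -> (u n <= esups u N)%E by move=> Nn; apply: ereal_sup_ubound; exists n.
have NF : esups u N \is a fin_num.
 rewrite ge0_fin_numE//; apply: le_trans (uN N.+1 _) => //; exact: u0.
have NC : (0 <= esups u N)%E by apply: le_trans (uN N.+1 _) => //; exact: u0.
exists (fine (esups u N)); split; first exact: fine_ge0.
exists N.+1 => n Nn; have n0 : (0 < n)%N by apply: leq_trans Nn.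
have := uN n (ltnW Nn); rewrite -(fineK NF) /u => Hn.
have S : sm n (E1 be).
 apply: eEsum_summ => [|k|]; [exact: (kp n0).2.1|exact: E1_ge0|].
 have : (ePistar p n (E1 be) <= ((a n)^-1 * fine (esups u N))%:E)%E.
  by rewrite EFinM muleC lee_pdivlMr// muleC.
 by move=> /le_lt_trans; apply; rewrite ltry.
split => //; split => //; rewrite /mm -lee_fin EFinM -eEsum//; first exact: (kp n0).2.1.
by move=> k; exact: E1_ge0.
Qed.

Lemma cont_lnmx c : 0 < c -> continuous (fun y : R => ln (mx y c)).
Proof.
move=> c0 y; apply: (@continuous_comp _ _ _ (fun y => mx y c) (@ln R)).
 exact: (@cont_mx R idfun c (@cont_id R) y).
by apply: continuous_ln; apply: lt_le_trans (mx_ge _ _).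
Qed.

Context (Pi : {measure set R -> \bar R}).
Hypothesis HA1 : A1 p a Pi.

(** (A1) in the logarithmic coordinate. As phi is constant beyond -A and A, composing it with y ->
    ln(max(y, e^-A)) gives a function continuous at 0 and constant near +oo, hence a legitimate test
    function; the maximum also avoids the logarithm of 0. *)
Lemma A1_u (phi : R -> R) A dl : continuous phi -> 0 < dl ->
 (forall u, `|u| < dl -> phi u = 0) -> 0 < A ->
 (forall u, u <= - A -> phi u = phi (- A)) -> (forall u, A <= u -> phi u = phi A) ->
 (fun x => mm x phi) @ \oo --> Int Pi phi.
Proof.
move=> cphi dl0 ph0 A0 phN phP.
have c0 : 0 < expR (- A) by exact: expR_gt0.
pose f y := phi (ln (mx y (expR (- A)))).
have cf : continuous f by apply: contcomp => //; exact: cont_lnmx.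
have tf : test_fun f.
 split; first exact: continuous_subspaceT.
 split.
  apply/cvg_ex; exists (phi A); apply: cvg_near_cst.
  exists (expR A); split; first exact: num_real.
  move=> y yA /=; have y0 : 0 < y by apply: lt_trans yA; exact: expR_gt0.
  have yA' : expR (- A) <= y.
   by apply/ltW/(le_lt_trans _ yA); rewrite ler_expR; lra.
  rewrite /f mxl// phP// -[A]expRK ler_ln ?posrE ?expR_gt0//; exact: ltW.
 have /cvgrPdist_lt /(_ _ dl0) := @cont_lnmx _ c0 1.
 rewrite mxl ?ln1; last by rewrite -[leRHS]expR0 ler_expR; lra.
 move=> /nbhs_ballP [d d0 Hd]; exists d => // y yd; apply: ph0.
 by have := Hd y; rewrite /ball /= distrC => /(_ yd); rewrite sub0r normrN.
have := HA1 tf; rewrite (_ : (fun x => phi _) = phi).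
 suff E : ev (fun n => a n * Estep p n f = mm n phi).
  move=> H; apply/cvgnE => e e0; have /cvgnE /(_ _ e0) H' := H.
  by apply: ev_imp (ev_and E H') => n [->].
 exists 1%N => n n1; congr (_ * _); apply: eq_Esum; first exact: (kern n1).1.
 move=> k k0; rewrite /f /lr.
 have kn : 0 < k%:R / n%:R :> R by pos.
 rewrite -ln_div ?posrE ?ltr0n//.
 have [h|h] := leP (expR (- A)) (k%:R / n%:R); first by rewrite mxl.
 rewrite mxr ?ltW// expRK [RHS]phN// -[leRHS]expRK ler_ln ?posrE ?expR_gt0//; exact: ltW.
apply/funext => u; rewrite /f.
have [h|h] := leP (-A) u; first by rewrite mxl ?expRK// ler_expR.
by rewrite mxr ?expRK ?[RHS]phN// ?ler_expR ltW.
Qed.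

Lemma mind1 : meas (fun u : R => ind (`|u| <= 1) : R).
Proof.
rewrite (_ : (fun u => _) = \1_(`[-1, 1]%classic)); first exact: measurable_indic.
apply/funext => u; rewrite indicE mem_setE /= in_itv /= -ler_norml; by case: (`|u| <= 1).
Qed.

Lemma mind2 : meas (fun u : R => ind (1 < u) : R).
Proof.
rewrite (_ : (fun u => _) = \1_(`]1, +oo[%classic)); first exact: measurable_indic.
by apply/funext => u; rewrite indicE mem_setE /= in_itv /= andbT; case: (1 < u).
Qed.

Lemma mE1 be : meas (E1 be).
Proof.
apply: measurable_funM; first exact: mind2.
by apply: cmf; apply: contexp; apply: contM; [exact: cont_cst|exact: cont_id].
Qed.

Lemma msq1 : meas sq1.
Proof.
apply: measurable_funM; first exact: mind1.
by apply: cmf; apply: contM; exact: cont_id.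
Qed.

Hypothesis LP : levy_measure Pi.

Definition min1 (u : R) : R := Num.min 1 (u ^+ 2).
Lemma min1_ge0 u : 0 <= min1 u.
Proof. by rewrite /min1 le_min ler01 sqr_ge0. Qed.
Lemma intg_min1 : intg Pi min1.
Proof.
apply/integrableP; split.
 have m2 : meas (fun u : R => u ^+ 2).
  by apply: cmf; apply: contM; exact: cont_id.
 by apply/measurable_EFinP; exact: measurable_minr.
rewrite (eq_integral (fun x : R => (Num.min 1 (x ^+ 2))%:E)); first exact: LP.2.2.
by move=> x _ /=; rewrite ger0_norm// min1_ge0.
Qed.

Lemma le_min1 u d : 0 < d -> d <= 1 -> d <= `|u| -> d ^+ 2 <= min1 u.
Proof.
move=> d0 d1 du; rewrite /min1 le_min; apply/andP; split.
 by nra.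
by rewrite -(real_normK (num_real u)) lerXn2r ?nnegrE ?(ltW d0).
Qed.

Lemma intg_dom (f : R -> R) (M d : R) : meas f -> 0 < d -> d <= 1 ->
 (forall u, `|u| < d -> f u = 0) -> (forall u, `|f u| <= M) -> intg Pi f.
Proof.
move=> mf d0 d1 f0 fM; apply: (intg_le (g := fun u => M / d ^+ 2 * min1 u)) => // [u|]; last first.
 exact/intgZ/intg_min1.
have M0 : 0 <= M by apply: le_trans (fM 0).
have d2 : 0 < d ^+ 2 by pos.
have [h|h] := ltP `|u| d.
 by rewrite f0// normr0 mulr_ge0 ?min1_ge0// divr_ge0// ltW.
rewrite -mulrA; apply: (le_trans (fM u)); rewrite -[leLHS]mulr1; apply: ler_wpM2l => //.
by rewrite mulrC ler_pdivlMr// mul1r; exact: le_min1.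
Qed.

(** Cutoff of the origin: 0 for |u| <= 1/4 and 1 for |u| >= 1/2. It is the dominating function for
    everything that lives away from 0. *)
Definition zeta (u : R) : R := cl (4 * `|u| - 1).
(** Equal to 1 except near the three places where (A1) cannot see the integrand: 0, the jump points
    -1 and 1 of the truncation, and infinity. *)
Definition chi (j : nat) (u : R) : R :=
 cl (j%:R * `|u| - 1) * (cl (j%:R * `| `|u| - 1| - 1) * cl (j.+1%:R - `|u|)).
Definition chi1 (j : nat) (u : R) : R :=
 cl (j%:R * `|u| - 1) * (cl (j%:R * (1 - `|u|) - 1) * cl (j.+1%:R - `|u|)).
(** What [chi j] removes away from the origin; a test function whose integral tends to 0. *)
Definition Hj j u := (1 - chi j u) * zeta u.
Lemma cl_ge0 (t : R) : 0 <= cl t. Proof. by have /andP[] := cl_bnd t. Qed.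
Lemma cl_le1 (t : R) : cl t <= 1. Proof. by have /andP[] := cl_bnd t. Qed.

Lemma chi_bnd j u : 0 <= chi j u <= 1.
Proof.
rewrite /chi; set A := cl _; set B := cl _; set C := cl _.
have /andP[hA hA'] : 0 <= A <= 1 := cl_bnd _; have /andP[hB hB'] : 0 <= B <= 1 := cl_bnd _.
have /andP[hC hC'] : 0 <= C <= 1 := cl_bnd _.
by apply/andP; split; [exact: mulr_ge0 hA (mulr_ge0 hB hC)|apply: mulr_ile1 => //; [exact: mulr_ge0|exact: mulr_ile1]].
Qed.

Lemma Hj_bnd j u : 0 <= Hj j u <= zeta u.
Proof.
have /andP[h1 h2] := chi_bnd j u; rewrite /Hj mulr_ge0 ?cl_ge0 ?subr_ge0//=.
by rewrite -[leRHS]mul1r ler_wpM2r ?cl_ge0// gerBl.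
Qed.

Let cabs : continuous (fun u : R => `|u|) := contnorm (@cont_id R).
Let caff (c d : R) f : continuous f -> continuous (fun u : R => cl (c * f u - d)).
Proof. by move=> cf; exact: (cont_cl (contB (contM (@cont_cst _ c) cf) (@cont_cst _ d))). Qed.
Lemma cont_chi j : continuous (chi j).
Proof.
rewrite /chi; exact: (contM (@caff j%:R 1 _ cabs) (contM (@caff j%:R 1 _ (contnorm (contB cabs (@cont_cst _ 1))))
 (cont_cl (contB (@cont_cst _ j.+1%:R) cabs)))).
Qed.

Lemma cont_chi1 j : continuous (chi1 j).
Proof.
rewrite /chi1; exact: (contM (@caff j%:R 1 _ cabs) (contM (@caff j%:R 1 _ (contB (@cont_cst _ 1) cabs))
 (cont_cl (contB (@cont_cst _ j.+1%:R) cabs)))).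
Qed.

Lemma cont_zeta : continuous zeta.
Proof. rewrite /zeta; exact: (@caff 4 1 _ cabs). Qed.
Lemma cont_Hj j : continuous (Hj j).
Proof. by rewrite /Hj; apply: contM; [apply: contB; [exact: cont_cst|exact: cont_chi]|exact: cont_zeta]. Qed.
(** [chi j] vanishes near |u| = 1, so multiplying by the discontinuous indicator leaves a continuous
    function; [chi1] is an explicit formula that shows it. *)
Lemma chi1E j u : (0 < j)%N -> ind (`|u| <= 1) * chi j u = chi1 j u.
Proof.
move=> j0; have j1 : 0 < j%:R :> R by pos.
rewrite /chi /chi1; case: (lerP `|u| 1) => h /=; last first.
 by rewrite mul0r [cl (_ * (_ - _) - _)]cl_eq0 ?mul0r ?mulr0//; nra.
by rewrite mul1r.
Qed.

Lemma chi_near0 j u : j%:R * `|u| <= 1 -> chi j u = 0.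
Proof. by move=> h; rewrite /chi cl_eq0 ?mul0r//; lra. Qed.
Lemma chi_far j u : j.+1%:R <= `|u| -> chi j u = 0.
Proof. by move=> h; rewrite /chi [cl (_ - `|u|)]cl_eq0 ?mulr0//; lra. Qed.
Lemma Hj_cvg u : ~ (u = -1 \/ u = 1) -> Hj ^~ u @ \oo --> 0.
Proof.
move=> u1; apply/cvgnE => e e0.
have [u0|u0] := eqVneq u 0.
 apply: ev_all => j; rewrite u0 /Hj /zeta normr0 mulr0 cl_eq0 ?mulr0 ?subr0 ?normr0 ?ltW//; lra.
have h1 : 0 < `|u| by rewrite normr_gt0.
have h2 : 0 < `| `|u| - 1|.
 rewrite normr_gt0 subr_eq0; apply/negP => /eqP h; apply: u1; move: h.
 have [h|h] := lerP 0 u; first by rewrite ger0_norm//; right.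
 by rewrite ltr0_norm// => h'; left; lra.
have := ev_and (ev_ger (2 / `|u|)) (ev_and (ev_ger (2 / `| `|u| - 1|)) (ev_ger `|u|)).
apply: ev_imp => j [j1 [j2 j3]]; rewrite ler_pdivrMr// in j1; rewrite ler_pdivrMr// in j2.
by rewrite subr0 /Hj /chi !cl_eq1 ?mulr1 ?subrr ?mul0r ?normr0 ?(ltW e0) -?natr1; lra.
Qed.

Lemma zeta0 u : `|u| < 1 / 4 -> zeta u = 0.
Proof. by move=> h; rewrite /zeta cl_eq0//; lra. Qed.
Lemma Pi_pm1 : Pi [set u | u = -1 \/ u = 1] = 0%E. Proof. by case: LP => _ []. Qed.

Lemma m_pm1 : measurable [set u : R | u = -1 \/ u = 1].
Proof.
rewrite (_ : [set _ | _] = [set -1] `|` [set 1]); last by apply/seteqP; split.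
by apply: measurableU.
Qed.

Lemma intg_zeta : intg Pi zeta.
Proof.
apply: (@intg_dom _ 1 (1/4)); rewrite ?divr_gt0//; try lra.
- by apply: cmf; exact: cont_zeta.
- exact: zeta0.
- by move=> u; rewrite ger0_norm ?cl_ge0 ?cl_le1.
Qed.

(** At -1 and 1 every [chi j] is 0, so [Hj j] does not tend to 0 there: this is where these points
    must have no mass. Elsewhere the convergence is dominated by [zeta]. *)
Lemma Hj_int : (fun j => Int Pi (Hj j)) @ \oo --> 0.
Proof.
have H1 j : meas (Hj j) by apply: cmf; exact: cont_Hj.
have H2 j u : ~ (u = -1 \/ u = 1) -> `|Hj j u| <= zeta u.
 by move=> _; have /andP[h1 h2] := Hj_bnd j u; rewrite ger0_norm.
have [_] := Rint_dct H1 (measurable_cst (0 : R)) m_pm1 Pi_pm1 Hj_cvg intg_zeta H2.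
by rewrite [X in _ --> X -> _](_ : _ = 0)// /Rintegral integral0.
Qed.

Lemma Hj_mm j : (0 < j)%N -> (fun x => mm x (Hj j)) @ \oo --> Int Pi (Hj j).
Proof.
move=> j0; have j1 : 1 <= j%:R :> R by rewrite ler1n.
have F u : j.+1%:R <= `|u| -> Hj j u = 1.
 move=> h; rewrite /Hj chi_far// /zeta cl_eq1 ?subr0 ?mulr1//.
 by rewrite -natr1 in h; lra.
apply: (@A1_u _ j.+1%:R (1/4)); rewrite ?ltr0n ?divr_gt0//.
- exact: cont_Hj.
- by move=> u /zeta0 h; rewrite /Hj h mulr0.
- move=> u h; have h' : j.+1%:R <= `|u| by apply: le_trans (_ : _ <= - u) _; [rewrite lerNr|rewrite -normrN ler_norm].
 by rewrite !F// normrN ger0_norm.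
- move=> u h; have h' : j.+1%:R <= `|u| := le_trans h (ler_norm u).
 by rewrite !F// ger0_norm.
Qed.

End Gen.


Section Lin3.
Context {R : realType} (p : nat -> nat -> R) (a : nat -> R).
Hypothesis kp : is_kernel p.

Lemma sm_lin3 x (f g h : R -> R) c1 c2 c3 : (0 < x)%N -> sm p x f -> sm p x g -> sm p x h ->
 sm p x (fun u => c1 * f u + (c2 * g u + c3 * h u)).
Proof.
move=> x0 sf sg sh; apply: (smD kp x0); first exact: smZ.
by apply: (smD kp x0); exact: smZ.
Qed.

Lemma mm_lin3 x (f g h : R -> R) c1 c2 c3 : (0 < x)%N -> sm p x f -> sm p x g -> sm p x h ->
 mm p a x (fun u => c1 * f u + (c2 * g u + c3 * h u)) =
 c1 * mm p a x f + (c2 * mm p a x g + c3 * mm p a x h).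
Proof.
move=> x0 sf sg sh; rewrite (mmD a kp x0 (smZ (c:=c1) sf)); last by apply: (smD kp x0); exact: smZ.
by rewrite (mmD a kp x0 (smZ (c:=c2) sg) (smZ (c:=c3) sh)) (mmZ a kp c1 x0 sf) (mmZ a kp c2 x0 sg) (mmZ a kp c3 x0 sh).
Qed.

Context (Pi : {measure set R -> \bar R}).

Lemma intg_lin3 (f g h : R -> R) c1 c2 c3 : intg Pi f -> intg Pi g -> intg Pi h ->
 intg Pi (fun u => c1 * f u + (c2 * g u + c3 * h u)).
Proof. by move=> *; apply: intgD; [exact: intgZ|apply: intgD; exact: intgZ]. Qed.
Lemma Rint_lin3 (f g h : R -> R) c1 c2 c3 : intg Pi f -> intg Pi g -> intg Pi h ->
 Int Pi (fun u => c1 * f u + (c2 * g u + c3 * h u)) =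
 c1 * Int Pi f + (c2 * Int Pi g + c3 * Int Pi h).
Proof.
move=> i1 i2 i3; rewrite (RintD (intgZ c1 i1) (intgD (intgZ c2 i2) (intgZ c3 i3))).
by rewrite (RintD (intgZ c2 i2) (intgZ c3 i3)) !RintZ.
Qed.

End Lin3.

Definition embd {R : realType} (p : nat -> nat -> R) a be Cb := ev (fun x => (0 < x)%N /\ sm p x (E1 be) /\ mm p a x (E1 be) <= Cb).

Section GenMain.
Context {R : realType} (p : nat -> nat -> R) (a : nat -> R).
Hypotheses (kp : is_kernel p) (a0 : forall n, 0 < a n).
Context (Pi : {measure set R -> \bar R}).
Hypotheses (HA1 : A1 p a Pi) (LP : levy_measure Pi).

Section Ebe.
Context (be Cb : R).
Hypotheses (be0 : 0 < be) (Cb0 : 0 <= Cb) (HE : embd p a be Cb).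

Let psi (u : R) := expR (be * u) * cl (u - 1).
Let phi (j : nat) (u : R) := expR (be * mn u j%:R) * cl (u - 1).
Let cont_clu : continuous (fun u : R => cl (u - 1)).
Proof. exact: (cont_cl (contB (@cont_id R) (@cont_cst R 1))). Qed.
Let cpsi : continuous psi.
Proof. exact: (contM (contexp (contM (@cont_cst R be) (@cont_id R))) cont_clu). Qed.
Let cphi j : continuous (phi j).
Proof.
have c1 : continuous (fun u : R => mn u j%:R).
 exact: (contB (contD (@cont_id R) (@cont_cst R j%:R)) (@cont_mx R _ j%:R (@cont_id R))).
exact: (contM (contexp (contM (@cont_cst R be) c1)) cont_clu).
Qed.

Let phi_ge0 j u : 0 <= phi j u.
Proof. by rewrite mulr_ge0 ?expR_ge0 ?cl_ge0. Qed.
Let mn_le u (c : R) : mn u c <= u.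
Proof. by have [h|/ltW h] := lerP u c; [rewrite mnl|rewrite mnr]. Qed.
Let mn_le2 u (c : R) : mn u c <= c.
Proof. by have [h|/ltW h] := lerP u c; [rewrite mnl|rewrite mnr]. Qed.
Let phi_E1 j u : phi j u <= E1 be u.
Proof.
rewrite /phi /E1; have [h|h] := ltP 1 u; last by rewrite /= cl_eq0 ?mul0r ?mulr0//; lra.
rewrite /= mulrC; apply: ler_pM; rewrite ?cl_ge0 ?cl_le1 ?expR_ge0// ler_expR.
by rewrite ler_pM2l.
Qed.

Let phi0 j u : u <= 1 -> phi j u = 0.
Proof. by move=> h; rewrite /phi cl_eq0 ?mulr0//; lra. Qed.
Let phi_int j : intg Pi (phi j).
Proof.
apply: (@intg_dom _ _ LP _ (expR (be * j%:R)) 1) => //.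
- by apply: cmf; exact: cphi.
- by move=> u /ltr_normlP[_ /ltW]; exact: phi0.
- move=> u; rewrite ger0_norm// /phi -[leRHS]mulr1.
 by apply: ler_pM; rewrite ?cl_ge0 ?cl_le1 ?expR_ge0// ler_expR ler_pM2l.
Qed.

Let phi_le j : Int Pi (phi j) <= Cb.
Proof.
have [N HN] := HE.
apply: (@cvg_le_ev _ (fun x => mm p a x (phi j))).
 apply: (@A1_u _ _ _ kp _ HA1 _ j.+2%:R 1) => //.
 - by move=> u /ltr_normlP[_ /ltW]; exact: phi0.
 - by move=> u h; have h0 := ler0n R j.+2; rewrite !phi0//; lra.
 - move=> u h; have j2 : j.+2%:R = j%:R + 2 :> R by rewrite -addn2 natrD.
  have j0 : 0 <= j%:R :> R by [].
  by rewrite /phi !mnr ?cl_eq1//; lra.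
exists N => x /HN[x0 [s1 m1]]; apply: le_trans m1; apply: mm_le => //.
by apply: (sm_le kp x0 (g := E1 be)) => // u; rewrite ger0_norm.
Qed.

Let psi_ge0 u : 0 <= psi u.
Proof. by rewrite mulr_ge0 ?expR_ge0 ?cl_ge0. Qed.
Let psi_int : intg Pi psi.
Proof.
apply/integrableP; split.
 by apply/measurable_EFinP; apply: cmf; exact: cpsi.
rewrite (eq_integral (fun u => limn (fun j => (phi j u)%:E))); last first.
 move=> u _; rewrite /= ger0_norm//; apply/esym/cvg_lim => //; apply: cvg_near_cst.
 have [N HN] := ev_ger u; exists N => // j /HN h /=.
 by rewrite /phi mnl.
rewrite monotone_convergence//; first last.
- move=> u _ i j ij; rewrite lee_fin /phi; apply: ler_wpM2r; first exact: cl_ge0.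
 rewrite ler_expR ler_pM2l//; have ij' : i%:R <= j%:R :> R by rewrite ler_nat.
 have [h|/ltW h] := lerP u i%:R; first by rewrite !mnl//; apply: le_trans ij'.
 by rewrite [leLHS]mnr//; have [h2|/ltW h2] := lerP u j%:R; [rewrite mnl|rewrite mnr].
- by move=> n u _; rewrite lee_fin.
- by move=> j; apply/measurable_EFinP; apply: cmf; exact: cphi.
apply: le_lt_trans (ltry Cb); apply: lime_le.
 apply: ereal_nondecreasing_is_cvgn => i j ij; apply: ge0_le_integral => //.
 - by move=> u _; rewrite lee_fin.
 - by apply/measurable_EFinP; apply: cmf; exact: cphi.
 - by apply/measurable_EFinP; apply: cmf; exact: cphi.
 - move=> u _; rewrite lee_fin /phi; apply: ler_wpM2r; first exact: cl_ge0.
  rewrite ler_expR ler_pM2l//; have ij' : i%:R <= j%:R :> R by rewrite ler_nat.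
  have [h|/ltW h] := lerP u i%:R; first by rewrite !mnl//; apply: le_trans ij'.
  by rewrite [leLHS]mnr//; have [h2|/ltW h2] := lerP u j%:R; [rewrite mnl|rewrite mnr].
by apply: nearW => j; rewrite -(Rint_fin (phi_int j)) lee_fin.
Qed.

(** The truncated functions [phi j] are test functions below [E1 be], so (A1) transfers the bound Cb
    to their Pi-integrals, and monotone convergence gives [psi]. Since [psi] may be small between 1
    and 2, that strip is dominated by a multiple of [min1]. *)
Lemma E1_int : intg Pi (E1 be).
Proof.
apply: (intg_le (g := fun u => psi u + expR (be * 2) * min1 u)); first exact: mE1.
 move=> u; rewrite ger0_norm ?E1_ge0// /E1 /psi; have [h|h] := ltP 1 u; last first.
  by rewrite /= mul0r; pos; rewrite ?cl_ge0 ?min1_ge0.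
 rewrite /= mul1r; have [h2|h2] := lerP 2 u.
  rewrite cl_eq1 ?mulr1 ?lerDl ?mulr_ge0 ?expR_ge0 ?min1_ge0//; lra.
 apply: (le_trans (y := expR (be * 2) * 1)).
  by rewrite mulr1 ler_expR ler_pM2l// ltW.
 rewrite -[leLHS]add0r; apply: lerD; first by rewrite mulr_ge0 ?expR_ge0 ?cl_ge0.
 by apply: ler_wpM2l; rewrite ?expR_ge0// /min1 le_min lexx /=; nra.
by apply: intgD; [exact: psi_int|apply: intgZ; exact: intg_min1].
Qed.

End Ebe.

Context (b sg2 be Cb : R).
Hypotheses (HA2 : A2 p a Pi b sg2) (be0 : 0 < be) (Cb0 : 0 <= Cb) (HE : embd p a be Cb).

Context (g : R -> R) (al ka C th : R).
Hypotheses (cg : continuous g) (g3 : forall u, `|u| <= 1 -> `|g u - al * u - ka * u ^+ 2| <= C * `|u| ^+ 3)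
 (gC : forall u, `|g u| <= C * (1 + expR (th * u))) (th0 : 0 <= th) (thbe : th < be) (C0 : 0 <= C).

Let r u := g u - ind (`|u| <= 1) * (al * u + ka * u ^+ 2).
Let C2 := C * (1 + expR (th * 2)) + `|al| + `|ka|.
Let qle u : `|u| <= 1 -> `|al * u + ka * u ^+ 2| <= `|al| + `|ka|.
Proof.
move=> u1; apply: (le_trans leND); rewrite !normrM.
by apply: lerD; apply: ler_piMr => //; rewrite mulr_ile1.
Qed.

Let eth u v : u <= v -> expR (th * u) <= expR (th * v).
Proof. by move=> uv; rewrite ler_expR ler_wpM2l. Qed.
Let rle u v : u <= v -> 1 <= v -> `|r u| <= C * (1 + expR (th * v)) + `|al| + `|ka|.
Proof.
move=> uv v1; rewrite -addrA; apply: (le_trans leND); apply: lerD.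
 by apply: (le_trans (gC u)); apply: ler_wpM2l => //; rewrite lerD2l eth.
rewrite normrN; case: (lerP `|u| 1) => h /=; first by rewrite mul1r qle.
by rewrite mul0r normr0 addr_ge0.
Qed.

(** One term for each excised region. Near 0 the cubic remainder is at most 2C/j times u^2; near |u|
    = 1, and for large negative u, r is bounded by C2; for u > j the surplus be - th of the exponent
    gives a factor e^(-(be-th)j). Taking j >= 8 keeps the neighbourhoods of 0 and 1 apart. *)
Let rbound j u : (8 <= j)%N -> `|r u| * (1 - chi j u) <=
 2 * C / j%:R * sq1 u + (C2 * Hj j u + C * expR (- ((be - th) * j%:R)) * E1 be u).
Proof.
move=> j8; have j8' : 8 <= j%:R :> R by rewrite ler_nat.
have C20 : 0 <= C2 by rewrite !addr_ge0// mulr_ge0// addr_ge0// expR_ge0.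
have jj : 0 < j%:R :> R by lra.
have /andP[ch0 ch1] := chi_bnd j u; have /andP[H0 _] := Hj_bnd j u.
have T1 : 0 <= 2 * C / j%:R * sq1 u by rewrite mulr_ge0 ?sq1_ge0// divr_ge0 ?mulr_ge0// ltW.
have T2 : 0 <= C2 * Hj j u by pos.
have T3 : 0 <= C * expR (- ((be - th) * j%:R)) * E1 be u by pos; exact: E1_ge0.
have chi1 : 2 <= j%:R * `|u| -> 2 <= j%:R * `| `|u| - 1| -> `|u| <= j%:R -> chi j u = 1.
 by move=> h1 h2 h3; rewrite /chi !cl_eq1 ?mulr1 -?natr1//; lra.
have [h|h] := ltP `|u| (1 / 2).
 have [h2|h2] := lerP 2 (j%:R * `|u|).
  rewrite chi1 ?subrr ?mulr0 ?addr_ge0//; last by lra.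
  by rewrite -normrN opprB ger0_norm; nra.
 apply: (via (2 * C / j%:R * sq1 u)); last by rewrite lerDl addr_ge0.
 have u1 : `|u| <= 1 by lra.
 rewrite /r /sq1 u1 /= !mul1r; apply: (via (C * `|u| ^+ 3 * 1)).
  apply: ler_pM => //; rewrite ?subr_ge0 ?gerBl//.
  by rewrite opprD addrA; exact: g3.
 rewrite mulr1 exprS real_normK ?num_real// mulrA; apply: ler_wpM2r; first exact: sqr_ge0.
 have h3 : `|u| <= 2 / j%:R by rewrite ler_pdivlMr// mulrC ltW.
 by rewrite (mulrC 2) -mulrA; apply: ler_wpM2l.
have z1 : zeta u = 1 by rewrite /zeta cl_eq1//; lra.
have HE1 : Hj j u = 1 - chi j u by rewrite /Hj z1 mulr1.
have [u2|u2] := lerP u 2.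
 apply: (via (C2 * Hj j u)); last by lra.
 by rewrite HE1; apply: ler_wpM2r; [lra|apply: rle => //; lra].
have nu : `|u| = u by rewrite ger0_norm//; lra.
have [uj|uj] := lerP u j%:R.
 rewrite chi1 ?subrr ?mulr0 ?addr_ge0// nu //; first by nra.
 by rewrite ger0_norm; nra.
have u1 : (`|u| <= 1) = false by apply/negbTE; rewrite -ltNge nu; lra.
have ru : r u = g u by rewrite /r u1 /= mul0r subr0.
apply: (via (C * Hj j u + C * expR (- ((be - th) * j%:R)) * E1 be u)); last first.
 apply: (via (C2 * Hj j u + C * expR (- ((be - th) * j%:R)) * E1 be u)); last by rewrite lerDr.
 rewrite lerD2r; apply: ler_wpM2r => //.
 rewrite /C2 mulrDr mulr1 -!addrA lerDl; pos.
rewrite ru HE1; apply: (via (C * (1 + expR (th * u)) * (1 - chi j u))).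
 by apply: ler_wpM2r; [lra|exact: gC].
rewrite (_ : C * (1 + expR (th * u)) * (1 - chi j u) = C * (1 - chi j u) + C * (expR (th * u) * (1 - chi j u))); last by ring.
rewrite lerD2l -mulrA; apply: ler_wpM2l => //.
rewrite /E1 (_ : 1 < u) /=; last by lra.
rewrite mul1r -expRD; apply: (via (expR (th * u))).
 by rewrite ler_piMr ?expR_ge0//; lra.
rewrite ler_expR -subr_ge0 (_ : _ - _ = (be - th) * (u - j%:R)); last by ring.
by apply: mulr_ge0; rewrite subr_ge0; exact: ltW.
Qed.

Let mr : meas r.
Proof.
apply: measurable_funB; first exact: cmf.
apply: measurable_funM; first exact: mind1.
apply: cmf.
exact: (contD (contM (@cont_cst R al) (@cont_id R)) (contM (@cont_cst R ka) (contM (@cont_id R) (@cont_id R)))).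
Qed.

Let rc j (u : R) := r u * chi j u.
(** The truncation inside r jumps only at |u| = 1, where [chi j] vanishes, so r times [chi j] is a
    test function for (A1). *)
Let crc j : (0 < j)%N -> continuous (rc j).
Proof.
move=> j0; rewrite (_ : rc j = fun u => g u * chi j u - (al * u + ka * u ^+ 2) * chi1 j u); last first.
 by apply/funext => u; rewrite /rc /r -(chi1E u j0); ring.
apply: contB; first exact: (contM cg (@cont_chi R j)).
refine (contM _ (@cont_chi1 R j)).
exact: (contD (contM (@cont_cst R al) (@cont_id R)) (contM (@cont_cst R ka) (contM (@cont_id R) (@cont_id R)))).
Qed.

Let Bj j := C * (1 + expR (th * j.+1%:R)) + `|al| + `|ka|.
Let rc_bnd j u : `|rc j u| <= Bj j.
Proof.
have /andP[h0 h1] := chi_bnd j u.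
have B0 : 0 <= Bj j by rewrite !addr_ge0// mulr_ge0// addr_ge0// expR_ge0.
rewrite normrM (ger0_norm h0); have [h|h] := lerP j.+1%:R `|u|.
 by rewrite chi_far ?mulr0.
apply: (via (Bj j * 1)); last by rewrite mulr1.
apply: ler_pM => //; apply: rle; last by rewrite ler1n.
by apply/ltW/(le_lt_trans (ler_norm _)).
Qed.

Let rc_near0 j u : (0 < j)%N -> `|u| < (j%:R)^-1 -> rc j u = 0.
Proof.
move=> j0 h; rewrite /rc chi_near0 ?mulr0//.
by apply: ltW; rewrite -ltr_pdivlMl ?mulr1// ltr0n.
Qed.

Let rc_int j : (0 < j)%N -> intg Pi (rc j).
Proof.
move=> j0; have j1 : 1 <= j%:R :> R by rewrite ler1n.
apply: (@intg_dom _ _ LP _ (Bj j) (j%:R)^-1) => //.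
- by apply: cmf; exact: crc.
- by pos.
- by rewrite invf_le1// ltr0n.
- by move=> u; exact: rc_near0.
Qed.

Let rc_mm j : (0 < j)%N -> (fun x => mm p a x (rc j)) @ \oo --> Int Pi (rc j).
Proof.
move=> j0; have F u : j.+1%:R <= `|u| -> rc j u = 0 by move=> h; rewrite /rc chi_far ?mulr0.
apply: (@A1_u _ _ _ kp _ HA1 _ j.+1%:R (j%:R)^-1); rewrite ?ltr0n ?invr_gt0 ?ltr0n//.
- exact: crc.
- by move=> u; exact: rc_near0.
- move=> u h; have h' : j.+1%:R <= `|u| by rewrite -normrN; apply: le_trans (ler_norm _); rewrite lerNr.
 by rewrite !F// normrN ger0_norm.
- move=> u h; have h' : j.+1%:R <= `|u| := le_trans h (ler_norm u).
 by rewrite !F// ger0_norm.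
Qed.

Let mrest j : meas (fun u => `|r u| * (1 - chi j u)).
Proof.
apply: measurable_funM; first exact: measurableT_comp.
by apply: cmf; exact: (contB (@cont_cst R 1) (@cont_chi R j)).
Qed.

Let int_sq1 : intg Pi sq1.
Proof.
apply: (intg_le (g := min1)); [exact: msq1| |exact: intg_min1].
move=> u; rewrite ger0_norm ?sq1_ge0// /min1 le_min sq1_le1/= /sq1.
by case: (`|u| <= 1) => /=; rewrite ?mul1r ?mul0r// sqr_ge0.
Qed.

Let int_Hj j : intg Pi (Hj j).
Proof.
apply: (intg_le (g := zeta)); [by apply: cmf; exact: (@cont_Hj R j)| |exact: intg_zeta].
by move=> u; have /andP[h1 h2] := Hj_bnd j u; rewrite ger0_norm.
Qed.

Let int_E1 : intg Pi (E1 be). Proof. apply: E1_int; [exact: be0|exact: HE]. Qed.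
Let int_rest j : (8 <= j)%N -> intg Pi (fun u => `|r u| * (1 - chi j u)).
Proof.
move=> j8; apply: (intg_le _ (g := fun u => 2 * C / j%:R * sq1 u +
 (C2 * Hj j u + C * expR (- ((be - th) * j%:R)) * E1 be u))); first exact: mrest.
 move=> u; rewrite ger0_norm; first exact: rbound.
 by have /andP[? ?] := chi_bnd j u; rewrite mulr_ge0 ?subr_ge0.
exact: (intgD (intgZ _ int_sq1) (intgD (intgZ _ (int_Hj j)) (intgZ _ int_E1))).
Qed.

Lemma gen_int_r : intg Pi r.
Proof.
apply: (intg_le _ (g := fun u => `|rc 8 u| + `|r u| * (1 - chi 8 u))) => //.
 move=> u; have /andP[? ?] := chi_bnd 8 u.
 by rewrite /rc normrM (@ger0_norm _ (chi 8 u))// -mulrDr addrC subrK mulr1.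
by apply: intgD; [apply: intg_norm; exact: rc_int|exact: int_rest].
Qed.

Lemma gen_sm_g : ev (fun x => (0 < x)%N /\ sm p x g).
Proof.
apply: ev_imp HE => x [x0 [s1 _]]; split=> //.
apply: (sm_le kp x0 (g := fun u => C * (1 + expR (th * 1)) + C * E1 be u)); last first.
 by apply: smD => //; [exact: (@sm_bnd _ _ kp x _ `|C * (1 + expR (th * 1))|)|exact: smZ].
move=> u; apply: (le_trans (gC u)); rewrite -mulrDr; apply: ler_wpM2l => //.
rewrite -addrA lerD2l; have [u1|u1] := lerP u 1.
 by rewrite -[leLHS]addr0; apply: lerD; [exact: eth|exact: E1_ge0].
by rewrite -[leLHS]add0r; apply: lerD; rewrite ?expR_ge0// /E1 u1 /= mul1r ler_expR; apply: ler_wpM2r; [exact: (le_trans ler01 (ltW u1))|exact: ltW].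
Qed.

Let mm_sq1_cvg : (fun x => mm p a x sq1) @ \oo --> sg2 + Rintegral Pi `[-1, 1] (fun x => x ^+ 2).
Proof. exact: HA2.2. Qed.
Let mm_id1_cvg : (fun x => mm p a x id1) @ \oo --> b.
Proof. exact: HA2.1. Qed.
Let sm_r x : (0 < x)%N -> sm p x g -> sm p x r.
Proof.
move=> x0 sg; apply: smB => //.
apply: (@sm_bnd _ _ kp x _ (`|al| + `|ka|)) => // u.
by case: (lerP `|u| 1) => h /=; [rewrite mul1r qle|rewrite mul0r normr0; pos].
Qed.

Let rest_le j : (8 <= j)%N -> forall x, (0 < x)%N -> sm p x g -> sm p x (E1 be) ->
 `|mm p a x r - mm p a x (rc j)| <=
 2 * C / j%:R * mm p a x sq1 + (C2 * mm p a x (Hj j) + C * expR (- ((be - th) * j%:R)) * mm p a x (E1 be)).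
Proof.
move=> j8 x x0 sg sE.
have sc : sm p x (rc j) by apply: (@sm_bnd _ _ kp x _ (Bj j)).
have sH : sm p x (Hj j).
 apply: (@sm_bnd _ _ kp x _ 1) => // u; have /andP[h1 h2] := @Hj_bnd R j u.
 by rewrite ger0_norm//; apply: le_trans h2 (cl_le1 _).
have s1 := sm_sq1 kp x0.
rewrite -(mmB a kp x0 (sm_r x0 sg) sc).
rewrite -(mm_lin3 a kp _ _ _ x0 s1 sH sE).
apply: mm_norm => //; first exact: sm_lin3.
move=> u; apply: le_trans (rbound u j8).
have /andP[h1 h2] := @chi_bnd R j u.
by rewrite -[r u]mulr1 /rc mulr1 -[X in `|X - _|]mulr1 -mulrBr normrM (@ger0_norm _ (1 - _)) ?subr_ge0.
Qed.

Let rest_int j : (8 <= j)%N ->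
 `|Int Pi r - Int Pi (rc j)| <=
 2 * C / j%:R * Int Pi sq1 + (C2 * Int Pi (Hj j) +
  C * expR (- ((be - th) * j%:R)) * Int Pi (E1 be)).
Proof.
move=> j8; have j0 : (0 < j)%N by apply: leq_trans j8.
rewrite -(Rint_lin3 _ _ _ int_sq1 (int_Hj j) int_E1).
rewrite -(RintB gen_int_r (rc_int j0)).
apply: Rint_norm_le.
- by apply: intgB; [exact: gen_int_r|exact: rc_int].
- exact: (intg_lin3 _ _ _ int_sq1 (int_Hj j) int_E1).
- move=> u; apply: le_trans (rbound u j8).
 have /andP[h1 h2] := @chi_bnd R j u.
 by rewrite -[r u]mulr1 /rc mulr1 -[X in `|X - _|]mulr1 -mulrBr normrM (@ger0_norm _ (1 - _)) ?subr_ge0.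
Qed.

(** j is fixed first, so that the three terms of [rbound] are small for Pi and for all large x at
    once; then (A1) handles the remaining test function r * chi j. *)
Let mm_r_cvg : (fun x => mm p a x r) @ \oo --> Int Pi r.
Proof.
have C20 : 0 <= C2 by rewrite /C2; pos.
set S := sg2 + Rintegral Pi `[-1, 1] (fun x => x ^+ 2).
have S1 : 0 <= Int Pi sq1 by apply: Rintegral_ge0 => x _; exact: sq1_ge0.
have S2 : 0 <= Int Pi (E1 be) by apply: Rintegral_ge0 => x _; exact: E1_ge0.
set I1 := Int Pi sq1 in S1; set I2 := Int Pi (E1 be) in S2.
apply/cvgnE => e e0.
have e9 : 0 < e / 9 by lra.
have [j [j8 [jA [jB jC]]]] : exists j, (8 <= j)%N /\ 2 * C / j%:R * (I1 + `|S| + 1) <= e / 9 /\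
  C2 * (`|Int Pi (Hj j)| + `|Int Pi (Hj j)|) <= e / 9 /\
  C * expR (- ((be - th) * j%:R)) * (I2 + Cb) <= e / 9.
 have c1 : ev (fun j : nat => 2 * C / j%:R * (I1 + `|S| + 1) <= e / 9).
  apply: ev_imp (ev_and (ev_ger (9 / e * (2 * C * (I1 + `|S| + 1)))) (ev_ge 1)) => j [h j1].
  rewrite mulrAC ler_pdivrMr ?ltr0n//.
  rewrite (_ : 2 * C * _ = e / 9 * (9 / e * (2 * C * (I1 + `|S| + 1)))).
   by apply: ler_wpM2l => //; exact: ltW.
  by field; rewrite gt_eqF.
 have c2 : ev (fun j : nat => C2 * (`|Int Pi (Hj j)| + `|Int Pi (Hj j)|) <= e / 9).
  have d0 : 0 < e / 9 / (2 * C2 + 1) by rewrite divr_gt0//; lra.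
  have /cvgnE /(_ _ d0) := Hj_int LP; apply: ev_imp => j; rewrite subr0 ler_pdivlMr; last lra.
  by have := normr_ge0 (Int Pi (Hj j)); nra.
 have bt : 0 < be - th by rewrite subr_gt0.
 have c3 := expNc_small bt (_ : 0 <= C * (I2 + Cb)) e9.
 have [|N HN] := ev_and (ev_ge 8) (ev_and c1 (ev_and c2 (c3 _))); first by pos.
 have [h1 [h2 [h3 h4]]] := HN N (leqnn N); exists N; do 3 (split => //).
 by rewrite mulrAC.
have j0 : (0 < j)%N by apply: leq_trans j8.
have /cvgnE /(_ _ e9) h1 := rc_mm j0.
have /cvgnE /(_ _ ltr01) h2 := mm_sq1_cvg.
have d0 : 0 < e / 9 / (C2 + 1) by rewrite divr_gt0//; lra.
have /cvgnE /(_ _ d0) h3 : (fun x => mm p a x (Hj j)) @ \oo --> Int Pi (Hj j) by apply: Hj_mm.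
apply: ev_imp (ev_and gen_sm_g (ev_and HE (ev_and h1 (ev_and h2 h3)))).
move=> x [[x0 sg] [[_ [sE mE]] [k1 [k2 k3]]]].
have R1 := rest_le j8 x0 sg sE.
have R2 := rest_int j8.
rewrite -/S in k2; rewrite -/I1 -/I2 in R2.
have C2j : 0 <= 2 * C / j%:R by pos.
have Cj : 0 <= C * expR (- ((be - th) * j%:R)) by pos.
have E' : C * expR (- ((be - th) * j%:R)) * mm p a x (E1 be) <= C * expR (- ((be - th) * j%:R)) * Cb.
 exact: ler_wpM2l.
have Q' : 2 * C / j%:R * mm p a x sq1 <= 2 * C / j%:R * (`|S| + 1).
 apply: ler_wpM2l => //; move: k2; rewrite ler_norml => /andP[_ k2].
 by have := ler_norm S; lra.
have H' : C2 * mm p a x (Hj j) <= C2 * Int Pi (Hj j) + e / 9.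
 move: k3; rewrite ler_norml => /andP[_]; rewrite ler_pdivlMr; last lra.
 move=> k3; have : 0 <= (mm p a x (Hj j) - Int Pi (Hj j)) \/ (mm p a x (Hj j) - Int Pi (Hj j)) <= 0.
  by apply/orP; exact: le_total.
 by move=> [] q; nra.
have H2 : C2 * Int Pi (Hj j) <= C2 * `|Int Pi (Hj j)|.
 by apply: ler_wpM2l => //; exact: ler_norm.
have := ler_normD (mm p a x r - mm p a x (rc j)) (mm p a x (rc j) - Int Pi (rc j)).
have := ler_normD (mm p a x r - mm p a x (rc j) + (mm p a x (rc j) - Int Pi (rc j)))
 (Int Pi (rc j) - Int Pi r).
rewrite (distrC (Int Pi (rc j))) !addrA !subrK.
move: jA jB jC; rewrite !mulrDr => jA jB jC; rewrite !mulrDr in Q'.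
lra.
Qed.

Lemma gen_int : intg Pi (fun u => g u - al * u * ind (`|u| <= 1)).
Proof.
apply: (intg_le (g := fun u => `|r u| + `|ka| * sq1 u)).
- apply: measurable_funB; first exact: cmf.
 apply: measurable_funM; last exact: mind1.
 by apply: cmf; exact: (contM (@cont_cst R al) (@cont_id R)).
- move=> u; rewrite (_ : _ - _ = r u + ka * sq1 u); last by rewrite /r /sq1; ring.
 by apply: (le_trans leND); rewrite normrM (ger0_norm (sq1_ge0 u)).
- exact: (intgD (intg_norm gen_int_r) (intgZ _ int_sq1)).
Qed.

(** g is split into r and its truncated second-order part, whose limits are given by (A2). The limit
    of [mm sq1] contains the Pi-integral of u^2 over |u| <= 1, which restores the quadratic part
    removed from g and leaves only ka * sg2 outside the integral. *)
Lemma gen_lim : (fun x => mm p a x g) @ \oo -->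
 al * b + ka * sg2 + Int Pi (fun u => g u - al * u * ind (`|u| <= 1)).
Proof.
have E : Rintegral Pi `[-1, 1] (fun x => x ^+ 2) = Int Pi sq1.
 rewrite Rintegral_mkcond; apply: eq_Rintegral => u _; rewrite /patch /sq1 mem_setE /= in_itv /= -ler_norml.
 by case: (`|u| <= 1); rewrite /= ?mul1r ?mul0r.
have -> : Int Pi (fun u => g u - al * u * ind (`|u| <= 1)) =
  Int Pi r + ka * Int Pi sq1.
 rewrite -(RintZ ka int_sq1) -(RintD gen_int_r (intgZ ka int_sq1)).
 by apply: eq_Rintegral => u _; rewrite /r /sq1; ring.
rewrite [X in _ --> X](_ : _ = Int Pi r + (al * b + ka * (sg2 + Int Pi sq1))); last by ring.
apply: (@cvg_near_ev _ (fun x => mm p a x r + (al * mm p a x id1 + ka * mm p a x sq1))).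
 apply: cvgD; first exact: mm_r_cvg.
 apply: cvgD; apply: cvgMr; first exact: mm_id1_cvg.
 by rewrite -E; exact: mm_sq1_cvg.
apply: ev_imp gen_sm_g => x [x0 sg].
have s1 := sm_sq1 kp x0; have s2 := sm_id1 kp x0; have s3 := sm_r x0 sg.
rewrite -[X in X + _](mul1r (mm p a x r)) -(mm_lin3 a kp _ _ _ x0 s3 s2 s1).
congr (_ * _); congr Esum; apply/funext => k; rewrite /r /sq1 /id1.
by case: (`|_| <= 1) => /=; ring.
Qed.

End GenMain.

(** * Regular variation *)

Section RegVar.
Context {R : realType}.
Implicit Types (la : nat -> R) (ga : R).

(** With la = ln a: convergence of ln(a_k/a_n) to ga ln(k/n), uniform for k/n in a compact subset of
    (0,+oo). *)
Definition UC la ga := forall c C : R, 0 < c -> forall e, 0 < e ->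
 ev (fun n => forall k, c * n%:R <= k%:R -> k%:R <= C * n%:R ->
  `|la k - la n - ga * (ld k n)| <= e).

Definition PC la ga := forall v : R, 0 < v ->
 (fun n => la (trunc (v * n%:R)) - la n) @ \oo --> ga * ln v.

Lemma reg_var_PC a ga : reg_var a ga -> PC (fun n => ln (a n)) ga.
Proof.
move=> [a0 H] v v0; have := H v v0 => {}H.
rewrite -ln_powR (_ : (fun n => _) = (fun n => ln (a (trunc (v * n%:R)) / a n))).
 apply: (cvg_comp _ _ H); apply: continuous_ln; exact: powR_gt0.
by apply/funext => n; rewrite ln_div// posrE.
Qed.

Lemma ln_le_sub1 (x : R) : 0 < x -> ln x <= x - 1.
Proof. by move=> x0; rewrite -{1}[x](subrKC 1) ; apply: le_ln1Dx; rewrite ltrBrDl subrr. Qed.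

(* The sets of [v] that are good from [N] on cover the positive reals, so by
  Baire one of them is dense in some interval; as the floor is locally constant,
  density is already enough for uniformity there. *)
Lemma PC_local la ga : PC la ga -> forall e, 0 < e ->
 exists s t : R, 1 <= s /\ s < t /\ ev (fun n => forall k, s * n%:R <= k%:R ->
  k%:R + 1 <= t * n%:R -> `|la k - la n - ga * (ld k n)| <= e).
Proof.
move=> H e e0; have e2 : 0 < e / 2 by lra.
pose V N := [set v : R | 1 < v < 2 /\
 forall n, (N <= n)%N -> `|la (trunc (v * n%:R)) - la n - ga * ln v| <= e / 2].
have [N [D [Do [D0 DV]]]] : exists N (D : set R), open D /\ D !=set0 /\ D `<=` closure (V N).
 apply: contrapT => HN.
 have DD N : open (~` closure (V N)) /\ dense (~` closure (V N)).
  split; first by apply: closed_openC; exact: closed_closure.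
  move=> O O0 Oo; apply: contrapT => HO; apply: HN; exists N, O; split => //; split => //.
  by move=> x Ox; apply: contrapT => nx; apply: HO; exists x.
 have [] := @Baire R R (fun N => ~` closure (V N)) DD [set x | 1 < x < 2].
 - by exists (3/2) => /=; apply/andP; split; lra.
 - rewrite (_ : [set x | _] = `]1, 2[%classic); first exact: itv_open.
  by apply/seteqP; split => x /=; rewrite in_itv.
 move=> v [/= v12 /= Hv]; have v0 : 0 < v by case/andP: v12 => ? _; lra.
 have /cvgnE /(_ _ e2) [N HNv] := H v v0.
 by apply: (Hv N I); apply: subset_closure; split.
have [z Dz] := D0; have /nbhs_ballP [r /= r0 Hr] := open_nbhs_nbhs (conj Do Dz).
have inV x y : z - r < x -> x < y -> y < z + r -> exists v, V N v /\ x < v < y.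
 move=> zx xy yz; have : D ((x + y) / 2).
  by apply: Hr; rewrite /ball /= ltr_distlC; apply/andP; split; lra.
 move=> /DV /(_ [set w | x < w < y]) [].
  have -> : [set w | x < w < y] = `]x, y[%classic by apply/seteqP; split => w /=; rewrite in_itv.
  by apply: open_nbhs_nbhs; split; [exact: itv_open|rewrite /= in_itv /=; apply/andP; split; lra].
 by move=> v [Vv /= xvy]; exists v.
have z1 : 1 <= z - r / 2.
 have [v [[/andP[v1 _] _] /andP[v2 v3]]] := inV (z - r * 3 / 4) (z - r / 2) ltac:(lra) ltac:(lra) ltac:(lra).
 exact: (le_trans (ltW v1) (ltW v3)).
exists (z - r / 2), (z + r / 2); split => //; split; first lra.
have ga1 : 0 <= `|ga| by [].
apply: ev_imp (ev_and (ev_ge N.+1) (ev_ger (`|ga| * 2 / e))) => n [nN ne] k k1 k2.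
have n0 : 0 < n%:R :> R by rewrite ltr0n; apply: leq_trans nN.
have nz : n%:R <= (z - r / 2) * n%:R :> R by rewrite ler_peMl// ltW.
have k0 : 0 < k%:R :> R by lra.
have [v [[_ Vv] /andP[v1 v2]]] : exists v, V N v /\ k%:R / n%:R < v < (k%:R + 1) / n%:R.
 apply: inV.
 - rewrite ltr_pdivlMr//; apply: lt_le_trans k1; rewrite ltr_pM2r//; lra.
 - by rewrite ltr_pM2r ?invr_gt0//; lra.
 - by rewrite ltr_pdivrMr//; apply: (le_lt_trans k2); rewrite ltr_pM2r//; lra.
rewrite ltr_pdivrMr// in v1; rewrite ltr_pdivlMr// in v2.
have v0 : 0 < v by rewrite -(pmulr_lgt0 _ n0); exact: lt_trans v1.
have fl : trunc (v * n%:R) = k.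
 by apply: truncn_def; rewrite (ltW v1) natr1 in v2 *.
have := Vv n (ltnW nN); rewrite fl => h1.
have lv : `|ln v - (ld k n)| <= (k%:R)^-1.
 rewrite -ln_div ?posrE// -ln_div ?posrE ?divr_gt0//.
 have x1 : 1 <= v / (k%:R / n%:R) by rewrite invf_div mulrA ler_pdivlMr// mul1r ltW.
 rewrite ger0_norm ?ln_ge0//; apply: le_trans (ln_le_sub1 _) _; first lra.
 rewrite invf_div mulrA lerBlDr ler_pdivrMr// mulrDl mul1r mulVf ?gt_eqF//; lra.
rewrite (_ : _ - _ = (la k - la n - ga * ln v) + ga * (ln v - (ld k n))); last by ring.
apply: le_trans leND _; rewrite normrM.
have kn : n%:R <= k%:R :> R by lra.
have : `|ga| * `|ln v - (ld k n)| <= e / 2.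
 apply: (via (`|ga| * (k%:R)^-1)); first exact: ler_wpM2l.
 rewrite ler_pdivrMr// ; rewrite ler_pdivrMr// in ne.
 apply: (via (e / 2 * n%:R)); [lra|exact: ler_wpM2l (ltW e2) _ _ kn].
lra.
Qed.

Lemma ev_forall_lt (Q : nat -> nat -> Prop) M : (forall i, (i < M)%N -> ev (Q i)) ->
 ev (fun n => forall i, (i < M)%N -> Q i n).
Proof.
elim: M => [|M IH] H; first by exists 0%N.
have := ev_and (IH (fun i iM => H i (leqW iM))) (H M (leqnn _)).
apply: ev_imp => n [h1 h2] i; rewrite ltnS leq_eqVlt => /orP[/eqP -> //|]; exact: h1.
Qed.

Lemma mid_ineq (s t m : R) : s < t -> 2 * (t + 1) <= m * (t - s) ->
 (s + t) / 2 * (m + 1) + 1 <= t * m.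
Proof. by move=> *; nra. Qed.
(** A ratio k/n in [c, C] is reached by two jumps: from n to m, the integer part of i*de*n, for one
    of finitely many multiples i*de (pointwise convergence), then from m to k with k/m in the
    interval [s, t] of [PC_local]. *)
Lemma PC_UC la ga : PC la ga -> UC la ga.
Proof.
move=> H c C c0 e e0; have e4 : 0 < e / 4 by lra.
have [s [t [s1 [st [N0 HN0]]]]] := PC_local H e4.
(* For i >= i0, (i+1)*s is at most i*(s+t)/2, so consecutive multiples of s*de are close enough for
   u to lie between s and (s+t)/2 times i*de; the choice of [de] turns u >= c into i >= i0. *)
pose i0 := (trunc (2 * s / (t - s))).+1.
have i0p : 0 < i0%:R :> R by pos.
have i0s : 2 * s / (t - s) < i0%:R := truncnS_gt _.
pose de := c / (s * i0%:R).
have s0 : 0 < s by lra.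
have de0 : 0 < de by rewrite /de; pos.
pose M := (trunc (C / (s * de))).+1.
have /ev_forall_lt HM : forall i, (i < M)%N -> ev (fun n => (0 < i)%N ->
  `|la (trunc (i%:R * de * n%:R)) - la n - ga * ln (i%:R * de)| <= e / 4).
 move=> i _; have [->|i1] := posnP i; first by exists 0%N.
 have /cvgnE /(_ _ e4) : (fun n => la (trunc (i%:R * de * n%:R)) - la n) @ \oo --> ga * ln (i%:R * de).
  by apply: H; rewrite mulr_gt0 ?ltr0n.
 by apply: ev_imp => n.
(* The summands make m at least N0, make |ga|/m at most e/4, and leave room for the unit in k + 1 <=
   t*m. *)
set B := N0%:R + 2 + 4 * `|ga| / e + 2 * (t + 1) / (t - s).
apply: ev_imp (ev_and HM (ev_and (ev_ger (B / de)) (ev_ge 1))) => n [hM [nB n1]] k k1 k2.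
have n0 : 0 < n%:R :> R by pos.
have k0 : 0 < k%:R :> R by apply: lt_le_trans k1; rewrite mulr_gt0.
set u := k%:R / n%:R : R.
have kun : k%:R = u * n%:R by rewrite /u mulfVK// gt_eqF.
have uc : c <= u by rewrite /u ler_pdivlMr.
have uC : u <= C by rewrite /u ler_pdivrMr.
pose i := trunc (u / (s * de)).
have sde0 : 0 < s * de by pos.
have u0 : 0 < u by lra.
have /andP[i1 i2] : i%:R <= u / (s * de) < i.+1%:R by apply: truncn_itv; rewrite divr_ge0 ?ltW.
have ii0 : (i0 <= i)%N.
 rewrite /i truncn_ge_nat; last by rewrite divr_ge0 // ltW.
 rewrite ler_pdivlMr//.
 by rewrite /de (_ : i0%:R * _ = c)//; field; rewrite !gt_eqF.
have iM : (i < M)%N.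
 by rewrite /M ltnS /i; apply: le_truncn; rewrite ler_pM2r ?invr_gt0.
have ip : (0 < i)%N by apply: leq_trans ii0.
have iR : i0%:R <= i%:R :> R by rewrite ler_nat.
have i1R : 1 <= i%:R :> R by rewrite ler1n.
have {HM} hMi := hM i iM ip.
set w := i%:R * de in hMi; set m := trunc (w * n%:R) in hMi.
have w0 : 0 < w by rewrite /w mulr_gt0// (lt_le_trans ltr01).
rewrite ler_pdivlMr// in i1; rewrite ltr_pdivrMr// in i2.
have sw : s * w <= u by rewrite /w mulrCA.
have i0s' : 2 * s < i0%:R * (t - s) by rewrite -ltr_pdivrMr// subr_gt0.
have sw2 : u <= (s + t) / 2 * w.
 apply: ltW; apply: (lt_le_trans i2); rewrite -natr1 /w.
 rewrite [X in X <= _](_ : _ = (i%:R * s + s) * de); last by ring.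
 rewrite mulrA ler_pM2r//; have : i0%:R * (t - s) <= i%:R * (t - s) by rewrite ler_pM2r ?subr_gt0.
 lra.
have /andP[m1 m2] : m%:R <= w * n%:R < m.+1%:R by apply: truncn_itv; rewrite mulr_ge0 ?ltW.
rewrite -natr1 in m2.
have dw : de * n%:R <= w * n%:R by rewrite ler_pM2r// /w ler_peMl// ltW.
rewrite ler_pdivrMr// in nB; rewrite mulrC in nB.
have mB : N0%:R + 1 + 4 * `|ga| / e + 2 * (t + 1) / (t - s) <= m%:R by rewrite /B in nB; lra.
have q1 : 0 <= 4 * `|ga| / e by apply: divr_ge0; [exact: mulr_ge0|exact: ltW].
have ts0 : 0 < t - s by lra.
have t0 : 0 < t := lt_trans s0 st.
have q2 : 0 <= 2 * (t + 1) / (t - s).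
 by apply: divr_ge0; [apply: mulr_ge0 => //; apply: addr_ge0; [exact: ltW|exact: ler01]|exact: ltW].
have N0m : (N0 <= m)%N by rewrite -(ler_nat R); lra.
have NR : 0 <= N0%:R :> R by [].
have m0 : 0 < m%:R :> R by lra.
have h1 : `|la k - la m - ga * (ld k m)| <= e / 4.
 apply: HN0 => //.
  apply: (via (s * (w * n%:R))); first by rewrite ler_pM2l.
  by rewrite mulrA kun ler_pM2r.
 have : 2 * (t + 1) <= m%:R * (t - s) by rewrite -ler_pdivrMr//; lra.
 have : k%:R <= (s + t) / 2 * (m%:R + 1).
  apply: (via ((s + t) / 2 * (w * n%:R))); first by rewrite mulrA kun ler_pM2r.
  by rewrite ler_pM2l ?(ltW m2)// divr_gt0// addr_gt0.
 move=> h2 h3; apply: (via ((s + t) / 2 * (m%:R + 1) + 1)); first by rewrite lerD2r.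
 exact: mid_ineq.
have h3 : `|ln w + ln n%:R - ln m%:R| <= (m%:R)^-1.
 have wn0 : 0 < w * n%:R := mulr_gt0 w0 n0.
 rewrite -lnM ?posrE// -ln_div ?posrE//.
 have x1 : 1 <= w * n%:R / m%:R by rewrite ler_pdivlMr// mul1r.
 rewrite ger0_norm ?ln_ge0//; apply: le_trans (ln_le_sub1 _) _; first lra.
 by rewrite lerBlDr ler_pdivrMr// mulrDl mul1r mulVf ?gt_eqF//; lra.
have h4 : `|ga| * `|ln w + ln n%:R - ln m%:R| <= e / 4.
 apply: (via (`|ga| * (m%:R)^-1)); first exact: ler_wpM2l.
 rewrite ler_pdivrMr//; have : 4 * `|ga| / e <= m%:R by lra.
 by rewrite ler_pdivrMr//; lra.
rewrite (_ : _ - _ = (la k - la m - ga * (ld k m)) + (la m - la n - ga * ln w) +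
  ga * (ln w + ln n%:R - ln m%:R)); last by ring.
apply: le_trans leND _; rewrite normrM.
have := ler_normD (la k - la m - ga * (ld k m)) (la m - la n - ga * ln w).
lra.
Qed.

Lemma UC_opp la ga : UC la ga -> UC (fun n => - la n) (- ga).
Proof.
move=> H c C c0 e e0; apply: ev_imp (H c C c0 e e0) => n Hn k k1 k2.
by rewrite -normrN [X in `|X|](_ : _ = la k - la n - ga * (ld k n)); [exact: Hn|ring].
Qed.

(** Potter's bound by repeated halving of n: going from n/2 to n gains at least (ga - th) ln 2,
    which pays exactly for the error allowed in one step, so a single error survives. Finitely many
    small x are absorbed in C. *)
Lemma potter_ge la ga th : UC la ga -> th < ga -> exists C, 0 <= C /\
 forall x n, (0 < x)%N -> (x <= n)%N -> la x - th * ln x%:R <= la n - th * ln n%:R + C.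
Proof.
move=> H thga; have e0 : 0 < (ga - th) * ln 2 :> R by rewrite mulr_gt0 ?subr_gt0// ln_gt0//; lra.
pose F n := la n - th * ln n%:R.
(* The ratio 3 rather than 2 accounts for odd n, which exceed twice their half. *)
have [x1 Hx1] := H 1 3 ltr01 _ e0.
pose x0 := x1.+1.
have S1 x k : (x0 <= x)%N -> (x <= k)%N -> (k <= 3 * x)%N ->
  F x + (ga - th) * (ld k x) - (ga - th) * ln 2 <= F k.
 move=> x0x xk kx; have := Hx1 x (ltnW x0x) k; rewrite mul1r -natrM !ler_nat => /(_ xk kx).
 by rewrite ler_norml => /andP[h _]; rewrite /F; lra.
have S2 : forall n x, (x0 <= x)%N -> (x <= n)%N -> F x - (ga - th) * ln 2 <= F n.
 elim/ltn_ind => n IH x x0x xn; have xp : (0 < x)%N by apply: leq_trans x0x.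
 have [nx|nx] := leqP n (3 * x)%N.
  apply: le_trans (S1 _ _ x0x xn nx); rewrite lerD2r lerDl mulr_ge0 ?subr_ge0 ?(ltW thga)//.
  by rewrite ler_ln ?posrE ?ltr0n ?ler_nat// (leq_trans xp).
 have hn : (n./2 < n)%N by lia.
 have xh : (x <= n./2)%N by lia.
 apply: le_trans (IH _ hn x x0x xh) _.
 have := S1 n./2 n (leq_trans x0x xh) ltac:(lia) ltac:(lia).
 apply: le_trans; rewrite -addrA lerDl -mulrBr mulr_ge0 ?subr_ge0 ?(ltW thga)//.
 rewrite -ln_div ?posrE ?ltr0n; [|lia|lia].
 have h0 : 0 < n./2%:R :> R by rewrite ltr0n; lia.
 rewrite ler_ln ?posrE ?divr_gt0 ?ltr0n//; [|lia|lia].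
 by rewrite ler_pdivlMr// -natrM ler_nat; lia.
have [B HB] : exists B, forall x, (x <= x0)%N -> `|F x| <= B.
 exists (\sum_(i < x0.+1) `|F i|) => x xx.
 rewrite -ltnS in xx; rewrite (bigD1 (Ordinal xx))//= lerDl; exact: sumr_ge0.
have B0 : 0 <= B by apply: le_trans (HB 0%N _).
exists (B + B + (ga - th) * ln 2); split; first by rewrite !addr_ge0// ltW.
move=> x n xp xn; rewrite -/(F x) -/(F n).
have [h|h] := leqP x0 x; first by have := S2 n x h xn; lra.
have Fx : F x <= B by have := HB x (ltnW h); rewrite ler_norml => /andP[].
have Fn : - B - (ga - th) * ln 2 <= F n.
 have [k|k] := leqP x0 n.
  by have := S2 n x0 (leqnn _) k; have := HB x0 (leqnn _); rewrite ler_norml => /andP[]; lra.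
 by have := HB n (ltnW k); rewrite ler_norml => /andP[]; lra.
lra.
Qed.

Lemma potter_le la ga th : UC la ga -> ga < th -> exists C, 0 <= C /\
 forall x n, (0 < x)%N -> (x <= n)%N -> la n - th * ln n%:R <= la x - th * ln x%:R + C.
Proof.
move=> /UC_opp H gt; have [|C [C0 HC]] := potter_ge H (th := - th); first by rewrite ltrN2.
by exists C; split => // x n x0 xn; have := HC x n x0 xn; lra.
Qed.

End RegVar.

Definition seqcont {R : realType} (F : (R -> R) -> \bar R -> R) := forall (xs : nat -> R -> R) (x : R -> R) (rs : nat -> \bar R) (r : \bar R),
  (forall k, cadlag (xs k)) -> cadlag x ->
  (forall k, (0 <= rs k)%E) -> (0 <= r)%E ->
  J1_cvg xs x -> rs @ \oo --> r ->
  (fun k => F (xs k) (rs k)) @ \oo --> F x r.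

(** * Closeness in the Skorokhod sense *)

Section Close.
Context {R : realType}.
Implicit Types (x y l : R -> R) (r s : \bar R) (e : R).

(** One time change for the whole half-line: stronger than J1 closeness, and available because the
    paths compared end up near 0. Inverses of time changes are never built; both directions are
    proved wherever they are needed. *)
Definition tclose e x y := exists l, time_change l /\
 (forall t, 0 <= t -> `|l t - t| <= e) /\ (forall t, 0 <= t -> `|x (l t) - y t| <= e).

(** [contract] metrizes the extended half-line, so infinite absorption times need no special
    case. *)
Definition close e x r y s := tclose e x y /\ `|contract r - contract s| <= e.
Lemma tc_id : time_change (fun t : R => t).
Proof.
split => //; split; first by apply: continuous_subspaceT; exact: cont_id.
split => // M; exists (`|M| + 1); have := ler_norm M; split; [pos|lra].
Qed.

Lemma tclose_unif e x y : 0 <= e -> (forall t, 0 <= t -> `|x t - y t| <= e) -> tclose e x y.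
Proof.
move=> e0 H; exists (fun t => t); split; first exact: tc_id.
by split => // t _; rewrite subrr normr0.
Qed.

Lemma tc_ge0 l t : time_change l -> 0 <= t -> 0 <= l t.
Proof.
move=> [l0 [_ [H _]]]; rewrite le_eqVlt => /orP[/eqP <-|t0]; first by rewrite l0.
by apply: ltW; have := H 0 t (lexx _) t0; rewrite l0.
Qed.

Lemma tc_comp l1 l2 : time_change l1 -> time_change l2 -> time_change (fun t => l1 (l2 t)).
Proof.
move=> T1 T2; have [z1 [c1 [i1 u1]]] := T1; have [z2 [c2 [i2 u2]]] := T2.
split; first by rewrite z2.
split.
 apply/subspace_continuousP => t /= t0; apply/cvgrPdist_lt => e e0.
 move/subspace_continuousP : c1 => /(_ (l2 t) (tc_ge0 T2 t0)) /cvgrPdist_lt /(_ _ e0).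
 move=> /nbhs_ballP [d d0 Hd].
 move/subspace_continuousP : c2 => /(_ t t0) /cvgrPdist_lt /(_ _ d0).
 apply: filterS2 (withinT _ _) => u /= u0 Hu.
 by apply: Hd; [exact: Hu|exact: tc_ge0].
split; first by move=> s t s0 st; apply: i1; [exact: tc_ge0|exact: i2].
move=> M; have [t1 [t10 Mt1]] := u1 M; have [t2 [t20 Mt2]] := u2 t1.
by exists t2; split => //; apply: (lt_trans Mt1); exact: i1.
Qed.

Lemma tclose_trans e1 e2 x y z : tclose e1 x y -> tclose e2 y z -> tclose (e1 + e2) x z.
Proof.
move=> [l1 [T1 [h1 k1]]] [l2 [T2 [h2 k2]]]; exists (fun t => l1 (l2 t)); split; first exact: tc_comp.
split=> t t0; have := tc_ge0 T2 t0 => lt0.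
- rewrite (_ : _ - _ = (l1 (l2 t) - l2 t) + (l2 t - t)); last by ring.
 by apply: le_trans leND _; apply: lerD; [exact: h1|exact: h2].
- rewrite (_ : _ - _ = (x (l1 (l2 t)) - y (l2 t)) + (y (l2 t) - z t)); last by ring.
 by apply: le_trans leND _; apply: lerD; [exact: k1|exact: k2].
Qed.

Lemma close_trans e1 e2 x y z r s q : close e1 x r y s -> close e2 y s z q -> close (e1 + e2) x r z q.
Proof.
move=> [h1 k1] [h2 k2]; split; first exact: tclose_trans h1 h2.
rewrite (_ : _ - _ = (contract r - contract s) + (contract s - contract q)); last by ring.
by apply: le_trans leND _; apply: lerD.
Qed.

Lemma tclose_mon e1 e2 x y : e1 <= e2 -> tclose e1 x y -> tclose e2 x y.
Proof.
move=> ee [l [T [h k]]]; exists l; split => //.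
by split=> t t0; apply: le_trans ee; [exact: h|exact: k].
Qed.

Lemma tclose_J1 (u : nat -> R) (xs : nat -> R -> R) y : u @ \oo --> 0 ->
 (forall k, tclose (u k) (xs k) y) -> J1_cvg xs y.
Proof.
move=> /cvgnE u0 H; have [l Hl] := choice H.
exists l; split; first by move=> k; have [] := Hl k.
have U e : 0 < e -> \forall k \near \oo, u k <= e.
 move=> /u0 [N HN]; exists N => // k /HN; rewrite subr0; exact/le_trans/ler_norm.
split => [e e0|T T0 e e0]; apply: filterS (U _ e0) => k ke t t0;
 have [_ [h1 h2]] := Hl k; apply: le_trans ke; [exact: h1|apply: h2].
by case/andP: t0.
Qed.

Lemma contract_cvg (u : nat -> R) (rs : nat -> \bar R) r : u @ \oo --> 0 ->
 (forall k, `|contract (rs k) - contract r| <= u k) -> rs @ \oo --> r.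
Proof.
move=> /cvgnE u0 H; apply/cvg_ballP => e e0; have e2 : 0 < e / 2 by lra.
have [N HN] := u0 _ e2; exists N => // k /= /HN; rewrite subr0 => ue.
rewrite /ball /= /ereal_ball distrC; apply: le_lt_trans (H k) _.
by apply: le_lt_trans (le_trans (ler_norm _) ue) _; lra.
Qed.

Definition cla (d t : R) := mn (mx t 0) d.
Lemma cont_cla d : continuous (cla d).
Proof.
have c1 : continuous (fun t : R => mx t 0) := @cont_mx R _ 0 (@cont_id R).
exact: (contB (contD c1 (@cont_cst R d)) (@cont_mx R _ d c1)).
Qed.

Lemma cla0 d t : 0 <= d -> t <= 0 -> cla d t = 0.
Proof. by move=> d0 t0; rewrite /cla mxr// mnl. Qed.
Lemma cla_id d t : 0 <= t -> t <= d -> cla d t = t.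
Proof. by move=> t0 td; rewrite /cla mxl// mnl. Qed.
Lemma cla_d d t : 0 <= d -> d <= t -> cla d t = d.
Proof. by move=> d0 td; rewrite /cla mxl ?mnr//; exact: le_trans td. Qed.
Lemma mx_mono (c u v : R) : u <= v -> mx u c <= mx v c.
Proof.
move=> uv; have [h|h] := lerP u c; first by rewrite mxr// mx_ge.
by rewrite !mxl//; [exact: le_trans (ltW h) uv|exact: ltW].
Qed.
Lemma cla_mono d u v : u <= v -> cla d u <= cla d v.
Proof.
move=> uv; rewrite /cla; have := mx_mono 0 uv; set a := mx u 0; set b := mx v 0 => ab.
have [h|h] := lerP b d; first by rewrite !mnl//; exact: le_trans h.
rewrite [leRHS]mnr; last exact: ltW.
by have [k|k] := lerP a d; [rewrite mnl|rewrite mnr// ltW].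
Qed.

Section Match.
Context (m : nat) (s : nat -> R).
Hypotheses (s0 : s 0%N = 0) (sS : forall i, (i < m)%N -> s i < s i.+1).

Lemma sle i j : (i <= j)%N -> (j <= m)%N -> s i <= s j.
Proof.
elim: j => [|j IH]; first by rewrite leqn0 => /eqP ->.
rewrite leq_eqVlt => /orP[/eqP -> //|ij] jm.
by apply: le_trans (IH ij (ltnW jm)) _; apply: ltW; exact: sS.
Qed.

(** The piecewise linear function from 0 with slope [sl i] on [s i, s (i+1)] and slope 1 after s m.
    As a sum of clamps it is continuous without any gluing. *)
Definition Lg (sl : nat -> R) (u : R) : R :=
 \sum_(0 <= i < m) sl i * cla (s i.+1 - s i) (u - s i) + mx (u - s m) 0.

Lemma cont_Lg sl : continuous (Lg sl).
Proof.
have cs c : continuous (fun u : R => u - c) := contB (@cont_id R) (@cont_cst R c).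
apply: contD; last exact: (@cont_mx R _ 0 (cs (s m))).
rewrite unlock; elim: (index_iota 0 m) => [|i r IH] /=; first exact: cont_cst.
apply: contD => //; apply: contM; first exact: cont_cst.
exact: (contcomp (@cont_cla _) (cs (s i))).
Qed.

Lemma Lg_eval sl j u : (j < m)%N -> s j <= u -> u <= s j.+1 ->
 Lg sl u = \sum_(0 <= i < j) sl i * (s i.+1 - s i) + sl j * (u - s j).
Proof.
move=> jm ju uj; rewrite /Lg (big_cat_nat (n := j))//=; last exact: ltnW.
rewrite [X in _ + X + _]big_ltn// cla_id ?subr_ge0 ?lerD2r//.
rewrite [X in _ + (_ + X) + _]big1_seq; last first.
 move=> i; rewrite mem_index_iota => /andP[_ /andP[ji im]].
 rewrite cla0 ?mulr0// ?subr_ge0 ?subr_le0; first exact/ltW/sS.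
 by apply: (le_trans uj); apply: sle => //; exact: ltnW.
rewrite mxr ?addr0; last by rewrite subr_le0; apply: (le_trans uj); exact: sle.
congr (_ + _); apply: eq_big_nat => i /andP[_ ij].
rewrite cla_d// ?lerD2r ?subr_ge0; first by apply/ltW/sS/(ltn_trans ij).
by apply: le_trans ju; apply: sle => //; exact: ltnW.
Qed.

Lemma Lg_evalm sl u : s m <= u ->
 Lg sl u = \sum_(0 <= i < m) sl i * (s i.+1 - s i) + (u - s m).
Proof.
move=> mu; rewrite /Lg mxl ?subr_ge0//; congr (_ + _).
apply: eq_big_nat => i /andP[_ im]; rewrite cla_d ?subr_ge0 ?lerD2r//; first exact/ltW/sS.
by apply: le_trans mu; exact: sle.
Qed.

Lemma locate u : 0 <= u -> (exists j, (j < m)%N /\ s j <= u < s j.+1) \/ s m <= u.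
Proof.
move=> u0; suff H j : (j <= m)%N -> (exists i, (i < j)%N /\ s i <= u < s i.+1) \/ s j <= u.
 by have := H m (leqnn m).
elim: j => [|j IH] jm; first by right; rewrite s0.
have [[i [ij iu]]|ju] := IH (ltnW jm).
 by left; exists i; split => //; exact: ltnW.
by have [h|h] := lerP (s j.+1) u; [right|left; exists j; rewrite ju h].
Qed.

Lemma Lg1 u : 0 <= u -> Lg (fun=> 1) u = u.
Proof.
move=> u0; have E j : \sum_(0 <= i < j) 1 * (s i.+1 - s i) = s j.
 under eq_bigr do rewrite mul1r.
 by rewrite telescope_sumr// s0 subr0.
have [[j [jm /andP[h1 h2]]]|h] := locate u0.
 by rewrite (@Lg_eval _ j)// ?E ?mul1r ?subrKC// ltW.
by rewrite Lg_evalm// E subrKC.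
Qed.

(** Term by term, the increment is at least c times the increment for slopes equal to 1, which is v
    - u by [Lg1]; c is the least slope, capped by 1. *)
Lemma Lg_incr sl : (forall i, (i < m)%N -> 0 < sl i) -> forall u v, 0 <= u -> u < v -> Lg sl u < Lg sl v.
Proof.
move=> sl0 u v u0 uv.
have [c [c0 [c1 cs]]] : exists c : R, 0 < c /\ c <= 1 /\ forall i, (i < m)%N -> c <= sl i.
 have : forall j, (j <= m)%N -> exists c : R, 0 < c /\ c <= 1 /\ forall i, (i < j)%N -> c <= sl i.
  elim=> [|j IH] jm; first by exists 1.
  have [c [c0 [c1 cs]]] := IH (ltnW jm); exists (Num.min c (sl j)).
  split; first by rewrite lt_min c0 sl0.
  split; first by rewrite ge_min c1.
  move=> i; rewrite ltnS leq_eqVlt => /orP[/eqP ->|ij]; first by rewrite ge_min lexx orbT.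
  by rewrite ge_min cs.
 by apply.
have D sl' : Lg sl' v - Lg sl' u =
  \sum_(0 <= i < m) sl' i * (cla (s i.+1 - s i) (v - s i) - cla (s i.+1 - s i) (u - s i)) +
  (mx (v - s m) 0 - mx (u - s m) 0).
 rewrite /Lg opprD addrACA -sumrB; congr (_ + _).
 by apply: eq_bigr => i _; rewrite [RHS]mulrBr.
have D1 := D (fun=> 1); rewrite (Lg1 u0) (Lg1 (le_trans u0 (ltW uv))) in D1.
rewrite -subr_gt0; apply: (@lt_le_trans _ _ (c * (v - u))); first by rewrite mulr_gt0// subr_gt0.
rewrite D D1 mulrDr; apply: lerD; last by rewrite ler_piMl// subr_ge0 mx_mono// lerD2r ltW.
rewrite mulr_sumr !big_nat; apply: ler_sum => i /andP[_ im].
by rewrite mul1r ler_wpM2r ?cs// subr_ge0 cla_mono// lerD2r ltW.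
Qed.

Context (t : nat -> R).
Hypotheses (t0 : t 0%N = 0) (tS : forall i, (i < m)%N -> t i < t i.+1).

(** The time change interpolates s i -> t i linearly. Inside a piece its displacement is a convex
    combination of those at the two ends, hence at most e. *)
Lemma match_tclose e x y : 0 <= e -> (forall i, (i <= m)%N -> `|t i - s i| <= e) ->
 (forall i u v, (i < m)%N -> t i <= u < t i.+1 -> s i <= v < s i.+1 -> `|x u - y v| <= e) ->
 (forall u v, t m <= u -> s m <= v -> `|x u - y v| <= e) ->
 tclose e x y.
Proof.
move=> e0 ts H1 H2; pose sl i := (t i.+1 - t i) / (s i.+1 - s i).
have ds i : (i < m)%N -> 0 < s i.+1 - s i by move=> /sS; rewrite subr_gt0.
have sl0 i : (i < m)%N -> 0 < sl i by move=> im; rewrite /sl divr_gt0 ?ds// subr_gt0 tS.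
have E j : (j <= m)%N -> \sum_(0 <= i < j) sl i * (s i.+1 - s i) = t j.
 move=> jm; have -> : t j = \sum_(0 <= i < j) (t i.+1 - t i) by rewrite telescope_sumr// t0 subr0.
 apply: eq_big_nat => i /andP[_ ij].
 by rewrite /sl mulfVK// gt_eqF// ds// (leq_trans ij).
have L0 : Lg sl 0 = 0.
 have := @Lg_evalm sl 0; have := @Lg_eval sl 0 0; rewrite s0 subr0 mulr0 big_geq// addr0.
 have [m0 _|m0 h _] := posnP m; first by rewrite m0 s0 subr0 big_geq// addr0 => ->.
 by rewrite h//; have := sS m0; rewrite s0; exact: ltW.
exists (Lg sl); split.
 split => //; split; first by apply: continuous_subspaceT; exact: cont_Lg.
 split; first exact: Lg_incr.
 move=> M; exists (Num.max (s m) (M + 1 - t m + s m)).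
 have sm0 : 0 <= s m by rewrite -s0; exact: sle.
 split; first by rewrite le_max sm0.
 rewrite Lg_evalm ?le_max ?lexx// E//.
 have : M + 1 - t m + s m <= Num.max (s m) (M + 1 - t m + s m) by rewrite le_max lexx orbT.
 lra.
split => u u0; have [[j [jm /andP[h1 h2]]]|h] := locate u0.
- rewrite (@Lg_eval sl j)// ?(ltW h2)// E ?(ltnW jm)//.
 have q0 := ts j (ltnW jm); have q1 := ts j.+1 jm.
 set w := (u - s j) / (s j.+1 - s j).
 have w0 : 0 <= w by rewrite divr_ge0 ?subr_ge0//; exact/ltW/sS.
 have w1 : w <= 1 by rewrite ler_pdivrMr ?ds// mul1r lerD2r ltW.
 rewrite (_ : _ - u = (1 - w) * (t j - s j) + w * (t j.+1 - s j.+1)); last first.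
  by rewrite /sl /w; field; rewrite gt_eqF// ds.
 apply: le_trans leND _; rewrite (normrM (1 - w)) (normrM w) (ger0_norm w0) (@ger0_norm _ (1 - w)) ?subr_ge0//.
 rewrite (_ : e = (1 - w) * e + w * e); last by ring.
 by apply: lerD; apply: ler_wpM2l => //; rewrite subr_ge0.
- rewrite Lg_evalm// E//; have := ts m (leqnn m).
 by congr (`|_| <= e); ring.
- rewrite (@Lg_eval sl j)// ?(ltW h2)// E ?(ltnW jm)//; apply: (H1 j) => //; last by rewrite h1.
 rewrite lerDl mulr_ge0 ?(ltW (sl0 _ _)) ?subr_ge0//= -ltrBrDl /sl -mulrA mulrC.
 rewrite -[ltRHS]mul1r ltr_pM2r ?subr_gt0 ?tS// mulrC ltr_pdivrMr ?ds// mul1r ltrD2r//.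
- by rewrite Lg_evalm// E//; apply: H2 => //; rewrite lerDl subr_ge0.
Qed.

End Match.

Section Lip.
Context (F : (R -> R) -> \bar R -> R) (M : R).
Hypothesis FM : forall x r, `|F x r| <= M.

Definition adm (x : R -> R) (r : \bar R) := cadlag x /\ (0 <= r)%E.
Definition Fk_set (k : nat) x r := [set z | exists y s e, [/\ adm y s, 0 <= e, close e y s x r & z = F y s + k%:R * e]].
(** The inf-convolution of [F] with k times the distance. Only admissible competitors are allowed,
    because [F] is continuous only along them. *)
Definition Fk (k : nat) x r := inf (Fk_set k x r).
Lemma close_refl x r : close 0 x r x r.
Proof. by split; [apply: tclose_unif => // t _; rewrite subrr normr0|rewrite subrr normr0]. Qed.
Lemma Fk_lb k x r : lbound (Fk_set k x r) (- M).
Proof.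
move=> z [y [s [e [_ e0 _ ->]]]]; have := FM y s; rewrite ler_norml => /andP[h _].
have : 0 <= k%:R * e by pos.
lra.
Qed.

Lemma Fk_has k x r : adm x r -> has_inf (Fk_set k x r).
Proof.
move=> ax; split; last by exists (- M); exact: Fk_lb.
by exists (F x r), x, r, 0; split => //; [exact: close_refl|rewrite mulr0 addr0].
Qed.

Lemma Fk_le k x r : adm x r -> Fk k x r <= F x r.
Proof.
move=> ax; apply: ge_inf; first by exists (- M); exact: Fk_lb.
by exists x, r, 0; split => //; [exact: close_refl|rewrite mulr0 addr0].
Qed.

Lemma Fk_bnd k x r : adm x r -> `|Fk k x r| <= M.
Proof.
move=> ax; rewrite ler_norml; apply/andP; split; last first.
 by apply: le_trans (Fk_le k ax) _; apply: le_trans (ler_norm _) (FM _ _).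
by apply: lb_le_inf; [exact: (Fk_has k ax).1|exact: Fk_lb].
Qed.

(** Competitors for (x, r) are competitors for (y, s) at an extra cost k*e. Thus (y, s) itself need
    not be admissible. *)
Lemma Fk_lip k x r y s e : adm x r -> 0 <= e -> close e x r y s -> Fk k y s <= Fk k x r + k%:R * e.
Proof.
move=> ax e0 C; rewrite -lerBlDr; apply: lb_le_inf; first exact: (Fk_has k ax).1.
move=> z [y' [s' [e' [a' e'0 C' ->]]]]; rewrite lerBlDr; apply: ge_inf; first by exists (- M); exact: Fk_lb.
exists y', s', (e' + e); split => //; [exact: addr_ge0|exact: close_trans C' C|].
by rewrite mulrDr addrA.
Qed.

Hypothesis FC : seqcont F.

(** A competitor doing better than F x r must lie within 2M/k of (x, r), as F varies by at most 2M.
    If the gain stayed above e, such competitors would converge to (x, r) and contradict the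
    sequential continuity of [F]. *)
Lemma Fk_cvg x r : adm x r -> (fun k => Fk k x r) @ \oo --> F x r.
Proof.
move=> ax; apply/cvgnE => e e0; apply: contrapT => H.
have {}H : forall N, exists k, (N <= k)%N /\ Fk k x r < F x r - e.
 move=> N; apply: contrapT => HN; apply: H; exists N => k Nk.
 rewrite ler0_norm ?subr_le0 ?Fk_le// opprB lerBlDr -lerBlDl leNgt; apply/negP => h.
 by apply: HN; exists k.
have G N : exists ys : (R -> R) * (\bar R), adm ys.1 ys.2 /\ F ys.1 ys.2 < F x r - e /\
  close (2 * M / N.+1%:R) ys.1 ys.2 x r.
 have [k [Nk hk]] := H N.+1; have [z [y [s [e' [ay e'0 C ->]]]] zk] := inf_lt (Fk_has k ax).1 hk.
 have kp : (0 < k)%N by apply: leq_trans Nk.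
 have k0 : 0 < k%:R :> R by pos.
 exists (y, s); split => //=; split; first by apply: le_lt_trans zk; rewrite lerDl; pos.
 have e'M : e' <= 2 * M / N.+1%:R.
  apply: (via (2 * M / k%:R)); last first.
   rewrite ler_wpM2l ?lef_pV2 ?posrE ?ltr0n ?ler_nat//.
   by apply: mulr_ge0 => //; apply: le_trans (FM x r).
  rewrite ler_pdivlMr// mulrC.
  have := FM y s; rewrite ler_norml => /andP[h1 _]; have := FM x r; rewrite ler_norml => /andP[_ h2].
  lra.
 by split; [exact: tclose_mon C.1|apply: le_trans C.2 e'M].
have [ys Hys] := choice G.
have u0 : (fun N => 2 * M / N.+1%:R) @ \oo --> (0 : R).
 by rewrite -(mulr0 (2 * M)); apply: cvgMr; exact: cvg_harmonic.
have J : J1_cvg (fun N => (ys N).1) x by apply: (tclose_J1 u0) => k; have [_ [_ []]] := Hys k.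
have K : (fun N => (ys N).2) @ \oo --> r by apply: (contract_cvg u0) => k; have [_ [_ []]] := Hys k.
move: (@FC _ x _ r (fun k => (Hys k).1.1) ax.1 (fun k => (Hys k).1.2) ax.2 J K).
have e2 : 0 < e / 2 by lra.
move=> /cvgnE /(_ _ e2)[N /(_ N (leqnn _))]; have [_ [h _]] := Hys N.
by rewrite ler_norml => /andP[]; lra.
Qed.

End Lip.

End Close.

(** * A bounded smooth detector of displacements and its drift under the chain *)

Section Psi.
Context {R : realType}.
Implicit Types z w : R.

(** A smooth substitute for min(1, z^2): it vanishes at 0, is at least 1/2 once |z| >= 1, and has
    bounded first and second differences, so its drift is controlled by (A1) and (A2) alone. *)
Definition ps z := z ^+ 2 / (1 + z ^+ 2).
Definition dps z := 2 * z / (1 + z ^+ 2) ^+ 2.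
Lemma sq1p z : 0 < 1 + z ^+ 2.
Proof. by have := sqr_ge0 z; lra. Qed.
Lemma ps_ge0 z : 0 <= ps z.
Proof. by rewrite divr_ge0 ?sqr_ge0// ltW// sq1p. Qed.
Lemma ps_le1 z : ps z <= 1.
Proof. by rewrite ler_pdivrMr ?sq1p// mul1r; lra. Qed.
Lemma ps0 : ps 0 = 0.
Proof. by rewrite /ps expr0n /= mul0r. Qed.
Lemma ps_half z : 1 <= `|z| -> 1 / 2 <= ps z.
Proof.
move=> z1; rewrite ler_pdivlMr ?sq1p// -(real_normK (num_real z)).
by have : 1 <= `|z| ^+ 2 by [rewrite exprn_ege1]; lra.
Qed.

Lemma dps_le1 z : `|dps z| <= 1.
Proof.
have h := sq1p z; rewrite /dps normrM normfV (@ger0_norm _ (_ ^+ 2)) ?sqr_ge0//.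
rewrite ler_pdivrMr ?exprn_gt0// mul1r normrM (@ger0_norm _ 2)// -(real_normK (num_real z)).
have := normr_ge0 z; set y := `|z| => y0; nra.
Qed.

Lemma ps_taylor z w : `|ps (z + w) - ps z - w * dps z| <= 2 * w ^+ 2.
Proof.
set m := z + w; have hz := sq1p z; have hm := sq1p m.
have E : ps m - ps z - w * dps z =
  - (w ^+ 2 * (3 * z ^+ 2 + 2 * z * w - 1) / ((1 + z ^+ 2) ^+ 2 * (1 + m ^+ 2))).
 rewrite /ps /dps /m; field; rewrite gt_eqF ?sq1p//= gt_eqF// ; exact: sq1p.
rewrite E normrN normrM normfV normrM (@ger0_norm _ (w ^+ 2)) ?sqr_ge0//.
rewrite (@gtr0_norm _ (_ * _)) ?mulr_gt0 ?exprn_gt0//.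
rewrite ler_pdivrMr ?mulr_gt0 ?exprn_gt0//.
rewrite (_ : 2 * w ^+ 2 * _ = w ^+ 2 * (2 * ((1 + z ^+ 2) ^+ 2 * (1 + m ^+ 2)))); last by ring.
apply: ler_wpM2l; first exact: sqr_ge0.
have -> : 3 * z ^+ 2 + 2 * z * w - 1 = z ^+ 2 + 2 * (z * m) - 1 by rewrite /m; ring.
have h1 : z ^+ 2 + 2 * (z * m) - 1 <= 2 * ((1 + z ^+ 2) * (1 + m ^+ 2)).
 by have := sqr_ge0 (z - m); have := sqr_ge0 (z * m); rewrite !expr2; nra.
have h2 : - (2 * ((1 + z ^+ 2) * (1 + m ^+ 2))) <= z ^+ 2 + 2 * (z * m) - 1.
 by have := sqr_ge0 (z + m); have := sqr_ge0 (z * m); rewrite !expr2; nra.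
have h3 : 2 * ((1 + z ^+ 2) * (1 + m ^+ 2)) <= 2 * ((1 + z ^+ 2) ^+ 2 * (1 + m ^+ 2)).
 rewrite ler_pM2l// ler_pM2r// expr2 ler_peMl ?(ltW hz)//.
 by have := sqr_ge0 z; lra.
by rewrite ler_norml; apply/andP; split; lra.
Qed.

Lemma ps_lip z w : `|ps (z + w) - ps z| <= `|w|.
Proof.
set m := z + w; have hz := sq1p z; have hm := sq1p m.
have -> : ps m - ps z = w * ((z + m) / ((1 + z ^+ 2) * (1 + m ^+ 2))).
 rewrite /ps /m; field; rewrite gt_eqF ?sq1p//= gt_eqF// ; exact: sq1p.
rewrite normrM ler_piMr// normrM normfV (@gtr0_norm _ (_ * _)) ?mulr_gt0//.
rewrite ler_pdivrMr ?mulr_gt0// mul1r ler_norml.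
have := sqr_ge0 (z - 1); have := sqr_ge0 (z + 1); have := sqr_ge0 (m - 1); have := sqr_ge0 (m + 1).
have := mulr_ge0 (sqr_ge0 z) (sqr_ge0 m).
by rewrite !expr2 => *; apply/andP; split; nra.
Qed.

End Psi.

Section Facts.
Context {R : realType} (p : nat -> nat -> R) (a : nat -> R).
Hypotheses (kp : is_kernel p) (a0 : forall n, 0 < a n).

Definition tl (A u : R) : R := ind (A < `|u|).
Definition factB (Cg : R) (x : nat) := (0 < x)%N /\ mm p a x sq1 <= Cg /\ `|mm p a x id1| <= Cg /\ mm p a x (tl 1) <= Cg.
Lemma sm_tl x A : (0 < x)%N -> sm p x (tl A).
Proof. by move=> x0; apply: (@sm_bnd _ _ kp x _ 1) => // u; rewrite ger0_norm ?ind_ge0 ?ind_le1. Qed.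
Lemma sm_ps x l c : (0 < x)%N -> sm p x (fun u => ps ((l + u) / c) - ps (l / c)).
Proof.
move=> x0; apply: (@sm_bnd _ _ kp x _ 1) => // u; rewrite ler_norml.
have := ps_ge0 ((l + u) / c); have := ps_le1 ((l + u) / c).
have := ps_ge0 (l / c); have := ps_le1 (l / c).
by move=> *; apply/andP; split; lra.
Qed.

(** Jumps of size at most 1 use the second-order expansion, jumps between 1 and A the Lipschitz
    bound, larger ones the bound 1. The last term stays separate because it does not shrink with de
    growing, but only with A. *)
Lemma ps_step Cg x de A l : factB Cg x -> 0 < de -> 1 <= A ->
 `|mm p a x (fun u => ps ((l + u) / de) - ps (l / de))| <=
  Cg / de + 2 * Cg / de ^+ 2 + A / de * Cg + mm p a x (tl A).
Proof.
move=> [x0 [B1 [B2 B3]]] de0 A1.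
have s1 := sm_sq1 kp x0; have s2 := sm_id1 kp x0; have s3 := sm_tl (A:=1) x0; have s4 := sm_tl (A:=A) x0.
have sp := sm_ps (l:=l) (c:=de) x0.
set D := dps (l / de) / de.
have HD : `|D| <= de^-1 by rewrite normrM normfV (gtr0_norm de0) ler_piMl ?invr_ge0 ?(ltW de0)// dps_le1.
pose g u := ps ((l + u) / de) - ps (l / de) - D * id1 u.
have sg : sm p x g by apply: (smB kp x0 sp); exact: smZ.
have -> : mm p a x (fun u => ps ((l + u) / de) - ps (l / de)) = mm p a x g + D * mm p a x id1.
 by rewrite -(mmZ a kp D x0 s2) -(mmD a kp x0 sg (smZ (c:=D) s2)); congr (_ * _); congr Esum; apply/funext => k; rewrite /g subrK.
have G : `|mm p a x g| <= 2 / de ^+ 2 * mm p a x sq1 + (A / de * mm p a x (tl 1) + 1 * mm p a x (tl A)).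
 rewrite -(mm_lin3 a kp _ _ _ x0 s1 s3 s4); apply: mm_norm => //; first exact: sm_lin3.
 move=> u; rewrite /g /id1 /sq1 /tl.
 have t1 : 0 <= 2 / de ^+ 2 * (ind (`|u| <= 1) * u ^+ 2).
  by rewrite mulr_ge0 ?divr_ge0 ?exprn_ge0 ?(ltW de0)// mulr_ge0 ?ind_ge0 ?sqr_ge0.
 have t2 : 0 <= A / de * ind (1 < `|u|).
  by rewrite mulr_ge0 ?ind_ge0// divr_ge0 ?(ltW de0)//; lra.
 have t3 : 0 <= 1 * ind (A < `|u|) :> R by rewrite mulr_ge0 ?ind_ge0.
 case: (lerP `|u| 1) => u1 /=.
  apply: (via (2 / de ^+ 2 * (1 * u ^+ 2))).
   rewrite !mul1r [X in _ <= X](_ : _ = 2 * (u / de) ^+ 2); last by field; rewrite gt_eqF.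
   rewrite (_ : D * u = u / de * dps (l / de)); last by rewrite /D; ring.
   by rewrite mulrDl; exact: ps_taylor.
  rewrite lerDl; move: t2 t3; rewrite (_ : (1 < `|u|) = false) /=; last by apply/negbTE; rewrite -leNgt.
  by rewrite mulr0 add0r.
 rewrite mul0r mulr0 subr0 mul0r mulr0 add0r.
 have [uA|uA] := lerP `|u| A; rewrite /=.
  rewrite mulr0 addr0 mulr1; apply: (via (`|u| / de)); last by rewrite ler_pM2r ?invr_gt0.
  rewrite -[X in _ <= _ * X](gtr0_norm (_ : 0 < de^-1)) ?invr_gt0// -normrM mulrDl; exact: ps_lip.
 rewrite !mulr1; apply: (via 1); last by rewrite lerDr divr_ge0 ?(ltW de0)//; lra.
 have := ps_ge0 ((l + u) / de); have := ps_le1 ((l + u) / de).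
 have := ps_ge0 (l / de); have := ps_le1 (l / de).
 by move=> *; rewrite ler_norml; apply/andP; split; lra.
apply: le_trans leND _; rewrite (normrM D).
have h1 : `|D| * `|mm p a x id1| <= Cg / de by rewrite mulrC ler_pM.
have h2 : 2 / de ^+ 2 * mm p a x sq1 <= 2 * Cg / de ^+ 2.
 by rewrite mulrAC ler_pM2r ?invr_gt0 ?exprn_gt0// ler_pM2l.
have h3 : A / de * mm p a x (tl 1) <= A / de * Cg.
 by apply: ler_wpM2l => //; apply: divr_ge0; [lra|exact: ltW].
lra.
Qed.

Context (Pi : {measure set R -> \bar R}) (b sg2 : R).
Hypotheses (HA1 : A1 p a Pi) (LP : levy_measure Pi) (HA2 : A2 p a Pi b sg2).

Lemma cvg_ubound (u : nat -> R) (l : R) : u @ \oo --> l -> exists2 C, 0 <= C & ev (fun n => `|u n| <= C).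
Proof.
move=> /cvgnE /(_ _ ltr01) H; exists (`|l| + 1); first by pos.
by apply: ev_imp H => n h; have := ler_normD (u n - l) l; rewrite subrK; lra.
Qed.

Lemma zeta_mm : (fun x => mm p a x zeta) @ \oo --> Int Pi zeta.
Proof.
have F u : 1 <= `|u| -> zeta u = 1 by move=> h; rewrite /zeta cl_eq1//; lra.
apply: (@A1_u _ _ _ kp _ HA1 _ 1 (1/4)); rewrite ?divr_gt0//.
- exact: cont_zeta.
- exact: zeta0.
- move=> u h; have h' : 1 <= `|u| by rewrite -normrN; apply: le_trans (ler_norm _); rewrite lerNr.
 by rewrite !F// normrN ger0_norm.
- by move=> u h; have h' : 1 <= `|u| := le_trans h (ler_norm u); rewrite !F// ger0_norm.
Qed.

Lemma factB_ev : exists2 Cg, 0 <= Cg & ev (factB Cg).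
Proof.
have [C1 C10 H1] := cvg_ubound (HA2.2 : (fun x => mm p a x sq1) @ \oo --> _).
have [C2 C20 H2] := cvg_ubound (HA2.1 : (fun x => mm p a x id1) @ \oo --> _).
have [C3 C30 H3] := cvg_ubound zeta_mm.
exists (C1 + C2 + C3); first by pos.
apply: ev_imp (ev_and (ev_ge 1) (ev_and H1 (ev_and H2 H3))) => x [x0 [h1 [h2 h3]]].
split => //; split; [|split].
- by apply: le_trans (ler_norm _) _; apply: (le_trans h1); lra.
- by apply: (le_trans h2); lra.
- have sz : sm p x zeta by apply: (@sm_bnd _ _ kp x _ 1) => // u; rewrite ger0_norm ?cl_ge0 ?cl_le1.
 apply: (via (mm p a x zeta)); last by apply: le_trans (ler_norm _) _; apply: (le_trans h3); lra.
 apply: mm_le => //; first exact: sm_tl.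
 move=> u; rewrite /tl; have [h|h] := ltP 1 `|u|; last by rewrite cl_ge0.
 by rewrite /zeta cl_eq1//; lra.
Qed.

(** Tightness of the jumps: continuous tail functions decrease to 0 under the domination of [zeta],
    so one of them has small Pi-integral, and (A1) carries this to all large x. *)
Lemma factT_ev e : 0 < e -> exists2 A, 1 <= A & ev (fun x => mm p a x (tl A) <= e).
Proof.
move=> e0; pose f (j : nat) (u : R) := cl (`|u| - j.+1%:R).
have cf j : continuous (f j).
 exact: (cont_cl (contB (contnorm (@cont_id R)) (@cont_cst R j.+1%:R))).
have fz j u : `|f j u| <= zeta u.
 rewrite ger0_norm ?cl_ge0// /f /zeta; have [h|h] := lerP (1/2) `|u|.
  by rewrite [cl (4 * _ - _)]cl_eq1 ?cl_le1//; lra.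
 rewrite cl_eq0 ?cl_ge0//; have : 1 <= j.+1%:R :> R by rewrite ler1n.
 lra.
have f0 u : f ^~ u @ \oo --> (0 : R).
 apply/cvgnE => e' e'0; apply: ev_imp (ev_ger `|u|) => j h.
 by rewrite subr0 /f cl_eq0 ?normr0 ?(ltW e'0)// -natr1; lra.
have mf j : meas (f j) := cmf (cf j).
have [_] := Rint_dctT mf (measurable_cst (0 : R)) f0 (intg_zeta LP) fz.
move=> /cvgnE /(_ (e / 2) ltac:(lra)) [j /(_ j (leqnn j))].
rewrite [X in _ - X](_ : _ = 0) ?subr0; last by rewrite /Rintegral integral0.
move=> Hj; exists j.+2%:R; first by rewrite ler1n.
have /cvgnE /(_ (e / 2) ltac:(lra)) H : (fun x => mm p a x (f j)) @ \oo --> Int Pi (f j).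
 have F u : j.+2%:R <= `|u| -> f j u = 1 by move=> h; rewrite /f cl_eq1//; rewrite -natr1 in h; lra.
 apply: (@A1_u _ _ _ kp _ HA1 _ j.+2%:R 1); rewrite ?ltr0n//.
 - move=> u h; rewrite /f cl_eq0//; have : 1 <= j.+1%:R :> R by rewrite ler1n.
  lra.
 - move=> u h; have h' : j.+2%:R <= `|u| by rewrite -normrN; apply: le_trans (ler_norm _); rewrite lerNr.
  by rewrite !F// normrN ger0_norm.
 - by move=> u h; have h' : j.+2%:R <= `|u| := le_trans h (ler_norm u); rewrite !F// ger0_norm.
apply: ev_imp (ev_and (ev_ge 1) H) => x [x0 h].
have sf : sm p x (f j) by apply: (@sm_bnd _ _ kp x _ 1) => // u; rewrite ger0_norm ?cl_ge0 ?cl_le1.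
apply: (via (mm p a x (f j))).
 apply: mm_le => //; first exact: sm_tl.
 move=> u; rewrite /tl; have [k|k] := ltP j.+2%:R `|u|; last by rewrite cl_ge0.
 by rewrite /f cl_eq1//; rewrite -natr1 in k; lra.
by move: h Hj; rewrite !ler_norml => /andP[_ h] /andP[_ h2]; lra.
Qed.

End Facts.

(** * Supermartingales along histories *)

Section HistFun.
Context {R : realType} (a : nat -> R).

(** The newest state has not been left yet, so its holding time is not counted. *)
Fixpoint clk (h : seq nat) : R :=
 if h is _ :: h' then (if h' is x :: _ then clk h' + (a x)^-1 else 0) else 0.

Lemma clk_cons y x h : clk (y :: x :: h) = clk (x :: h) + (a x)^-1.
Proof. by []. Qed.

Context (de ep : R).

(** The reference state moves to the current one whenever the latter is more than de away in
    logarithm. Along these exits, [erc] records the clock at the last one, [eJ] counts them, and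
    [enb] counts those that follow the previous one by less than 2*ep. These two counts control the
    number and the clock lengths of the pieces of the path. *)
Fixpoint eref (h : seq nat) : nat :=
 if h is y :: h' then (if h' is _ :: _ then
  (if de < `|ld y (eref h')| then y else eref h') else y) else 0%N.

Definition isex (y : nat) (h : seq nat) := de < `|ld y (eref h)|.
Fixpoint erc (h : seq nat) : R :=
 if h is y :: h' then (if h' is _ :: _ then
  (if isex y h' then clk h else erc h') else 0) else 0.

Fixpoint eJ (h : seq nat) : nat :=
 if h is y :: h' then (if h' is _ :: _ then (isex y h' + eJ h')%N else 0%N) else 0%N.

Fixpoint enb (h : seq nat) : nat :=
 if h is y :: h' then (if h' is _ :: _ then
  ((isex y h' && (clk h - erc h' < 2 * ep)%R) + enb h')%N else 0%N) else 0%N.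

Lemma eref_cons y x h : eref (y :: x :: h) = if isex y (x :: h) then y else eref (x :: h).
Proof. by []. Qed.
Lemma erc_cons y x h : erc (y :: x :: h) = if isex y (x :: h) then clk (y :: x :: h) else erc (x :: h).
Proof. by []. Qed.
Lemma eJ_cons y x h : eJ (y :: x :: h) = (isex y (x :: h) + eJ (x :: h))%N.
Proof. by []. Qed.
Lemma enb_cons y x h : enb (y :: x :: h) =
 ((isex y (x :: h) && (clk (y :: x :: h) - erc (x :: h) < 2 * ep)%R) + enb (x :: h))%N.
Proof. by []. Qed.
Definition edev (h : seq nat) : R := ps ((ld (hd0 h) (eref h)) / de).

End HistFun.

Section ChainEst.
Context {R : realType} (p : nat -> nat -> R) (a : nat -> R).
Hypotheses (kp : is_kernel p) (a0 : forall n, 0 < a n).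

Lemma Qe_le f g x h (r : R) : (0 < x)%N -> (forall h, 0 <= f h) ->
 (forall y, (0 < y)%N -> f (y :: x :: h) <= g y) -> summ (p x) g -> Esum (p x) g <= r ->
 (Qe p (fun h => (f h)%:E) (x :: h) <= r%:E)%E.
Proof.
move=> x0 f0 fg sg Er; have [q0 [q1 q2]] := kern kp x0.
have sf : summ (p x) (fun y => f (y :: x :: h)).
 by apply: (summ_le (h := g)) => // k k0; rewrite ger0_norm// fg.
rewrite /Qe /=; under eq_eseriesr do rewrite -EFinM.
rewrite (eEsum (q := p x) (g := fun y => f (y :: x :: h)))// lee_fin.
by apply: le_trans Er; apply: le_Esum.
Qed.

Lemma Esum_mm x (g : R -> R) : Esum (p x) (fun k => g (lr x k)) = mm p a x g / a x.
Proof. by rewrite /mm mulrAC divff ?mul1r// gt_eqF. Qed.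
Lemma Qe_ps f x h (c0 c1 l0 de Cd : R) : (0 < x)%N -> (forall h, 0 <= f h) -> 0 <= c1 ->
 (forall y, (0 < y)%N -> f (y :: x :: h) <= c0 + c1 * ps ((ln y%:R - l0) / de)) ->
 `|mm p a x (fun u => ps ((ln x%:R - l0 + u) / de) - ps ((ln x%:R - l0) / de))| <= Cd ->
 (Qe p (fun h => (f h)%:E) (x :: h) <= (c0 + c1 * (ps ((ln x%:R - l0) / de) + Cd / a x))%:E)%E.
Proof.
move=> x0 f0 c10 fy HC.
set l := ln x%:R - l0; pose d u := ps ((l + u) / de) - ps (l / de).
have Q := kern kp x0; have [q0 [q1 q2]] := Q.
have sd : sm p x d := sm_ps kp (l := l) (c := de) x0.
apply: (Qe_le (g := fun y => (c0 + c1 * ps (l / de)) + c1 * d (lr x y))) => //.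
- move=> y y0; apply: le_trans (fy y y0) _; rewrite /d /l /lr.
 rewrite (_ : ln x%:R - l0 + (ld y x) = ln y%:R - l0); last by ring.
 by rewrite le_eqVlt; apply/orP; left; apply/eqP; ring.
- by apply: summD => //; [exact: summ_cst|exact: summZ].
rewrite EsumD//; [|exact: summ_cst|exact: summZ].
rewrite Esum_cst// EsumZ// (Esum_mm x d) mulrDr addrA lerD2l; apply: ler_wpM2l => //.
by rewrite ler_pM2r ?invr_gt0//; apply: le_trans (ler_norm _) HC.
Qed.

Context (n : nat) (B S : R).

Definition act1 (h : seq nat) : bool :=
 [&& clk a h < S, (0 < hd0 h)%N & `|ld (hd0 h) n| <= B].

(** Remaining clock, used as the currency that pays for drifts. The extra unit covers the overshoot
    of the last step, so that on an active history it decreases by exactly 1/a_x. *)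
Definition remc (h : seq nat) : R := mx (S + 1 - clk a h) 0.
Lemma remc_ge0 h : 0 <= remc h. Proof. exact: mx_ge. Qed.

Lemma remc_step y x h : act1 (x :: h) -> 1 <= a x -> remc (y :: x :: h) = remc (x :: h) - (a x)^-1.
Proof.
move=> /and3P[cS _ _] ax; have : (a x)^-1 <= 1 by rewrite invf_le1// (lt_le_trans ltr01).
by move=> h1; rewrite /remc clk_cons !mxl; lra.
Qed.

Section Exits.
Context (de ep Cd : R).
Hypotheses (S0 : 0 <= S) (de0 : 0 < de) (ep0 : 0 < ep) (ep1 : ep <= 1) (Cd0 : 0 <= Cd)
 (Hps : forall x, (0 < x)%N -> `|ld x n| <= B -> (a x)^-1 <= ep /\ forall l, `|mm p a x (fun u => ps ((l + u) / de) - ps (l / de))| <= Cd).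

Let isex_ps y h : isex de y h -> 1 <= 2 * ps ((ld y (eref de h)) / de).
Proof.
rewrite /isex => H; have : 1 / 2 <= ps ((ld y (eref de h)) / de); last by lra.
by apply: ps_half; rewrite normrM normfV (gtr0_norm de0) ler_pdivlMr// mul1r ltW.
Qed.

Let ax1 x : (0 < x)%N -> `|ld x n| <= B -> 1 <= a x.
Proof.
move=> x0 xB; have [h _] := Hps x0 xB; rewrite -[leLHS]invrK -[leRHS]invrK lef_pV2 ?posrE ?invr_gt0//.
by rewrite invr1; exact: le_trans ep1.
Qed.

(** An exit adds 1 to the count but resets a deviation whose double is at least 1; between exits the
    drift of the deviation is paid by the clock. The expected number of exits is thus at most the
    initial value 2*Cd*(S+1). *)
Definition fJ h : R := (eJ de h)%:R + (2 * edev de h + 2 * Cd * remc h).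
Let edev_ge0 h : 0 <= edev de h. Proof. exact: ps_ge0. Qed.
Lemma fJ_ge0 h : 0 <= fJ h.
Proof. by rewrite /fJ; pos; [exact: edev_ge0|exact: remc_ge0]. Qed.
Lemma fJ_super h : act1 h -> (0 < hd0 h)%N -> (Qe p (fun h => (fJ h)%:E) h <= (fJ h)%:E)%E.
Proof.
case: h => // x h Ha x0; have /and3P[cS _ xB] := Ha.
have [ae Hm] := Hps x0 xB.
have -> : fJ (x :: h) = ((eJ de (x :: h))%:R + 2 * Cd * remc (x :: h) - 2 * Cd / a x) +
  2 * (ps ((ld x (eref de (x :: h))) / de) + Cd / a x).
 by rewrite /fJ /edev; ring.
apply: Qe_ps => //; first exact: fJ_ge0.
move=> y y0; rewrite /fJ remc_step ?ax1// eJ_cons /edev eref_cons.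
case: ifPn => [/isex_ps|_] /=; last by rewrite add0n; lra.
by rewrite subrr mul0r ps0 natrD; lra.
Qed.

Let ka := 2 * Cd * (3 * ep).
Definition early h : bool := clk a h - erc a de h < 2 * ep.
(** A budget reopened at each exit: 2*ep for the window in which a new exit counts as early, and one
    more ep because a step started inside the window may end beyond it. *)
Definition bud h : R := mx (3 * ep - (clk a h - erc a de h)) 0.
(** An early exit is paid by the deviation accumulated inside the window, whose drift is paid by the
    budget. Reopening the budget costs [ka] at each exit, which a multiple [ka] of the potential in
    [fJ] pays in advance. The initial value is therefore of order ep. *)
Definition fN h : R := (enb a de ep h)%:R + 2 * ind (early h) * edev de h + 2 * Cd * bud h +
 ka * (2 * edev de h + 2 * Cd * remc h).

Let ka0 : 0 <= ka. Proof. by rewrite /ka; pos. Qed.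
Lemma fN_ge0 h : 0 <= fN h.
Proof.
by rewrite /fN; pos; rewrite ?ind_ge0 ?edev_ge0 ?remc_ge0//; [exact: mx_ge].
Qed.

Lemma fN_super h : act1 h -> (0 < hd0 h)%N -> (Qe p (fun h => (fN h)%:E) h <= (fN h)%:E)%E.
Proof.
case: h => // x h Ha x0; have /and3P[cS _ xB] := Ha.
have [ae Hm] := Hps x0 xB.
set i1 : R := ind (early (x :: h)).
have -> : fN (x :: h) = ((enb a de ep (x :: h))%:R + 2 * Cd * (bud (x :: h) - i1 / a x) +
   ka * (2 * Cd * (remc (x :: h) - (a x)^-1))) +
  (2 * i1 + 2 * ka) * (ps ((ld x (eref de (x :: h))) / de) + Cd / a x).
 by rewrite /fN /edev -/i1; ring.
apply: Qe_ps => //; first exact: fN_ge0.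
 by have := ind_ge0 (R := R) (early (x :: h)); rewrite -/i1; have := ka0; lra.
move=> y y0; have ax := ax1 x0 xB; rewrite /fN remc_step// enb_cons.
have ia : 0 < (a x)^-1 by pos.
set Z := ps ((ld y (eref de (x :: h))) / de).
have Z0 : 0 <= Z by exact: ps_ge0.
have i10 : 0 <= i1 by exact: ind_ge0.
have bud0 : i1 / a x <= bud (x :: h).
 rewrite /bud /i1; have [e1|e1] := boolP (early (x :: h)); last by rewrite mul0r mx_ge.
 by rewrite mul1r; apply: le_trans (ae) _; rewrite mxl; move: e1; rewrite /early; lra.
have [ex|ex] := boolP (isex de y (x :: h)).
 have Z1 := isex_ps ex; rewrite -/Z in Z1.
 have E1 : edev de (y :: x :: h) = 0 by rewrite /edev eref_cons ex /= subrr mul0r ps0.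
 have E2 : bud (y :: x :: h) = 3 * ep by rewrite /bud erc_cons ex subrr subr0 mxl//; lra.
 rewrite E1 E2 mulr0 addr0 natrD /=.
 have bi : (clk a (y :: x :: h) - erc a de (x :: h) < 2 * ep)%R%:R <= i1.
  rewrite /i1 /early clk_cons; case: ltrP => h1; last exact: ind_ge0.
  have -> : (clk a (x :: h) - erc a de (x :: h) < 2 * ep) = true by apply/idP; lra.
  by rewrite /ind.
 have m1 : 0 <= Cd * (bud (x :: h) - i1 / a x) by apply: mulr_ge0 => //; rewrite subr_ge0.
 have m2 : i1 <= i1 * (2 * Z) by rewrite ler_peMr.
 have m3 : ka <= ka * (2 * Z) by rewrite ler_peMr.
 by move: m2 m3; rewrite /ka => m2 m3; lra.
have E1 : edev de (y :: x :: h) = Z by rewrite /edev eref_cons (negbTE ex).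
rewrite E1 add0n.
have bb : bud (y :: x :: h) <= bud (x :: h) - i1 / a x.
 rewrite /bud erc_cons (negbTE ex) clk_cons /i1 /early.
 set c := clk a (x :: h); set e := erc a de (x :: h).
 case: ltrP => h1 /=.
  rewrite mul1r; have [h2|h2] := lerP 0 (3 * ep - (c + (a x)^-1 - e)).
   by rewrite mxl// mxl; lra.
  by rewrite mxr ?(ltW h2)// subr_ge0 mxl; lra.
 by rewrite mul0r subr0; apply: mx_mono; lra.
have ii : ind (early (y :: x :: h)) <= i1.
 rewrite /i1 /early erc_cons (negbTE ex) clk_cons; case: ltrP => h1; last exact: ind_ge0.
 have -> : (clk a (x :: h) - erc a de (x :: h) < 2 * ep) = true by apply/idP; lra.
 by rewrite /ind.
have m1 : ind (early (y :: x :: h)) * Z <= i1 * Z by apply: ler_wpM2r.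
have m2 : Cd * bud (y :: x :: h) <= Cd * (bud (x :: h) - i1 / a x) by apply: ler_wpM2l.
lra.
Qed.

Lemma fN_init : fN [:: n] = ka * (1 + 2 * Cd * (S + 1)).
Proof.
rewrite /fN /edev /= subrr mul0r ps0 /bud /remc /= !subr0 mulr0 !mxl; [by rewrite /ka; ring|by apply: addr_ge0|by pos].
Qed.

Lemma fJ_init : fJ [:: n] = 2 * Cd * (S + 1).
Proof. by rewrite /fJ /edev /= subrr mul0r ps0 /remc /= subr0 mulr0 mxl ?add0r//; apply: addr_ge0. Qed.

End Exits.

Section Exit.
Context (eta : R).
Hypotheses (S0 : 0 <= S) (B0 : 0 < B) (eta0 : 0 <= eta)
 (HB : forall x, (0 < x)%N -> `|ld x n| <= B -> 1 <= a x /\ forall l, `|mm p a x (fun u => ps ((l + u) / B) - ps (l / B))| <= eta).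

Definition fB h : R := 2 * ps ((ld (hd0 h) n) / B) + 2 * eta * remc h.
Lemma fB_ge0 h : 0 <= fB h.
Proof. by rewrite /fB; pos; [exact: ps_ge0|exact: remc_ge0]. Qed.
Lemma fB_super h : act1 h -> (0 < hd0 h)%N -> (Qe p (fun h => (fB h)%:E) h <= (fB h)%:E)%E.
Proof.
case: h => // x h Ha x0; have /and3P[cS _ xB] := Ha; have [ax Hm] := HB x0 xB.
have -> : fB (x :: h) = (2 * eta * remc (x :: h) - 2 * eta / a x) +
  2 * (ps ((ld x n) / B) + eta / a x) by rewrite /fB; ring.
apply: Qe_ps => //; first exact: fB_ge0.
by move=> y y0; rewrite /fB remc_step//=; lra.
Qed.

Lemma fB_init : fB [:: n] = 2 * eta * (S + 1).
Proof. by rewrite /fB /= subrr mul0r ps0 /remc /= subr0 mulr0 mxl ?add0r//; apply: addr_ge0. Qed.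

End Exit.

End ChainEst.

(** * Absorption from a finite set of states, and the trajectory after a large clock time *)

Section NoHit.
Context {R : realType} (p : nat -> nat -> R) (K : nat).
Hypothesis kp : is_kernel p.

(* [U N x]: probability, from [x], not to enter {1..K} during the next N steps *)
Fixpoint U (N : nat) (x : nat) : R :=
 if N is N'.+1 then Esum (p x) (fun y => ind (K < y)%N * U N' y) else 1.

Lemma U_bnd N x : (0 < x)%N -> 0 <= U N x <= 1.
Proof.
elim: N x => [|N IH] x x0 /=; first by rewrite ler01 lexx.
have Q := kern kp x0; have [q0 [q1 _]] := Q.
have B y : (0 < y)%N -> 0 <= ind (K < y)%N * U N y <= 1.
 move=> y0; have /andP[h1 h2] := IH y y0.
 by case: (K < y)%N; rewrite /= ?mul1r ?mul0r ?h1// lexx ler01.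
have sB : summ (p x) (fun y => ind (K < y)%N * U N y).
 by apply: (@summ_bnd _ _ _ 1) => // y /B /andP[h1 h2]; rewrite ger0_norm.
rewrite Esum_ge0//=; last by move=> y /B /andP[].
rewrite -(Esum_cst 1 Q); apply: le_Esum => //; first exact: summ_cst.
by move=> y /B /andP[].
Qed.

Lemma summ_U N x : (0 < x)%N -> summ (p x) (fun y => ind (K < y)%N * U N y).
Proof.
move=> x0; apply: (@summ_bnd _ _ _ 1); first exact: kern.
move=> y y0; have /andP[h1 h2] := U_bnd N y0.
by case: (K < y)%N; rewrite /= ?mul1r ?mul0r ?normr0 // ger0_norm.
Qed.

Lemma U_decr N x : (0 < x)%N -> U N.+1 x <= U N x.
Proof.
elim: N x => [|N IH] x x0; first by have /andP[] := U_bnd 1 x0.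
have [q0 [q1 _]] := kern kp x0.
change (Esum (p x) (fun y => ind (K < y)%N * U N.+1 y) <= Esum (p x) (fun y => ind (K < y)%N * U N y)).
have s1 : summ (p x) (fun y => ind (K < y)%N * U N.+1 y) by exact: (@summ_U N.+1).
have s2 : summ (p x) (fun y => ind (K < y)%N * U N y) by exact: (@summ_U N).
by apply: (le_Esum q1 q0 s1 s2) => y y0; apply: ler_wpM2l; [exact: ind_ge0|exact: IH].
Qed.

Lemma U_mono N M x : (0 < x)%N -> (N <= M)%N -> U M x <= U N x.
Proof.
move=> x0; elim: M => [|M IH]; first by rewrite leqn0 => /eqP ->.
rewrite leq_eqVlt => /orP[/eqP -> //|NM].
by apply: le_trans (U_decr _ x0) (IH NM).
Qed.

(** The expected number of the first N0 times before which absorption has not occurred. Being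
    bounded, it serves as a Lyapunov function on the finite set (K, K1], where powers of x have no
    useful drift. *)
Definition wU N0 x : R := ind (K < x)%N * \sum_(0 <= i < N0) U i x.
Lemma wU_bnd N0 x : (0 < x)%N -> 0 <= wU N0 x <= N0%:R.
Proof.
move=> x0; have h0 : 0 <= \sum_(0 <= i < N0) U i x.
 by apply: sumr_ge0 => i _; have /andP[] := U_bnd i x0.
have h1 : \sum_(0 <= i < N0) U i x <= N0%:R.
 apply: (via (\sum_(0 <= i < N0) 1)).
  by apply: ler_sum => i _; have /andP[] := U_bnd i x0.
 by rewrite big_mkord sumr_const card_ord.
by rewrite /wU; case: (K < x)%N; rewrite /= ?mul1r ?mul0r ?h0 ?lexx//=.
Qed.

Lemma summ_wU N0 x : (0 < x)%N -> summ (p x) (wU N0).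
Proof.
move=> x0; apply: (@summ_bnd _ _ _ N0%:R); first exact: kern.
by move=> y y0; have /andP[h1 h2] := wU_bnd N0 y0; rewrite ger0_norm.
Qed.

(** One step turns [U i] into [U i.+1], so the sum shifts: it loses U 0 = 1 and gains U N0. The
    drift is -(1 - U N0 x). *)
Lemma Esum_wU N0 x : (K < x)%N -> Esum (p x) (wU N0) = wU N0 x - 1 + U N0 x.
Proof.
move=> Kx; have x0 : (0 < x)%N by apply: leq_trans Kx.
have Q := kern kp x0; have [q0 [q1 _]] := Q.
rewrite /wU Kx mul1r; elim: N0 => [|N IH].
 rewrite (eq_Esum (h := fun=> 0)) ?Esum_cst//; first by rewrite big_geq//= sub0r addNr.
 by move=> k _; rewrite big_geq// mulr0.
rewrite (eq_Esum (h := fun y => ind (K < y)%N * \sum_(0 <= i < N) U i y + ind (K < y)%N * U N y))//; last first.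
 by move=> k _; rewrite big_nat_recr//= mulrDr.
by rewrite EsumD//; [rewrite IH big_nat_recr//=; ring|exact: summ_wU|exact: summ_U].
Qed.

End NoHit.

Section Tail.
Context {R : realType} (p : nat -> nat -> R) (a : nat -> R).
Hypotheses (kp : is_kernel p) (a0 : forall n, 0 < a n).
Context (n K K1 N0 Rb : nat) (th c' c S' q kR g Dn eta : R).
Hypotheses (n0 : (0 < n)%N) (K0 : (0 < K)%N)
 (Hth : forall x, (K1 < x)%N -> 1 <= a x /\ sm p x (fun u => expR (th * u)) /\ mm p a x (fun u => expR (th * u) - 1) <= - c')
 (th0 : 0 < th) (c0 : 0 < c) (cc' : 2 * c <= c') (c1 : c <= 1) (q0 : 0 < q)
 (Hq : forall x, (K < x)%N -> (x <= K1)%N -> q <= 1 - U p K N0 x) (kR0 : 0 <= kR)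
 (HR : forall x, (K < x)%N -> (x <= K1)%N -> Esum (p x) (fun y => ind (Rb < y)%N) <= kR) (g0 : 0 <= g)
 (Hg : forall x, (K1 < x)%N -> (x <= n)%N -> g / a n <= c' * expR (th * (ld x n)) / a x) (Dn0 : 0 <= Dn)
 (HD : expR (th * (ld Rb n)) + g / a n <= Dn * q) (eta1 : eta <= 1) (Rb0 : (0 < Rb)%N).

Definition pw (x : nat) : R := expR (th * (ld x n)).
Lemma summ_pw x : (K1 < x)%N -> summ (p x) pw.
Proof.
move=> /Hth[_ [s _]]; rewrite /pw.
have := summZ (c := expR (th * (ld x n))) s; congr (summ _ _).
by apply/funext => k; rewrite /lr -expRD; congr expR; ring.
Qed.

Lemma Esum_pw x : (0 < x)%N -> (K1 < x)%N -> Esum (p x) pw <= pw x * (1 - c' / a x).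
Proof.
move=> x0 K1x; have [_ [s m]] := Hth K1x; have Q := kern kp x0; have [q0' [q1 _]] := Q.
have E : pw = fun k => pw x * (expR (th * lr x k) - 1) + pw x.
 by apply/funext => k; rewrite mulrBr mulr1 subrK /pw /lr -expRD; congr expR; ring.
have sb : summ (p x) (fun k => expR (th * lr x k) - 1) by apply: summB => //; exact: summ_cst.
have sc : summ (p x) (fun=> pw x) by exact: summ_cst.
have sz : summ (p x) (fun k => pw x * (expR (th * lr x k) - 1)) by exact: summZ.
rewrite {1}E EsumD// EsumZ//.
rewrite (Esum_mm p a0 x (fun u => expR (th * u) - 1)) Esum_cst// mulrBr mulr1 addrC lerD2l -mulrN.
by apply: ler_wpM2l; [exact: expR_ge0|rewrite -mulNr ler_pM2r ?invr_gt0].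
Qed.

Definition bj (h : seq nat) : bool :=
 if h is y :: x :: _ then [&& (K < x)%N, (x <= K1)%N & (Rb < y)%N] else false.
Fixpoint cnt (h : seq nat) : nat :=
 if h is _ :: h' then (if h' is _ :: _ then ((S' <= clk a h')%R + cnt h')%N else 0%N) else 0%N.

(** Before clock S' only the range above K1 is followed; afterwards the chain is followed down to K,
    unless it jumps from (K, K1] beyond Rb or exceeds eta*n. *)
Definition act2 (h : seq nat) : bool :=
 (0 < hd0 h)%N && (if clk a h < S' then (K1 < hd0 h)%N
  else [&& (K < hd0 h)%N, ~~ bj h & (hd0 h)%:R <= eta * n%:R]).

Let W := Dn + kR / q.
(** Before S' the power of x/n is weighted by an exponential in the clock, which makes the initial
    value small. After S' it is completed by the finite-set potential with weight W and by a fee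
    g/a_n per step. W = Dn + kR/q is what the drift -q of [wU] needs to pay, on (K, K1], for a
    possible jump beyond Rb, for the power at Rb and for the fee. The constant W*N0 prepays the
    potential. *)
Definition f2 (h : seq nat) : R :=
 if clk a h < S' then pw (hd0 h) * expR (c * (clk a h - S')) + W * N0%:R
 else (if bj h then 1 else pw (hd0 h)) +
  W * (if (0 < hd0 h)%N then wU p K N0 (hd0 h) else 0) + g / a n * (cnt h)%:R.

Let W0 : 0 <= W. Proof. by rewrite /W addr_ge0// divr_ge0// ltW. Qed.
Let ga0 : 0 <= g / a n. Proof. by rewrite divr_ge0// ltW. Qed.
Let pw0 x : 0 <= pw x. Proof. exact: expR_ge0. Qed.
Lemma f2_ge0 h : 0 <= f2 h.
Proof.
rewrite /f2; case: ifP => _; first by pos.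
rewrite !addr_ge0//; first by case: ifP.
- rewrite mulr_ge0//; case: ifP => // h0; by have /andP[] := wU_bnd K kp N0 h0.
- by rewrite mulr_ge0.
Qed.

Lemma cnt_cons y x h : cnt (y :: x :: h) = ((S' <= clk a (x :: h))%R + cnt (x :: h))%N.
Proof. by []. Qed.
Lemma cnt_clk0 h : clk a h < S' -> cnt h = 0%N.
Proof.
elim: h => // y [|x h] IH // H; rewrite /= -/(clk a (x :: h)).
have H' : clk a (x :: h) < S' by apply: le_lt_trans H; rewrite clk_cons lerDl invr_ge0 ltW.
by rewrite -[X in (_ + X)%N]/(cnt (x :: h)) IH// addn0 leNgt H'.
Qed.

Lemma f2_super h : act2 h -> (0 < hd0 h)%N -> (Qe p (fun h => (f2 h)%:E) h <= (f2 h)%:E)%E.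
Proof.
case: h => // x h /andP[_ Ha] x0; rewrite [head _ _]/= in x0.
have Q := kern kp x0; have [Q0 [Q1 _]] := Q.
have cc : c <= c' by move: cc' c0; lra.
have sw : summ (p x) (wU p K N0) by exact: summ_wU.
have wE y : (0 < y)%N -> (if (0 < y)%N then wU p K N0 y else 0) = wU p K N0 y by move=> ->.
have [cS|cS] := ltP (clk a (x :: h)) S'.
 rewrite cS /= in Ha; have [ax [sx mx]] := Hth Ha.
 have ia : 0 < (a x)^-1 by pos.
 have ia1 : (a x)^-1 <= 1 by rewrite invf_le1.
 have sp := summ_pw Ha; have Ep := Esum_pw x0 Ha.
 set C := clk a (x :: h) in cS.
 have e1 : 1 + c * (C - S') <= expR (c * (C - S')) by exact: expR_ge1Dx.
 have bjF y : bj (y :: x :: h) = false by rewrite /= [(x <= K1)%N]leqNgt Ha andbF.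
 have wN y : (0 < y)%N -> wU p K N0 y <= N0%:R by move=> y0; have /andP[] := wU_bnd K kp N0 y0.
 rewrite [f2 (x :: h)]/f2 -/C cS /=.
 have [cS'|cS'] := ltP (C + (a x)^-1) S'.
  apply: (Qe_le kp (g := fun y => expR (c * (C + (a x)^-1 - S')) * pw y + W * N0%:R)) => //.
  - exact: f2_ge0.
  - by move=> y y0; rewrite /f2 clk_cons -/C cS' /= mulrC.
  - by apply: summD => //; [exact: summZ|exact: summ_cst].
  rewrite EsumD//; [|exact: summZ|exact: summ_cst].
  rewrite Esum_cst// EsumZ// lerD2r.
  apply: (via (expR (c * (C + (a x)^-1 - S')) * (pw x * (1 - c' / a x)))).
   by apply: ler_wpM2l => //; exact: expR_ge0.
  rewrite (_ : c * (C + (a x)^-1 - S') = c * (C - S') + c / a x); last by ring.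
  rewrite expRD mulrCA mulrA [X in X <= _](_ : _ = pw x * expR (c * (C - S')) * (expR (c / a x) * (1 - c' / a x))); last by ring.
  apply: ler_piMr; first by pos.
  have e2 : 1 - c / a x <= expR (- (c / a x)) by have := expR_ge1Dx (- (c / a x)).
  apply: (via (expR (c / a x) * expR (- (c / a x)))); last by rewrite -expRD subrr expR0.
  apply: ler_wpM2l; first exact: expR_ge0.
  by apply: le_trans e2; rewrite lerD2l lerN2 ler_pM2r.
 (* This step crosses S'. Since S' - C <= 1/a_x, the exponential weight is at least 1 - c/a_x, and
    the drift -c'/a_x of [pw] covers the missing part. *)
 apply: (Qe_le kp (g := fun y => 1 * pw y + W * N0%:R)) => //.
 - exact: f2_ge0.
 - move=> y y0; rewrite /f2 clk_cons -/C ltNge cS' bjF cnt_cons -/C [S' <= C]leNgt cS cnt_clk0// addn0.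
  rewrite [head _ _]/= y0 mul1r [(~~ true : nat)]/= mulr0 addr0 lerD2l.
  by apply: ler_wpM2l => //; exact: wN.
 - by apply: summD => //; [exact: summZ|exact: summ_cst].
 rewrite EsumD//; [|exact: summZ|exact: summ_cst].
 rewrite Esum_cst// EsumZ// lerD2r mul1r; apply: (le_trans Ep).
 apply: ler_wpM2l => //; apply: le_trans e1; rewrite lerD2l lerNl -mulrN.
 apply: (via (c / a x)); first by rewrite ler_pM2l//; lra.
 by rewrite ler_pM2r//; lra.
rewrite ltNge cS in Ha; have /and3P[Kx nbj xn] := Ha; rewrite [head _ _]/= in Kx xn.
have cy y : clk a (y :: x :: h) < S' = false.
 by rewrite clk_cons; apply/negbTE; rewrite -leNgt; apply: (le_trans cS); rewrite lerDl invr_ge0 ltW.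
have cE y : cnt (y :: x :: h) = (cnt (x :: h)).+1 by rewrite cnt_cons cS.
have Ew := Esum_wU kp N0 Kx.
have Uq := U_bnd K kp N0 x0.
rewrite [f2 (x :: h)]/f2 ltNge cS (negbTE nbj) [head _ _]/= x0 [~~ true]/=.
set cn := (cnt (x :: h))%:R.
(* Above K1 the drift of [pw] pays the fee of the step. [Hg] asks for x <= n, which holds since the
   history is active and eta <= 1. *)
have [K1x|xK1] := ltnP K1 x.
 have [ax [sx mx]] := Hth K1x.
 have sp := summ_pw K1x; have Ep := Esum_pw x0 K1x.
 apply: (Qe_le kp (g := fun y => (1 * pw y + W * wU p K N0 y) + g / a n * (cn + 1))) => //.
 - exact: f2_ge0.
 - move=> y y0; rewrite /f2 cy cE -natr1 -/cn /= [(x <= K1)%N]leqNgt K1x andbF y0 mul1r lexx //.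
 - by apply: summD => //; [apply: summD => //; exact: summZ|exact: summ_cst].
 rewrite EsumD//; [|by apply: summD => //; exact: summZ|exact: summ_cst].
 rewrite EsumD//; try exact: summZ.
 rewrite Esum_cst// !EsumZ// mul1r Ew.
 have xn' : (x <= n)%N.
  by rewrite -(ler_nat R); apply: (le_trans xn); rewrite ler_piMl.
 have h1 := Hg K1x xn'; rewrite -/(pw x) in h1.
 have h2 : W * (wU p K N0 x - 1 + U p K N0 x) <= W * wU p K N0 x.
  by apply: ler_wpM2l => //; case/andP: Uq; lra.
 have h3 : pw x * (1 - c' / a x) = pw x - c' * pw x / a x by ring.
 by rewrite h3 in Ep; rewrite [g / a n * _]mulrDr mulr1; lra.
(* Here x lies in (K, K1]: a jump beyond Rb costs 1, any other jump costs at most the power at Rb,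
   and the drift of W times [wU] pays both and the fee. *)
have sR : summ (p x) (fun y => ind (Rb < y)%N : R).
 by apply: (@summ_bnd _ _ _ 1) => // k _; rewrite ger0_norm ?ind_ge0 ?ind_le1.
have sR1 : summ (p x) (fun y => 1 * ind (Rb < y)%N : R) by exact: summZ.
have sw1 : summ (p x) (fun y => W * wU p K N0 y) by exact: summZ.
have sRw : summ (p x) (fun y => 1 * ind (Rb < y)%N + W * wU p K N0 y) by exact: summD.
apply: (Qe_le kp (g := fun y => (1 * ind (Rb < y)%N + W * wU p K N0 y) + (pw Rb + g / a n * (cn + 1)))) => //.
- exact: f2_ge0.
- move=> y y0; rewrite /f2 cy cE -natr1 -/cn /= Kx xK1 y0 mul1r.
 rewrite -!addrA; have pR0 := pw0 Rb; case: ltnP => Ry /=; first lra.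
 rewrite add0r [X in _ <= X]addrCA lerD2r.
 rewrite /pw ler_expR ler_pM2l// lerD2r ler_ln ?posrE ?ltr0n// ler_nat //.
- by apply: summD => //; exact: summ_cst.
rewrite EsumD//; last exact: summ_cst.
rewrite (EsumD Q1 sR1 sw1) Esum_cst// !EsumZ// mul1r Ew.
have h1 := HR Kx xK1; have h2 := Hq Kx xK1; have h3 := pw0 x; have h4 := HD; rewrite -/(pw Rb) in h4.
have h5 : W * (wU p K N0 x - 1 + U p K N0 x) <= W * wU p K N0 x - W * q.
 by rewrite -mulrBr; apply: ler_wpM2l => //; lra.
have h6 : W * q = Dn * q + kR by rewrite /W mulrDl mulfVK// gt_eqF.
by rewrite [g / a n * _]mulrDr mulr1; lra.
Qed.

Lemma f2_init : 0 < S' -> f2 [:: n] = expR (- (c * S')) + W * N0%:R.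
Proof. by move=> S0; rewrite /f2 /= S0 /pw subrr mulr0 expR0 mul1r sub0r mulrN. Qed.

End Tail.

Section SuperE.
Context {R : realType} (p : nat -> nat -> R) {d} {T : measurableType d}
 (P : probability T R) (n : nat) (X : nat -> T -> nat).
Hypotheses (kp : is_kernel p) (n1 : (1 <= n)%N) (mc : markov_chain P p n X).

Lemma mHkset k (A : set (seq nat)) : measurable [set w | A (Hk X k w)].
Proof. exact: (measurable_discrete (mHk mc k)). Qed.
(** Maximal inequality. Stopping also at the first bad history makes the events increasing in N, and
    Markov's inequality bounds each of them by f(start)/c. *)
Lemma superE (act bad : pred (seq nat)) f (c : R) : 0 < c -> (forall h, 0 <= f h) ->
 (forall h, act h -> (0 < hd0 h)%N -> Qe p (fun h => (f h)%:E) h <= (f h)%:E)%E ->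
 (forall h, bad h -> c <= f h) ->
 (P (\bigcup_N [set w | bad (sth act (Hk X N w))]) <= (f [:: n] / c)%:E)%E.
Proof.
move=> c0 f0 Qf bf.
pose act' h := act h && ~~ bad h.
have S N w : sth act' (Hk X N w) = sth act (Hk X N w) \/ bad (sth act' (Hk X N w)).
 elim: N => [|N [IH|IH]]; first by left.
  have [b|b] := boolP (bad (sth act' (Hk X N w))).
   by right; rewrite /Hk sthS /= {1}/act' b andbF.
  rewrite /Hk !sthS /= -/(Hk X N w) {1}/act' b andbT -IH.
  by case: ifP => _; left.
 by right; rewrite /Hk sthS /= {1}/act' IH andbF.
have E : \bigcup_N [set w | bad (sth act (Hk X N w))] `<=` \bigcup_N [set w | bad (sth act' (Hk X N w))].
 by move=> w [N _ /= b]; exists N => //=; have [->|//] := S N w.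
have mb (N : nat) : measurable [set w | bad (sth act' (Hk X N w))].
 exact: (mHkset N (fun h => bad (sth act' h))).
have mb' (N : nat) : measurable [set w | bad (sth act (Hk X N w))].
 exact: (mHkset N (fun h => bad (sth act h))).
apply: (via (P (\bigcup_N [set w | bad (sth act' (Hk X N w))]))).
 by apply: le_measure; rewrite ?inE//; apply: bigcup_measurable.
have nd : {homo (fun N => [set w | bad (sth act' (Hk X N w))]) : i j / (i <= j)%N >-> i `<=` j}.
 move=> i; elim=> [|j IH]; first by rewrite leqn0 => /eqP ->.
 rewrite leq_eqVlt => /orP[/eqP -> //|ij] w /(IH ij); rewrite /mkset => b.
 by rewrite /Hk sthS /= {1}/act' b andbF.
have cv := nondecreasing_cvg_mu (mu := P) mb (bigcup_measurable (fun k _ => mb k)) (fun i j ij => introT (subsetPset _ _) (nd i j ij)).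
rewrite -(cvg_lim _ cv)//; apply: lime_le; first by apply/cvg_ex; eexists; exact: cv.
apply: nearW => N /=; set A := [set w | _].
have mf : meas (fun w => (f (sth act' (Hk X N w)))%:E).
 exact: (mfHk mc N (fun h => (f (sth act' h))%:E)).
have h1 : (c%:E * P A <= \int[P]_(w in A) (f (sth act' (Hk X N w)))%:E)%E.
 rewrite -int_cst//; last exact: mb.
 apply: ge0_le_integral => //; first exact: mb.
 - by move=> w _; rewrite lee_fin ltW.
 - exact: measurable_funTS.
 - by move=> w Aw; rewrite lee_fin; exact: bf.
have h2 : (\int[P]_(w in A) (f (sth act' (Hk X N w)))%:E <= (f [:: n])%:E)%E.
 have h3 := supermart kp n1 mc (act := act') f0 (fun h ah h0 => Qf h (andP ah).1 h0) N.
 by apply: le_trans h3; apply: ge0_subset_integral => //; [exact: mb|move=> w _; rewrite lee_fin].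
rewrite mulrC EFinM -[leLHS]mul1e (_ : 1%E = (c^-1)%:E * c%:E)%E; last by rewrite -EFinM mulVf// gt_eqF.
rewrite -muleA; apply: lee_wpmul2l; first by rewrite lee_fin invr_ge0 ltW.
exact: le_trans h1 h2.
Qed.

End SuperE.

(** * Taylor bounds with explicit constants *)

Section Taylor.
Context {R : realType}.

Lemma mvt0 (g g' : R -> R) (x C : R) : (forall c : R, is_derive c (1 : R) g (g' c)) -> g 0 = 0 ->
 (forall c, `|c| <= `|x| -> `|g' c| <= C) -> `|g x| <= C * `|x|.
Proof.
move=> dg g0 H.
have cg : continuous g by move=> y; apply: differentiable_continuous; apply/derivable1_diffP; have [] := dg y.
have [x0|x0|->] := ltgtP x 0; last by rewrite g0 !normr0 mulr0.
- have [|c /itvP cI E] := MVT x0 (f := g) (df := g') (fun y _ => dg y); first exact: continuous_subspaceT.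
 rewrite g0 !sub0r in E; rewrite -normrN E normrM normrN; apply: ler_wpM2r => //; apply: H.
 have [c1 c2] : x <= c /\ c <= 0 by rewrite !ltW ?cI.
 by rewrite !ler0_norm ?lerN2// ltW.
- have [|c /itvP cI E] := MVT x0 (f := g) (df := g') (fun y _ => dg y); first exact: continuous_subspaceT.
 rewrite g0 !subr0 in E; rewrite E normrM; apply: ler_wpM2r => //; apply: H.
 by rewrite !ger0_norm ?cI// ltW// cI.
Qed.

Lemma sin_lip (x : R) : `|sin x| <= `|x|.
Proof.
rewrite -[leRHS]mul1r; apply: (mvt0 (g' := cos)); [exact: sin0|].
by move=> c _; rewrite ler_norml cos_geN1 cos_le1.
Qed.

Lemma cos_tay2 (x : R) : `|cos x - 1| <= x ^+ 2.
Proof.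
have -> : x ^+ 2 = `|x| * `|x| by rewrite -normrM ger0_norm -?expr2// sqr_ge0.
apply: (mvt0 (g := fun x => cos x - 1) (g' := fun x => - sin x - 0)).
- by rewrite cos0 subrr.
- by move=> c cx; rewrite subr0 normrN; apply: le_trans cx; exact: sin_lip.
Qed.

Lemma sin_tay (x : R) : `|sin x - x| <= `|x| ^+ 3.
Proof.
rewrite exprSr; apply: (mvt0 (g := fun x => sin x - x) (g' := fun x => cos x - 1)).
- by rewrite sin0 subrr.
- move=> c cx; apply: le_trans (cos_tay2 c) _.
 by rewrite -[c ^+ 2]real_normK ?num_real//; apply: lerXn2r.
Qed.

Lemma cos_tay (x : R) : `|cos x - 1 + x ^+ 2 / 2| <= 2 * `|x| ^+ 3.
Proof.
have [x1|x1] := lerP `|x| 1; last first.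
 have x2 : `|x| ^+ 2 <= `|x| ^+ 3 by rewrite [leRHS]exprS ler_peMl ?sqr_ge0// ltW.
 apply: (le_trans leND); rewrite [`|x ^+ 2 / 2|]normrM normrX [`|2^-1|]ger0_norm//.
 by have := cos_tay2 x; rewrite -[x ^+ 2]real_normK ?num_real//; have := sqr_ge0 `|x|; lra.
apply: (via (`|x| ^+ 3 * `|x|)); last first.
 have h0 : 0 <= `|x| ^+ 3 by pos.
 by apply: (via (`|x| ^+ 3)); [rewrite ler_piMr|lra].
apply: (mvt0 (g := fun x => cos x - 1 + x ^+ 2 / 2) (g' := fun x => (- sin x - 0) + x)).
- move=> c; rewrite (_ : (fun x => _) = (fun x => cos x - 1 + 2^-1 * x ^+ 2)); last first.
  by apply/funext => y; rewrite [2^-1 * _]mulrC.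
 by apply: is_derive_eq; rewrite /GRing.scale /=; field.
- by rewrite cos0; ring.
- move=> c cx; rewrite subr0 addrC -opprB normrN; apply: le_trans (sin_tay c) _.
 by apply: lerXn2r.
Qed.

Lemma exp_le9 (c : R) : `|c| <= 1 -> `|expR c| <= 9.
Proof.
move=> c1; rewrite ger0_norm ?expR_ge0//; apply: (via (expR 1)).
 by rewrite ler_expR; apply: le_trans c1; exact: ler_norm.
have h := expR_ge1Dx (- (1 / 2) : R); have h2 : expR (1 / 2) * expR (- (1 / 2)) = 1 :> R by rewrite -expRD subrr expR0.
have -> : expR 1 = expR (1 / 2) * expR (1 / 2) :> R by rewrite -expRD; congr expR; field.
have := expR_gt0 (1 / 2 : R); nra.
Qed.

Lemma exp_tay1 (c : R) : `|c| <= 1 -> `|expR c - 1| <= 9 * `|c|.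
Proof.
move=> c1; apply: (mvt0 (g := fun x => expR x - 1) (g' := fun x => expR x - 0)).
 by rewrite expR0 subrr.
by move=> y yc; rewrite subr0; apply: exp_le9; exact: le_trans c1.
Qed.

Lemma exp_tay2 (x : R) : `|x| <= 1 -> `|expR x - 1 - x| <= 9 * x ^+ 2.
Proof.
move=> x1; have -> : 9 * x ^+ 2 = (9 * `|x|) * `|x| by rewrite -mulrA -normrM ger0_norm -?expr2// sqr_ge0.
apply: (mvt0 (g := fun x => expR x - 1 - x) (g' := fun x => expR x - 0 - 1)).
 by rewrite expR0; ring.
move=> c cx; rewrite subr0; apply: le_trans (exp_tay1 (le_trans cx x1)) _.
by rewrite ler_pM2l.
Qed.

End Taylor.

(** * Trigonometric approximation and grid increments *)

Section Trig.
Context {R : realType} (M : nat).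
Implicit Types (v : nat -> R).

Inductive trig : ((nat -> R) -> R) -> Prop :=
| trig_cos lam phi : trig (fun v => cos (\sum_(0 <= j < M) lam j * v j + phi))
| trig_add f g : trig f -> trig g -> trig (fun v => f v + g v)
| trig_scl c f : trig f -> trig (fun v => c * f v).

Lemma trig_eq f g : f =1 g -> trig f -> trig g.
Proof. by move=> /funext ->. Qed.
Lemma trig_cst (c : R) : trig (fun=> c).
Proof.
apply: trig_eq (trig_scl c (trig_cos (fun=> 0) 0)) => v.
by rewrite big1 ?add0r ?cos0 ?mulr1// => i _; rewrite mul0r.
Qed.

Lemma cos_mul (x y : R) : cos x * cos y = 2^-1 * (cos (x + y) + cos (x - y)).
Proof. by rewrite cosD cosB; field. Qed.
Lemma trig_mul f g : trig f -> trig g -> trig (fun v => f v * g v).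
Proof.
move=> tf; elim: tf g => [lam phi|f1 f2 _ I1 _ I2|c f1 _ I1] g tg.
- elim: tg => [mu psi|g1 g2 _ J1 _ J2|c g1 _ J1].
 + apply: trig_eq (trig_scl 2^-1 (trig_add (trig_cos (fun j => lam j + mu j) (phi + psi))
   (trig_cos (fun j => lam j - mu j) (phi - psi)))) => v.
  rewrite cos_mul; congr (_ * (cos _ + cos _)).
   by under eq_bigr do rewrite mulrDl; rewrite big_split /=; ring.
  by under eq_bigr do rewrite mulrBl; rewrite sumrB; ring.
 + by apply: trig_eq (trig_add J1 J2) => v; rewrite mulrDr.
 + by apply: trig_eq (trig_scl c J1) => v; rewrite mulrCA.
- by apply: trig_eq (trig_add (I1 _ tg) (I2 _ tg)) => v; rewrite mulrDl.
- by apply: trig_eq (trig_scl c (I1 _ tg)) => v; rewrite mulrA.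
Qed.

Definition zw (w x : R) : R := (1 + sin (w * x)) / 2.
Lemma trig_z i w : (i < M)%N -> trig (fun v => zw w (v i)).
Proof.
move=> iM; apply: trig_eq (trig_scl 2^-1 (trig_add (trig_cst 1)
 (trig_cos (fun j => if j == i then w else 0) (- (pi / 2))))) => v.
rewrite /zw mulrC; congr ((_ + _) * _).
rewrite (bigD1_seq i)//= ?mem_index_iota ?iota_uniq// eqxx big1 ?addr0; last first.
 by move=> j /negbTE ->; rewrite mul0r.
by rewrite cosB cos_pihalf sin_pihalf mulr0 mulr1 add0r.
Qed.

(* The expectation of g(S) for S binomial with parameters N and z. *)
Fixpoint bo N (z : R) (g : nat -> R) : R :=
 if N is N'.+1 then z * bo N' z (fun k => g k.+1) + (1 - z) * bo N' z g else g 0%N.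

Lemma bo_le N z g h : 0 <= z <= 1 -> (forall k, (k <= N)%N -> g k <= h k) -> bo N z g <= bo N z h.
Proof.
move=> /andP[z0 z1]; elim: N g h => [|N IH] g h gh /=; first exact: gh.
apply: lerD; apply: ler_wpM2l; rewrite ?subr_ge0//; apply: IH => k kN; apply: gh => //.
exact: leqW.
Qed.

Lemma boD N z g h : bo N z (fun k => g k + h k) = bo N z g + bo N z h.
Proof. by elim: N g h => [|N IH] g h //=; rewrite (IH (fun k => g k.+1)) IH; ring. Qed.
Lemma boZ N z c g : bo N z (fun k => c * g k) = c * bo N z g.
Proof. by elim: N g => [|N IH] g //=; rewrite (IH (fun k => g k.+1)) IH; ring. Qed.
Lemma bo_cst N z c : bo N z (fun=> c) = c.
Proof. by elim: N => [|N IH] //=; rewrite IH; ring. Qed.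
Lemma bo_var N z c : bo N z (fun k => (k%:R - c) ^+ 2) = (N%:R * z - c) ^+ 2 + N%:R * z * (1 - z).
Proof.
elim: N c => [|N IH] c /=; first by ring.
rewrite (_ : (fun k => _) = (fun k : nat => (k%:R - (c - 1)) ^+ 2 : R)); last first.
 by apply/funext => k; rewrite -natr1; ring.
by rewrite !IH -natr1; ring.
Qed.

Lemma trig_bo N (z : (nat -> R) -> R) (g : nat -> (nat -> R) -> R) : trig z -> (forall k, trig (g k)) ->
 trig (fun v => bo N (z v) (fun k => g k v)).
Proof.
move=> tz; elim: N g => [|N IH] g tg /=; first exact: tg.
apply: trig_add; apply: trig_mul => //; first exact: (IH (fun k => g k.+1)).
 by apply: trig_eq (trig_add (trig_cst 1) (trig_scl (-1) tz)) => v; rewrite mulN1r.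
exact: IH.
Qed.

(** Bernstein approximation: |d| <= t + d^2/t replaces the absolute deviation by its square, whose
    binomial mean is N z (1 - z). *)
Lemma bo_approx N z g (g0 C e t : R) : (0 < N)%N -> 0 <= z <= 1 -> 0 < t -> 0 <= C -> 
 (forall k, (k <= N)%N -> `|g k - g0| <= C * `|k%:R / N%:R - z| + e) ->
 `|bo N z g - g0| <= C * (t + (N%:R * t)^-1) + e.
Proof.
move=> N0 z01 t0 C0 H.
have NR : 0 < N%:R :> R by pos.
have Q k : (k <= N)%N -> `|g k - g0| <= (C * t + e) + C / (t * N%:R ^+ 2) * (k%:R - N%:R * z) ^+ 2.
 move=> kN; apply: le_trans (H k kN) _; set x := k%:R / N%:R - z.
 have -> : k%:R - N%:R * z = N%:R * x by rewrite /x; field; rewrite gt_eqF.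
 have h1 : `|x| <= t + x ^+ 2 / t.
  have [h|h] := lerP `|x| t; first by apply: (le_trans h); rewrite lerDl divr_ge0 ?sqr_ge0// ltW.
  rewrite -[x ^+ 2]real_normK ?num_real// expr2 -mulrA; apply: (via (`|x| * (`|x| / t))); last by rewrite lerDr ltW.
  by rewrite ler_peMr// ler_pdivlMr// mul1r ltW.
 have -> : C / (t * N%:R ^+ 2) * (N%:R * x) ^+ 2 = C * (x ^+ 2 / t) by field; rewrite !gt_eqF.
 by have := ler_wpM2l C0 h1; lra.
set S := C / _ in Q.
have V : bo N z (fun k => (C * t + e) + S * (k%:R - N%:R * z) ^+ 2) <= C * (t + (N%:R * t)^-1) + e.
 rewrite boD bo_cst boZ bo_var subrr expr2 mul0r add0r.
 have h2 : S * (N%:R * z * (1 - z)) <= C * (N%:R * t)^-1.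
  have -> : S * (N%:R * z * (1 - z)) = C * (N%:R * t)^-1 * (z * (1 - z)) by rewrite /S; field; rewrite !gt_eqF.
  case/andP: z01 => z0 z1; apply: ler_piMr; first by pos.
  nra.
 lra.
have -> : bo N z g - g0 = bo N z (fun k => g k - g0) by rewrite boD bo_cst.
rewrite ler_norml; apply/andP; split; last first.
 by apply: le_trans V; apply: bo_le => // k kN; apply: le_trans (ler_norm _) (Q k kN).
rewrite lerNl -mulN1r -boZ; apply: le_trans V; apply: bo_le => // k kN.
by rewrite mulN1r; apply: le_trans (Q k kN); rewrite -normrN ler_norm.
Qed.

Definition blip i (W : R) (G : (nat -> R) -> R) := exists2 L, 0 <= L &
 forall u v d, 0 <= d -> (forall j, (j < i)%N -> [/\ `|u j| <= W, `|v j| <= W & `|u j - v j| <= d]) ->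
 `|G u - G v| <= L * d.

Definition yw (w : R) v : nat -> R := fun j => sin (w * v j) / w.
Lemma yw_bnd w v j : 0 < w -> `|yw w v j| <= w^-1.
Proof.
move=> w0; rewrite /yw normrM normfV (gtr0_norm w0) ler_piMl ?invr_ge0//; first exact: ltW.
by rewrite ler_norml sin_geN1 sin_le1.
Qed.

(** Induction on the number of coordinates. A Bernstein polynomial in z = (1 + sin(w v))/2 handles
    the last one; its coefficients are functions of the other coordinates, approximated by
    induction, and trigonometric sums are stable under products. *)
Lemma trig_dense_w w i G : 0 < w -> (i <= M)%N -> blip i w^-1 G ->
 forall e, 0 < e -> exists2 T, trig T & forall v, `|G (yw w v) - T v| <= e.
Proof.
move=> w0; elim: i G => [|i IH] G iM [L L0 GL] e e0.
 exists (fun=> G (fun=> 0)); first exact: trig_cst.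
 by move=> v; apply: le_trans (GL _ _ 0 _ _) _ => //; rewrite mulr0 ltW.
set W : R := w^-1; have W0 : 0 < W by rewrite invr_gt0.
pose C : R := L * (2 * W).
have C0 : 0 <= C by rewrite /C; pos.
pose t : R := e / 4 / (C + 1).
have t0 : 0 < t by rewrite /t !divr_gt0// ltr_wpDl.
have Ct : C * t <= e / 4.
 rewrite /t mulrCA; apply: ler_piMr; first by lra.
 by rewrite ler_pdivrMr ?mul1r ?lerDl// ltr_wpDl.
have [N0 HN] := ev_ger (C / t / (e / 4)).
set N := N0.+1; have NR : 0 < N%:R :> R by pos.
have CN : C * (N%:R * t)^-1 <= e / 4.
 have := HN N (leqnSn _); rewrite ler_pdivrMr; last lra.
 rewrite ler_pdivrMr; last by lra.
 have Nt : 0 < N%:R * t by exact: mulr_gt0.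
 by move=> h; rewrite (ler_pdivrMr _ _ Nt); apply: (le_trans h); rewrite le_eqVlt; apply/orP; left; apply/eqP; ring.
(* The value of sin(w v)/w at which (1 + sin(w v))/2 equals k/N. *)
pose uk (k : nat) : R := (2 * (k%:R / N%:R) - 1) * W.
pose Gk k v := G (fun j => if j == i then uk k else v j).
have ukB k : (k <= N)%N -> `|uk k| <= W.
 move=> kN; rewrite /uk normrM (gtr0_norm W0); apply: ler_piMl; first exact: ltW.
 have : k%:R / N%:R <= 1 :> R by rewrite ler_pdivrMr// mul1r ler_nat.
 have : 0 <= k%:R / N%:R :> R by pos.
 by rewrite ler_norml => h1 h2; apply/andP; split; lra.
have HT k : exists T, trig T /\ ((k <= N)%N -> forall v, `|Gk k (yw w v) - T v| <= e / 2).
 have [kN|_] := leqP k N; last by exists (fun=> 0); split => //; exact: trig_cst.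
 have [||T tT HT] := IH (Gk k) (ltnW iM) _ (e / 2); [|lra|by exists T].
 exists L => // u v d' d0 H; apply: GL => // j; rewrite ltnS leq_eqVlt => /orP[/eqP ->|ji].
  by rewrite eqxx subrr normr0 ukB.
 by rewrite ltn_eqF//; exact: H.
have [Tk HTk] := choice HT.
exists (fun v => bo N (zw w (v i)) (fun k => Tk k v)).
 by apply: trig_bo; [exact: trig_z|move=> k; case: (HTk k)].
move=> v; rewrite distrC.
have z01 : 0 <= zw w (v i) <= 1.
 have := sin_geN1 (w * v i); have := sin_le1 (w * v i); rewrite /zw => h1 h2; apply/andP; split; lra.
apply: le_trans (bo_approx (C := C) (e := e / 2) _ z01 t0 C0 _) _ => //; last by lra.
move=> k kN; have [_ /(_ kN v) h] := HTk k.
have h2 : `|Gk k (yw w v) - G (yw w v)| <= C * `|k%:R / N%:R - zw w (v i)|.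
 rewrite /C -mulrA; apply: GL => [|j]; first by pos.
 rewrite ltnS leq_eqVlt => /orP[/eqP ->|ji].
  rewrite eqxx ukB// yw_bnd//; split=> //.
  have -> : uk k - yw w v i = 2 * W * (k%:R / N%:R - zw w (v i)) by rewrite /uk /yw /zw -/W; field; rewrite gt_eqF.
  by rewrite normrM ger0_norm//; pos.
 by rewrite ltn_eqF// subrr normr0 !yw_bnd//; split => //; pos.
have -> : Tk k v - G (yw w v) = - (Gk k (yw w v) - Tk k v) + (Gk k (yw w v) - G (yw w v)) by ring.
by apply: le_trans leND _; rewrite normrN; lra.
Qed.

(** G is first composed with v -> sin(w v)/w, which is periodic and hence approximable for all v at
    once: this gives the bound C + e everywhere, needed outside the box. Closeness to G itself holds
    on the box, where sin(w v)/w is near v. *)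
Lemma trig_dense G C : (forall v, `|G v| <= C) -> (forall W, blip M W G) -> forall e B, 0 < e -> 0 <= B ->
 exists2 T, trig T & (forall v, `|T v| <= C + e) /\
  forall v, (forall j, (j < M)%N -> `|v j| <= B) -> `|G v - T v| <= e.
Proof.
move=> GC lipG e B e0 B0; have [L L0 HL] := lipG (B + 1).
(* The displacement |v - sin(w v)/w| is at most w*B^3. The first bound makes L times it at most e/2;
   the second keeps sin(w v)/w in the box of radius B + 1 on which L was taken. *)
pose w : R := Num.min (e / 2 / ((L + 1) * (B ^+ 3 + 1))) (1 / (B ^+ 3 + 1)).
have B3 : 0 <= B ^+ 3 by pos.
have B31 : 0 < B ^+ 3 + 1 by lra.
have w0 : 0 < w by rewrite /w lt_min !divr_gt0 ?mulr_gt0//; lra.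
have wB : w * B ^+ 3 <= 1.
 apply: (via (1 / (B ^+ 3 + 1) * B ^+ 3)); first by apply: ler_wpM2r => //; rewrite ge_min lexx orbT.
 by rewrite mulrAC ler_pdivrMr//; lra.
have LwB : L * (w * B ^+ 3) <= e / 2.
 have h1 : w <= e / 2 / ((L + 1) * (B ^+ 3 + 1)) by rewrite ge_min lexx.
 have LB0 : 0 < (L + 1) * (B ^+ 3 + 1) by rewrite mulr_gt0//; lra.
 rewrite ler_pdivlMr// in h1; apply: le_trans h1.
 by rewrite mulrCA ler_pM2l//; nra.
have w1 : w <= 1 by apply: (via (1 / (B ^+ 3 + 1))); [rewrite ge_min lexx orbT|rewrite ler_pdivrMr//; lra].
have yv v j : `|v j| <= B -> `|v j - yw w v j| <= w * B ^+ 3.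
 move=> vB; rewrite distrC /yw (_ : _ - _ = (sin (w * v j) - w * v j) / w); last by field; rewrite gt_eqF.
 rewrite normrM normfV (gtr0_norm w0) ler_pdivrMr//; apply: le_trans (sin_tay _) _.
 rewrite normrM (gtr0_norm w0) exprMn.
 have h3 : `|v j| ^+ 3 <= B ^+ 3 by apply: lerXn2r; rewrite ?nnegrE.
 have ww : 0 <= w * w by pos.
 have h4 : w ^+ 3 <= w * w by rewrite !exprS expr0 mulr1 mulrA ler_piMr//; pos.
 have := normr_ge0 (v j); have := exprn_ge0 3 (normr_ge0 (v j)) => h5 _.
 rewrite mulrAC; apply: ler_pM => //; first by pos.
 by apply: ler_wpM2l => //; exact: ltW.
by apply: ler_piMr => //; exact: ltW.
have [T tT HT] := trig_dense_w w0 (leqnn M) (lipG w^-1) (e := e / 2) ltac:(lra).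
exists T => //; split=> [v|v vB].
 rewrite -[T v](subrK (G (yw w v))) ; apply: le_trans leND _; rewrite addrC.
 by apply: lerD (GC _) _; rewrite distrC; apply: le_trans (HT v) _; lra.
rewrite (_ : _ - _ = (G v - G (yw w v)) + (G (yw w v) - T v)); last by ring.
apply: le_trans leND _; rewrite (_ : e = e / 2 + e / 2); last by field.
apply: lerD (HT v); apply: le_trans LwB; apply: HL; first by pos.
move=> j jM; have h := yv v j (vB j jM); split=> //; first by apply: (le_trans (vB j jM)); lra.
rewrite (_ : yw w v j = v j - (v j - yw w v j)); last by ring.
by apply: le_trans (ler_normB _ _) _; have := vB j jM; lra.
Qed.

End Trig.

(** * Independent increments and their trigonometric moments *)

Section Prob.
Context {R : realType} {d} {O : measurableType d} (P : probability O R).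
Local Notation E f := (Int P f).
Lemma intg_bnd (f : O -> R) C : meas f -> (forall w, `|f w| <= C) -> intg P f.
Proof.
move=> mf fC; apply: (@intg_le _ _ _ _ _ (fun=> C)) => //.
have := finite_measure_integrable_cst P C; exact.
Qed.

Lemma Ecst (c : R) : E (fun=> c) = c.
Proof. by rewrite Rintegral_cst//= probability_setT mulr1. Qed.
Lemma E_norm_le (f : O -> R) C : meas f -> (forall w, `|f w| <= C) -> `|E f| <= C.
Proof.
move=> mf fC; rewrite -[leRHS]Ecst; apply: Rint_norm_le => //; first exact: intg_bnd fC.
by apply: intg_bnd => [|w]; [exact: measurable_cst|].
Qed.

Lemma intg_sum n (f : nat -> O -> R) : (forall k, intg P (f k)) -> intg P (fun w => \sum_(0 <= k < n) f k w).
Proof.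
move=> H; elim: n => [|n IH].
 rewrite (_ : (fun w => _) = fun=> 0); last by apply/funext => w; rewrite big_geq.
 by apply: (@intg_bnd _ 0) => // w; rewrite normr0.
rewrite (_ : (fun w => _) = fun w => \sum_(0 <= k < n) f k w + f n w); first exact: intgD.
by apply/funext => w; rewrite big_nat_recr.
Qed.

Lemma Rint_sum n (f : nat -> O -> R) : (forall k, intg P (f k)) ->
 E (fun w => \sum_(0 <= k < n) f k w) = \sum_(0 <= k < n) E (f k).
Proof.
move=> H; elim: n => [|n IH].
 rewrite (_ : (fun w => _) = fun=> 0); last by apply/funext => w; rewrite big_geq.
 by rewrite Ecst big_geq.
rewrite big_nat_recr//= -IH -RintD//; last exact: intg_sum.
by congr Rintegral; apply/funext => w; rewrite big_nat_recr.
Qed.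

(* g is uniformly approximated by the step functions floor(N (g + 1)) / N - 1. *)
Lemma indic_ext (Z Q : O -> R) (q : R) : meas Z -> meas Q ->
 (forall w, `|Q w| <= 1) ->
 (forall B, measurable B -> E (fun w => \1_B (Z w) * Q w) = q * E (fun w => \1_B (Z w))) ->
 forall g : R -> R, meas g -> (forall u, `|g u| <= 1) ->
 E (fun w => g (Z w) * Q w) = q * E (fun w => g (Z w)).
Proof.
move=> mZ mQ Q1 H g mg g1; apply/eqP; rewrite -subr_eq0 -normr_le0; apply/ler_addgt0Pl => e e0.
rewrite addr0; have [N0 HN] := ev_ger ((1 + `|q|) / e).
set N := N0.+1; have NR : 0 < N%:R :> R by pos.
pose A k := [set u | trunc ((g u + 1) * N%:R) = k].
have g01 u : 0 <= g u + 1 by have := g1 u; rewrite ler_norml => /andP[h _]; lra.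
have gN u : 0 <= (g u + 1) * N%:R by rewrite mulr_ge0.
have mA k : measurable (A k).
 rewrite (_ : A k = (fun u => (g u + 1) * N%:R) @^-1` [set x | k%:R <= x < k.+1%:R]).
  rewrite -[X in measurable X]setTI; apply: (measurable_funM (measurable_funD mg (measurable_cst _)) (measurable_cst _)) => //.
  rewrite (_ : [set x | _] = `[k%:R, k.+1%:R[%classic)//.
 apply/seteqP; split => u /=; rewrite /A /=; last by move/truncn_def.
 by move=> <-; rewrite truncn_itv.
pose c k : R := k%:R / N%:R - 1.
pose s u : R := \sum_(0 <= k < N.*2.+1) c k * \1_(A k) u.
have sE u : s u = c (trunc ((g u + 1) * N%:R)).
 rewrite /s (bigD1_seq (trunc ((g u + 1) * N%:R))) ?iota_uniq//=; last first.
  rewrite mem_index_iota /= ltnS -(ler_nat R); have /andP[tl _] := truncn_itv (gN u); apply: (le_trans tl).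
  have := g1 u; rewrite ler_norml => /andP[_ h].
  by rewrite -muln2 natrM mulrC ler_pM2l//; lra.
 rewrite big1 ?addr0 => [|k kn]; first by rewrite indicE mem_set// mulr1.
 by rewrite indicE memNset ?mulr0//= => E'; rewrite E' eqxx in kn.
have gs u : `|g u - s u| <= N%:R^-1.
 have := truncn_itv (gN u); rewrite sE /c => /andP[h1 h2].
 set t := trunc _ in h1 h2 *.
 have -> : g u - (t%:R / N%:R - 1) = ((g u + 1) * N%:R - t%:R) / N%:R by field; rewrite gt_eqF.
 rewrite normrM normfV (gtr0_norm NR); apply: ler_piMl; first by pos.
 by rewrite -natr1 in h2; rewrite ger0_norm; lra.
have mind (B : set R) : measurable B -> meas (fun w => \1_B (Z w) : R).
 by move=> mB; apply: measurableT_comp => //; exact: measurable_indic.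
have i1 k : intg P (fun w => c k * \1_(A k) (Z w)).
 apply: intgZ; apply: (@intg_bnd _ 1) => [|w]; first exact: mind.
 by rewrite indicE; case: (_ \in _); rewrite ?normr1 ?normr0.
have i2 k : intg P (fun w => \1_(A k) (Z w) * Q w).
 apply: (@intg_bnd _ 1) => [|w]; first by apply: measurable_funM => //; exact: mind.
 by rewrite indicE; case: (_ \in _); rewrite ?mul1r ?mul0r ?normr0.
have i3 k : intg P (fun w => c k * (\1_(A k) (Z w) * Q w)) by exact: intgZ.
have Es : E (fun w => s (Z w) * Q w) = q * E (fun w => s (Z w)).
 rewrite (_ : (fun w => s (Z w) * Q w) = fun w => \sum_(0 <= k < N.*2.+1) c k * (\1_(A k) (Z w) * Q w)); last first.
  by apply/funext => w; rewrite /s mulr_suml; under eq_bigr do rewrite -mulrA.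
 rewrite Rint_sum// Rint_sum// mulr_sumr; apply: eq_bigr => k _.
 rewrite RintZ// H// RintZ; last by apply: (@intg_bnd _ 1) => [|w]; [exact: mind|rewrite indicE; case: (_ \in _); rewrite ?normr1 ?normr0].
 by rewrite mulrCA.
have iS : intg P (fun w => s (Z w)) by exact: intg_sum.
have iSQ : intg P (fun w => s (Z w) * Q w).
 rewrite (_ : (fun w => s (Z w) * Q w) = fun w => \sum_(0 <= k < N.*2.+1) c k * (\1_(A k) (Z w) * Q w)); first exact: intg_sum.
 by apply/funext => w; rewrite /s mulr_suml; under eq_bigr do rewrite -mulrA.
have mgZ : meas (fun w => g (Z w)) by exact: measurableT_comp.
have iG : intg P (fun w => g (Z w)) by exact: (@intg_bnd _ 1).
have iGQ : intg P (fun w => g (Z w) * Q w).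
 apply: (@intg_bnd _ 1) => [|w]; first exact: measurable_funM.
 by rewrite normrM mulr_ile1.
rewrite -[X in `|X|]subr0 -[X in _ - X](subrr (E (fun w => s (Z w) * Q w))) {2}Es.
have -> : E (fun w => g (Z w) * Q w) - q * E (fun w => g (Z w)) - (E (fun w => s (Z w) * Q w) - q * E (fun w => s (Z w)))
  = E (fun w => g (Z w) * Q w - s (Z w) * Q w) - q * E (fun w => g (Z w) - s (Z w)).
 by rewrite !RintB//; ring.
have h1 : `|E (fun w => g (Z w) * Q w - s (Z w) * Q w)| <= N%:R^-1.
 apply: E_norm_le => [|w]; first exact: intg_mf (intgB iGQ iSQ).
 by rewrite -mulrBl normrM; apply: le_trans (ler_pM _ _ (gs _) (Q1 w)) _ => //; rewrite mulr1.
have h2 : `|E (fun w => g (Z w) - s (Z w))| <= N%:R^-1.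
 by apply: E_norm_le => [|w]; [exact: intg_mf (intgB iG iS)|exact: gs].
apply: le_trans (ler_normB _ _) _; rewrite normrM.
apply: (via (N%:R^-1 + `|q| * N%:R^-1)); first by apply: lerD => //; apply: ler_wpM2l.
have := HN N (leqnSn _); rewrite ler_pdivrMr// => h.
have -> : N%:R^-1 + `|q| * N%:R^-1 = (1 + `|q|) / N%:R by ring.
by rewrite ler_pdivrMr// mulrC.
Qed.

Context (D : nat -> O -> R).
Hypotheses (mD : forall j, meas (D j))
 (iD : forall m B, (forall j, measurable (B j)) -> P (\bigcap_(j in [set j | (j < m)%N]) [set w | D j w \in B j]) = (\prod_(0 <= j < m) P [set w | D j w \in B j])%E).

(** Independence is given for events, that is, for indicators. The indicators are replaced by
    bounded functions one coordinate at a time through [indic_ext]; the induction counts the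
    coordinates already replaced. *)
Lemma indep_prod m (g : nat -> R -> R) : (forall j, meas (g j)) ->
 (forall j u, `|g j u| <= 1) ->
 E (fun w => \prod_(0 <= j < m) g j (D j w)) = \prod_(0 <= j < m) E (fun w => g j (D j w)).
Proof.
move=> mg g1.
suff H i : forall g : nat -> R -> R, (forall j, meas (g j)) -> (forall j u, `|g j u| <= 1) ->
  (forall j, (i <= j)%N -> (j < m)%N -> exists2 B, measurable B & g j = \1_B) ->
  E (fun w => \prod_(0 <= j < m) g j (D j w)) = \prod_(0 <= j < m) E (fun w => g j (D j w)).
 by apply: (H m) => // j mj; rewrite ltnNge mj.
elim: i => [|i IH] {mg g1}g mg g1 gB.
 have HB0 j : exists B, measurable B /\ ((j < m)%N -> g j = \1_B).
  have [jm|_] := ltnP j m; last by exists setT.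
  by have [B mB ->] := gB j (leq0n _) jm; exists B.
 have [B HB] := choice HB0.
 have mZ j : measurable [set w | D j w \in B j].
  rewrite (_ : [set w | _] = D j @^-1` B j); last by apply/seteqP; split => w /=; rewrite inE.
  by rewrite -[X in measurable X]setTI; apply: mD => //; have [] := HB j.
 have EB (A : set O) : measurable A -> E (\1_A) = fine (P A).
  by move=> mA; rewrite /Rintegral integral_indic// setIT.
 transitivity (E (\1_(\bigcap_(j in [set j | (j < m)%N]) [set w | D j w \in B j]))).
  congr Rintegral; apply/funext => w; rewrite indicE.
  have [/set_mem H|/negP H] := boolP (w \in _).
   rewrite big_seq big1 // => j; rewrite mem_index_iota => /andP[_ jm].
   by have [_ ->//] := HB j; rewrite indicE (H j jm).
  have [j [jm nj]] : exists j, (j < m)%N /\ D j w \notin B j.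
   apply: contrapT => H'; apply: H; apply/mem_set => j /= jm; apply/negPn/negP => nj; by apply: H'; exists j.
  rewrite (bigD1_seq j) ?iota_uniq ?mem_index_iota//=; have [_ ->//] := HB j.
  by rewrite indicE (negbTE nj) mul0r.
 rewrite EB; last by apply: bigcap_measurableType => //.
 rewrite iD; last by move=> j; have [] := HB j.
 have F j : (j < m)%N -> P [set w | D j w \in B j] = (E (fun w => g j (D j w)))%:E.
  move=> jm; have [_ /(_ jm) gE] := HB j; rewrite (_ : (fun w => _) = \1_[set w | D j w \in B j]).
   by rewrite EB// fineK// fin_num_measure.
  by apply/funext => w; rewrite gE !indicE /= mem_setE.
 rewrite (eq_big_nat _ _ (F2 := fun j => (E (fun w => g j (D j w)))%:E)); last by move=> j /andP[_]; exact: F.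
 by rewrite prodEFin.
have [im|mi] := ltnP i m; last first.
 by apply: IH => // j ij; rewrite ltnNge (leq_trans mi ij).
have S (F : nat -> R) : \prod_(0 <= j < m) F j = F i * \prod_(0 <= j < m | j != i) F j.
 by rewrite (bigD1_seq i) ?iota_uniq ?mem_index_iota.
rewrite S; under eq_Rintegral do rewrite S.
rewrite mulrC; apply: (indic_ext (Z := D i) (Q := fun w => \prod_(0 <= j < m | j != i) g j (D j w))) => //.
- rewrite (_ : (fun w => _) = fun w => \prod_(j <- [seq j <- index_iota 0 m | j != i]) g j (D j w)).
  by apply: measurable_prod => j _; exact: measurableT_comp.
 by apply/funext => w; rewrite big_filter.
- move=> w; rewrite normr_prod; apply: prodr_ile1 => j _; by rewrite normr_ge0 g1.
move=> B mB; pose g' j := if j == i then \1_B else g j.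
have e1 (F : (R -> R) -> nat -> R) : \prod_(0 <= j < m | j != i) F (g' j) j = \prod_(0 <= j < m | j != i) F (g j) j.
 by apply: eq_bigr => j /negbTE ji; rewrite /g' ji.
have mg' j : meas (g' j) by rewrite /g'; case: ifP => // _; exact: measurable_indic.
have g1' j u : `|g' j u| <= 1 by rewrite /g'; case: ifP => // _; rewrite indicE; case: (_ \in _); rewrite ?normr1 ?normr0.
have gi : g' i = \1_B by rewrite /g' eqxx.
have := IH g' mg' g1'; rewrite S (e1 (fun f j => E (fun w => f (D j w)))) gi => HH.
rewrite [RHS]mulrC -HH => [|j]; last first.
 rewrite leq_eqVlt /g' => /orP[/eqP <- _|ij jm]; first by rewrite eqxx; exists B.
 by rewrite gtn_eqF//; exact: gB.
by congr Rintegral; apply/funext => w; rewrite S (e1 (fun f j => f (D j w))) gi.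
Qed.

Context (ep : R) (lam : nat -> R) (r i : nat -> R).
Hypotheses (EC : forall j, E (fun w => cos (lam j * D j w)) = expR (ep * r j) * cos (ep * i j))
 (ES : forall j, E (fun w => sin (lam j * D j w)) = expR (ep * r j) * sin (ep * i j)).

(** The product formula for characteristic functions in real form. The induction carries along a
    product of functions of the remaining coordinates, so that the addition formula can move one
    summand out of the cosine; a sine is a cosine with phase shifted by -pi/2. *)
Lemma indep_trig M phi : E (fun w => cos (\sum_(0 <= j < M) lam j * D j w + phi)) =
 expR (ep * \sum_(0 <= j < M) r j) * cos (ep * \sum_(0 <= j < M) i j + phi).
Proof.
have mlam j : meas (fun u : R => lam j * u) by apply: measurable_funM => //; exact: measurable_cst.
have mcos (f : R -> R) : meas f -> meas (fun u => cos (f u)).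
 by move=> mf; apply: measurableT_comp mf; apply: cmf; exact: continuous_cos.
have msin (f : R -> R) : meas f -> meas (fun u => sin (f u)).
 by move=> mf; apply: measurableT_comp mf; apply: cmf; exact: continuous_sin.
have c1 (u : R) : `|cos u| <= 1 by rewrite ler_norml cos_geN1 cos_le1.
have s1 (u : R) : `|sin u| <= 1 by rewrite ler_norml sin_geN1 sin_le1.
suff H k m : forall (g : nat -> R -> R) phi, (k <= m)%N -> (forall j, meas (g j)) -> (forall j u, `|g j u| <= 1) ->
  E (fun w => cos (\sum_(0 <= j < k) lam j * D j w + phi) * \prod_(k <= j < m) g j (D j w)) =
  (expR (ep * \sum_(0 <= j < k) r j) * cos (ep * \sum_(0 <= j < k) i j + phi)) *
   \prod_(k <= j < m) E (fun w => g j (D j w)).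
 have := H M M (fun=> cst 1) phi (leqnn M) (fun j => measurable_cst _) (fun j u => _).
 rewrite big_geq// mulr1 => <-; last by move=> j u /=; rewrite normr1.
 by congr Rintegral; apply/funext => w; rewrite big_geq// mulr1.
elim: k => [|k IH] g psi km mg g1.
 rewrite [\sum_(0 <= j < 0) r j]big_geq// [\sum_(0 <= j < 0) i j]big_geq// mulr0 expR0 mul1r !add0r -indep_prod// -RintZ.
  by congr Rintegral; apply/funext => w; rewrite [\sum_(0 <= j < 0) _]big_geq// add0r.
 apply: (@intg_bnd _ 1) => [|w]; first by apply: measurable_prod => j _; exact: measurableT_comp.
 by rewrite normr_prod; apply: prodr_ile1 => j _; rewrite normr_ge0 g1.
pose gc j := if j == k then (fun u => cos (lam k * u)) else g j.
pose gs j := if j == k then (fun u => sin (lam k * u)) else g j.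
have Hc := IH gc psi (ltnW km) _ _.
have Hs := IH gs (psi - pi / 2) (ltnW km) _ _.
have cut (F : (R -> R) -> nat -> R) (h : R -> R) : \prod_(k <= j < m) F (if j == k then h else g j) j =
  F h k * \prod_(k.+1 <= j < m) F (g j) j.
 rewrite big_ltn// eqxx; congr (_ * _); apply: eq_big_nat => j /andP[kj _].
 by rewrite gtn_eqF.
have mc' j : meas (gc j) by rewrite /gc; case: ifP => // _; exact: mcos.
have ms' j : meas (gs j) by rewrite /gs; case: ifP => // _; exact: msin.
have {}Hc := Hc mc' ltac:(by move=> j u; rewrite /gc; case: ifP).
have {}Hs := Hs ms' ltac:(by move=> j u; rewrite /gs; case: ifP).
rewrite (cut (fun f j => E (fun w => f (D j w)))) EC in Hc.
rewrite (cut (fun f j => E (fun w => f (D j w)))) ES in Hs.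
have mS : meas (fun w => \sum_(0 <= j < k) lam j * D j w).
 by apply: measurable_sum => j; apply: measurable_funM => //; exact: measurable_cst.
have mP (h : nat -> R -> R) : (forall j, meas (h j)) -> meas (fun w => \prod_(k <= j < m) h j (D j w)).
 by move=> mh; apply: measurable_prod => j _; exact: measurableT_comp.
have iF (h : nat -> R -> R) x : (forall j, meas (h j)) -> (forall j u, `|h j u| <= 1) ->
  intg P (fun w => cos (\sum_(0 <= j < k) lam j * D j w + x) * \prod_(k <= j < m) h j (D j w)).
 move=> mh h1; apply: (@intg_bnd _ 1) => [|w].
  apply: measurable_funM; last exact: mP.
  apply: measurableT_comp; first by apply: cmf; exact: continuous_cos.
  by apply: measurable_funD => //; exact: measurable_cst.
 by rewrite normrM normr_prod mulr_ile1// ?prodr_ge0//; apply: prodr_ile1 => j _; rewrite normr_ge0 h1.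
have sinE (x : R) : cos (x + (psi - pi / 2)) = sin (x + psi).
 by rewrite addrA cosB cos_pihalf sin_pihalf mulr0 mulr1 add0r.
have := RintB (iF gc psi mc' ltac:(by move=> j u; rewrite /gc; case: ifP)) (iF gs (psi - pi / 2) ms' ltac:(by move=> j u; rewrite /gs; case: ifP)).
rewrite Hc Hs => HH; transitivity (E (fun w => cos (\sum_(0 <= j < k) lam j * D j w + psi) * \prod_(k <= j < m) gc j (D j w) -
  cos (\sum_(0 <= j < k) lam j * D j w + (psi - pi / 2)) * \prod_(k <= j < m) gs j (D j w))).
 congr Rintegral; apply/funext => w; rewrite big_nat_recr//= !(cut (fun f j => f (D j w))) sinE.
 by rewrite -addrA [lam k * _ + psi]addrC addrA cosD; ring.
rewrite HH sinE !big_nat_recr//= !mulrDr expRD.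
rewrite (_ : ep * _ + ep * i k + psi = (ep * \sum_(0 <= j < k) i j + psi) + ep * i k); last by ring.
by rewrite [cos (_ + psi + _)]cosD; ring.
Qed.

End Prob.

Notation ibnd c := (@intg_bnd _ _ _ _ _ c) (only parsing).

Lemma levy_trig {R : realType} {d} {O : measurableType d} (P : probability O R)
 (Pi : {measure set R -> \bar R}) (b sg2 : R) (xi : R -> O -> R) (ep : R) M lam phi :
 levy_process P Pi b sg2 xi -> 0 <= ep ->
 Int P (fun w => cos (\sum_(0 <= j < M) lam j * (xi (j.+1%:R * ep) w - xi (j%:R * ep) w) + phi)) =
 expR (ep * \sum_(0 <= j < M) RePhi Pi sg2 (lam j)) * cos (ep * \sum_(0 <= j < M) ImPhi Pi b (lam j) + phi).
Proof.
move=> [mxi [_ [_ [ind st]]]] ep0.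
apply: (indep_trig (D := fun j w => xi (j.+1%:R * ep) w - xi (j%:R * ep) w)).
- by move=> j; apply: measurable_funB; exact: mxi.
- move=> m B mB; apply: (ind m (fun j => j%:R * ep)) => //; first by rewrite mul0r.
 by move=> j; apply: ler_wpM2r => //; rewrite ler_nat.
- move=> j; have [] := st (j%:R * ep) ep (lam j) _ ep0; first by pos.
 by rewrite -natr1 mulrDl mul1r.
- move=> j; have [] := st (j%:R * ep) ep (lam j) _ ep0; first by pos.
 by rewrite -natr1 mulrDl mul1r.
Qed.

(** Every state but the newest was the head of an active history when it was left. *)
Lemma sth_all (act : pred (seq nat)) (Q : pred nat) h : (forall g, act g -> Q (hd0 g)) ->
 all Q (behead (sth act h)).
Proof.
move=> H; elim: h => // y [|z h] IH //; rewrite sth_cons; case: ifPn => // ac.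
change (all Q (sth act (z :: h))); case: (sth act (z :: h)) ac IH => // u s ac IH; rewrite /= IH andbT.
exact: (H _ ac).
Qed.

(** * Increments over windows of the clock, and the trigonometric supermartingale *)

Section Grid.
Context {R : realType} (a : nat -> R).
Hypothesis a0 : forall n, 0 < a n.
Context (ep : R).
Hypothesis ep0 : 0 < ep.

(* [gw V j h]: value of V at the first time the clock reaches j * ep. *)
Fixpoint gw (V : seq nat -> R) (j : nat) (h : seq nat) : R :=
 if h is y :: h' then (if h' is _ :: _ then
  (if clk a h' < j%:R * ep then V h else gw V j h') else V h) else 0.

Lemma gw_cons V j y x h : gw V j (y :: x :: h) =
 if clk a (x :: h) < j%:R * ep then V (y :: x :: h) else gw V j (x :: h).
Proof. by []. Qed.
Lemma clk_ge0 h : 0 <= clk a h.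
Proof. by elim: h => // y [|x h] IH //; rewrite clk_cons addr_ge0// invr_ge0 ltW. Qed.
Lemma gw_early V j x h : clk a (x :: h) < j%:R * ep -> gw V j (x :: h) = V (x :: h).
Proof.
case: h => // z h H; rewrite gw_cons ifT//; apply: le_lt_trans H.
by rewrite clk_cons lerDl invr_ge0 ltW.
Qed.

Definition dl V j h := gw V j.+1 h - gw V j h.
Lemma dl_cons V j y x h : dl V j (y :: x :: h) =
 dl V j (x :: h) + ind (j%:R * ep <= clk a (x :: h) < j.+1%:R * ep) * (V (y :: x :: h) - V (x :: h)).
Proof.
rewrite /dl !gw_cons; have jj : j%:R * ep <= j.+1%:R * ep by rewrite ler_pM2r// ler_nat.
have [h1|h1] := ltrP (clk a (x :: h)) (j%:R * ep).
 have h2 : clk a (x :: h) < j.+1%:R * ep by exact: lt_le_trans jj.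
 by rewrite h2 !gw_early//= mul0r !subrr addr0.
have [h2|h2] := ltrP (clk a (x :: h)) (j.+1%:R * ep); last by rewrite /= mul0r addr0.
by rewrite (gw_early V h2) /= mul1r; ring.
Qed.

Lemma win_ex M c : 0 <= c -> c < M%:R * ep -> exists2 w, (w < M)%N & forall j : nat, (j%:R * ep <= c < j.+1%:R * ep) = (j == w).
Proof.
move=> c0 cM; have ce : 0 <= c / ep by pos.
exists (trunc (c / ep)) => [|j].
 by rewrite -(ltr_nat R); have /andP[h _] := truncn_itv ce; apply: (le_lt_trans h); rewrite ltr_pdivrMr.
rewrite -ler_pdivlMr// -ltr_pdivrMr//; apply/idP/eqP => [/truncn_def <- //|->].
exact: truncn_itv.
Qed.

Lemma sum_dl V (r : nat -> R) M y x h w : (w < M)%N ->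
 (forall j : nat, (j%:R * ep <= clk a (x :: h) < j.+1%:R * ep) = (j == w)) ->
 \sum_(0 <= j < M) r j * dl V j (y :: x :: h) =
 \sum_(0 <= j < M) r j * dl V j (x :: h) + r w * (V (y :: x :: h) - V (x :: h)).
Proof.
move=> wM Hw; under eq_bigr do rewrite dl_cons Hw mulrDr.
rewrite big_split /=; congr (_ + _).
rewrite (bigD1_seq w) ?iota_uniq ?mem_index_iota//= eqxx mul1r big1 ?addr0// => j /negbTE ->.
by rewrite mul0r mulr0.
Qed.

Lemma gwclk_mono j h : 0 <= dl (clk a) j h.
Proof.
elim: h => [|y [|x h] IH]; rewrite ?/dl ?subrr//; rewrite -/(dl _ _ _) dl_cons addr_ge0// mulr_ge0 ?ind_ge0//.
by rewrite clk_cons addrC addKr invr_ge0 ltW.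
Qed.

Lemma gw0 V h : gw V 0 h = if h is _ :: _ then V [:: last 0%N h] else 0.
Proof.
elim: h => // y [|x h] IH //; rewrite gw_cons mul0r ltNge clk_ge0 /= -/(gw V 0 (x :: h)).
by rewrite IH.
Qed.

Lemma gwclk_le j h : gw (clk a) j h <= clk a h.
Proof.
elim: h => // y [|x h] IH //; rewrite gw_cons; case: ifP => // _.
by apply: (le_trans IH); rewrite clk_cons lerDl invr_ge0 ltW.
Qed.

Lemma sum_dlclk M h : \sum_(0 <= j < M) dl (clk a) j h <= clk a h.
Proof.
rewrite telescope_sumr// gw0; apply: le_trans (gwclk_le M h).
by case: h => [|y h]; rewrite subr0.
Qed.

(** The clock passes the level j*ep by one step, of length at most e0. *)
Lemma gwclk_end (e0 : R) j h : h <> [::] -> all (fun x => (a x)^-1 <= e0) (behead h) -> 0 <= e0 ->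
 j%:R * ep <= clk a h -> j%:R * ep <= gw (clk a) j h <= j%:R * ep + e0.
Proof.
move=> + + e00; elim: h => // y [|x h] IH _ Ha jc.
 rewrite /= in jc *; have : 0 <= j%:R * ep by pos.
 by move=> h0; apply/andP; split; lra.
rewrite gw_cons; have /andP[ax Hx] : ((a x)^-1 <= e0) && all (fun x => (a x)^-1 <= e0) h by exact: Ha.
case: ltrP => h1; last exact: IH.
by apply/andP; split => //; rewrite clk_cons; move: h1 ax; lra.
Qed.

Lemma dlclk_end (e0 : R) j h : h <> [::] -> all (fun x => (a x)^-1 <= e0) (behead h) -> 0 <= e0 ->
 j.+1%:R * ep <= clk a h -> `|dl (clk a) j h - ep| <= e0.
Proof.
move=> h0 Ha e00 jc; have jj : j%:R * ep <= j.+1%:R * ep by rewrite ler_pM2r// ler_nat.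
have /andP[u1 u2] := gwclk_end h0 Ha e00 jc.
have /andP[v1 v2] := gwclk_end h0 Ha e00 (le_trans jj jc).
have E : j.+1%:R * ep = j%:R * ep + ep by rewrite -natr1 mulrDl mul1r.
by rewrite /dl ler_norml; apply/andP; split; lra.
Qed.

Lemma clk_size (e1 : R) h : h <> [::] -> all (fun x => e1 <= (a x)^-1) (behead h) -> (size h).-1%:R * e1 <= clk a h.
Proof.
elim: h => // y [|x h] IH _ Ha; first by rewrite mul0r.
have /andP[ax Hx] : (e1 <= (a x)^-1) && all (fun x => e1 <= (a x)^-1) h by exact: Ha.
rewrite clk_cons /= -natr1 mulrDl mul1r; apply: lerD => //.
exact: (IH _ Hx).
Qed.

End Grid.

Section TrigStep.
Context {R : realType}.

(** The factor e^(-rq) and the phase shift iq compensate the mean of the cosine after one step of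
    clock length q up to second order. Every second-order term is at most a multiple of eta*q
    because Rm^2 * q <= eta; 90 is a generous total of the numerical factors. *)
Lemma step_trig (psi r i mc ms q eta Rm : R) : 0 < q -> 1 <= Rm -> `|r| <= Rm -> `|i| <= Rm ->
 0 <= eta <= 1 -> `|mc - r| <= eta -> `|ms - i| <= eta -> Rm ^+ 2 * q <= eta ->
 expR (- (r * q)) * (cos psi * (1 + mc * q) - sin psi * (ms * q)) <= cos (psi + i * q) + 90 * eta * q.
Proof.
move=> q0 Rm1 rR iR /andP[e0 e1] Hc Hs Rq.
have Rq1 : Rm * q <= 1 by apply: le_trans (le_trans Rq e1); rewrite expr2 -mulrA ler_peMl//; pos; lra.
have c1 : `|cos psi| <= 1 by rewrite ler_norml cos_geN1 cos_le1.
have s1 : `|sin psi| <= 1 by rewrite ler_norml sin_geN1 sin_le1.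
have rq (x : R) : `|x| <= Rm -> `|x * q| <= Rm * q by move=> h; rewrite normrM (gtr0_norm q0) ler_pM2r.
have sq2 (x : R) : `|x| <= Rm -> (x * q) ^+ 2 <= eta * q.
 move=> h; rewrite -[X in X <= _]real_normK ?num_real//; apply: (via ((Rm * q) ^+ 2)).
  by apply: lerXn2r; rewrite ?nnegrE// ?rq//; pos; lra.
 by rewrite (_ : (Rm * q) ^+ 2 = Rm ^+ 2 * q * q) ?ler_pM2r//; ring.
have A1 : `|expR (- (r * q)) - 1 + r * q| <= 9 * (eta * q).
 have := @exp_tay2 R (- (r * q)); rewrite normrN sqrrN opprK => h.
 by apply: (le_trans (h (le_trans (rq _ rR) Rq1))); rewrite ler_pM2l//; exact: sq2.
have A2 : `|cos (i * q) - 1| <= eta * q by apply: le_trans (cos_tay2 _) (sq2 _ iR).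
have A3 : `|sin (i * q) - i * q| <= eta * q.
 apply: (le_trans (sin_tay _)); rewrite exprS -[X in _ * X <= _]/(`|i * q| ^+ 2) real_normK ?num_real//.
 apply: le_trans (sq2 _ iR); rewrite ler_piMl ?sqr_ge0//.
 exact: le_trans (rq _ iR) Rq1.
set E := expR _ in A1 *; set c := cos psi in c1 *; set s := sin psi in s1 *.
set C := cos (i * q) in A2; set S := sin (i * q) in A3.
have ce : cos (psi + i * q) = c * C - s * S by rewrite cosD.
rewrite ce.
have B1 : `|c * (mc - r)| <= eta by rewrite normrM; apply: le_trans Hc; rewrite ler_piMl.
have B2 : `|s * (ms - i)| <= eta by rewrite normrM; apply: le_trans Hs; rewrite ler_piMl.
have B3 : `|c * (C - 1)| <= eta * q by rewrite normrM; apply: le_trans A2; rewrite ler_piMl.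
have B4 : `|s * (S - i * q)| <= eta * q by rewrite normrM; apply: le_trans A3; rewrite ler_piMl.
have B5 : `|(c * r - s * i) * q| <= 2 * (Rm * q).
 rewrite normrM (gtr0_norm q0) mulrA ler_pM2r//; apply: (le_trans (ler_normB _ _)).
 rewrite !normrM; have h1 : `|c| * `|r| <= Rm by apply: le_trans rR; rewrite ler_piMl.
 have h2 : `|s| * `|i| <= Rm by apply: le_trans iR; rewrite ler_piMl.
 lra.
have q1 : q <= 1 by apply: le_trans Rq1; rewrite ler_peMl// ltW.
set u := c * (1 + mc * q) - s * (ms * q).
have uE : u = c + (c * r - s * i) * q + (c * (mc - r) - s * (ms - i)) * q by rewrite /u; ring.
have B6 : `|(c * (mc - r) - s * (ms - i)) * q| <= 2 * (eta * q).
 rewrite normrM (gtr0_norm q0) mulrA ler_pM2r//; apply: (le_trans (ler_normB _ _)); lra.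
have u5 : `|u| <= 5.
 have eq1 : eta * q <= 1 by rewrite mulr_ile1// ltW.
 rewrite uE; apply: (le_trans leND); apply: (via (1 + 2 * (Rm * q) + 2 * (eta * q))); last lra.
 by apply: lerD => //; apply: (le_trans leND); apply: lerD.
have T1 : `|(E - 1 + r * q) * u| <= 45 * (eta * q).
 rewrite normrM (_ : 45 * (eta * q) = 9 * (eta * q) * 5); last by ring.
 by apply: ler_pM.
have rq1 : `|1 - r * q| <= 2.
 by apply: (le_trans (ler_normB _ _)); rewrite normr1; have := rq _ rR; lra.
have T2 : `|(1 - r * q) * ((c * (mc - r) - s * (ms - i)) * q)| <= 4 * (eta * q).
 by rewrite normrM (_ : 4 * (eta * q) = 2 * (2 * (eta * q))); [apply: ler_pM|ring].
have T3 : `|r * q * ((c * r - s * i) * q)| <= 2 * (eta * q).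
 rewrite normrM; apply: (via ((Rm * q) * (2 * (Rm * q)))); first by apply: ler_pM => //; exact: rq.
 rewrite (_ : _ * _ = 2 * (Rm ^+ 2 * q * q)); last by ring.
 by rewrite ler_pM2l// ler_pM2r.
have -> : E * u = c * C - s * S + ((E - 1 + r * q) * u + (1 - r * q) * ((c * (mc - r) - s * (ms - i)) * q)
  - r * q * ((c * r - s * i) * q) - c * (C - 1) + s * (S - i * q)).
 by rewrite [in RHS]uE /u; ring.
rewrite lerD2l; apply: (le_trans (ler_norm _)).
move: T1 T2 T3 B3 B4; rewrite !ler_norml => /andP[? ?] /andP[? ?] /andP[? ?] /andP[? ?] /andP[? ?].
have eq0 : 0 <= eta * q by pos.
apply/andP; split; lra.
Qed.

End TrigStep.

Section ChainTrig.
Context {R : realType} (p : nat -> nat -> R) (a : nat -> R).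
Hypotheses (kp : is_kernel p) (a0 : forall n, 0 < a n).
Context (n M : nat) (B ep : R) (lam r i : nat -> R) (phi eta Rm : R).
Hypotheses (n0 : (0 < n)%N) (ep0 : 0 < ep).
Let S := M%:R * ep.
Hypotheses (Rm1 : 1 <= Rm) (rR : forall j, `|r j| <= Rm) (iR : forall j, `|i j| <= Rm) (eta01 : 0 <= eta <= 1)
 (Hx : forall x, (0 < x)%N -> `|ld x n| <= B -> Rm ^+ 2 / a x <= eta /\ forall j, (j < M)%N -> `|mm p a x (fun u => cos (lam j * u) - 1) - r j| <= eta /\ `|mm p a x (fun u => sin (lam j * u)) - i j| <= eta).

Let act := act1 a n B S.
Definition lnh (h : seq nat) : R := ln (hd0 h)%:R.
Definition Th h := \sum_(0 <= j < M) lam j * dl a ep lnh j h.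
Definition AR h := \sum_(0 <= j < M) r j * dl a ep (clk a) j h.
Definition AI h := \sum_(0 <= j < M) i j * dl a ep (clk a) j h.
Definition Wt h := expR (- AR h) * cos (Th h - AI h + phi).
Let C0 := expR (Rm * (S + 1)).
(** [Wt] is the real part of a complex exponential divided by its compensator. Adding C0 makes it
    nonnegative, the last term pays the error of [step_trig] over the remaining clock, and the value
    0 beyond S + 1, never met by one step from an active history, makes positivity unconditional. *)
Definition fT h : R := if clk a h <= S + 1 then Wt h + C0 + 90 * eta * C0 * remc a S h else 0.
Let eta0 : 0 <= eta. Proof. by case/andP: eta01. Qed.
Let S0 : 0 <= S. Proof. by rewrite /S mulr_ge0// ltW. Qed.
Let Rm0 : 0 <= Rm. Proof. exact: le_trans Rm1. Qed.
Lemma ax_ge1 x : (0 < x)%N -> `|ld x n| <= B -> (a x)^-1 <= eta.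
Proof.
move=> x0 xB; have [h _] := Hx x0 xB; apply: le_trans h.
by rewrite ler_peMl ?invr_ge0 ?exprn_ege1// ltW.
Qed.

Lemma sumR_clk (r' : nat -> R) h : (forall j, `|r' j| <= Rm) ->
 `|\sum_(0 <= j < M) r' j * dl a ep (clk a) j h| <= Rm * clk a h.
Proof.
move=> r'R; apply: le_trans (ler_norm_sum _ _ _) _.
apply: (via (\sum_(0 <= j < M) Rm * dl a ep (clk a) j h)).
 apply: ler_sum => j _; rewrite normrM (ger0_norm (gwclk_mono a0 ep0 j h)).
 by apply: ler_wpM2r => //; exact: gwclk_mono.
by rewrite -mulr_sumr; apply: ler_wpM2l => //; exact: sum_dlclk.
Qed.

Lemma expAR h : clk a h <= S + 1 -> expR (- AR h) <= C0.
Proof.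
move=> cS; rewrite ler_expR; apply: le_trans (ler_norm _) _; rewrite normrN.
by apply: (le_trans (sumR_clk h rR)); apply: ler_wpM2l.
Qed.

Lemma Wt_bnd h : clk a h <= S + 1 -> `|Wt h| <= C0.
Proof.
move=> cS; rewrite normrM ger0_norm ?expR_ge0//; apply: le_trans (expAR cS).
by rewrite ler_piMr ?expR_ge0// ler_norml cos_geN1 cos_le1.
Qed.

Lemma fT_ge0 h : 0 <= fT h.
Proof.
rewrite /fT; case: ifP => // /Wt_bnd; rewrite ler_norml => /andP[h1 _].
have : 0 <= 90 * eta * C0 * remc a S h by pos; exact: remc_ge0.
lra.
Qed.

Lemma fT_super h : act h -> (0 < hd0 h)%N -> (Qe p (fun h => (fT h)%:E) h <= (fT h)%:E)%E.
Proof.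
case: h => // x h Ha x0; have /and3P[cS _ xB] := Ha.
have [ae Hm] := Hx x0 xB; have ax := ax_ge1 x0 xB.
have q0 : 0 < (a x)^-1 by pos.
have q1 : (a x)^-1 <= 1 by apply: le_trans ax _; case/andP: eta01.
have a1 : 1 <= a x by rewrite -[leLHS]invr1 -[a x]invrK lef_pV2 ?posrE.
(* A step contributes only to the window w containing the current clock, so the three sums change by
   a single term each. *)
have [w wM Hw] := win_ex ep0 (clk_ge0 a0 (x :: h)) cS.
have [mc ms] := Hm w wM.
have Q := kern kp x0; have [Q0 [Q1 _]] := Q.
have E1 y : Th (y :: x :: h) = Th (x :: h) + lam w * lr x y by rewrite /Th (sum_dl a0 ep0 lnh lam y wM Hw).
have E2 y : AR (y :: x :: h) = AR (x :: h) + r w / a x.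
 by rewrite /AR (sum_dl a0 ep0 (clk a) r y wM Hw) clk_cons addrAC subrr add0r.
have E3 y : AI (y :: x :: h) = AI (x :: h) + i w / a x.
 by rewrite /AI (sum_dl a0 ep0 (clk a) i y wM Hw) clk_cons addrAC subrr add0r.
set psi := Th (x :: h) - AI (x :: h) - i w / a x + phi.
set A := expR (- AR (x :: h)).
have cSx : clk a (x :: h) <= S + 1 by apply: (le_trans (ltW cS)); rewrite lerDl.
have A0 : A <= C0 by exact: expAR.
set E := expR (- (r w / a x)).
have sc : summ (p x) (fun y => cos (lam w * lr x y)).
 by apply: (@summ_bnd _ _ _ 1) => // k _; rewrite ler_norml cos_geN1 cos_le1.
have sc1 : summ (p x) (fun y => cos (lam w * lr x y) - 1).
 by apply: (@summ_bnd _ _ _ 2) => // k _; apply: le_trans (ler_normB _ _) _; rewrite normr1 -[leRHS]/(1 + 1) lerD2r ler_norml cos_geN1 cos_le1.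
have ss : summ (p x) (fun y => sin (lam w * lr x y)).
 by apply: (@summ_bnd _ _ _ 1) => // k _; rewrite ler_norml sin_geN1 sin_le1.
have s1 : summ (p x) (fun y => (A * E * cos psi) * cos (lam w * lr x y)) by exact: summZ.
have s2 : summ (p x) (fun y => (A * E * sin psi) * sin (lam w * lr x y)) by exact: summZ.
have s12 : summ (p x) (fun y => (A * E * cos psi) * cos (lam w * lr x y) - (A * E * sin psi) * sin (lam w * lr x y)).
 by apply: summB.
pose c1 := C0 + 90 * eta * C0 * (remc a S (x :: h) - (a x)^-1).
have sC : summ (p x) (fun=> c1) by exact: summ_cst.
apply: (Qe_le kp (g := fun y => ((A * E * cos psi) * cos (lam w * lr x y) - (A * E * sin psi) * sin (lam w * lr x y)) + c1)) => //.
- exact: fT_ge0.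
- move=> y y0; rewrite /fT ifT; last by rewrite clk_cons; move: cS q1; lra.
 rewrite (remc_step a0 y Ha a1) -addrA -/c1 lerD2r /Wt E1 E2 E3 opprD expRD -/A -/E.
 rewrite (_ : _ + phi = psi + lam w * lr x y); last by rewrite /psi; ring.
 by rewrite cosD le_eqVlt; apply/orP; left; apply/eqP; ring.
- by apply: summD.
rewrite EsumD// EsumB// !EsumZ// Esum_cst//.
have Ec : Esum (p x) (fun y => cos (lam w * lr x y)) = 1 + mm p a x (fun u => cos (lam w * u) - 1) / a x.
 rewrite -(Esum_mm p a0 x (fun u => cos (lam w * u) - 1)) EsumB//; last exact: summ_cst.
 by rewrite Esum_cst//; ring.
have Es : Esum (p x) (fun y => sin (lam w * lr x y)) = mm p a x (fun u => sin (lam w * u)) / a x.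
 by rewrite -(Esum_mm p a0 x (fun u => sin (lam w * u))).
rewrite Ec Es; set mcx := mm p a x _ in mc *; set msx := mm p a x _ in ms *.
have := step_trig psi q0 Rm1 (rR w) (iR w) eta01 mc ms ae.
rewrite -/E (_ : psi + i w / a x = Th (x :: h) - AI (x :: h) + phi); last by rewrite /psi; ring.
move=> ST; rewrite /fT cSx /Wt -/A.
have h1 := ler_wpM2l (expR_ge0 (- AR (x :: h))) ST; rewrite -/A in h1.
have h2 : A * (90 * eta / a x) <= C0 * (90 * eta / a x) by apply: ler_wpM2r => //; apply: mulr_ge0; [apply: mulr_ge0|exact: ltW].
have -> : A * E * cos psi * (1 + mcx / a x) - A * E * sin psi * (msx / a x) =
 A * (E * (cos psi * (1 + mcx / a x) - sin psi * (msx / a x))) by ring.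
rewrite /c1; move: h1 h2; set X := E * _; lra.
Qed.

Lemma fT_init : fT [:: n] = cos phi + C0 + 90 * eta * C0 * (S + 1).
Proof.
have D0 V j : dl a ep V j [:: n] = 0 by rewrite /dl /= subrr.
have Z (g : nat -> R) V : \sum_(0 <= j < M) g j * dl a ep V j [:: n] = 0.
 by rewrite big1 // => j _; rewrite D0 mulr0.
rewrite /fT /= ifT; last by move: S0; lra.
rewrite /Wt /AR /AI /Th !Z /remc /= subr0 mxl ?oppr0 ?expR0 ?mul1r ?subrr ?add0r//; last by rewrite ?oppr0 ?addr0; move: S0; lra.
by rewrite ?oppr0 ?addr0.
Qed.

(** Once the clock has reached S, each window has clock length ep up to e1, so the random
    compensators may be replaced by ep times the sums of the exponents. *)
Lemma W_end h (e1 : R) : h <> [::] -> all (fun x => (a x)^-1 <= e1) (behead h) -> 0 <= e1 ->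
 S <= clk a h -> clk a h <= S + 1 -> M%:R * Rm * e1 <= 1 ->
 `|Wt h - expR (- (ep * \sum_(0 <= j < M) r j)) * cos (Th h - ep * \sum_(0 <= j < M) i j + phi)|
  <= C0 * (10 * (M%:R * Rm * e1)).
Proof.
move=> h0 Ha e10 Sc cS MR1.
have near (r' : nat -> R) : (forall j, `|r' j| <= Rm) ->
  `|\sum_(0 <= j < M) r' j * dl a ep (clk a) j h - ep * \sum_(0 <= j < M) r' j| <= M%:R * Rm * e1.
 move=> r'R; rewrite mulr_sumr -sumrB; apply: le_trans (ler_norm_sum _ _ _) _.
 apply: (via (\sum_(0 <= j < M) Rm * e1)).
  rewrite !big_seq; apply: ler_sum => j; rewrite mem_index_iota => /andP[_ jM].
  rewrite (_ : _ - _ = r' j * (dl a ep (clk a) j h - ep)); last by ring.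
  rewrite normrM; apply: ler_pM; [exact: normr_ge0|exact: normr_ge0|exact: r'R|].
  have jS : j.+1%:R * ep <= clk a h by apply: le_trans Sc; rewrite ler_pM2r// ler_nat.
  exact (dlclk_end ep0 h0 Ha e10 jS).
 by rewrite -mulrA mulr_natl big_const_nat iter_addr_0 subn0.
have nr := near _ rR; have ni := near _ iR.
rewrite -/(AR h) in nr; rewrite -/(AI h) in ni.
set u := AR h in nr *; set u' := ep * _ in nr *; set v := AI h in ni *; set v' := ep * \sum_(0 <= j < M) i j in ni *.
set q := M%:R * Rm * e1 in nr ni MR1 *.
have cl (x y : R) : `|cos x - cos y| <= `|x - y|.
 have := @mvt0 R (fun z => cos (y + z) - cos y) (fun z => - sin (y + z)) (x - y) 1.
 rewrite mul1r subrKC; apply.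
 - move=> z; have -> : (fun z0 => cos (y + z0) - cos y) = (fun z => cos (y + z) - cst (cos y) z) by [].
  by apply: is_derive_eq; rewrite ?scaler0 /GRing.scale /=; ring.
 - by rewrite addr0 subrr.
 - by move=> z _; rewrite normrN ler_norml sin_geN1 sin_le1.
have Au : expR (- u) <= C0 by exact: expAR.
have h1 : `|cos (Th h - v + phi) - cos (Th h - v' + phi)| <= q.
 apply: (le_trans (cl _ _)); rewrite (_ : _ - _ = - (v - v')); last by ring.
 by rewrite normrN.
have h2 : `|expR (- u) - expR (- u')| <= C0 * (9 * q).
 have -> : expR (- u) - expR (- u') = - (expR (- u) * (expR (u - u') - 1)).
  by rewrite mulrBr -expRD mulr1 opprB; congr (_ - expR _); ring.
 rewrite normrN normrM ger0_norm ?expR_ge0//; apply: ler_pM => //.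
 apply: (via (9 * `|u - u'|)); last by rewrite ler_pM2l.
 by apply: exp_tay1; exact: le_trans MR1.
rewrite /Wt -/u -/v (_ : _ - _ = expR (- u) * (cos (Th h - v + phi) - cos (Th h - v' + phi)) +
 (expR (- u) - expR (- u')) * cos (Th h - v' + phi)); last by ring.
apply: (le_trans leND); rewrite !normrM (ger0_norm (expR_ge0 (- u))).
have h3 : expR (- u) * `|cos (Th h - v + phi) - cos (Th h - v' + phi)| <= C0 * q by apply: ler_pM => //; exact: expR_ge0.
have h4 : `|expR (- u) - expR (- u')| * `|cos (Th h - v' + phi)| <= C0 * (9 * q).
 by apply: le_trans h2; rewrite ler_piMr// ler_norml cos_geN1 cos_le1.
by rewrite (_ : C0 * (10 * q) = C0 * q + C0 * (9 * q)); [exact: lerD|ring].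
Qed.

End ChainTrig.

(** * Deterministic properties of stopped paths *)

Section Path.
Context {R : realType} (a : nat -> R).
Hypothesis a0 : forall n, 0 < a n.

Definition inr n (B : R) x := `|ld x n| <= B.
(** States in range are at least e^(-B) n, so a property of all large states holds uniformly over
    the range. *)
Lemma ev_inr (Q : nat -> Prop) B : ev Q -> ev (fun n => (0 < n)%N /\ forall x, (0 < x)%N -> inr n B x -> Q x).
Proof.
move=> [N0 HN]; apply: ev_imp (ev_and (ev_ge 1) (ev_ger (expR B * N0%:R))) => n [n0 h]; split => // x x0.
rewrite /inr ler_norml => /andP[h1 _]; apply: HN; rewrite -(ler_nat R).
have n0R : 0 < n%:R :> R by pos. have x0R : 0 < x%:R :> R by pos.
have : expR (- B) <= x%:R / n%:R.
 by rewrite -[leRHS](@lnK R) ?posrE ?divr_gt0// ler_expR ln_div ?posrE.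
rewrite ler_pdivlMr// => h2; apply: le_trans h2; rewrite expRN mulrC ler_pdivlMr ?expR_gt0//.
by rewrite mulrC.
Qed.

(** Potter's bound with exponent ga/2 compares a_n with a_1. *)
Lemma a_inf ga : 0 < ga -> reg_var a ga -> forall C, ev (fun n => C <= a n).
Proof.
move=> ga0 rv C; have th : ga / 2 < ga by lra.
have [c [c0 Hc]] := potter_ge (PC_UC (reg_var_PC rv)) th.
have g2 : 0 < ga / 2 by lra.
apply: ev_imp (ev_and (ev_ge 1) (ev_ger (expR ((ln `|C| + c - ln (a 1%N)) / (ga / 2))))) => n [n0 h].
have [C0|C0] := lerP C 0; first by apply: le_trans C0 _; exact: ltW.
have := Hc 1%N n isT n0; rewrite ln1 mulr0 subr0 => h1.
have n0R : 0 < n%:R :> R by pos.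
rewrite -[n%:R]lnK ?posrE// ler_expR ler_pdivrMr// (gtr0_norm C0) in h.
by rewrite -ler_ln ?posrE//; lra.
Qed.

Context (n : nat) (S : R).

(** Lets B grow after an estimate has been made with a smaller range: a path that never leaves the
    small range is stopped by the clock alone in both cases. *)
Lemma act1_mono B1 B x : B1 <= B -> (forall N, inr n B1 (hd0 (sth (act1 a n B1 S) (hist x N)))) ->
 forall N, sth (act1 a n B S) (hist x N) = sth (act1 a n B1 S) (hist x N).
Proof.
move=> BB H; elim=> [|N IH] //; rewrite !sthS IH /=.
have := H N; rewrite /inr => h; congr (if _ then _ else _).
by rewrite /act1 h (le_trans h BB).
Qed.

Lemma sth_neq0 act x N : sth act (hist x N) <> [::].
Proof. by elim: N => // N IH; rewrite sthS /=; case: ifP. Qed.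
Lemma act1_all B (Q : pred nat) h : (forall x, (0 < x)%N -> inr n B x -> Q x) -> all Q (behead (sth (act1 a n B S) h)).
Proof. by move=> H; apply: sth_all => g /and3P[_ g0 gB]; exact: H. Qed.
Lemma act1_clk B (e1 : R) x N : 0 <= e1 -> 0 <= S -> (forall x, (0 < x)%N -> inr n B x -> (a x)^-1 <= e1) ->
 clk a (sth (act1 a n B S) (hist x N)) <= S + e1.
Proof.
move=> e10 S0 H; elim: N => [|N IH]; first by pos.
rewrite sthS /=; case: ifPn => // ac; have := ac; rewrite /act1.
case: (sth _ _) ac {IH} => [|y h] ac /and3P[c1 h0 hB]; first by pos.
by rewrite clk_cons; apply: lerD; [exact: ltW|exact: H].
Qed.

Lemma act1_full B x N : act1 a n B S (sth (act1 a n B S) (hist x N)) -> sth (act1 a n B S) (hist x N) = hist x N.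
Proof. exact: sth_id. Qed.
(** In range, a is bounded by some [am], so each step adds at least 1/am to the clock. The number of
    steps needed is therefore the same for all paths, which lets N be fixed before the path. *)
Lemma act1_end B : (0 < n)%N -> exists N0, forall x, (forall N, (0 < x N)%N) ->
 (forall N, inr n B (hd0 (sth (act1 a n B S) (hist x N)))) ->
 forall N, (N0 <= N)%N -> S <= clk a (sth (act1 a n B S) (hist x N)).
Proof.
move=> n0; have n0R : 0 < n%:R :> R by pos.
pose X0 := (trunc (expR B * n%:R)).+1.
pose am := \sum_(0 <= x < X0) a x + 1.
have am0 : 0 < am by rewrite /am ltr_wpDl// sumr_ge0// => i _; exact: ltW.
have Ham x : (0 < x)%N -> inr n B x -> am^-1 <= (a x)^-1.
 move=> x0; rewrite /inr ler_norml => /andP[_ h]; rewrite lef_pV2 ?posrE//.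
 have xX : (x < X0)%N.
  rewrite -(ltr_nat R); apply: le_lt_trans (truncnS_gt _).
  have x0R : 0 < x%:R :> R by pos.
  by rewrite -[x%:R]lnK ?posrE// -[n%:R in leRHS]lnK ?posrE// -expRD ler_expR; lra.
 rewrite /am (bigD1_seq x) ?iota_uniq ?mem_index_iota//= -addrA lerDl addr_ge0// sumr_ge0// => i _.
 exact: ltW.
exists (trunc (`|S| * am)).+1 => x xp xr N NN; rewrite leNgt; apply/negP => cS.
have ac : act1 a n B S (sth (act1 a n B S) (hist x N)).
 have xrN := xr N; rewrite /inr in xrN; rewrite /act1 cS xrN andbT /=.
 elim: N {NN cS xrN} => [|N IH]; first exact: xp.
 by rewrite sthS /=; case: ifP => //= _; exact: xp.
have := clk_size (sth_neq0 (x := x) (N := N)) (act1_all (B := B) (hist x N) Ham).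
rewrite (act1_full ac) size_hist /= => h; rewrite (act1_full ac) in cS.
have h1 := truncnS_gt (`|S| * am); have : S < N%:R / am.
 rewrite ltr_pdivlMr//; apply: (@le_lt_trans _ _ (`|S| * am)); first by rewrite ler_pM2r// ler_norm.
 by apply: (lt_le_trans h1); rewrite ler_nat.
lra.
Qed.

Lemma gw_in (ep : R) j (Q : R -> Prop) h : h <> [::] -> all (fun x => `[< Q (ln x%:R) >]) h -> Q (gw a ep (@lnh R) j h).
Proof.
elim: h => // y [|x h] IH _; first by rewrite /= andbT => /asboolP.
move=> /andP[/asboolP Qy Ha]; rewrite gw_cons; case: ifP => // _.
exact: IH.
Qed.

Lemma dl_bnd (ep : R) B j x N : (forall N, (0 < x N)%N) ->
 (forall N, inr n B (hd0 (sth (act1 a n B S) (hist x N)))) ->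
 `|dl a ep (@lnh R) j (sth (act1 a n B S) (hist x N))| <= 2 * B.
Proof.
move=> xp xr; set h := sth _ _.
have Ha : all (fun x : nat => `[< `|ld x n| <= B >]) h.
 have hb := @act1_all B (fun x : nat => `[< `|ld x n| <= B >]) (hist x N) (fun x _ h => asboolT h).
 have := xr N; rewrite -/h; have := sth_neq0 (act := act1 a n B S) (x := x) (N := N); rewrite -/h in hb *.
 by case: (h) hb => // y s hb _ yB; rewrite /= hb andbT; apply/asboolP.
have G k := @gw_in ep k (fun l => `|l - ln n%:R| <= B) h (@sth_neq0 _ _ _) Ha.
rewrite /dl; have := G j.+1; have := G j; rewrite !ler_norml => /andP[? ?] /andP[? ?].
apply/andP; split; lra.
Qed.

End Path.

Definition DV {R : realType} (a : nat -> R) ep (h : seq nat) : nat -> R := fun j => dl a ep (@lnh R) j h.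
Lemma sth_act (act : pred (seq nat)) x k : sth act (hist x k) = hist x k -> act (hist x k) ->
 sth act (hist x k.+1) = hist x k.+1.
Proof. by move=> E ac; rewrite sthS /= E ac. Qed.

Section TailPath.
Context {R : realType} (a : nat -> R).
Hypothesis a0 : forall n, 0 < a n.
Context (n K K1 Rb : nat) (S' eta : R).

Definition badT (h : seq nat) : bool := (S' <= clk a h) &&
 [|| bj K K1 Rb h, eta * n%:R < (hd0 h)%:R | eta * a n < (cnt a S' h)%:R].

Local Notation act := (act2 a n K K1 Rb S' eta).
(** As long as no bad history occurs, the stopped history is the full one until absorption and [cnt]
    counts the steps made since ka. Without absorption that count would exceed eta*a_n, which is
    bad; hence the chain is absorbed, soon and without climbing above eta*n. *)
Lemma tail_det (x : nat -> nat) ka : (0 < K)%N ->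
 (forall j, (j < ka)%N -> clk a (hist x j) < S' /\ (K1 < x j)%N) -> S' <= clk a (hist x ka) ->
 (K < x ka)%N -> (forall N, ~~ badT (sth act (hist x N))) -> 0 <= eta * a n ->
 exists A, [/\ (ka < A)%N, (x A <= K)%N, (forall j, (ka <= j < A)%N -> (K < x j)%N),
  (forall j, (ka <= j <= A)%N -> (x j)%:R <= eta * n%:R) & (A - ka)%:R <= eta * a n].
Proof.
move=> K0 H1 H2 Kx nb ea0.
have hd j : hd0 (hist x j) = x j by case: j.
have clm i j : (i <= j)%N -> clk a (hist x i) <= clk a (hist x j).
 elim: j => [|j IH]; first by rewrite leqn0 => /eqP ->.
 rewrite leq_eqVlt => /orP[/eqP -> //|/IH h]; apply: (le_trans h).
 have [t [g E]] : exists t g, hist x j = t :: g by case: (j) => [|j']; [exists (x 0%N), [::]|exists (x j'.+1), (hist x j')].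
 by rewrite -[hist x j.+1]/(x j.+1 :: hist x j) E clk_cons lerDl invr_ge0 ltW.
have early j : (j <= ka)%N -> sth act (hist x j) = hist x j.
 elim: j => [|j IH] // jk; have E := IH (ltnW jk).
 have ac : act (hist x j).
  have [c1 k1] := H1 _ jk; rewrite /act2 hd c1 k1 andbT.
  exact: leq_trans k1.
 exact: sth_act.
have late j : (ka <= j)%N -> (forall i, (ka <= i < j)%N -> (K < x i)%N) ->
  sth act (hist x j) = hist x j /\ cnt a S' (hist x j) = (j - ka)%N.
 elim: j => [|j IH].
  rewrite leqn0 => /eqP k0 _; split; first by apply: early.
  by rewrite /= sub0n.
 rewrite leq_eqVlt => /orP[/eqP <- _|kj Hi].
  rewrite subnn; split; first exact: early.
  have: forall i, (i <= ka)%N -> cnt a S' (hist x i) = 0%N; last exact.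
  elim=> // i IHi ik; have := IHi (ltnW ik); have [c1 _] := H1 _ ik.
  have [t [g E]] : exists t g, hist x i = t :: g by case: (i) => [|j']; [exists (x 0%N), [::]|exists (x j'.+1), (hist x j')].
  rewrite -[hist x i.+1]/(x i.+1 :: hist x i) E cnt_cons -E => ->.
  by rewrite leNgt c1.
 have [|E C] := IH kj; first by move=> i /andP[i1 i2]; apply: Hi; rewrite i1 ltnW.
 have Kj : (K < x j)%N by apply: Hi; rewrite -ltnS kj /=.
 have cj : S' <= clk a (hist x j) by apply: (le_trans H2); exact: clm.
 have := nb j; rewrite E /badT cj /= !negb_or hd => /and3P[b1 b2 b3].
 have ac : act (hist x j).
  by rewrite /act2 hd ltNge cj /= (leq_trans _ Kj)//= Kj b1 leNgt b2.
 split; first exact: sth_act.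
 have [t [g Eh]] : exists t g, hist x j = t :: g by case: (j) => [|j']; [exists (x 0%N), [::]|exists (x j'.+1), (hist x j')].
 by move: cj C; rewrite Eh => cj' C'; rewrite cj' C' subSn.
have bnd j : (ka <= j)%N -> (forall i, (ka <= i < j)%N -> (K < x i)%N) ->
  (x j)%:R <= eta * n%:R /\ (j - ka)%:R <= eta * a n.
 move=> kj Hi; have [E C] := late j kj Hi.
 have cj : S' <= clk a (hist x j) by apply: (le_trans H2); exact: clm.
 have := nb j; rewrite E /badT cj /= !negb_or hd C => /and3P[b1 b2 b3].
 by rewrite !leNgt b2 b3.
have exA : exists i, (ka <= i)%N && (x i <= K)%N.
 apply: contrapT => nex; pose j := (ka + (trunc (eta * a n)).+1)%N.
 have [|_] := bnd j (leq_addr _ _).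
  by move=> i /andP[i1 _]; rewrite ltnNge; apply/negP => i2; apply: nex; exists i; rewrite i1.
 by rewrite /j addKn leNgt truncnS_gt.
case: (ex_minnP exA) => A /andP[kA xA] min.
have Hi i : (ka <= i < A)%N -> (K < x i)%N.
 move=> /andP[i1 i2]; rewrite ltnNge; apply/negP => i3.
 by have := min i; rewrite i1 i3 => /(_ isT); rewrite leqNgt i2.
exists A; split => //.
- by rewrite ltn_neqAle kA andbT; apply/eqP => E; move: xA; rewrite -E leqNgt Kx.
- move=> j /andP[j1 j2]; apply: (bnd j j1 _).1 => i /andP[i1 i2]; apply: Hi; rewrite i1.
 exact: leq_trans j2.
- by have [] := bnd A kA Hi.
Qed.

End TailPath.

Section Access.
Context {R : realType} (p : nat -> nat -> R) {d} {T : measurableType d}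
 (P : probability T R) (n K : nat) (X : nat -> T -> nat).
Hypotheses (kp : is_kernel p) (n0 : (0 < n)%N) (mc : markov_chain P p n X).

Lemma Esum_eq0 (q g : nat -> R) : (forall k, 0 <= q k) -> (forall k, 0 <= g k) -> summ q g -> Esum q g = 0 ->
 forall k, q k * g k = 0.
Proof.
move=> q0 g0 sg E k; apply/eqP; rewrite eq_le mulr_ge0// andbT -E.
have cv := summ_cvg q0 sg; rewrite /Esum.
apply: le_trans (nondecreasing_cvgn_le _ cv k.+1).
 by rewrite /series /= big_nat_recr//= lerDr sumr_ge0// => i _; rewrite mulr_ge0.
by apply/nondecreasing_seqP => i; rewrite /series /= big_nat_recr//= lerDl mulr_ge0.
Qed.

(** Contrapositive: the states above K from which no finite horizon gives a chance of absorption
    form a set Z closed under the kernel. The indicator of its complement has nonpositive drift and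
    vanishes at n, so {1..K} is almost surely never visited. *)
Lemma access_U : (K < n)%N -> (0 < P (\bigcup_i [set w | (X i w <= K)%N]))%E -> exists N, U p K N n < 1.
Proof.
move=> Kn; apply: contraPP => /forallNP H; apply/negP; rewrite -leNgt.
pose Z (x : nat) := (K < x)%N && `[< forall N, U p K N x = 1 >].
pose f (h : seq nat) : R := ind (~~ Z (hd0 h)).
have sid (h : seq nat) : sth predT h = h by elim: h => // y [|z h] IH //; rewrite sth_cons IH.
have Zn : Z n.
 rewrite /Z Kn; apply/asboolP => N; apply/eqP; rewrite eq_le.
 by have /andP[_ ->] := U_bnd K kp N n0; rewrite leNgt; apply/negP; exact: H.
have := superE kp n0 mc (act := predT) (bad := fun h => (hd0 h <= K)%N) (f := f) (c := 1) ltr01.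
have f0 : f [:: n] = 0 by rewrite /f /= Zn.
rewrite f0 mul0r => HH.
have E : \bigcup_i [set w | (X i w <= K)%N] = \bigcup_N [set w | (hd0 (sth predT (Hk X N w)) <= K)%N].
 apply: eq_bigcupr => i _; apply/seteqP; split => w /=; rewrite sid; by case: i.
rewrite E; apply: HH.
- by move=> h; exact: ind_ge0.
- case=> // x h _ x0; have Q := kern kp x0; have [q0 [q1 q2]] := Q.
 apply: (@Qe_le _ p kp f (fun y => ind (~~ Z y))) => //.
 + by move=> g; exact: ind_ge0.
 + by apply: (@summ_bnd _ _ _ 1) => // k _; rewrite ger0_norm ?ind_ge0 ?ind_le1.
 + rewrite {1}/f /=; have sZ : summ (p x) (fun y => ind (~~ Z y) : R).
   by apply: (@summ_bnd _ _ _ 1) => // k _; rewrite ger0_norm ?ind_ge0 ?ind_le1.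
  have [Zx|nZ] := boolP (Z x); last first.
   rewrite /= -(Esum_cst 1 Q); apply: le_Esum => //; first exact: summ_cst.
   by move=> k _; exact: ind_le1.
  have z y : p x y * ind (~~ Z y) = 0.
   have [->|py] := eqVneq (p x y) 0; first by rewrite mul0r.
   have y0 : (0 < y)%N by rewrite lt0n; apply: contraNneq py => ->; rewrite q0.
   have Uy N : ind (K < y)%N * U p K N y = 1.
    have /andP[_ /asboolP HU] := Zx.
    have sU : summ (p x) (fun y => ind (K < y)%N * U p K N y) by exact: (@summ_U).
    pose g y := if (0 < y)%N then 1 - ind (K < y)%N * U p K N y else 0.
    have s1 : summ (p x) (fun y => 1 - ind (K < y)%N * U p K N y) by apply: summB => //; exact: summ_cst.
    have g0 k : 0 <= g k.
     rewrite /g; case: ifP => // k0; rewrite subr_ge0; have /andP[u1 u2] := U_bnd K kp N k0.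
     by case: (K < k)%N; rewrite /= ?mul1r ?mul0r// ltW.
    have sg : summ (p x) g.
     by apply: (summ_le (h := g)) => //; [move=> k _; rewrite ger0_norm|apply: (@summ_bnd _ _ _ 1) => // k k0; rewrite ger0_norm// /g k0 lerBlDr lerDl mulr_ge0 ?ind_ge0//; have /andP[] := U_bnd K kp N k0].
    have Eg : Esum (p x) g = 0.
     rewrite (eq_Esum (h := fun y => 1 - ind (K < y)%N * U p K N y))//; last by move=> k k0; rewrite /g k0.
     rewrite EsumB//; last exact: summ_cst.
     rewrite Esum_cst//; apply/eqP; rewrite subr_eq0; apply/eqP; apply: esym; exact: (HU N.+1).
    have := Esum_eq0 q1 g0 sg Eg y => /eqP; rewrite mulf_eq0 (negbTE py) /= /g y0 subr_eq0 => /eqP <- //.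
   have Ky : (K < y)%N.
    by have := Uy 0%N; case: ltnP => //= _ /eqP; rewrite mul0r eq_sym oner_eq0.
   rewrite (_ : Z y = true) ?mulr0//; rewrite /Z Ky; apply/asboolP => N.
   by have := Uy N; rewrite Ky /= mul1r.
  rewrite /Esum (_ : (fun k => _) = fun=> 0); last by apply/funext => k; exact: z.
  rewrite (_ : series _ = fun=> 0) ?lim_cst//; apply/funext => k.
  by rewrite /series /= big1.
- move=> h hK; rewrite /f /Z ltnNge hK //=.
Qed.

End Access.

(** * Exponential moments, and convexity of Psi *)

Section Exp3.
Context {R : realType}.

Lemma exp_tay3 (x : R) : `|expR x - 1 - x - x ^+ 2 / 2| <= expR `|x| * `|x| ^+ 3.
Proof.
set E := expR `|x|.
have e0 (c : R) : `|c| <= `|x| -> `|expR c| <= E.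
 by move=> cx; rewrite ger0_norm ?expR_ge0// ler_expR; apply: le_trans cx; exact: ler_norm.
have E0 : 0 <= E by exact: expR_ge0.
have e1 (c : R) : `|c| <= `|x| -> `|expR c - 1| <= E * `|x|.
 move=> cx; apply: (via (E * `|c|)); last exact: ler_wpM2l.
 apply: (mvt0 (g := fun x => expR x - 1) (g' := fun x => expR x - 0)); first by rewrite expR0 subrr.
 by move=> y yc; rewrite subr0; apply: e0; exact: le_trans cx.
have e2 (c : R) : `|c| <= `|x| -> `|expR c - 1 - c| <= E * `|x| ^+ 2.
 move=> cx; apply: (via (E * `|x| * `|c|)); last by rewrite expr2 mulrA; apply: ler_wpM2l => //; rewrite mulr_ge0.
 apply: (mvt0 (g := fun x => expR x - 1 - x) (g' := fun x => expR x - 0 - 1)); first by rewrite expR0; ring.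
 by move=> y yc; rewrite subr0; apply: e1; exact: le_trans cx.
rewrite [`|x| ^+ 3]exprSr mulrA.
apply: (mvt0 (g := fun x => expR x - 1 - x - x ^+ 2 / 2) (g' := fun x => expR x - 0 - 1 - x)).
- move=> c; rewrite (_ : (fun x => _) = (fun x => expR x - 1 - x - 2^-1 * x ^+ 2)); last first.
  by apply/funext => y; rewrite [2^-1 * _]mulrC.
 by apply: is_derive_eq; rewrite /GRing.scale /=; field.
- by rewrite expR0; ring.
- by move=> c cx; rewrite subr0; exact: e2.
Qed.

End Exp3.

Section GenExp.
Context {R : realType} (p : nat -> nat -> R) (a : nat -> R) (Pi : {measure set R -> \bar R}) (b sg2 be Cb : R).
Hypotheses (kp : is_kernel p) (a0 : forall n, 0 < a n) (LP : levy_measure Pi) (HA1 : A1 p a Pi)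
 (HA2 : A2 p a Pi b sg2) (be0 : 0 < be) (Cb0 : 0 <= Cb) (HE : embd p a be Cb).

Definition Cth (th : R) : R := expR th * th ^+ 3 + 1.
Lemma exp_bnds (th : R) : 0 <= th -> [/\ 0 <= Cth th,
 forall u, `|u| <= 1 -> `|expR (th * u) - 1 - th * u - th ^+ 2 / 2 * u ^+ 2| <= Cth th * `|u| ^+ 3 &
 forall u, `|expR (th * u) - 1| <= Cth th * (1 + expR (th * u))].
Proof.
move=> th0; have t3 : 0 <= expR th * th ^+ 3 by pos.
split; first by rewrite /Cth; lra.
- move=> u u1; have := exp_tay3 (th * u); rewrite normrM (ger0_norm th0) exprMn => h.
 rewrite (_ : th ^+ 2 / 2 * u ^+ 2 = (th * u) ^+ 2 / 2); last by ring.
 rewrite exprMn in h; rewrite exprMn; apply: (le_trans h); rewrite /Cth mulrA ler_wpM2r ?exprn_ge0//.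
 apply: (via (expR th * th ^+ 3)); last by lra.
 by rewrite ler_wpM2r ?exprn_ge0// ler_expR ler_piMr.
- move=> u; apply: (le_trans (ler_normB _ _)); rewrite normr1 ger0_norm ?expR_ge0// addrC.
 by rewrite ler_peMl ?addr_ge0 ?expR_ge0// /Cth; lra.
Qed.

Lemma cexp (th : R) : continuous (fun u : R => expR (th * u) - 1).
Proof.
apply: contB; last exact: cont_cst.
by apply: contexp; apply: contM; [exact: cont_cst|exact: cont_id].
Qed.

Lemma gen_exp th : 0 <= th -> th < be -> (fun x => mm p a x (fun u => expR (th * u) - 1)) @ \oo --> Psi Pi b sg2 th.
Proof.
move=> th0 thb; have [C0 h1 h2] := exp_bnds th0.
have := gen_lim kp a0 HA1 LP HA2 be0 Cb0 HE (@cexp th) h1 h2 th0 thb C0.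
rewrite /Psi /psi_integrand; congr (_ --> _); ring.
Qed.

Lemma sm_exp th : 0 <= th -> th < be -> ev (fun x => (0 < x)%N /\ sm p x (fun u => expR (th * u))).
Proof.
move=> th0 thb; apply: ev_imp HE => x [x0 [s _]]; split=> //.
apply: (sm_le kp x0 (g := fun u => expR be + E1 be u)) => //; last first.
 by apply: smD => //; apply: (@sm_bnd _ _ kp x _ (expR be)) => // _; rewrite ger0_norm ?expR_ge0.
move=> u; rewrite ger0_norm ?expR_ge0// /E1; case: ltrP => u1 /=.
 rewrite mul1r; apply: (via (expR (be * u))); last by rewrite lerDr expR_ge0.
 by rewrite ler_expR ler_wpM2r// ?ltW//; lra.
rewrite mul0r addr0 ler_expR; apply: (via (th * 1)); first by rewrite ler_wpM2l.
by rewrite mulr1 ltW.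
Qed.

End GenExp.

Section PsiFacts.
Context {R : realType} (p : nat -> nat -> R) (a : nat -> R) (Pi : {measure set R -> \bar R}) (b sg2 be Cb : R).
Hypotheses (kp : is_kernel p) (a0 : forall n, 0 < a n) (LP : levy_measure Pi) (s20 : 0 <= sg2) (HA1 : A1 p a Pi)
 (HA2 : A2 p a Pi b sg2) (be0 : 0 < be) (Cb0 : 0 <= Cb) (HE : embd p a be Cb).

Lemma int_psi th : 0 <= th -> th < be -> intg Pi (psi_integrand th).
Proof.
move=> th0 thb; have [C0 h1 h2] := exp_bnds th0.
by have := gen_int kp a0 HA1 LP be0 HE (@cexp R th) h1 h2 th0 thb C0.
Qed.

(** Convexity from the tangent at s*y, evaluated at 0 and at y with weights 1 - s and s. *)
Lemma exp_conv (s y : R) : 0 <= s <= 1 -> expR (s * y) - 1 <= s * (expR y - 1).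
Proof.
move=> /andP[s0 s1]; have h1 := expR_ge1Dx (- (s * y)); have h2 := expR_ge1Dx (y - s * y).
have p0 := expR_gt0 (s * y).
have E1 : expR (s * y) * expR (- (s * y)) = 1 by rewrite -expRD subrr expR0.
have E2 : expR (s * y) * expR (y - s * y) = expR y by rewrite -expRD addrC subrK.
have k1 := ler_wpM2l (ltW p0) h1; have k2 := ler_wpM2l (ltW p0) h2; rewrite E1 in k1; rewrite E2 in k2.
have j1 : (1 - s) * (expR (s * y) * (1 + - (s * y))) <= (1 - s) * 1 by apply: ler_wpM2l => //; lra.
have j2 : s * (expR (s * y) * (1 + (y - s * y))) <= s * expR y by apply: ler_wpM2l.
set E := expR (s * y) in j1 j2 *.
have -> : E = (1 - s) * (E * (1 + - (s * y))) + s * (E * (1 + (y - s * y))) by ring.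
lra.
Qed.

Lemma Psi_conv s th : 0 <= s <= 1 -> 0 <= th -> th < be -> Psi Pi b sg2 (s * th) <= s * Psi Pi b sg2 th.
Proof.
move=> s01 th0 thb; have /andP[s0 s1] := s01.
have i1 := int_psi th0 thb.
have i2 : intg Pi (psi_integrand (s * th)).
 by apply: int_psi; [rewrite mulr_ge0|apply: le_lt_trans thb; rewrite ler_piMl].
have h : Int Pi (psi_integrand (s * th)) <= s * Int Pi (psi_integrand th).
 rewrite -RintZ//; apply: Rint_le => //; first exact: intgZ.
 move=> x; rewrite /psi_integrand -mulrA; have := exp_conv (th * x) s01.
 by rewrite !mulrBr mulr1 !mulrA; lra.
rewrite /Psi; have : sg2 * (s * th) ^+ 2 <= s * (sg2 * th ^+ 2).
 rewrite (_ : sg2 * (s * th) ^+ 2 = s * (s * (sg2 * th ^+ 2))); last by ring.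
 by apply: ler_wpM2l => //; rewrite ler_piMl// mulr_ge0// sqr_ge0.
have -> : b * (s * th) = s * (b * th) by ring.
lra.
Qed.

(** The second difference Psi(2 th) - 2 Psi(th): the linear part and the truncation cancel, leaving
    a nonnegative quantity. *)
Definition Vq th := sg2 * th ^+ 2 + Int Pi (fun x => (expR (th * x) - 1) ^+ 2).
Let sqE th x : (expR (th * x) - 1) ^+ 2 = psi_integrand (2 * th) x - 2 * psi_integrand th x :> R.
Proof.
rewrite /psi_integrand (_ : 2 * th * x = th * x + th * x); last by ring.
by rewrite expRD; ring.
Qed.

Let int_sq th : 0 <= th -> 2 * th < be -> intg Pi (fun x => (expR (th * x) - 1) ^+ 2).
Proof.
move=> th0 tb; rewrite (_ : (fun x => _) = fun x => psi_integrand (2 * th) x - 2 * psi_integrand th x).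
 by apply: intgB; [apply: int_psi => //; lra|apply: intgZ; apply: int_psi => //; lra].
by apply/funext => x; exact: sqE.
Qed.

Lemma Psi_double th : 0 <= th -> 2 * th < be -> Psi Pi b sg2 (2 * th) = 2 * Psi Pi b sg2 th + Vq th.
Proof.
move=> th0 tb; have i1 : intg Pi (psi_integrand (2 * th)) by apply: int_psi => //; lra.
have i2 : intg Pi (psi_integrand th) by apply: int_psi => //; lra.
have E : Int Pi (fun x => (expR (th * x) - 1) ^+ 2) =
  Int Pi (psi_integrand (2 * th)) - 2 * Int Pi (psi_integrand th).
 rewrite -RintZ// -RintB//; last exact: intgZ.
 by apply: eq_Rintegral => x _; exact: sqE.
by rewrite /Vq E /Psi; field.
Qed.

(** A bounded function below ((e^(th x) - 1)/th)^2 for all th in (0,1], positive away from 0. *)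
Definition kq (x : R) := (1 - expR (- `|x|)) ^+ 2.
Lemma kq_le th x : 0 <= th <= 1 -> th ^+ 2 * kq x <= (expR (th * x) - 1) ^+ 2.
Proof.
move=> t01; have /andP[t0 t1] := t01; rewrite /kq -exprMn -[leRHS]real_normK ?num_real//.
have h := exp_conv (- `|x|) t01.
have e1 : expR (- `|x|) <= 1 by rewrite -expR0 ler_expR oppr_le0.
apply: lerXn2r; rewrite ?nnegrE//; first by apply: mulr_ge0 => //; lra.
apply: (via (1 - expR (th * - `|x|))); first by rewrite mulrBr mulr1 in h; rewrite mulrBr mulr1; lra.
have [x0|x0] := leP 0 x; last by rewrite (ltr0_norm x0) opprK -normrN opprB ler_norm.
rewrite (ger0_norm x0).
have := expR_ge1Dx (th * x); have tx : 0 <= th * x by pos.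
have p0 := expR_gt0 (- (th * x)).
have E1 : expR (th * x) * expR (- (th * x)) = 1 by rewrite -expRD subrr expR0.
rewrite mulrN => h2; rewrite ger0_norm; last by lra.
by nra.
Qed.

(** V' is sg2 plus the integral of [kq]. If it vanishes, there is no Gaussian part and Pi does not
    charge the complement of 0, so Psi is linear. *)
Lemma Vq_ge : exists2 V', 0 <= V' & (forall th, 0 <= th <= 1 -> 2 * th < be -> th ^+ 2 * V' <= Vq th) /\
 (V' = 0 -> forall th, 0 <= th -> th < be -> Psi Pi b sg2 th = b * th).
Proof.
have ebe : exists2 th, 0 < th <= 1 & 2 * th < be.
 exists (Num.min 1 (be / 4)); first by rewrite lt_min ltr01 ge_min lexx andbT /= divr_gt0.
 have : Num.min 1 (be / 4) <= be / 4 by rewrite ge_min lexx orbT.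
 have := be0; lra.
have [t1 /andP[t10 t11] t1b] := ebe.
have mk : meas (kq : R -> R).
 apply: cmf.
 have c : continuous (fun x : R => 1 - expR (- `|x|)).
  by apply: contB; [exact: cont_cst|apply: contexp; apply: contN; apply: contnorm; exact: cont_id].
 exact: (contM c c).
have ik : intg Pi kq.
 apply: (intg_le (g := fun x => (t1 ^+ 2)^-1 * (expR (t1 * x) - 1) ^+ 2)) => //; last by apply/intgZ/int_sq => //; lra.
 move=> x; rewrite ger0_norm ?sqr_ge0// ler_pdivlMl ?exprn_gt0//.
 by apply: kq_le; rewrite ltW.
have Ik0 : 0 <= Int Pi kq by apply: Rintegral_ge0 => x _; exact: sqr_ge0.
exists (sg2 + Int Pi kq); first by pos.
split=> [th t01 tb|V0 th th0 thb].
 have /andP[t0 _] := t01; rewrite /Vq mulrDr mulrC lerD2l -RintZ//.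
 by apply: Rint_le => [||x]; [exact: intgZ|exact: int_sq|exact: kq_le].
have s0 : sg2 = 0 by apply/eqP; rewrite eq_le s20 andbT; lra.
have I0 : Int Pi kq = 0 by lra.
have K0 : (\int[Pi]_x `|(kq x)%:E| = 0)%E.
 rewrite (eq_integral (fun x => (kq x)%:E)); last by move=> x _; rewrite gee0_abs// lee_fin sqr_ge0.
 by rewrite -Rint_fin// I0.
have mk' : meas (fun x : R => (kq x)%:E) by exact/measurable_EFinP.
have ae0 := (ae_eq_integral_abs Pi measurableT mk').1 K0.
have i1 := int_psi th0 thb.
rewrite /Psi s0 !mul0r add0r; suff -> : Int Pi (psi_integrand th) = 0 by rewrite addr0.
rewrite /Rintegral (ae_eq_integral (fun=> 0%E)) ?integral0//.
- by apply/measurable_EFinP; exact: (intg_mf i1).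
- apply: filterS ae0 => x /= H _; have := H I => -[] /eqP; rewrite /kq sqrf_eq0 subr_eq0 => /eqP h.
 have : expR (- `|x|) = expR 0 by rewrite expR0.
 move=> /expR_inj /eqP; rewrite oppr_eq0 normr_eq0 => /eqP ->.
 by rewrite /psi_integrand !mulr0 expR0 subrr mul0r subrr.
Qed.

End PsiFacts.

(** * Reconstruction from grid increments *)

Section StepF.
Context {R : realType}.
Implicit Types f g : R -> R.

(** Locally constant on each side. This is stable under sums and gives cadlag paths without
    computing limits. *)
Definition stepf f := (forall t, 0 <= t -> exists2 d, 0 < d & forall u, t < u -> u < t + d -> f u = f t) /\
 (forall t, 0 < t -> exists d, 0 < d /\ exists c, forall u, t - d < u -> u < t -> f u = c).

Lemma stepf_cadlag f : stepf f -> cadlag f.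
Proof.
move=> [H1 H2]; split=> t t0.
 have [d d0 Hd] := H1 t t0; apply: cvg_near_cst; rewrite near_withinE.
 exists d => //= u; rewrite /ball /= => h tu; apply: Hd => //.
 by rewrite -ltrBlDl; apply: le_lt_trans h; rewrite distrC; exact: ler_norm.
have [d [d0 [c Hc]]] := H2 t t0; apply/cvg_ex; exists c; apply: cvg_near_cst.
rewrite near_withinE; exists d => //= u; rewrite /ball /= => h ut; apply: Hc => //.
by rewrite ltrBlDr -ltrBlDl; apply: le_lt_trans h; exact: ler_norm.
Qed.

Lemma stepfD f g : stepf f -> stepf g -> stepf (fun t => f t + g t).
Proof.
move=> [f1 f2] [g1 g2]; split=> t t0.
 have [d1 d10 h1] := f1 t t0; have [d2 d20 h2] := g1 t t0.
 exists (Num.min d1 d2) => [|u tu]; first by rewrite lt_min d10.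
 by rewrite -ltrBlDl lt_min !ltrBlDl => /andP[u1 u2]; rewrite h1// h2.
have [d1 [d10 [c1 h1]]] := f2 t t0; have [d2 [d20 [c2 h2]]] := g2 t t0.
exists (Num.min d1 d2); rewrite lt_min d10 d20; split => //; exists (c1 + c2) => u.
by rewrite ltrBlDr -ltrBlDl lt_min !ltrBlDl -!ltrBlDr => /andP[u1 u2] ut; rewrite h1// h2.
Qed.

Lemma stepf_cst (c : R) : stepf (fun=> c).
Proof. by split=> t t0; [exists 1|exists 1; split => //; exists c]. Qed.
Lemma stepf_ind (s s' c : R) : stepf (fun t => ind (s <= t < s') * c).
Proof.
have L (r : R) : (forall t, exists2 d, 0 < d & forall u, t < u -> u < t + d -> (r <= u) = (r <= t)) /\
  (forall t, exists2 d, 0 < d & forall u, t - d < u -> u < t -> (r <= u) = (r < t)).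
 split=> t.
  have [st|ts] := lerP r t; first by exists 1 => // u tu _; rewrite (le_trans st)// ltW.
  exists (r - t) => [|u tu]; first by rewrite subr_gt0.
  by rewrite addrC subrK ltNge => /negbTE.
 have [st|ts] := ltrP r t; last by exists 1 => // u _ ut; rewrite leNgt (lt_le_trans ut ts).
 exists (t - r) => [|u]; first by rewrite subr_gt0.
 by rewrite opprB addrC subrK => su _; rewrite ltW.
have [L1 L2] := L s; have [L1' L2'] := L s'; split=> t _.
 have [d d0 h] := L1 t; have [d' d'0 h'] := L1' t.
 exists (Num.min d d') => [|u tu]; first by rewrite lt_min d0.
 by rewrite -ltrBlDl lt_min !ltrBlDl => /andP[u1 u2]; rewrite h// !ltNge h'.
have [d d0 h] := L2 t; have [d' d'0 h'] := L2' t.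
exists (Num.min d d'); rewrite lt_min d0; split => //; exists (ind ((s < t) && (t <= s')) * c) => u.
rewrite ltrBlDr -ltrBlDl lt_min !ltrBlDl -!ltrBlDr => /andP[u1 u2] ut.
by rewrite h// [u < s']ltNge h'// -leNgt.
Qed.

Lemma stepf_sum n (f : nat -> R -> R) : (forall i, stepf (f i)) -> stepf (fun t => \sum_(0 <= i < n) f i t).
Proof.
move=> H; elim: n => [|n IH].
 by rewrite (_ : (fun t => _) = fun=> 0); [exact: stepf_cst|apply/funext => t; rewrite big_geq].
rewrite (_ : (fun t => _) = fun t => \sum_(0 <= i < n) f i t + f n t); first exact: stepfD.
by apply/funext => t; rewrite big_nat_recr.
Qed.

Lemma stepf_trunc (c : R) (g : nat -> R) : 0 < c -> stepf (fun t => g (trunc (c * t))).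
Proof.
move=> c0; split=> t t0.
 have ct : 0 <= c * t by pos.
 have /andP[h1 h2] := truncn_itv ct; set k := trunc _ in h1 h2 *.
 exists (k.+1%:R / c - t) => [|u tu]; first by rewrite subr_gt0 ltr_pdivlMr// mulrC.
 rewrite addrC subrK ltr_pdivlMr// mulrC => h; congr g; apply: truncn_def.
 by rewrite h andbT (le_trans h1)// ler_pM2l// ltW.
have ct : 0 < c * t by pos.
have [k /andP[k1 k2]] : exists k : nat, k%:R < c * t <= k.+1%:R.
 have /andP[h1 h2] := truncn_itv (ltW ct); move: h1 h2; set j := trunc _.
 rewrite le_eqVlt => /orP[/eqP E|h1] h2; last by exists j; rewrite h1 ltW.
 case: j E h2 => [|j] E _; first by move: ct; rewrite -E ltxx.
 by exists j; rewrite -E lexx ltr_nat leqnn.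
exists (t - k%:R / c); split; first by rewrite subr_gt0 ltr_pdivrMr// mulrC.
exists (g k) => u; rewrite opprB addrC subrK ltr_pdivrMr// mulrC => u1 u2; congr g; apply: truncn_def.
by rewrite ltW//=; apply: lt_le_trans k2; rewrite ltr_pM2l.
Qed.

End StepF.

Section Recon.
Context {R : realType} (ep gm : R).
Hypotheses (ep0 : 0 < ep) (ga0 : 0 < gm).

(** The Riemann sum over clock cells of length ep for the real time, the integral of e^(gm v).
    [recY] then takes the value e^(v j) during the j-th cell and 0 after the last one. *)
Definition recT (v : nat -> R) (j : nat) : R := \sum_(0 <= i < j) ep * expR (gm * v i).
Definition recY (M : nat) (v : nat -> R) (t : R) : R :=
 \sum_(0 <= j < M) ind (recT v j <= t < recT v j.+1) * expR (v j).

Lemma recTS v j : recT v j.+1 = recT v j + ep * expR (gm * v j).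
Proof. by rewrite /recT big_nat_recr. Qed.
Lemma recT0 v : recT v 0 = 0. Proof. by rewrite /recT big_geq. Qed.
Lemma recT_lt v j : recT v j < recT v j.+1.
Proof. by rewrite recTS ltrDl mulr_gt0// expR_gt0. Qed.
Lemma recT_mono v i j : (i <= j)%N -> recT v i <= recT v j.
Proof.
elim: j => [|j IH]; first by rewrite leqn0 => /eqP ->.
rewrite leq_eqVlt => /orP[/eqP -> //|/IH h]; apply: (le_trans h); exact/ltW/recT_lt.
Qed.
Lemma recT_smono v i j : (i < j)%N -> recT v i < recT v j.
Proof. by move=> h; apply: lt_le_trans (recT_lt v i) (recT_mono v h). Qed.
Lemma recT_ge0 v j : 0 <= recT v j.
Proof. by rewrite -(recT0 v); exact: recT_mono. Qed.
Lemma recY_cadlag M v : cadlag (recY M v).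
Proof. by apply: stepf_cadlag; apply: stepf_sum => i; exact: stepf_ind. Qed.
Lemma recY_val M v j t : (j < M)%N -> recT v j <= t < recT v j.+1 -> recY M v t = expR (v j).
Proof.
move=> jM /andP[h1 h2]; rewrite /recY (bigD1_seq j) ?iota_uniq ?mem_index_iota//= h1 h2 mul1r.
rewrite big1 ?addr0// => i; rewrite neq_ltn => /orP[ij|ji].
 by rewrite [t < _]ltNge (le_trans (recT_mono v ij) h1) andbF mul0r.
by rewrite leNgt (lt_le_trans h2 (recT_mono v ji)) mul0r.
Qed.

Lemma recY_end M v t : recT v M <= t -> recY M v t = 0.
Proof.
move=> h; rewrite /recY big_nat big1// => j /= jM.
by rewrite [t < _]ltNge (le_trans (recT_mono v jM) h) andbF mul0r.
Qed.

Lemma recT_locate v (j1 j2 : nat) t : (j1 <= j2)%N -> recT v j1 <= t < recT v j2 ->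
 exists q, (j1 <= q < j2)%N /\ recT v q <= t < recT v q.+1.
Proof.
elim: j2 => [|j2 IH].
 by rewrite leqn0 => /eqP -> /andP[h1 h2]; have := le_lt_trans h1 h2; rewrite ltxx.
rewrite leq_eqVlt => /orP[/eqP ->|j12] /andP[h1 h2].
 by have := le_lt_trans h1 h2; rewrite ltxx.
have [h|h] := ltrP t (recT v j2).
 have [|q [/andP[q1 q2] hq]] := IH j12; first by rewrite h1.
 by exists q; rewrite q1 ltnW.
by exists j2; rewrite -ltnS j12 ltnSn /=; split => //; rewrite h.
Qed.

(** A coarse partition serves both paths: on its i-th piece each is within e/2 of the same value E
    i, and after the last point both are at most e/2. Only the times of the coarse points have to be
    compared. *)
Lemma recon_match M m (v : nat -> R) (x : R -> R) (t E : nat -> R) (j : nat -> nat) e : 0 <= e ->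
 t 0%N = 0 -> j 0%N = 0%N -> (forall i, (i < m)%N -> t i < t i.+1) -> (forall i, (i < m)%N -> (j i < j i.+1)%N) ->
 (j m <= M)%N ->
 (forall i, (i <= m)%N -> `|t i - recT v (j i)| <= e) ->
 (forall i u, (i < m)%N -> t i <= u < t i.+1 -> `|x u - E i| <= e / 2) ->
 (forall i q, (i < m)%N -> (j i <= q < j i.+1)%N -> `|expR (v q) - E i| <= e / 2) ->
 (forall u, t m <= u -> `|x u| <= e / 2) ->
 (forall q, (j m <= q < M)%N -> expR (v q) <= e / 2) ->
 tclose e x (recY M v) /\ tclose e (recY M v) x.
Proof.
move=> e0 t0 j0 tS jS jM H1 H2 H3 H4 H5.
pose s i := recT v (j i).
have s0 : s 0%N = 0 by rewrite /s j0 recT0.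
have sS i : (i < m)%N -> s i < s i.+1 by move=> im; apply: recT_smono; exact: jS.
have jle i : (i <= m)%N -> (j i <= M)%N.
 move=> im; apply: leq_trans jM.
 suff H k : (i <= k)%N -> (k <= m)%N -> (j i <= j k)%N by exact: H.
 elim: k => [|k IH]; first by rewrite leqn0 => /eqP ->.
 rewrite leq_eqVlt => /orP[/eqP -> //|ik km].
 by apply: leq_trans (IH ik (ltnW km)) _; apply: ltnW; exact: jS.
have A i u w : (i < m)%N -> t i <= u < t i.+1 -> s i <= w < s i.+1 -> `|x u - recY M v w| <= e.
 move=> im hu hw; have [q [hq hq']] := recT_locate (ltnW (jS i im)) hw.
 have qM : (q < M)%N by case/andP: hq => _ h; exact: leq_trans h (jle _ im).
 rewrite (recY_val qM hq') (_ : _ - _ = (x u - E i) - (expR (v q) - E i)); last by ring.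
 by apply: (le_trans (ler_normB _ _)); have := H2 i u im hu; have := H3 i q im hq; lra.
have B u w : t m <= u -> s m <= w -> `|x u - recY M v w| <= e.
 move=> hu hw; have h1 := H4 u hu; have [h|h] := lerP (recT v M) w.
  by rewrite recY_end// subr0; lra.
 have [|q [/andP[q1 q2] hq]] := @recT_locate v (j m) M w jM; first by rewrite hw.
 rewrite (recY_val q2 hq); apply: (le_trans (ler_normB _ _)); rewrite [`|expR _|]ger0_norm ?expR_ge0//.
 by have := H5 q; rewrite q1 q2 => /(_ isT); lra.
split; last first.
 apply: (match_tclose t0 tS s0 sS) => //.
 - by move=> i im; rewrite distrC; exact: H1.
 - by move=> i w u im hw hu; rewrite distrC; exact: (A i u w).
 - by move=> w u hw hu; rewrite distrC; exact: (B u w).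
by apply: (match_tclose s0 sS t0 tS).
Qed.

Lemma recT_cst (v : nat -> R) F de j1 j2 : (j1 <= j2)%N ->
 (forall q, (j1 <= q < j2)%N -> `|expR (gm * v q) - F| <= de) ->
 `|recT v j2 - recT v j1 - F * ((j2%:R - j1%:R) * ep)| <= de * ((j2%:R - j1%:R) * ep).
Proof.
elim: j2 => [|j2 IH]; first by rewrite leqn0 => /eqP -> _; rewrite !subrr !mul0r !mulr0 subrr normr0.
rewrite leq_eqVlt => /orP[/eqP -> _|j12 H]; first by rewrite !subrr !mul0r !mulr0 subrr normr0.
have h1 : `|expR (gm * v j2) - F| <= de by apply: H; rewrite -ltnS j12 ltnSn.
have h2 : `|recT v j2 - recT v j1 - F * ((j2%:R - j1%:R) * ep)| <= de * ((j2%:R - j1%:R) * ep).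
 by apply: IH => // q /andP[q1 q2]; apply: H; rewrite q1 ltnW.
rewrite recTS -natr1.
rewrite (_ : _ - _ - _ = recT v j2 - recT v j1 - F * ((j2%:R - j1%:R) * ep) + ep * (expR (gm * v j2) - F)); last by ring.
rewrite (_ : de * _ = de * ((j2%:R - j1%:R) * ep) + ep * de); last by ring.
by apply: (le_trans leND); apply: lerD => //; rewrite normrM gtr0_norm// ler_pM2l.
Qed.

Lemma timecmp (v c t F : nat -> R) (j : nat -> nat) m de d4 Fm : 0 <= de -> 0 <= d4 -> 0 <= Fm ->
 c 0%N = 0 -> t 0%N = 0 -> j 0%N = 0%N ->
 (forall i, (i < m)%N -> [/\ c i <= c i.+1, (j i <= j i.+1)%N, 0 <= F i & F i <= Fm]) ->
 (forall i, (i < m)%N -> `|t i.+1 - t i - F i * (c i.+1 - c i)| <= de * (c i.+1 - c i) + d4) ->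
 (forall i q, (i < m)%N -> (j i <= q < j i.+1)%N -> `|expR (gm * v q) - F i| <= de) ->
 (forall i, (i <= m)%N -> 0 <= (j i)%:R * ep - c i <= ep) ->
 forall i, (i <= m)%N -> `|t i - recT v (j i)| <= de * (c i + (j i)%:R * ep) + i%:R * (Fm * ep + d4).
Proof.
move=> de0 d40 Fm0 c0 t0 j0 H1 H2 H3 H4; elim=> [|i IH] im.
 by rewrite c0 t0 j0 recT0 subrr normr0 !mul0r !addr0 mulr0.
have {}IH := IH (ltnW im); have [ci ji F0 FF] := H1 i im.
have T : `|recT v (j i.+1) - recT v (j i) - F i * (((j i.+1)%:R - (j i)%:R) * ep)| <= de * (((j i.+1)%:R - (j i)%:R) * ep).
 by apply: recT_cst => // q; exact: H3.
have C : `|F i * (c i.+1 - c i - ((j i.+1)%:R - (j i)%:R) * ep)| <= Fm * ep.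
 rewrite normrM ger0_norm//; apply: ler_pM => //.
 by have := H4 i (ltnW im); have := H4 i.+1 im; rewrite ler_norml; lra.
have D := H2 i im.
rewrite (_ : t i.+1 - _ = (t i - recT v (j i)) + (t i.+1 - t i - F i * (c i.+1 - c i))
 - (recT v (j i.+1) - recT v (j i) - F i * (((j i.+1)%:R - (j i)%:R) * ep))
 + F i * (c i.+1 - c i - ((j i.+1)%:R - (j i)%:R) * ep)); last by ring.
rewrite (_ : de * _ + _ = de * (c i + (j i)%:R * ep) + i%:R * (Fm * ep + d4)
 + (de * (c i.+1 - c i) + d4) + de * (((j i.+1)%:R - (j i)%:R) * ep) + Fm * ep); last by rewrite -natr1; ring.
apply: (le_trans leND); apply: lerD => //.
by apply: (le_trans (ler_normB _ _)); apply: lerD => //; apply: (le_trans leND); exact: lerD.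
Qed.

End Recon.

Lemma expR_lip {R : realType} (u v W : R) : u <= W -> v <= W -> `|expR u - expR v| <= expR W * `|u - v|.
Proof.
wlog vu : u v / v <= u.
 move=> H uW vW; have [|/ltW] := leP v u; first by move=> h; exact: H.
 by move=> h; rewrite distrC [`|u - v|]distrC; exact: H.
move=> uW vW; rewrite !ger0_norm ?subr_ge0 ?ler_expR//.
have h := expR_ge1Dx (v - u).
have E : expR v = expR u * expR (v - u) by rewrite -expRD; congr expR; ring.
rewrite E; apply: (via (expR u * (u - v))).
 by have := expR_gt0 u; nra.
by rewrite ler_wpM2r ?subr_ge0// ler_expR.
Qed.

Lemma contract_lip {R : realType} (r s : R) : 0 <= r -> 0 <= s ->
 `|contract r%:E - contract s%:E| <= `|r - s|.
Proof.
move=> r0 s0; rewrite /= (ger0_norm r0) (ger0_norm s0).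
rewrite (_ : _ - _ = (r - s) / ((1 + r) * (1 + s))); last by field; lra.
rewrite normrM ler_piMr// normfV invf_le1; last by rewrite normr_gt0; nra.
by rewrite ger0_norm; nra.
Qed.

Section GRec.
Context {R : realType} (ep gm : R) (F : (R -> R) -> \bar R -> R) (B : R).
Hypotheses (ep0 : 0 < ep) (ga0 : 0 < gm) (FB : forall x r, `|F x r| <= B).

Definition psum (D : nat -> R) (j : nat) : R := \sum_(0 <= i < j) D i.
Definition Grec (k M : nat) (D : nat -> R) : R :=
 Fk F k (recY ep gm M (psum D)) (recT ep gm (psum D) M)%:E.

Lemma rec_adm v M : adm (recY ep gm M v) (recT ep gm v M)%:E.
Proof. by split; [exact: recY_cadlag|rewrite lee_fin; exact: recT_ge0]. Qed.
Lemma Grec_bnd k M D : `|Grec k M D| <= B.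
Proof. by apply: Fk_bnd => //; exact: rec_adm. Qed.
(** On a box, partial sums, times and values are Lipschitz in the increments; [match_tclose] on the
    reconstructed times and the Lipschitz property of [Fk] do the rest. *)
Lemma Grec_blip k M W : blip M W (Grec k M).
Proof.
pose W' := `|W| * M%:R; have W'0 : 0 <= W' by rewrite /W'; pos.
pose L1 := M%:R * (ep * (expR (gm * W') * (gm * M%:R))); have L10 : 0 <= L1 by rewrite /L1; pos.
pose L2 := expR W' * M%:R; have L20 : 0 <= L2 by rewrite /L2; pos.
suff H u v d : 0 <= d -> (forall j, (j < M)%N -> [/\ `|u j| <= W, `|v j| <= W & `|u j - v j| <= d]) ->
  Grec k M u <= Grec k M v + k%:R * ((L1 + L2) * d).
 exists (k%:R * (L1 + L2)) => [|u v d d0 h]; first by pos.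
 rewrite -mulrA ler_distl; have h1 := H u v d d0 h.
 have h2 : Grec k M v <= Grec k M u + k%:R * ((L1 + L2) * d).
  by apply: H => // j /h[h1' h2' h3']; split => //; rewrite distrC.
 by rewrite h1 lerBlDr h2.
move=> d0 h.
have bn w : (forall j, (j < M)%N -> `|w j| <= W) -> forall j, (j <= M)%N -> `|psum w j| <= W'.
 move=> hw j jM; rewrite /psum; apply: (le_trans (ler_norm_sum _ _ _)).
 apply: (via (\sum_(0 <= i < j) `|W|)).
  rewrite big_nat [leRHS]big_nat; apply: ler_sum => i ij.
  by apply: le_trans (ler_norm W); apply: hw; exact: leq_trans jM.
 rewrite big_const_nat iter_addr_0 subn0 -mulr_natr ler_wpM2l// ler_nat//.
have bu := bn u (fun j jM => let: And3 a _ _ := h j jM in a).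
have bv := bn v (fun j jM => let: And3 _ a _ := h j jM in a).
have bd j : (j <= M)%N -> `|psum u j - psum v j| <= M%:R * d.
 move=> jM; rewrite /psum -sumrB; apply: (le_trans (ler_norm_sum _ _ _)).
 apply: (via (\sum_(0 <= i < j) d)).
  rewrite big_nat [leRHS]big_nat; apply: ler_sum => i /andP[_ ij].
  by have [_ _] := h i (leq_trans ij jM).
 by rewrite big_const_nat iter_addr_0 subn0 -[leLHS]mulr_natl ler_wpM2r// ler_nat.
have eT j : (j <= M)%N -> `|recT ep gm (psum v) j - recT ep gm (psum u) j| <= L1 * d.
 move=> jM; rewrite /recT -sumrB; apply: (le_trans (ler_norm_sum _ _ _)).
 apply: (via (\sum_(0 <= i < j) (ep * (expR (gm * W') * (gm * M%:R)) * d))).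
  rewrite big_nat [leRHS]big_nat; apply: ler_sum => i /andP[_ ij].
  have iM := ltnW (leq_trans ij jM).
  rewrite -mulrBr normrM gtr0_norm// -!mulrA ler_wpM2l ?(ltW ep0)//.
  have u2 := le_trans (ler_norm _) (bu i iM); have v2 := le_trans (ler_norm _) (bv i iM).
  apply: (le_trans (expR_lip (W := gm * W') _ _)); rewrite ?ler_pM2l//.
  - by rewrite -mulrBr normrM (gtr0_norm ga0) ler_pM2l// distrC; exact: bd.
  - exact: expR_gt0.
 rewrite big_const_nat iter_addr_0 subn0 -[leLHS]mulr_natl /L1 -!mulrA ler_wpM2r ?ler_nat//; pos.
have Ld0 : 0 <= (L1 + L2) * d by pos.
apply: (@Fk_lip _ F B) => //; first exact: rec_adm.
have T0 w : recT ep gm (psum w) 0 = 0 by exact: recT0.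
have TS w i : (i < M)%N -> recT ep gm (psum w) i < recT ep gm (psum w) i.+1 by move=> _; exact: recT_lt.
have L1d : L1 * d <= (L1 + L2) * d by rewrite ler_wpM2r// lerDl.
split; last first.
 by apply: (le_trans (contract_lip _ _)); rewrite ?recT_ge0//; apply: le_trans L1d; exact: eT.
apply: (match_tclose (T0 u) (TS u) (T0 v) (TS v)) => //.
- by move=> i iM; apply: le_trans L1d; exact: eT.
- move=> i t s iM ht hs; rewrite !(recY_val ep0 iM)//.
 have u2 := le_trans (ler_norm _) (bu i (ltnW iM)); have v2 := le_trans (ler_norm _) (bv i (ltnW iM)).
 apply: (le_trans (expR_lip v2 u2)); apply: (via (L2 * d)); last by rewrite ler_wpM2r// lerDr.
 by rewrite /L2 -mulrA ler_pM2l ?expR_gt0// distrC; exact: bd (ltnW iM).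
- by move=> t s ht hs; rewrite !(recY_end ep0)// subrr normr0.
Qed.

End GRec.

(** * Reconstruction of the chain from its grid increments *)

Section Prefix.
Context {R : realType} (a : nat -> R).
Hypothesis a0 : forall n, 0 < a n.

Lemma head_hist x k : hd0 (hist x k) = x k. Proof. by case: k. Qed.

Lemma hist_cons x k : exists g, hist x k = x k :: g.
Proof. by case: k => [|k]; [exists [::]|exists (hist x k)]. Qed.
Lemma clkS x k : clk a (hist x k.+1) = clk a (hist x k) + (a (x k))^-1.
Proof. by have [g E] := hist_cons x k; rewrite -[hist x k.+1]/(x k.+1 :: hist x k) E clk_cons. Qed.
Lemma clk0 x : clk a (hist x 0) = 0. Proof. by []. Qed.

Lemma clk_mono x i j : (i <= j)%N -> clk a (hist x i) <= clk a (hist x j).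
Proof.
elim: j => [|j IH]; first by rewrite leqn0 => /eqP ->.
by rewrite leq_eqVlt => /orP[/eqP -> //|/IH h]; rewrite clkS (le_trans h)// lerDl invr_ge0 ltW.
Qed.

Lemma sth_pre act x N : exists k, [/\ (k <= N)%N, sth act (hist x N) = hist x k,
 forall i, (i < k)%N -> act (hist x i) & forall i, (i <= k)%N -> sth act (hist x i) = hist x i].
Proof.
elim: N => [|N [k [kN E A B]]]; first by exists 0%N; split => // i; rewrite leqn0 => /eqP ->.
rewrite sthS /=; case: ifPn => ac; last by exists k; rewrite (leqW kN).
have EN : sth act (hist x N) = hist x N by exact: sth_id.
have kN' : k = N.
 by apply: succn_inj; rewrite -(size_hist x k) -(size_hist x N) -E EN.
move: kN' A B => -> A B; exists N.+1; rewrite EN; split => // i.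
 by rewrite ltnS leq_eqVlt => /orP[/eqP ->|]; [rewrite -EN|exact: A].
by rewrite leq_eqVlt => /orP[/eqP ->|]; [rewrite sthS /= EN -EN ac EN|exact: B].
Qed.

Lemma gw_eval ep V j x i k : (i <= k)%N -> j%:R * ep <= clk a (hist x i) ->
 (forall i', (i' < i)%N -> clk a (hist x i') < j%:R * ep) -> gw a ep V j (hist x k) = V (hist x i).
Proof.
move=> ik h1 h2; elim: k ik => [|k IH]; first by rewrite leqn0 => /eqP ->.
have [g E] := hist_cons x k; rewrite -[hist x k.+1]/(x k.+1 :: hist x k) E gw_cons -E.
rewrite leq_eqVlt => /orP[/eqP Ei|ik]; first by rewrite h2 ?Ei.
by rewrite ltNge (le_trans h1 (clk_mono x (ik : (i <= k)%N)))/= IH.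
Qed.

Lemma nat_steps (f : nat -> nat) m : (forall i, (i < m)%N -> (f i < f i.+1)%N) ->
 forall i j, (i <= j)%N -> (j <= m)%N -> (f i <= f j)%N.
Proof.
move=> H i; elim=> [|j IH]; first by rewrite leqn0 => /eqP ->.
rewrite leq_eqVlt => /orP[/eqP -> //|ij jm]; apply: leq_trans (IH ij (ltnW jm)) _; apply: ltnW; exact: H.
Qed.

(** Turns the counters along a history into explicit step indices [kk i] of the exits: between two
    of them the path stays within de of its reference, and when no exit is early they are at least
    2*ep apart on the clock, hence separated by the grid. *)
Lemma skeleton de ep x k : exists kk : nat -> nat, [/\ kk 0%N = 0%N,
 (forall i, (i < eJ de (hist x k))%N -> (kk i < kk i.+1)%N) /\ (kk (eJ de (hist x k)) <= k)%N,
 eref de (hist x k) = x (kk (eJ de (hist x k))) /\ erc a de (hist x k) = clk a (hist x (kk (eJ de (hist x k)))),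
 forall i q, (i <= eJ de (hist x k))%N -> (kk i <= q <= k)%N -> ((i < eJ de (hist x k))%N -> (q < kk i.+1)%N) ->
   0 <= de -> `|ld (x q) (x (kk i))| <= de :> R &
 enb a de ep (hist x k) = 0%N -> forall i, (i < eJ de (hist x k))%N ->
   2 * ep <= clk a (hist x (kk i.+1)) - clk a (hist x (kk i))].
Proof.
elim: k => [|k [kk [k0 [kS kl] [er ec] near gap]]].
 exists (fun=> 0%N); split => //= i q; rewrite leqn0 => /eqP ->; rewrite leqn0 => /eqP -> _ d0.
 by rewrite subrr normr0.
have [g E] := hist_cons x k; rewrite -[hist x k.+1]/(x k.+1 :: hist x k) E eJ_cons eref_cons erc_cons enb_cons -E.
case: ifPn => ex; last first.
 rewrite add0n; exists kk; split => //; first by split => //; exact: leqW.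
 move=> i q im /andP[q1 q2] q3 d0; move: q2; rewrite leq_eqVlt => /orP[/eqP Eq|qk]; last by apply: near => //; rewrite q1.
 have iE : i = eJ de (hist x k).
  apply/eqP; rewrite eqn_leq im leqNgt; apply/negP => im'; have := q3 im'; rewrite Eq ltnNge => /negP; apply.
  by apply: leq_trans (leqW kl); apply: nat_steps kS _ _ _ _.
 by rewrite Eq iE -er leNgt.
rewrite add1n; set m := eJ de (hist x k) in kS kl er ec near gap *.
exists (fun i => if (i <= m)%N then kk i else k.+1); split => //.
- split; last by rewrite ltnn.
 move=> i; rewrite ltnS => im; rewrite im; case: ifPn => [im'|]; first exact: kS.
 by rewrite -ltnNge ltnS => mi; have -> : i = m by [apply/eqP; rewrite eqn_leq im]; rewrite ltnS.
- by rewrite ltnn.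
- move=> i q im /andP[q1 q2] q3 d0; move: im; rewrite leq_eqVlt => /orP[/eqP Ei|].
  by move: q1; rewrite Ei ltnn => q1; have -> : q = k.+1 by [apply/eqP; rewrite eqn_leq q2]; rewrite subrr normr0.
 rewrite ltnS => im; move: q1 q3; rewrite im ltnS im => q1 /(_ isT).
 have kim j : (j <= m)%N -> (kk j <= k)%N by move=> jm; apply: leq_trans kl; exact: (nat_steps kS).
 move: (im); rewrite leq_eqVlt => /orP[/eqP Ei|im'].
  by rewrite Ei ltnn => q3; apply: near => //; rewrite -?Ei ?q1// ltnn.
 rewrite im' => q3; apply: near => //; rewrite q1/=.
 by apply: leq_trans (kim _ im'); exact: ltnW.
- move=> /eqP; rewrite addn_eq0 => /andP[ee /eqP en] i; rewrite ltnS => im; rewrite im; case: ifPn => [im'|].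
  exact: gap.
 rewrite -ltnNge ltnS => mi; have -> : i = m by apply/eqP; rewrite eqn_leq im.
 by move: ee; rewrite -ec leNgt; case: (_ < _).
Qed.

End Prefix.

Lemma hit_stop {R : realType} (K : nat) (x : nat -> nat) A : (0 < A)%N -> (x A <= K)%N ->
 (forall j, (0 < j)%N -> (j < A)%N -> (K < x j)%N) ->
 hit_time K x = (A%:R)%:E :> \bar R /\ forall k, stopped K x k = x (minn k A).
Proof.
move=> A0 xA H; split.
 apply/eqP; rewrite eq_le; apply/andP; split.
  by apply: ereal_inf_lbound; exists A.
 apply: le_ereal_inf_tmp => _ [k [k1 kK] <-]; rewrite lee_fin ler_nat leqNgt; apply/negP => kA.
 by have := H k k1 kA; rewrite ltnNge kK.
have E k : (k < A)%N -> [seq j <- iota 1 k | (x j <= K)%N] = [::].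
 move=> kA; rewrite -(filter_pred0 (iota 1 k)); apply: eq_in_filter => j; rewrite mem_iota => /andP[j1 j2].
 by rewrite leqNgt H//; apply: leq_ltn_trans kA; rewrite -ltnS -add1n.
move=> k; rewrite /stopped; have [kA|Ak] := ltnP k A; first by rewrite E.
have -> : iota 1 k = iota 1 A.-1 ++ iota (1 + A.-1) (k - A).+1 by rewrite -iotaD; congr iota; lia.
by rewrite filter_cat E ?prednK// /= add1n prednK// xA.
Qed.

Section ChainRecon.
Context {R : realType} (a : nat -> R) (gm : R) (n K K1 Rb M' J0 : nat) (ep B de eta e1 d2 : R).
Hypotheses (a0 : forall n, 0 < a n) (ga0 : 0 < gm) (n0 : (0 < n)%N) (K0 : (0 < K)%N) (M0 : (0 < M')%N)
 (ep0 : 0 < ep) (de0 : 0 <= de) (eta0 : 0 <= eta) (e1ep : e1 <= ep) (d20 : 0 <= d2).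
Local Notation act := (act1 a n B (M'.+1%:R * ep)).

Section Path.
Context (x : nat -> nat).
Hypotheses (x0 : x 0%N = n) (xp : forall N, (0 < x N)%N) (rng : forall N, inr n B (hd0 (sth act (hist x N))))
 (HJ : forall N, (eJ de (sth act (hist x N)) <= J0)%N) (HN : forall N, enb a de ep (sth act (hist x N)) = 0%N)
 (HT : forall N, ~~ badT a n K K1 Rb (M'%:R * ep) eta (sth (act2 a n K K1 Rb (M'%:R * ep) eta) (hist x N)))
 (HR : forall y, (0 < y)%N -> inr n B y -> [/\ (a y)^-1 <= e1, `|a y / a n - expR (gm * (ld y n))| <= d2 & (maxn K K1 < y)%N]).

Local Notation C i := (clk a (hist x i)).
Local Notation lx i := (ln (x i)%:R - ln n%:R : R).
Let Fm := expR (gm * B).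
Let D := d2 + Fm * (gm * de).
Let D0 : 0 <= D. Proof. by rewrite /D /Fm; pos. Qed.
Let Fm0 : 0 <= Fm. Proof. exact: expR_ge0. Qed.

Context (k : nat) (kap : nat -> nat).
Hypotheses (sthk : forall i, (i <= k)%N -> sth act (hist x i) = hist x i)
 (actk : forall i, (i < k)%N -> act (hist x i))
 (Hkap : forall j, (j <= M'.+1)%N -> [/\ (kap j <= k)%N, j%:R * ep <= C (kap j) & forall i, (i < kap j)%N -> C i < j%:R * ep]).

Let rk i : (i <= k)%N -> inr n B (x i).
Proof. by move=> ik; rewrite -head_hist -(sthk ik). Qed.
Let lxB i : (i <= k)%N -> lx i <= B.
Proof. by move=> /rk; apply: le_trans; exact: ler_norm. Qed.
Let Cm i j : (i <= j)%N -> C i <= C j. Proof. exact: clk_mono. Qed.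
(** The least grid index q whose passage step [kap q] is at least i, since [kap q] >= i means that
    the clock at step i - 1 is still below q*ep. This is why [cf] uses the clock one step
    earlier. *)
Let jf i := if i is i'.+1 then (trunc (C i' / ep)).+1 else 0%N.
Let cf i := C i.-1.
Let C0 i : 0 <= C i. Proof. by rewrite -(clk0 a x); exact: Cm. Qed.
Let jfP i : (0 < i)%N -> cf i < (jf i)%:R * ep <= cf i + ep.
Proof.
case: i => // i _; rewrite /cf /jf/=.
have /andP[h1 h2] := truncn_itv (divr_ge0 (C0 i) (ltW ep0)).
by rewrite -ltr_pdivrMr// h2/= -natr1 mulrDl mul1r lerD2r -ler_pdivlMr.
Qed.
Let jfP0 i : 0 <= (jf i)%:R * ep - cf i <= ep.
Proof.
case: i => [|i]; first by rewrite /cf /jf/= mul0r subrr lexx ltW.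
by have /andP[h1 h2] := jfP (ltn0Sn i); rewrite subr_ge0 (ltW h1) lerBlDl.
Qed.
Let jf1 i q : (q <= M'.+1)%N -> (q < jf i)%N -> (kap q < i)%N.
Proof.
case: i => // i qM; rewrite /jf !ltnS => q1; have [_ _ h] := Hkap qM.
rewrite leqNgt; apply/negP => /h; rewrite ltNge -ler_pdivlMr// => /negP; apply.
apply: (via (trunc (C i / ep))%:R); first by rewrite ler_nat.
by have /andP[] := truncn_itv (divr_ge0 (C0 i) (ltW ep0)).
Qed.
Let jf2 i q : (q <= M'.+1)%N -> (jf i <= q)%N -> (i <= kap q)%N.
Proof.
case: i => // i qM q1; have [_ h _] := Hkap qM.
rewrite ltnNge; apply/negP => /Cm h2; have /andP[h3 _] := jfP (ltn0Sn i).
have := lt_le_trans h3 (ler_wpM2r (ltW ep0) (_ : (jf i.+1)%:R <= q%:R)).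
by rewrite ler_nat => /(_ q1); rewrite ltNge (le_trans h h2).
Qed.
Let jfm i i' : (i <= i')%N -> (jf i <= jf i')%N.
Proof.
case: i => // i; case: i' => // i' h; rewrite /jf ltnS; apply: le_truncn.
by rewrite ler_pM2r ?invr_gt0//; exact: Cm.
Qed.
Let ks := kap M'.
Let M'le : (M' <= M'.+1)%N. Proof. exact: leqW. Qed.
Let ksk : (ks <= k)%N. Proof. by have [] := Hkap M'le. Qed.
Let ks0 : (0 < ks)%N.
Proof.
have [_ h _] := Hkap M'le; rewrite lt0n; apply/eqP => E; move: h.
by rewrite -/ks E clk0 leNgt mulr_gt0// ltr0n.
Qed.
Let ax i : (i <= k)%N -> (a (x i))^-1 <= e1.
Proof. by move=> ik; have [] := HR (xp i) (rk ik). Qed.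
Let e10 : 0 <= e1.
Proof. by apply: le_trans (ax (leq0n k)); rewrite invr_ge0 ltW. Qed.
Let cfC i : (i <= k)%N -> cf i <= C i <= cf i + e1.
Proof.
case: i => [|i] ik; first by rewrite /cf lexx lerDl.
by rewrite /cf clkS lerDl lerD2l invr_ge0 (ltW (a0 _))/= ax// ltnW.
Qed.
Let jfks : jf ks = M'.
Proof.
apply/eqP; rewrite eqn_leq; apply/andP; split.
 by rewrite leqNgt; apply/negP => /(jf1 M'le); rewrite ltnn.
have [_ h _] := Hkap M'le; have /andP[_ h2] := cfC ksk; have /andP[h3 _] := jfP ks0.
rewrite -ltnS -(ltr_nat R) -natr1 -(ltr_pM2r ep0) mulrDl mul1r.
by move: h h2 h3 e1ep; rewrite -/ks => h h2 h3 h4; lra.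
Qed.

Let v := psum (DV a ep (hist x k)).
Let vE j : (j <= M'.+1)%N -> v j = lx (kap j).
Proof.
move=> jM; rewrite /v /psum /DV /dl telescope_sumr//.
have [k1 k2 k3] := Hkap jM; rewrite (gw_eval a0 (@lnh R) k1 k2 k3) /lnh head_hist; congr (_ - _).
rewrite (gw_eval a0 (@lnh R) (i := 0%N))// ?mul0r//=; by rewrite /lnh/= x0.
Qed.

Let tinc k1 k2 E : (k1 <= k2)%N -> (k2 <= k)%N -> E <= B ->
 (forall q, (k1 <= q < k2)%N -> `|lx q - E| <= de) ->
 `|k2%:R / a n - k1%:R / a n - expR (gm * E) * (C k2 - C k1)| <= D * (C k2 - C k1).
Proof.
move=> k12 k2k EB; elim: k2 k12 k2k => [|k2 IH].
 by rewrite leqn0 => /eqP -> _ _; rewrite !subrr !mulr0 subrr normr0.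
rewrite leq_eqVlt => /orP[/eqP -> _ _|k12 k2k H]; first by rewrite !subrr !mulr0 subrr normr0.
have {}IH : `|k2%:R / a n - k1%:R / a n - expR (gm * E) * (C k2 - C k1)| <= D * (C k2 - C k1).
 by apply: IH => // [|q /andP[q1 q2]]; [exact: ltnW|apply: H; rewrite q1 ltnW].
have Hq : `|lx k2 - E| <= de by apply: H; rewrite -ltnS k12 ltnSn.
rewrite clkS -natr1; set w := (a (x k2))^-1; have w0 : 0 < w by rewrite invr_gt0.
rewrite (_ : _ - _ - _ = k2%:R / a n - k1%:R / a n - expR (gm * E) * (C k2 - C k1) +
 (a (x k2) / a n - expR (gm * E)) * w); last first.
 rewrite /w mulrBl mulrAC mulfV ?gt_eqF//; ring.
rewrite (_ : D * _ = D * (C k2 - C k1) + D * w); last by ring.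
apply: (le_trans leND); apply: lerD => //; rewrite normrM (gtr0_norm w0) ler_pM2r//.
have [_ h _] := HR (xp k2) (rk (ltnW k2k)).
rewrite (_ : _ - _ = a (x k2) / a n - expR (gm * lx k2) + (expR (gm * lx k2) - expR (gm * E))); last by ring.
apply: (le_trans leND); apply: lerD => //.
apply: (le_trans (expR_lip (W := gm * B) _ _)); rewrite ?ler_pM2l ?(lxB (ltnW k2k))// ?expR_gt0//.
by rewrite -mulrBr normrM gtr0_norm// ler_pM2l.
Qed.

Let vB j : (j <= M'.+1)%N -> v j <= B.
Proof. by move=> jM; rewrite vE// lxB//; have [] := Hkap jM. Qed.
(** The bound of [timecmp] for at most J0 + 1 pieces over a clock of length M'*ep. *)
Definition eT := 2 * D * (M'%:R * ep) + J0.+1%:R * ((2 * Fm + D) * ep).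
Lemma chain_rec0 e : expR B * de <= e / 2 -> eta * expR (2 * de) <= e / 2 -> eT + ep * Fm + eta <= e ->
 exists r : R, [/\ (hit_time K x * ((a n)^-1)%:E)%E = r%:E, 0 <= r, `|r - recT ep gm v M'.+1| <= e,
  tclose e (fun t => (stopped K x (trunc (a n * t)))%:R / n%:R) (recY ep gm M'.+1 v) &
  tclose e (recY ep gm M'.+1 v) (fun t => (stopped K x (trunc (a n * t)))%:R / n%:R)].
Proof.
move=> h1 h2 h3.
(* The pieces are taken up to the passage of M'*ep, one cell before the horizon of the grid: from
   there on the trajectory belongs to the tail estimate. *)
have [kk [kk0 [kS kl] _ near gap]] := skeleton a de ep x ks.
have mJ : (eJ de (hist x ks) <= J0)%N by rewrite -(sthk ksk).
have {}gap := gap (ltac:(by rewrite -(sthk ksk))).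
set m := eJ de (hist x ks) in kS kl near gap mJ.
have kkm := nat_steps kS.
have {}kkm i : (i <= m)%N -> (kk i <= ks)%N by move=> im; apply: leq_trans kl; exact: kkm.
have xK i : (i <= k)%N -> (maxn K K1 < x i)%N by move=> ik; have [] := HR (xp i) (rk ik).
(* Up to ks the path is in range, hence above K and K1; the absence of bad tail histories then gives
   the absorption step A, at most eta*a_n later. *)
have [A [kA xA KA etaA Aka]] : exists A, [/\ (ks < A)%N, (x A <= K)%N, (forall j, (ks <= j < A)%N -> (K < x j)%N),
  (forall j, (ks <= j <= A)%N -> (x j)%:R <= eta * n%:R) & (A - ks)%:R <= eta * a n].
 apply: (tail_det a0 K0 _ _ _ HT).
 - move=> j jk; split; last by apply: leq_ltn_trans (leq_maxr K K1) _; apply: xK; apply: leq_trans ksk; exact: ltnW.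
  by have [_ _] := Hkap M'le; apply.
 - by have [] := Hkap M'le.
 - by apply: leq_ltn_trans (leq_maxl K K1) _; exact: xK.
 - by apply: mulr_ge0 => //; exact: ltW.
have [hitE stE] := @hit_stop R K x A (leq_trans ks0 (ltnW kA)) xA (fun j j0 jA =>
 ltac:(have [jk|kj] := ltnP j ks; [apply: leq_ltn_trans (leq_maxl K K1) _; apply: xK; apply: leq_trans ksk; exact: ltnW|by apply: KA; rewrite kj])).
have an0 : 0 < a n by [].
have nR : 0 < n%:R :> R by pos.
have xnE i : (x i)%:R / n%:R = expR (lx i) :> R.
 by rewrite expRB !lnK// posrE ltr0n.
have near' i q : (i < m)%N -> (kk i <= q < kk i.+1)%N -> `|lx q - lx (kk i)| <= de.
 move=> im /andP[q1 q2]; rewrite opprB addrA subrK; apply: near => //; first exact: ltnW.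
 by rewrite q1/=; apply: leq_trans (kkm _ im); exact: ltnW.
have nearm q : (kk m <= q <= ks)%N -> `|lx q - lx (kk m)| <= de.
 by move=> hq; rewrite opprB addrA subrK; apply: near => //; rewrite ltnn.
have kapm i j : (j <= M')%N -> (i <= ks)%N -> (jf i <= j)%N -> (i <= kap j <= ks)%N.
 move=> jM ik ji; rewrite jf2 ?(leq_trans jM)//=; have [_ _ h] := Hkap (leq_trans jM M'le).
 rewrite leqNgt; apply/negP => /h; have [_ h' _] := Hkap M'le; rewrite ltNge => /negP; apply.
 by apply: le_trans h'; rewrite ler_pM2r// ler_nat.
have kapi i j : (i < m)%N -> (jf (kk i) <= j < jf (kk i.+1))%N -> (j <= M'.+1)%N /\ (kk i <= kap j < kk i.+1)%N.
 move=> im /andP[j1 j2]; have jM : (j <= M'.+1)%N.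
  by apply: leq_trans M'le; rewrite -jfks; apply: ltnW; apply: leq_trans j2 _; apply: jfm; exact: kkm.
 by split => //; rewrite jf2//= jf1.
have expB u w : u <= B -> w <= B -> `|u - w| <= de -> `|expR u - expR w| <= e / 2.
 move=> uB wB uw; apply: (le_trans (expR_lip uB wB)); apply: le_trans h1.
 by rewrite ler_pM2l// expR_gt0.
have kk_k i : (i <= m)%N -> (kk i <= k)%N by move=> /kkm h; exact: leq_trans ksk.
have stq i u : (i <= m)%N -> (kk i)%:R / a n <= u -> (kk i <= trunc (a n * u))%N.
 by move=> im; rewrite ler_pdivrMr// mulrC => h; rewrite truncn_ge_nat// (le_trans _ h).
have tlq q : (kk m <= q <= ks)%N -> expR (lx q) <= e / 2.
 move=> hq; apply: le_trans h2; apply: (via (expR (lx ks) * expR (2 * de))).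
  rewrite -expRD ler_expR; have := nearm q hq; have := nearm ks; rewrite leqnn andbT => /(_ (kkm _ (leqnn m))).
  by rewrite !ler_norml => /andP[u1 u2] /andP[u3 u4]; lra.
 by rewrite ler_pM2r ?expR_gt0// -xnE ler_pdivrMr//; apply: etaA; rewrite leqnn ltnW.
have tlx q : (ks <= q <= A)%N -> expR (lx q) <= e / 2.
 move=> hq; rewrite -xnE; apply: le_trans h2; apply: (via eta).
  by rewrite ler_pdivrMr//; exact: etaA.
 by rewrite ler_peMr// -expR0 ler_expR mulr_ge0.
(* The end ks is added as a partition point because the absorption time needs the real time at ks.
   The paths are matched only up to [kk m], after which both are already small. *)
pose kk' i := if (i <= m)%N then kk i else ks.
have kk'S i : (i <= m)%N -> (kk' i <= kk' i.+1)%N.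
 by move=> im; rewrite /kk' im; case: ifPn => [im'|_]; [apply: ltnW; exact: kS|exact: kkm].
have kk'k i : (kk' i <= ks)%N by rewrite /kk'; case: ifPn => // im; exact: kkm.
have nk i q : (i <= m)%N -> (kk' i <= q < kk' i.+1)%N -> `|lx q - lx (kk' i)| <= de.
 move=> im; rewrite /kk' im; case: ifPn => [im'|mi]; first exact: near'.
 have -> : i = m by apply/eqP; rewrite eqn_leq im leqNgt.
 by move=> /andP[q1 q2]; apply: nearm; rewrite q1 ltnW.
pose F i := expR (gm * lx (kk' i)).
have FF i : 0 <= F i <= Fm by rewrite expR_ge0 ler_expR ler_pM2l// lxB// (leq_trans (kk'k i)).
have TC : forall i, (i <= m.+1)%N -> `|(kk' i)%:R / a n - recT ep gm v (jf (kk' i))| <=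
  D * (cf (kk' i) + (jf (kk' i))%:R * ep) + i%:R * (Fm * ep + (D + Fm) * e1).
 apply: (@timecmp _ ep gm ep0 v (fun i => cf (kk' i)) (fun i => (kk' i)%:R / a n) F (fun i => jf (kk' i)) m.+1 D ((D + Fm) * e1) Fm) => //.
 - by apply: mulr_ge0 => //; exact: addr_ge0.
 - by rewrite /kk' leq0n kk0.
 - by rewrite /kk' leq0n kk0 mul0r.
 - by rewrite /kk' leq0n kk0.
 - move=> i; rewrite ltnS => im; have /andP[F1 F2] := FF i; split => //.
   by apply: Cm; have := kk'S i im; case: (kk' i) => //= u; case: (kk' i.+1).
  by apply: jfm; exact: kk'S.
 - move=> i; rewrite ltnS => im; have h := @tinc (kk' i) (kk' i.+1) (lx (kk' i)) (kk'S i im) (leq_trans (kk'k _) ksk) (lxB (leq_trans (kk'k i) ksk)) (fun q => nk i q im).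
  have /andP[f1 f2] := FF i.
  have c1 := cfC (leq_trans (kk'k i) ksk); have c2 := cfC (leq_trans (kk'k i.+1) ksk).
  move: h c1 c2; rewrite -/(F i); set c := cf _; set c' := cf _; set g := clk _ _; set g' := clk _ _ => h /andP[c1 c2] /andP[c3 c4].
  rewrite (_ : _ - _ - _ = (kk' i.+1)%:R / a n - (kk' i)%:R / a n - F i * (g - g') + F i * ((g - g') - (c' - c))); last by ring.
  apply: (le_trans leND); have : `|F i * ((g - g') - (c' - c))| <= Fm * e1.
   by rewrite normrM ger0_norm//; apply: ler_pM => //; rewrite ler_norml; apply/andP; split; lra.
  have : D * (g - g') <= D * (c' - c + e1) by apply: ler_wpM2l => //; lra.
  move=> u1 u2; apply: (le_trans (lerD (le_trans h u1) u2)).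
  by rewrite (mulrDr D) (mulrDl D) addrA.
 - move=> i q; rewrite ltnS => im /andP[q1 q2].
  have qM : (q <= M'.+1)%N by apply: ltnW; apply: (leq_trans q2); apply: leq_trans M'le; rewrite -jfks; exact: jfm.
  have hq : (kk' i <= kap q < kk' i.+1)%N by rewrite jf2// jf1.
  apply: (via (Fm * (gm * de))); last by rewrite /D lerDr.
  rewrite vE//; apply: (le_trans (expR_lip (W := gm * B) _ _)).
  - by rewrite ler_pM2l// lxB//; have [] := Hkap qM.
  - by rewrite ler_pM2l// lxB// (leq_trans (kk'k i)).
  - by rewrite -mulrBr normrM gtr0_norm// ler_pM2l ?expR_gt0// ler_pM2l//; exact: nk.
have TE i : (i <= m.+1)%N -> `|(kk' i)%:R / a n - recT ep gm v (jf (kk' i))| <= eT.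
 move=> im; apply: (le_trans (TC i im)); rewrite /eT; apply: lerD.
  have j1 : (jf (kk' i))%:R * ep <= M'%:R * ep by rewrite ler_pM2r// ler_nat -jfks; exact: jfm.
  have /andP[j2 _] := jfP0 (kk' i).
  by rewrite [2 * D]mulrC -mulrA; apply: ler_wpM2l => //; lra.
 apply: ler_pM => //; first by apply: addr_ge0; apply: mulr_ge0 => //; [exact: ltW|exact: addr_ge0].
  by rewrite ler_nat; apply: leq_trans im _; rewrite ltnS.
 have : (D + Fm) * e1 <= (D + Fm) * ep by apply: ler_wpM2l => //; exact: addr_ge0.
 by move: D Fm => ? ?; lra.
have rj j : (j <= m)%N -> kk' j = kk j by rewrite /kk' => ->.
have Tm i : (i <= m)%N -> `|(kk i)%:R / a n - recT ep gm v (jf (kk i))| <= e.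
 move=> im; rewrite -rj//; apply: (le_trans (TE i (leqW im))); apply: le_trans h3.
 by rewrite -addrA lerDl addr_ge0// mulr_ge0// ltW.
have [R1 R2] : tclose e (fun t => (stopped K x (trunc (a n * t)))%:R / n%:R) (recY ep gm M'.+1 v) /\
  tclose e (recY ep gm M'.+1 v) (fun t => (stopped K x (trunc (a n * t)))%:R / n%:R).
 apply: (@recon_match _ ep gm ep0 M'.+1 m v _ (fun i => (kk i)%:R / a n) (fun i => expR (lx (kk i))) (fun i => jf (kk i)) e) => //.
 - exact: le_trans (Tm 0%N (leq0n _)).
 - by rewrite kk0 mul0r.
 - by rewrite kk0.
 - by move=> i im; rewrite ltr_pM2r ?invr_gt0// ltr_nat; exact: kS.
 - move=> i im; have := gap i im; have c1 := cfC (kk_k _ im); have := Cm (leq0n (kk i)).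
  have /andP[c3 c4] := jfP0 (kk i); have c5 := cfC (kk_k _ (ltnW im)).
  have /andP[c6 _] := jfP (leq_ltn_trans (leq0n _) (kS i im)).
  rewrite -(ltr_nat R) -(ltr_pM2r ep0); move: c1 c5 e1ep c3 c4 c6.
  by move=> /andP[? ?] /andP[? ?]; lra.
 - by apply: leq_trans M'le; rewrite -jfks; apply: jfm; exact: kkm.
 - move=> i u im /andP[u1 u2]; have q1 := stq i u (ltnW im) u1.
  have q2 : (trunc (a n * u) < kk i.+1)%N.
   rewrite truncn_lt_nat; first by move: u2; rewrite ltr_pdivlMr// mulrC.
   by rewrite mulr_ge0 ?(ltW an0)//; apply: le_trans u1; rewrite divr_ge0// ltW.
  set q := trunc _ in q1 q2 *; have qk : (q <= ks)%N by apply: leq_trans (kkm _ im); exact: ltnW.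
  have qA : (q <= A)%N by apply: (leq_trans qk); exact: ltnW.
  rewrite stE (minn_idPl qA) xnE; apply: expB.
  + by rewrite lxB// (leq_trans qk).
  + by rewrite lxB// kk_k// ltnW.
  + by apply: near' => //; rewrite q1.
 - move=> i q im hq; have [qM hq'] := kapi i q im hq; rewrite vE//; apply: expB.
  + by rewrite lxB//; have [] := Hkap qM.
  + by rewrite lxB// kk_k// ltnW.
  + exact: near'.
 - move=> u u1; have q1 := stq m u (leqnn _) u1; set q := trunc _ in q1 *.
  rewrite stE xnE ger0_norm ?expR_ge0//; have [qk|kq] := leqP q ks.
   have qA : (q <= A)%N by apply: (leq_trans qk); exact: ltnW.
   by rewrite (minn_idPl qA); apply: tlq; rewrite q1.
  by apply: tlx; rewrite geq_minr leq_min (ltnW kq) (ltnW kA).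
 - move=> q /andP[q1 q2]; rewrite (vE (ltnW q2)); by apply: tlq; apply: kapm.
exists (A%:R / a n); rewrite hitE; split => //.
- by pos.
- rewrite recTS; have := TE m.+1 (leqnn _); rewrite /kk' ltnn jfks => u1.
 have u2 : `|A%:R / a n - ks%:R / a n| <= eta.
  by rewrite -mulrBl -natrB ?(ltnW kA)// ger0_norm ?ler_pdivrMr// divr_ge0// ltW.
 have u3 : ep * expR (gm * v M') <= ep * Fm by rewrite ler_pM2l// ler_expR ler_pM2l// vB.
 have u4 : 0 <= ep * expR (gm * v M') by pos.
 apply: le_trans h3; move: u1 u2 u3 u4; set z := ep * expR _; set z' := ep * Fm; rewrite !ler_norml => /andP[u1 u2] /andP[u3 u4] u5 u6.
 by apply/andP; split; lra.
Qed.

End Path.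

Definition goodx (x : nat -> nat) := [/\ x 0%N = n, forall N, (0 < x N)%N,
 forall N, inr n B (hd0 (sth act (hist x N))),
 forall N, (eJ de (sth act (hist x N)) <= J0)%N /\ enb a de ep (sth act (hist x N)) = 0%N &
 forall N, ~~ badT a n K K1 Rb (M'%:R * ep) eta (sth (act2 a n K K1 Rb (M'%:R * ep) eta) (hist x N))].

Lemma chain_recon x N e : goodx x -> (forall y, (0 < y)%N -> inr n B y ->
 [/\ (a y)^-1 <= e1, `|a y / a n - expR (gm * (ld y n))| <= d2 & (maxn K K1 < y)%N]) ->
 M'.+1%:R * ep <= clk a (sth act (hist x N)) ->
 expR B * de <= e / 2 -> eta * expR (2 * de) <= e / 2 -> eT + ep * expR (gm * B) + eta <= e ->
 close e (fun t => (stopped K x (trunc (a n * t)))%:R / n%:R) (hit_time K x * ((a n)^-1)%:E)%E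
  (recY ep gm M'.+1 (psum (DV a ep (sth act (hist x N))))) (recT ep gm (psum (DV a ep (sth act (hist x N)))) M'.+1)%:E /\
 close e (recY ep gm M'.+1 (psum (DV a ep (sth act (hist x N))))) (recT ep gm (psum (DV a ep (sth act (hist x N)))) M'.+1)%:E
  (fun t => (stopped K x (trunc (a n * t)))%:R / n%:R) (hit_time K x * ((a n)^-1)%:E)%E.
Proof.
move=> [x0 xp rng HJN HT] HR ck h1 h2 h3.
have [k [kN Ek actk sthk]] := @sth_pre act x N.
rewrite Ek in ck *.
have HK j : exists i, (j <= M'.+1)%N -> [/\ (i <= k)%N, j%:R * ep <= clk a (hist x i) &
 forall i', (i' < i)%N -> clk a (hist x i') < j%:R * ep].
 have [jM|_] := leqP j M'.+1; last by exists 0%N.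
 have jk : j%:R * ep <= clk a (hist x k) by apply: le_trans ck; rewrite ler_pM2r// ler_nat.
 have ex : exists i, j%:R * ep <= clk a (hist x i) by exists k.
 case: (ex_minnP ex) => i ji mi; exists i => _; split => //; first exact: mi.
 by move=> i' ii; rewrite ltNge; apply/negP => /mi; rewrite leqNgt ii.
have [kap Hkap] := choice HK.
have [r [-> r0 rT t1 t2]] := @chain_rec0 x x0 xp rng (fun N => (HJN N).1) (fun N => (HJN N).2) HT HR k kap sthk Hkap e h1 h2 h3.
have cc := contract_lip r0 (recT_ge0 gm ep0 (psum (DV a ep (hist x k))) M'.+1).
split; (split; first by []); first exact: le_trans rT.
by rewrite distrC; apply: le_trans rT.
Qed.

End ChainRecon.

(** * Reconstruction of the time-changed exponential from a cadlag path *)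

Section Path.
Context {R : realType} (gm : R) (x : R -> R).
Hypotheses (ga0 : 0 < gm) (cx : cadlag x).

Local Notation mu := (@lebesgue_measure R).
Local Notation g := (fun s => expR (gm * x s)).
Lemma cadlag_r t e : 0 <= t -> 0 < e -> exists2 d, 0 < d & forall u, t <= u < t + d -> `|x u - x t| <= e.
Proof.
move=> t0 e0; have [+ _] := cx; move=> /(_ t t0) /cvgrPdist_le /(_ e e0).
rewrite near_withinE => -[d /= d0 H]; exists d => // u /andP[]; rewrite le_eqVlt => /orP[/eqP <- _|tu ud].
 by rewrite subrr normr0 ltW.
by rewrite distrC; apply: H => //=; rewrite /ball/= distrC gtr0_norm ?subr_gt0// ltrBlDl.
Qed.

Lemma cadlag_l t e : 0 < t -> 0 < e -> exists2 d, 0 < d & forall u u', t - d < u < t -> t - d < u' < t -> `|x u - x u'| <= e.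
Proof.
move=> t0 e0; have [_ /(_ t t0) /cvg_ex[l /=]] := cx => /cvgrPdist_le /(_ (e / 2)).
rewrite divr_gt0// => /(_ isT); rewrite near_withinE => -[d /= d0 H].
have H' u : t - d < u < t -> `|l - x u| <= e / 2.
 move=> /andP[u1 u2]; apply: H => //=; rewrite /ball/= gtr0_norm ?subr_gt0//.
 by rewrite ltrBlDr -ltrBlDl.
exists d => // u u' hu hu'; rewrite (_ : _ - _ = (l - x u') - (l - x u)); last by ring.
by apply: (le_trans (ler_normB _ _)); have := H' u hu; have := H' u' hu'; lra.
Qed.

Inductive part (e : R) : R -> Prop :=
| part0 : part e 0
| partS s s' : part e s -> s < s' -> (forall u, s <= u < s' -> `|x u - x s| <= e) -> part e s'.

(** Supremum of the attainable end points: the left limit there makes it attainable, and right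
    continuity would push it further. *)
Lemma part_all e S : 0 < e -> 0 <= S -> part e S.
Proof.
move=> e0 S0; pose A := [set s | part e s /\ s <= S].
have A0 : A 0 by split => //; exact: part0.
have hA : has_sup A by split; [exists 0|exists S => s []].
pose t := sup A; have tS : t <= S by apply: ge_sup => //; [exists 0|move=> s []].
have t0 : 0 <= t by apply: ub_le_sup => //; exact: hA.2.
have At : part e t.
 have [tp|] := ltP 0 t; last by move=> h; have -> : t = 0 by [lra]; exact: part0.
 have [d d0 Hd] := cadlag_l tp e0.
 have [s [ps sS] st] := sup_adherent d0 hA.
 have : s <= t by apply: ub_le_sup => //; exact: hA.2.
 rewrite le_eqVlt => /orP[/eqP <- //|s_t]; apply: (partS ps s_t) => u /andP[su ut].
 by apply: Hd; rewrite ?ut ?s_t andbT//; apply: lt_le_trans su.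
have [<-//|tS'] := eqVneq t S; exfalso.
have {tS'} tS' : t < S by rewrite lt_neqAle tS'.
have [d d0 Hd] := cadlag_r t0 e0.
pose s := Num.min S (t + d / 2).
have ts : t < s by rewrite lt_min tS' ltrDl divr_gt0.
have sd : s <= t + d / 2 by rewrite ge_min lexx orbT.
have : A s.
 split; last by rewrite ge_min lexx.
 apply: (partS At ts) => u /andP[tu us]; apply: Hd; rewrite tu/=; lra.
by move=> As; have : s <= t by [apply: ub_le_sup => //; exact: hA.2]; rewrite leNgt ts.
Qed.

Lemma path_bnd S : 0 <= S -> exists2 W, 0 <= W & forall u, 0 <= u <= S -> `|x u| <= W.
Proof.
move=> S0; suff [W W0 H] : exists2 W, 0 <= W & forall u, 0 <= u < S -> `|x u| <= W.
 exists (W + `|x S|) => [|u /andP[u0]]; first by pos.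
 rewrite le_eqVlt => /orP[/eqP ->|uS]; first by rewrite lerDr.
 by apply: (le_trans (H u _)); rewrite ?u0 ?lerDl.
elim: (part_all ltr01 S0) => [|s s' _ [W W0 H] ss h].
 by exists 0 => // u /andP[u0 u1]; have := le_lt_trans u0 u1; rewrite ltxx.
exists (W + (`|x s| + 1)) => [|u /andP[u0 u1]]; first by pos.
have [us|su] := ltP u s; first by apply: (le_trans (H u _)); rewrite ?u0 ?lerDl//; pos.
have := h u; rewrite su u1 => /(_ isT) k; rewrite -(subrK (x s) (x u)).
by apply: (le_trans leND); lra.
Qed.

(** By right continuity, the path is the pointwise limit of its values at grid points strictly to
    the right. *)
Lemma mx_path : measurable_fun (`[0, +oo[%classic : set (measurableTypeR R)) x.
Proof.
apply: (@measurable_fun_cvg _ (measurableTypeR R) R (`[0%R, +oo[%classic : set R) (fun n s => x ((trunc (n.+1%:R * s)).+1%:R / n.+1%:R)) x).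
 move=> n _ Y mY; pose c := n.+1%:R : R; have c0 : 0 < c by [].
 rewrite (_ : _ `&` _ = \bigcup_(k in [set k | Y (x (k.+1%:R / c))]) `[k%:R / c, k.+1%:R / c[%classic).
  by apply: bigcup_measurable => k _; exact: measurable_itv.
 apply/seteqP; split => s /=.
  rewrite in_itv/= andbT => -[s0 Ys]; exists (trunc (c * s)) => //=.
  have /andP[h1 h2] := truncn_itv (mulr_ge0 (ltW c0) s0).
  by rewrite in_itv/= ler_pdivrMr// ltr_pdivlMr// [s * c]mulrC h1 h2.
 move=> [k /= Yk]; rewrite in_itv/= ler_pdivrMr// ltr_pdivlMr// => /andP[h1 h2].
 rewrite in_itv/= andbT; have s0 : 0 <= s by rewrite -(pmulr_lge0 _ c0) (le_trans _ h1).
 by split => //; rewrite (@truncn_def _ _ k)// mulrC h1.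
move=> s /=; rewrite in_itv/= andbT => s0; apply/cvgnE => e e0.
have [d d0 Hd] := cadlag_r s0 e0.
apply: ev_imp (ev_ger d^-1) => n dn; apply: Hd.
have n0 : 0 < n.+1%:R :> R by [].
have /andP[h1 h2] := truncn_itv (mulr_ge0 (ltW n0) s0).
apply/andP; split; first by rewrite ler_pdivlMr// [s * _]mulrC ltW.
have nd : 1 < d * n.+1%:R.
 by rewrite mulrC -ltr_pdivrMr// mul1r; apply: (le_lt_trans dn); rewrite ltr_nat.
by rewrite ltr_pdivrMr// mulrDl -natr1 [s * _]mulrC; lra.
Qed.

Let G s := (expR (gm * x s))%:E.
Lemma mG (A : set R) : A `<=` `[0, +oo[%classic -> measurable_fun A G.
Proof.
move=> h; apply: (measurable_funS _ h) => //.
apply/measurable_EFinP; apply: (@measurableT_comp _ _ _ _ _ _ (@expR R)); first exact: measurable_expR.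
by apply: measurable_funM; [exact: measurable_cst|exact: mx_path].
Qed.

Definition EI u := (\int[mu]_(s in `[0%R, u[%classic) G s)%E.
Lemma EI_add u u' : 0 <= u -> u <= u' -> EI u' = (EI u + \int[mu]_(s in `[u, u'[%classic) G s)%E.
Proof.
move=> u0 uu; rewrite /EI -ge0_integral_setU//.
- by congr (integral _ _ _); rewrite -itv_bndbnd_setU.
- by apply: mG => s /=; rewrite !in_itv/= => -[/andP[h1 _]|/andP[h1 _]]; rewrite andbT// (le_trans u0).
- by move=> s _; rewrite /G lee_fin expR_ge0.
- apply/disj_setPS => s /= []; rewrite !in_itv/= => /andP[_ h1] /andP[h2 _].
 by have := lt_le_trans h1 h2; rewrite ltxx.
Qed.

Lemma int_bnds u u' lo hi : 0 <= u -> u <= u' -> (forall s, u <= s < u' -> lo <= g s <= hi) -> 0 <= lo ->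
 ((lo * (u' - u))%:E <= \int[mu]_(s in `[u, u'[%classic) G s <= (hi * (u' - u))%:E)%E.
Proof.
move=> u0 uu H lo0.
have mA : measurable (`[u, u'[%classic : set R) by exact: measurable_itv.
have L : mu (`[u, u'[%classic : set R) = (u' - u)%:E.
 by rewrite lebesgue_measure_itv/= lte_fin; case: ltP => // h; rewrite (_ : u' = u) ?subrr//; lra.
have mg : measurable_fun (`[u, u'[%classic : set R) G.
 by apply: mG => s /=; rewrite !in_itv/= andbT => /andP[h1 _]; exact: le_trans h1.
have C c : (\int[mu]_(s in `[u, u'[%classic) (cst c%:E s) = (c * (u' - u))%:E)%E.
 by rewrite integral_cst// EFinM -L.
rewrite -!C; apply/andP; split; apply: ge0_le_integral => //.
- by move=> s /=; rewrite in_itv/= lee_fin => /H /andP[].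
- by move=> s _; rewrite lee_fin expR_ge0.
- by move=> s /=; rewrite in_itv/= lee_fin => /H /andP[].
Qed.

Lemma EI_upto u : 0 <= u -> EI u = (I_upto gm x u)%:E.
Proof.
move=> u0; rewrite /I_upto.
have E : EI u = (\int[mu]_(s in `[0%R, u]%classic) G s)%E.
 by apply: integral_itv_bndo_bndc; apply: mG => s /=; rewrite !in_itv/= andbT => /andP[].
have [W W0 HW] := path_bnd u0.
have /andP[_ h] : ((0 * (u - 0))%:E <= EI u <= (expR (gm * W) * (u - 0))%:E)%E.
 apply: int_bnds => // s /andP[s0 su]; rewrite expR_ge0/= ler_expR ler_pM2l//.
 by apply: (le_trans (ler_norm _)); apply: HW; rewrite s0 ltW.
rewrite /= -/G -E fineK// ge0_fin_numE; first by apply: (le_lt_trans h); exact: ltry.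
by apply: integral_ge0 => s _; rewrite lee_fin expR_ge0.
Qed.

Local Notation II := (I_upto gm x).
Lemma I_bnds u u' lo hi : 0 <= u -> u <= u' -> (forall s, u <= s < u' -> lo <= g s <= hi) -> 0 <= lo ->
 lo * (u' - u) <= II u' - II u <= hi * (u' - u).
Proof.
move=> u0 uu H lo0; have := int_bnds u0 uu H lo0; have := EI_add u0 uu.
rewrite !EI_upto//; last exact: le_trans uu.
case: (\int[mu]_(s in _) G s)%E => [r| |]//= [->].
by rewrite !lee_fin addrAC subrr add0r.
Qed.

Lemma I_lt u u' : 0 <= u -> u < u' -> II u < II u'.
Proof.
move=> u0 uu; have u'0 : 0 <= u' by apply: (le_trans u0); exact: ltW.
have [W W0 HW] := path_bnd u'0.
have /andP[h _] : expR (gm * - W) * (u' - u) <= II u' - II u <= expR (gm * W) * (u' - u).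
 apply: I_bnds => // [|s /andP[s0 su]]; first exact: ltW.
 rewrite !ler_expR !ler_pM2l//.
 by rewrite -ler_norml; apply: HW; rewrite (le_trans u0 s0) ltW.
rewrite -subr_gt0; apply: lt_le_trans h; apply: mulr_gt0; first exact: expR_gt0.
by rewrite subr_gt0.
Qed.

Lemma I_lip u : 0 <= u -> exists2 C, 0 < C & forall s, 0 <= s <= u -> II u - II s <= C * (u - s).
Proof.
move=> u0; have [W W0 HW] := path_bnd u0; exists (expR (gm * W)); first exact: expR_gt0.
move=> s /andP[s0 su]; have /andP[_ //] : 0 * (u - s) <= II u - II s <= expR (gm * W) * (u - s).
apply: I_bnds => // z /andP[z0 zu]; rewrite expR_ge0/= ler_expR ler_pM2l//.
by apply: (le_trans (ler_norm _)); apply: HW; rewrite (le_trans s0 z0) ltW.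
Qed.

Lemma I_0 : II 0 = 0.
Proof.
by have := EI_upto (lexx 0); rewrite /EI set_itvco0 integral_set0 => -[].
Qed.

Lemma I_cvg_infty : (fun n => (II n%:R)%:E) @ \oo --> I_infty gm x.
Proof.
rewrite (_ : I_infty gm x = \int[mu]_(s in \bigcup_(n : nat) (`[0%R, n%:R[%classic : set R)) G s)%E; last first.
 congr (integral _ _ _); apply/seteqP; split => s /=; last by move=> [n _ /=]; rewrite !in_itv/= andbT => /andP[].
 rewrite in_itv/= andbT => s0; exists (trunc s).+1 => //=; rewrite in_itv/= s0.
 by have /andP[] := truncn_itv s0.
rewrite (_ : (fun n => _) = fun n => EI n%:R); last by apply/funext => n; rewrite EI_upto.
apply: (@ge0_nondecreasing_set_cvg_integral _ (measurableTypeR R) R (fun n => `[0%R, n%:R[%classic : set R) G mu).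
- apply/nondecreasing_seqP => n; rewrite subsetEset => s /=; rewrite !in_itv/= => /andP[-> h]/=.
 by apply: (lt_trans h); rewrite ltr_nat.
- by move=> i; exact: measurable_itv.
- by move=> i; apply: mG => s /=; rewrite !in_itv/= andbT => /andP[].
- by move=> i s _; rewrite lee_fin expR_ge0.
Qed.

Lemma I_le_infty u : 0 <= u -> ((II u)%:E < I_infty gm x)%E.
Proof.
move=> u0; have u1 : u < u + 1 by rewrite ltrDl.
apply: (@lt_le_trans _ _ (II (u + 1))%:E); first by rewrite lte_fin I_lt.
rewrite -EI_upto; last by pos.
apply: ge0_subset_integral => //.
- exact: mG.
- by move=> s _; rewrite lee_fin expR_ge0.
- by move=> s /=; rewrite !in_itv/= andbT => /andP[].
Qed.

(** Strict monotonicity of the integral makes u a lower bound; its Lipschitz continuity provides an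
    element of the set strictly below u', hence the strict inequality. *)
Lemma tau_in u u' t : 0 <= u -> u < u' -> II u <= t < II u' -> u <= tau gm x t < u'.
Proof.
move=> u0 uu /andP[h1 h2]; set A := [set z | 0 <= z /\ t < II z].
have u'0 : 0 <= u' by apply: (le_trans u0); exact: ltW.
have lb : lbound A u.
 move=> z [z0 tz]; rewrite leNgt; apply/negP => zu.
 by have := I_lt z0 zu; rewrite ltNge (le_trans h1 (ltW tz)).
have [C C0 HC] := I_lip u'0.
pose z := Num.max 0 (u' - (II u' - t) / C / 2).
have tp : 0 < II u' - t by rewrite subr_gt0.
have qp : 0 < (II u' - t) / C / 2 by rewrite !divr_gt0.
have zu : z < u' by rewrite gt_max (le_lt_trans u0 uu) ltrBlDr ltrDl.
have Az : A z.
 split; first by rewrite le_max lexx.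
 have hz := HC z; rewrite le_max lexx/= (ltW zu) in hz; have {}hz := hz isT.
 have : C * (u' - z) <= (II u' - t) / 2.
  apply: (via (C * ((II u' - t) / C / 2))).
   by rewrite ler_pM2l// lerBlDl -lerBlDr le_max lexx orbT.
  by rewrite le_eqVlt; apply/orP; left; apply/eqP; field; rewrite gt_eqF.
 lra.
apply/andP; split; first by apply: lb_le_inf => //; exists z.
by apply: le_lt_trans zu; apply: ge_inf => //; exists u.
Qed.

Lemma Y_in u u' t : 0 <= u -> u < u' -> II u <= t < II u' ->
 exists2 z, u <= z < u' & Yproc gm x t = expR (x z).
Proof.
move=> u0 uu h; exists (tau gm x t); first exact: tau_in.
rewrite /Yproc ifT//; case/andP: h => _ h; apply: (@lt_trans _ _ (II u')%:E); first by rewrite lte_fin.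
by apply: I_le_infty; apply: (le_trans u0); exact: ltW.
Qed.

Lemma Y_tail S t (c : R) : 0 <= S -> (forall u, S <= u -> expR (x u) <= c) -> II S <= t -> `|Yproc gm x t| <= c.
Proof.
move=> S0 H St; have c0 : 0 <= c by apply: (le_trans (expR_ge0 _) (H S (lexx _))).
rewrite /Yproc; case: ifPn => [h|_]; last by rewrite normr0.
rewrite ger0_norm ?expR_ge0//; apply: H.
have [n Hn] : exists n : nat, t < II n%:R.
 apply: contrapT => /forallNP N; move: h; rewrite ltNge => /negP; apply.
 apply: (@cvge_le _ _ _ _ _ _ _ _ I_cvg_infty); apply: nearW => n.
 by rewrite lee_fin leNgt; apply/negP; exact: N.
have Sn : S < n%:R.
 by rewrite ltNge; apply/negP; rewrite le_eqVlt => /orP[/eqP E|nS];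
  [move: Hn; rewrite E ltNge St|have := I_lt (ler0n R n) nS; rewrite ltNge => /negP; apply; exact: ltW (le_lt_trans St Hn)].
by have /andP[] := @tau_in S n%:R t S0 Sn ltac:(by rewrite St).
Qed.

Lemma part_seq e S : part e S -> exists m, exists c : nat -> R, [/\ c 0%N = 0, c m = S &
 forall i, (i < m)%N -> c i < c i.+1 /\ forall u, c i <= u < c i.+1 -> `|x u - x (c i)| <= e].
Proof.
elim=> [|s s' _ [m [c [c0 cm H]]] ss h]; first by exists 0%N, (fun=> 0).
exists m.+1, (fun i => if (i <= m)%N then c i else s'); split => //; first by rewrite ltnn.
move=> i; rewrite ltnS => im; rewrite im; case: ifPn => [im'|]; first exact: H.
by rewrite -ltnNge ltnS => mi; have -> : i = m by [apply/eqP; rewrite eqn_leq im]; rewrite cm.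
Qed.

Lemma contract_I e : 0 < e -> exists2 S0, 0 <= S0 & forall S, S0 <= S -> `|contract (II S)%:E - contract (I_infty gm x)| <= e.
Proof.
move=> e0; have := I_cvg_infty => /cvg_ballP /(_ e e0) [N _ HN].
exists N%:R => // S NS.
have h : `|contract (I_infty gm x) - contract (II N%:R)%:E| <= e by apply: ltW; exact: (HN N (leqnn _)).
have S0 : 0 <= S by exact: le_trans NS.
have h1 : contract (II N%:R)%:E <= contract (II S)%:E.
 rewrite le_contract lee_fin; move: NS; rewrite le_eqVlt => /orP[/eqP -> //|NS]; exact/ltW/I_lt.
have h2 : contract (II S)%:E <= contract (I_infty gm x) by rewrite le_contract ltW// I_le_infty.
move: h h1 h2; set c1 := contract _; set c2 := contract _; set c3 := contract _; rewrite !ler_norml => /andP[? ?] ? ?.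
by apply/andP; split; lra.
Qed.

Hypothesis dx : forall A, exists B, forall t, B <= t -> x t <= A.

(** The analogue for one path of the reconstruction of the chain. The exits are replaced by a
    partition of [0, S] with small oscillation; after S the path is so low that its exponential is
    at most e/2 and the rest of the integral is negligible. *)
Lemma xi_recon e : 0 < e -> exists2 S0, 0 < S0 & forall S, S0 <= S -> exists M0, forall M', (M0 <= M')%N ->
 let ep := S / M'.+1%:R in let v := fun j : nat => x (j%:R * ep) in
 close e (recY ep gm M'.+1 v) (recT ep gm v M'.+1)%:E (Yproc gm x) (I_infty gm x) /\
 close e (Yproc gm x) (I_infty gm x) (recY ep gm M'.+1 v) (recT ep gm v M'.+1)%:E.
Proof.
move=> e0; have e2 : 0 < e / 2 by pos.
have [B HB] := dx (ln (e / 2)).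
have [S1 S10 HS1] := contract_I e2.
exists (`|B| + S1 + 1) => [|S SS]; first by have := normr_ge0 B; lra.
have SB : B <= S by have := ler_norm B; lra.
have S0 : 0 < S by have := normr_ge0 B; lra.
have {}HS1 := HS1 S ltac:(have := normr_ge0 B; lra).
have tl u : S <= u -> expR (x u) <= e / 2.
 by move=> Su; rewrite -[leRHS]lnK ?posrE// ler_expR; apply: HB; exact: le_trans Su.
have [W W0 HW] := path_bnd (ltW S0).
pose Fm := expR (gm * W); have Fm0 : 0 < Fm by exact: expR_gt0.
(* The first bound keeps the exponential within e/2 on a piece; the second keeps the accumulated
   time error at e/4. *)
pose de := Num.min (e / 2 / expR W) (e / (4 * (2 * S)) / (Fm * gm)).
have de0 : 0 < de.
 rewrite lt_min; apply/andP; split; first by pos.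
 by pos.
have deW : expR W * de <= e / 2 by rewrite mulrC -ler_pdivlMr ?expR_gt0// ge_min lexx.
pose D := Fm * (gm * de).
have D0 : 0 <= D by rewrite /D; pos.
have DS : D * (2 * S) <= e / 4.
 rewrite -ler_pdivlMr ?mulr_gt0// -[leRHS]mulrA -invfM /D mulrA mulrC -ler_pdivlMr ?mulr_gt0//.
 by rewrite ge_min lexx orbT.
have [m [c [c0 cm Hc]]] := part_seq (part_all de0 (ltW S0)).
have [gap gap0 Hgap] : exists2 gp, 0 < gp & forall i, (i < m)%N -> gp <= c i.+1 - c i.
 have : forall i, (i < m)%N -> 0 < c i.+1 - c i by move=> i /Hc[h _]; rewrite subr_gt0.
 elim: (m) => [|k IH] H; first by exists 1.
 have [|gp gp0 h] := IH _; first by move=> i ik; apply: H; exact: ltnW.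
 exists (Num.min gp (c k.+1 - c k)) => [|i]; first by rewrite lt_min gp0 H.
 by rewrite ltnS leq_eqVlt => /orP[/eqP ->|/h ih]; rewrite ge_min ?lexx ?orbT// ih.
have cmono i j : (i <= j)%N -> (j <= m)%N -> c i <= c j.
 elim: j => [|j IH]; first by rewrite leqn0 => /eqP ->.
 rewrite leq_eqVlt => /orP[/eqP -> //|ij jm]; apply: (le_trans (IH ij (ltnW jm))).
 by apply: ltW; have [] := Hc j jm.
have cge0 i : (i <= m)%N -> 0 <= c i by move=> im; rewrite -c0 cmono.
have cleS i : (i <= m)%N -> c i <= S by move=> im; rewrite -cm cmono.
have xW u : 0 <= u <= S -> x u <= W by move=> /HW; apply: le_trans; exact: ler_norm.
(* The first bound gives distinct partition points distinct grid indices; the second keeps the m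
   rounding errors below e/4 in total. *)
pose es := Num.min (gap / 2) (e / 4 / (m.+1%:R * Fm)).
have es0 : 0 < es by rewrite lt_min !divr_gt0// mulr_gt0.
have [M0 HM0] := ev_ger (S / es).
exists M0 => M' MM ep v.
have ep0 : 0 < ep by rewrite divr_gt0.
have epe : ep <= es.
 by rewrite /ep ler_pdivrMr// mulrC -ler_pdivrMr//; apply: HM0; exact: leqW.
have MS : M'.+1%:R * ep = S by rewrite /ep mulrC divfK// pnatr_eq0.
have epg : ep < gap.
 have : es <= gap / 2 by rewrite ge_min lexx.
 by have := gap0; have := epe; lra.
have HJ i : exists j : nat, c i <= j%:R * ep /\ forall j' : nat, (j' < j)%N -> j'%:R * ep < c i.
 have ex : exists j : nat, c i <= j%:R * ep.
  by have [N HN] := ev_ger (c i / ep); exists N; rewrite -ler_pdivrMr//; exact: HN.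
 case: (ex_minnP ex) => j cj mj; exists j; split => // j' jj.
 by rewrite ltNge; apply/negP => /mj; rewrite leqNgt jj.
have [j Hj] := choice HJ.
have j0 : j 0%N = 0%N.
 apply/eqP; rewrite -leqn0 leqNgt; apply/negP => /(Hj 0%N).2; by rewrite c0 mul0r ltxx.
have jm : j m = M'.+1.
 apply/eqP; rewrite eqn_leq; apply/andP; split.
  by rewrite leqNgt; apply/negP => /(Hj m).2; rewrite cm MS ltxx.
 by have [+ _] := Hj m; rewrite cm -MS ler_pM2r// ler_nat.
have jP i : (i <= m)%N -> 0 <= (j i)%:R * ep - c i < ep.
 move=> im; have [h1 h2] := Hj i; have := cge0 i im; rewrite subr_ge0 h1/=; case: (j i) h2 h1 => [|k] h2 h1.
  by rewrite mul0r in h1 *; lra.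
 by have := h2 k (leqnn _); rewrite -natr1; lra.
have jS i : (i < m)%N -> (j i < j i.+1)%N.
 move=> im; rewrite -(ltr_nat R) -(ltr_pM2r ep0).
 have /andP[_ h1] := jP i (ltnW im); have /andP[h2 _] := jP i.+1 im; have := Hgap i im; have := epg; lra.
have jin i q : (j i <= q < j i.+1)%N -> c i <= q%:R * ep < c i.+1.
 move=> /andP[q1 /(Hj i.+1).2 ->]; rewrite andbT; have [h _] := Hj i; apply: (le_trans h).
 by rewrite ler_pM2r// ler_nat.
have gD i u : (i < m)%N -> c i <= u < c i.+1 -> `|g u - g (c i)| <= D /\ `|expR (x u) - expR (x (c i))| <= e / 2.
 move=> im hu; have [_ /(_ u hu) h] := Hc i im; case/andP: hu => u1 u2.
 have uW : x u <= W by apply: xW; rewrite (le_trans (cge0 i (ltnW im)) u1) (le_trans (ltW u2))// cleS.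
 have cW : x (c i) <= W by apply: xW; rewrite cge0 ?cleS// ltnW.
 split; last by apply: (le_trans (expR_lip uW cW)); apply: le_trans deW; rewrite ler_pM2l// expR_gt0.
 apply: (le_trans (expR_lip (W := gm * W) _ _)); rewrite ?ler_pM2l//.
 by rewrite -mulrBr normrM gtr0_norm// ler_pM2l.
have TC : forall i, (i <= m)%N -> `|II (c i) - recT ep gm v (j i)| <= D * (c i + (j i)%:R * ep) + i%:R * (Fm * ep + 0).
 apply: (@timecmp _ ep gm ep0 v c (fun i => II (c i)) (fun i => g (c i)) j m D 0 Fm) => //.
 - exact: ltW.
 - by rewrite c0 I_0.
 - move=> i im; have [h _] := Hc i im; split; [exact: ltW|by apply: ltnW; exact: jS|exact: expR_ge0|].
  by rewrite ler_expR ler_pM2l// xW// cge0 ?cleS// ltnW.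
 - move=> i im; rewrite addr0; have [h _] := Hc i im.
  have /andP[h1 h2] : Num.max 0 (g (c i) - D) * (c i.+1 - c i) <= II (c i.+1) - II (c i) <= (g (c i) + D) * (c i.+1 - c i).
   apply: I_bnds => //; [by rewrite cge0// ltnW|exact: ltW| |by rewrite le_max lexx].
   move=> u hu; have [+ _] := gD i u im hu; rewrite ler_norml ge_max expR_ge0/= => /andP[? ?].
   by apply/andP; split; lra.
  have h3 : (g (c i) - D) * (c i.+1 - c i) <= Num.max 0 (g (c i) - D) * (c i.+1 - c i).
   by apply: ler_wpM2r; rewrite ?subr_ge0 ?(ltW h)// le_max lexx orbT.
  move: h1 h2 h3; rewrite ler_norml mulrDl mulrBl; set z := Num.max _ _ * _; set z1 := D * _; set z2 := g _ * _.
  by move=> h1 h2 h3; apply/andP; split; lra.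
 - by move=> i q im hq; have [] := gD i (q%:R * ep) im (jin i q hq).
 - by move=> i im; have /andP[-> /ltW ->] := jP i im.
have TE i : (i <= m)%N -> `|II (c i) - recT ep gm v (j i)| <= e / 2.
 move=> im; apply: (le_trans (TC i im)); rewrite addr0.
 have h1 : D * (c i + (j i)%:R * ep) <= D * (2 * S).
  have h3 : (j i <= j m)%N.
   have : forall k, (i + k <= m)%N -> (j i <= j (i + k))%N.
    elim=> [|k IH]; first by rewrite addn0.
    by rewrite addnS => ik; apply: leq_trans (IH (ltnW ik)) _; apply: ltnW; exact: jS.
   by move=> /(_ (m - i)%N); rewrite subnKC// => /(_ (leqnn _)).
  have h4 : (j i)%:R * ep <= S by rewrite -MS -jm ler_pM2r// ler_nat.
  by apply: ler_wpM2l => //; have := cleS i im; lra.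
 have h2 : i%:R * (Fm * ep) <= e / 4.
  have h5 : ep <= e / 4 / (m.+1%:R * Fm) by apply: (le_trans epe); rewrite ge_min lexx orbT.
  apply: (via (m.+1%:R * Fm * ep)).
   by rewrite -mulrA ler_pM2r ?mulr_gt0// ler_nat leqW.
  by rewrite mulrC -ler_pdivlMr// mulr_gt0.
 lra.
have [R1 R2] : tclose e (Yproc gm x) (recY ep gm M'.+1 v) /\ tclose e (recY ep gm M'.+1 v) (Yproc gm x).
 apply: (@recon_match _ ep gm ep0 M'.+1 m v _ (fun i => II (c i)) (fun i => expR (x (c i))) j e) => //.
 - exact: ltW.
 - by rewrite c0 I_0.
 - by move=> i im; have [h _] := Hc i im; apply: I_lt => //; rewrite cge0// ltnW.
 - by rewrite jm.
 - by move=> i im; apply: (le_trans (TE i im)); lra.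
 - move=> i u im hu; have [h _] := Hc i im.
  have [z hz ->] := Y_in (cge0 i (ltnW im)) h hu.
  by have [] := gD i z im hz.
 - by move=> i q im hq; have [] := gD i (q%:R * ep) im (jin i q hq).
 - move=> u; rewrite cm => hu; exact: (Y_tail (ltW S0) tl).
 - by move=> q; rewrite jm => /andP[q1 q2]; have := leq_ltn_trans q1 q2; rewrite ltnn.
have CC : `|contract (recT ep gm v M'.+1)%:E - contract (I_infty gm x)| <= e.
 rewrite -[X in X - _](subrK (contract (II S)%:E)) -addrA.
 apply: (le_trans leND); rewrite [leRHS](_ : e = e / 2 + e / 2); last by lra.
 apply: lerD => //; apply: (le_trans (contract_lip _ _)).
 - exact: recT_ge0.
 - by rewrite -I_0 ltW// I_lt.
 - by rewrite distrC -{1}cm -jm; exact: TE.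
by split; split => //; rewrite distrC.
Qed.

End Path.

(** * Regularity of the limits: cadlag paths, null sets, measurability *)

Section Cad.
Context {R : realType}.

Lemma tc_cont (l : R -> R) t d : time_change l -> 0 <= t -> 0 < d ->
 exists2 d', 0 < d' & forall u, 0 <= u -> `|u - t| < d' -> `|l u - l t| < d.
Proof.
move=> [_ [cl _]] t0 d0; move/subspace_continuousP : cl => /(_ t t0) /cvgrPdist_lt /(_ d d0).
rewrite near_withinE => -[d' /= d'0 H]; exists d' => // u u0 ut; rewrite distrC.
by apply: H => //; rewrite /ball/= distrC.
Qed.

(** Used to see that [Yproc] is cadlag, as a limit of reconstructed step paths, without examining
    its definition. Existence of left limits is obtained by the Cauchy criterion. *)
Lemma tclose_cadlag (y : R -> R) : (forall e, 0 < e -> exists2 z, cadlag z & tclose e z y) -> cadlag y.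
Proof.
move=> H; split=> t t0.
 apply/cvgrPdist_le => e e0; have e3 : 0 < e / 3 by pos.
 have [z [cz _] [l [T [_ hy]]]] := H _ e3.
 have lt0 := tc_ge0 T t0.
 have := cz (l t) lt0 => /cvgrPdist_le /(_ _ e3); rewrite near_withinE => -[d /= d0 Hd].
 have [d' d'0 Hd'] := tc_cont T t0 d0.
 rewrite near_withinE; exists d' => //= u; rewrite /ball/= distrC => ut tu.
 have u0 : 0 <= u by apply: (le_trans t0); exact: ltW.
 have [_ [_ [lS _]]] := T.
 have h1 : `|z (l t) - z (l u)| <= e / 3 by apply: Hd; [rewrite /= distrC; exact: Hd'|exact: lS].
 rewrite (_ : y t - y u = (z (l t) - z (l u)) - (z (l t) - y t) + (z (l u) - y u)); last by ring.
 apply: (le_trans leND); have := hy u u0; have := hy t t0.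
 by have := ler_normB (z (l t) - z (l u)) (z (l t) - y t); lra.
apply/cauchy_cvgP; apply: cauchy_exP => e e0; have e4 : 0 < e / 8 by pos.
have [z [_ cz] [l [T [_ hy]]]] := H _ e4.
have [l0 [_ [lS _]]] := T.
have lt0 : 0 < l t by rewrite -l0; exact: lS.
have := cz (l t) lt0 => /cvg_ex[a /=] /cvgrPdist_le /(_ _ e4); rewrite near_withinE => -[d /= d0 Hd].
have [d' d'0 Hd'] := tc_cont T (ltW t0) d0.
exists a; suff: \forall u \near at_left t, ball a e (y u) by [].
rewrite near_withinE.
exists (Num.min d' t) => /=; first by rewrite lt_min d'0.
move=> u; rewrite /ball/= lt_min => /andP[ut u_t] tu.
have u0 : 0 <= u by move: u_t; rewrite gtr0_norm ?subr_gt0//; lra.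
have h1 : `|a - z (l u)| <= e / 8 by apply: Hd; [rewrite /= distrC; apply: Hd'; rewrite // distrC|exact: lS].
rewrite (_ : a - y u = (a - z (l u)) + (z (l u) - y u)); last by ring.
by apply: (le_lt_trans leND); have := hy u u0; lra.
Qed.

End Cad.

Section Null.
Import HBNNSimple.
Context {R : realType} {d} {T : measurableType d} (mu : {measure set T -> \bar R}) (N : set T).
Hypotheses (mN : measurable N) (N0 : mu N = 0%E).

(** No measurability of f or f' is asked: the integral is a supremum over simple functions below,
    and a simple function may be cut off on the null set N at no cost. *)
Lemma int_null_le (f f' : T -> \bar R) : (forall x, 0 <= f x)%E -> (forall x, 0 <= f' x)%E ->
 (forall x, ~ N x -> f x = f' x) -> (\int[mu]_x f x <= \int[mu]_x f' x)%E.
Proof.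
move=> f0 f'0 E; rewrite ge0_integralTE// ge0_integralTE//; apply: ge_ereal_sup => _ [h hf <-].
have mC := measurableC mN.
pose h' := mul_nnsfun h (indic_nnsfun R mC).
apply: ereal_sup_ubound; exists h' => [x|].
 have -> : h' x = h x * \1_(~` N) x by [].
 rewrite indicE; case: (pselect (N x)) => Nx.
  by rewrite memNset ?mulr0//= => nx; exact: nx.
 by rewrite mem_set//= mulr1 -E.
rewrite -!integralT_nnsfun; apply: ae_eq_integral => //.
- by apply/measurable_EFinP.
- by apply/measurable_EFinP.
exists N; split => // x /= H; apply: contrapT => Nx; apply: H => _.
rewrite /= -[mindic R mC x]/(\1_(~` N) x) indicE mem_set//.
by rewrite mulr1.
Qed.

Lemma Rint_null (f f' : T -> R) : (forall x, ~ N x -> f x = f' x) -> Int mu f = Int mu f'.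
Proof.
move=> E; rewrite /Rintegral; congr fine; rewrite integralE [in RHS]integralE; congr (_ - _)%E.
 by apply/eqP; rewrite eq_le; apply/andP; split; apply: int_null_le => // x Nx; rewrite !funeposE E.
by apply/eqP; rewrite eq_le; apply/andP; split; apply: int_null_le => // x Nx; rewrite !funenegE E.
Qed.

End Null.

Section Freeze.
Context {R : realType} (F : (R -> R) -> \bar R -> R) (K n : nat) (c : R).
Hypotheses (FC : seqcont F) (c0 : 0 < c).

Definition froz (h : seq nat) (j : nat) : nat := nth 0%N h ((size h).-1 - minn j (size h).-1).
Lemma frozE x N j : froz (hist x N) j = x (minn j N).
Proof. by rewrite /froz size_hist/=; have /(_ _ (geq_minr j N)) -> := (hist_eq x (size_hist x N)).1 erefl. Qed.
Definition Fx (x : nat -> nat) : R :=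
 F (fun t => (stopped K x (trunc (c * t)))%:R / n%:R) (hit_time K x * (c^-1)%:E)%E.

Lemma xpath_cadlag x : cadlag (fun t => (stopped K x (trunc (c * t)))%:R / n%:R : R).
Proof. by apply: stepf_cadlag; exact: (stepf_trunc (fun k => (stopped K x k)%:R / n%:R)). Qed.
Lemma hit_ge0 x : (0 <= hit_time K x * (c^-1)%:E :> \bar R)%E.
Proof.
apply: mule_ge0; last by rewrite lee_fin invr_ge0 ltW.
by apply: le_ereal_inf_tmp => _ [k _ <-]; rewrite lee_fin.
Qed.

Lemma hit_cases x : (exists A, [/\ (0 < A)%N, (x A <= K)%N & forall j, (0 < j)%N -> (j < A)%N -> (K < x j)%N]) \/
 (forall j, (0 < j)%N -> (K < x j)%N).
Proof.
have [ex|nex] := pselect (exists j, (0 < j)%N && (x j <= K)%N).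
 left; case: (ex_minnP ex) => A /andP[A0 xA] mA; exists A; split => // j j0 jA.
 by rewrite ltnNge; apply/negP => xj; have := mA j; rewrite j0 xj => /(_ isT); rewrite leqNgt jA.
by right => j j0; rewrite ltnNge; apply/negP => xj; apply: nex; exists j; rewrite j0.
Qed.

Lemma stop_inf x : (forall j, (0 < j)%N -> (K < x j)%N) -> hit_time K x = +oo%E :> \bar R /\ forall k, stopped K x k = x k.
Proof.
move=> H; split.
 rewrite /hit_time (_ : [set _ | _ in _] = set0) ?ereal_inf0//.
 by apply/seteqP; split => // r [k [/H + kK] _]; rewrite ltnNge kK.
move=> k; rewrite /stopped (_ : [seq j <- iota 1 k | _] = [::])//.
rewrite -(filter_pred0 (iota 1 k)); apply: eq_in_filter => j; rewrite mem_iota => /andP[j1 _].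
by rewrite leqNgt H.
Qed.

(** Freezing the path after step N changes it only late, so sequential continuity gives the limit,
    even when absorption never occurs. Frozen values depend on a finite history, whence the
    functional of the chain is measurable. *)
Lemma Fx_cvg x : (fun N => Fx (froz (hist x N))) @ \oo --> Fx x.
Proof.
have st N k : (k <= N)%N -> stopped K (froz (hist x N)) k = stopped K x k.
 move=> kN; rewrite /stopped.
 have -> : [seq j <- iota 1 k | (froz (hist x N) j <= K)%N] = [seq j <- iota 1 k | (x j <= K)%N].
  apply: eq_in_filter => j; rewrite mem_iota add1n ltnS => /andP[_ jk].
  by rewrite frozE (minn_idPl _)// (leq_trans jk).
 rewrite frozE (minn_idPl _)//; case E: [seq j <- iota 1 k | _] => [|j s] //=.
 have : j \in [seq j <- iota 1 k | (x j <= K)%N] by rewrite E mem_head.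
 by rewrite mem_filter mem_iota add1n ltnS => /and3P[_ _ jk]; exact: leq_trans kN.
apply: FC.
- by move=> N; exact: xpath_cadlag.
- exact: xpath_cadlag.
- by move=> N; exact: hit_ge0.
- exact: hit_ge0.
- exists (fun _ => id); split; [by move=> _; exact: tc_id|split].
  by move=> e e0; near=> N => t t0; rewrite subrr normr0 ltW.
 move=> S S0 e e0; exists (trunc (c * S)) => // N /= NS t /andP[t0 tS].
 rewrite st ?subrr ?normr0 ?ltW//; apply: leq_trans NS.
 by apply: le_truncn; rewrite ler_pM2l.
- have [[A [A0 xA HA]]|H] := hit_cases x.
  apply: cvg_near_cst; exists A => // N /= AN.
  have [-> _] := @hit_stop R K x A A0 xA HA.
  have [|j j0 jA|-> _//] := @hit_stop R K (froz (hist x N)) A A0; rewrite frozE (minn_idPl _)//.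
  + exact: HA.
  + by apply: leq_trans AN; exact: ltnW.
 apply: cvg_near_cst; exists 1%N => // N /= N1.
 have [-> _] := stop_inf H; have [|-> _//] := @stop_inf (froz (hist x N)).
 by move=> j j0; rewrite frozE; apply: H; rewrite leq_min j0.
Unshelve. all: by end_near. Qed.

End Freeze.

(** * Occupation sums and the mean absorption time *)

Section Occ.
Context {R : realType} (p : nat -> nat -> R) (n K : nat).
Context {d} {T : measurableType d} (P : probability T R) (X : nat -> T -> nat).
Hypotheses (kp : is_kernel p) (n0 : (0 < n)%N) (Kn : (K < n)%N) (mc : markov_chain P p n X).

Definition actK (h : seq nat) := (K < hd0 h)%N.
Definition hK N w := sth actK (Hk X N w).
Definition wsum (w : nat -> R) (h : seq nat) : R := \sum_(x <- behead h) w x.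
Lemma intg_bounded (f : seq nat -> R) N C : (forall h, 0 <= f h) -> (\int[P]_w (f (hK N w))%:E <= C%:E)%E ->
 intg P (fun w => f (hK N w)) /\ Int P (fun w => f (hK N w)) <= C.
Proof.
move=> f0 h; have mf : meas (fun w => f (hK N w)) by exact: (mfHk mc N (fun h => f (sth actK h))).
have i : intg P (fun w => f (hK N w)).
 apply/integrableP; split; first exact/measurable_EFinP.
 under eq_integral do rewrite /= ger0_norm//; exact: le_lt_trans h (ltry _).
by split => //; rewrite -lee_fin Rint_fin.
Qed.

Lemma wsum_ge0 w h : (forall x, 0 <= w x) -> 0 <= wsum w h.
Proof. by move=> w0; apply: sumr_ge0. Qed.
(** Foster's inequality: g at the newest state plus the sum of w over the states already left has
    nonpositive drift. *)
Lemma occ_up (g w : nat -> R) : (forall x, 0 <= g x) -> (forall x, 0 <= w x) ->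
 (forall x, (K < x)%N -> summ (p x) g /\ Esum (p x) g + w x <= g x) ->
 forall N, intg P (fun w' => g (hd0 (hK N w')) + wsum w (hK N w')) /\
  Int P (fun w' => g (hd0 (hK N w')) + wsum w (hK N w')) <= g n.
Proof.
move=> g0 w0 H N; pose V h := g (hd0 h) + wsum w h.
have V0 h : 0 <= V h by apply: addr_ge0 => //; exact: wsum_ge0.
apply: (@intg_bounded V) => //; rewrite (_ : g n = V [:: n]); last by rewrite /V /wsum/= big_nil addr0.
apply: (supermart kp n0 mc V0) => -[//|x h] ac x0; have [sg E] := H x ac.
have Q := kern kp x0; have [Q0 [Q1 _]] := Q.
have sc : summ (p x) (fun=> w x + wsum w (x :: h)) by exact: summ_cst.
apply: (@Qe_le _ p kp V (fun y => g y + (w x + wsum w (x :: h)))) => //.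
- by move=> y _; rewrite /V /wsum/= big_cons.
- exact: summD.
- by rewrite EsumD// Esum_cst// /V/= addrA lerD2r.
Qed.

Lemma occ_lo (g w : nat -> R) : (forall x, 0 <= g x) -> (forall x, 0 <= w x) ->
 (forall x, (K < x)%N -> summ (p x) g /\ g x <= Esum (p x) g + w x) ->
 forall N, intg P (fun w' => g (hd0 (hK N w'))) -> intg P (fun w' => wsum w (hK N w')) ->
  g n <= Int P (fun w' => g (hd0 (hK N w'))) + Int P (fun w' => wsum w (hK N w')).
Proof.
move=> g0 w0 H N i1 i2; pose V h := g (hd0 h) + wsum w h.
have V0 h : 0 <= V h by apply: addr_ge0 => //; exact: wsum_ge0.
rewrite -RintD// -lee_fin Rint_fin; last exact: intgD.
rewrite (_ : g n = V [:: n]); last by rewrite /V /wsum/= big_nil addr0.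
apply: (submart kp n0 mc V0) => -[//|x h] ac x0; have [sg E] := H x ac.
have Q := kern kp x0; have [Q0 [Q1 _]] := Q.
have sc : summ (p x) (fun=> w x + wsum w (x :: h)) by exact: summ_cst.
have sV : summ (p x) (fun y => V (y :: x :: h)).
 by rewrite (_ : (fun y => _) = fun y => g y + (w x + wsum w (x :: h))); [exact: summD|apply/funext => y; rewrite /V /wsum/= big_cons].
rewrite /Qe/=; under eq_eseriesr do rewrite -EFinM.
rewrite (eEsum Q1 sV)// lee_fin.
rewrite (_ : (fun y => _) = fun y => g y + (w x + wsum w (x :: h))); last by apply/funext => y; rewrite /V /wsum/= big_cons.
by rewrite EsumD// Esum_cst// /V/= addrA lerD2r.
Qed.

Lemma wsumS w N w' : wsum w (hK N.+1 w') = wsum w (hK N w') + ind (actK (hK N w')) * w (hd0 (hK N w')).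
Proof.
rewrite /hK /Hk sthS /=; case: ifPn => ac; last by rewrite mul0r addr0.
by rewrite /wsum/= mul1r; case: (sth _ _) ac => //= x s _; rewrite big_cons addrC.
Qed.

Lemma wsum1 h : wsum (fun=> 1) h = (size h).-1%:R.
Proof. by rewrite /wsum big_const_seq iter_addr_0 count_predT size_behead. Qed.
Lemma size_hit w : X 0%N w = n -> (fun N => ((size (hK N w)).-1%:R : R)%:E) @ \oo --> (hit_time K (X ^~ w) : \bar R).
Proof.
move=> X0; set x := X ^~ w.
have sz N : (forall j, (j < N)%N -> (K < x j)%N) -> hK N w = hist x N.
 elim: N => [//|N IH] H; rewrite /hK /Hk sthS /=.
 have E : sth actK (hist x N) = hist x N by apply: IH => j jN; apply: H; exact: ltnW.
 by rewrite -/x E /actK head_hist H.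
have [[A [A0 xA HA]]|H] := hit_cases K x.
 have xK j : (j < A)%N -> (K < x j)%N by case: j => [_|j]; [rewrite /x X0|exact: HA].
 have [-> _] := @hit_stop R K x A A0 xA HA.
 apply: cvg_near_cst; exists A => // N /= AN; suff -> : hK N w = hist x A by rewrite size_hist.
 rewrite -(subnK AN); elim: (N - A)%N => [|m IH]; first by rewrite add0n sz.
 by rewrite addSn /hK /Hk sthS/= -/x -[sth _ _]/(hK (m + A) w) IH /actK head_hist ltnNge xA.
have [-> _] := @stop_inf R K x H.
rewrite (_ : (fun N => _) = fun N => (N%:R : R)%:E); last first.
 apply/funext => N; rewrite sz ?size_hist// => j _; case: j => [|j]; first by rewrite /x X0.
 exact: H.
by apply/cvgeryP; exact: cvgr_idn.
Qed.

(** Monotone convergence for the number of steps made before absorption. It equals the hitting time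
    only when the chain starts at n, so the two are compared off that null event. *)
Lemma hit_int : (fun N => (Int P (fun w => wsum (fun=> 1) (hK N w)))%:E) @ \oo --> (\int[P]_w hit_time K (X ^~ w))%E.
Proof.
have ms N : meas (fun w => wsum (fun=> 1) (hK N w)) by exact: (mfHk mc N (fun h => wsum (fun=> 1) (sth actK h))).
have sb N w : 0 <= wsum (fun=> 1) (hK N w) <= N%:R.
 rewrite wsum1 ler0n ler_nat/=; have [k [kN E _ _]] := @sth_pre actK (X ^~ w) N.
 by rewrite /hK /Hk E size_hist.
have i N : intg P (fun w => wsum (fun=> 1) (hK N w)).
 by apply: (ibnd N%:R) => // w; have /andP[h1 h2] := sb N w; rewrite ger0_norm.
have P0 : P [set w | X 0 w <> n] = 0%E.
 have mA : measurable [set w | X 0 w = n] by exact: mc.1.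
 rewrite (_ : [set w | X 0 w <> n] = ~` [set w | X 0 w = n])// probability_setC//.
 have := mc.2 0%N (fun=> n); rewrite big_geq// /ind eqxx mulr1 => h.
 rewrite (_ : [set w | X 0 w = n] = [set w | forall j, (j <= 0)%N -> X j w = n]) ?h ?subee//.
 by apply/seteqP; split => w /= => [E j|]; [rewrite leqn0 => /eqP ->|exact].
have mN : measurable [set w | X 0 w <> n] by apply: measurableC; exact: mc.1.
pose Z := fun w => (limn (fun N => (wsum (fun=> 1) (hK N w))%:E) : \bar R).
have nd w : nondecreasing_seq (fun N => (wsum (fun=> 1) (hK N w))%:E : \bar R).
 apply/nondecreasing_seqP => N; rewrite lee_fin wsumS lerDl /ind; case: actK; rewrite ?mul1r ?mul0r//.
have -> : (\int[P]_w hit_time K (X ^~ w))%E = (\int[P]_w Z w)%E.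
 have Z0 w : (0 <= Z w)%E.
  apply: lime_ge; first by apply: ereal_nondecreasing_is_cvgn; exact: nd.
  by apply: nearW => N; rewrite lee_fin; case/andP: (sb N w).
 have H0 w : (0 <= hit_time K (X ^~ w) :> \bar R)%E by apply: le_ereal_inf_tmp => _ [k _ <-]; rewrite lee_fin.
 have E w : ~ (X 0 w <> n) -> hit_time K (X ^~ w) = Z w.
  move=> /contrapT X0; apply/esym/cvg_lim => //; have := size_hit X0.
  by rewrite (_ : (fun N => _) = fun N => (wsum (fun=> 1) (hK N w))%:E)//; apply/funext => N; rewrite wsum1.
 by apply/eqP; rewrite eq_le; apply/andP; split; apply: (int_null_le mN P0) => // w nw; rewrite E.
rewrite (_ : (fun N => _) = fun N => (\int[P]_w (wsum (fun=> 1) (hK N w))%:E)%E); last by apply/funext => N; rewrite Rint_fin.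
apply: cvg_monotone_convergence => //.
- by move=> N; apply/measurable_EFinP.
- by move=> N w _; rewrite lee_fin; case/andP: (sb N w).
Qed.

End Occ.

Section FinN.
Context {R : realType} (p : nat -> nat -> R) (a : nat -> R) (n K K1 N0 : nat) (q : R).
Context {d} {T : measurableType d} (P : probability T R) (X : nat -> T -> nat).
Hypotheses (kp : is_kernel p) (a0 : forall x, 0 < a x) (n0 : (0 < n)%N) (Kn : (K < n)%N) (mc : markov_chain P p n X)
 (q0 : 0 < q) (Hq : forall x, (K < x)%N -> (x <= K1)%N -> q <= 1 - U p K N0 x).

Local Notation E f := (Int P f).
Local Notation hh N w := (hK K X N w).
Let wp f x : R := f x / a x.
Let mh d' (T' : measurableType d') N (f : seq nat -> T') : meas (fun w => f (hh N w)).
Proof. exact: (mfHk mc N (fun h => f (sth (actK K) h))). Qed.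
Lemma wsumZ c (w : nat -> R) h : wsum (fun x => c * w x) h = c * wsum w h.
Proof. by rewrite /wsum mulr_sumr. Qed.
(** On (K, K1], where f has no negative drift, the correction W times [wU] supplies one; above K1
    the correction does no harm. *)
Lemma occW (f : nat -> R) c W : (forall x, 0 <= f x) -> 0 < c -> 0 <= W ->
 (forall x, (K < x)%N -> summ (p x) f) ->
 (forall x, (K < x)%N -> (K1 < x)%N -> Esum (p x) f + c * wp f x <= f x) ->
 (forall x, (K < x)%N -> (x <= K1)%N -> Esum (p x) f + c * wp f x <= W * q) ->
 forall N, [/\ intg P (fun w => f (hd0 (hh N w))), intg P (fun w => wsum (wp f) (hh N w)) &
  E (fun w => f (hd0 (hh N w))) + c * E (fun w => wsum (wp f) (hh N w)) <= f n + W * N0%:R].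
Proof.
move=> f0 c0 W0 sf H1 H2 N.
have wp0 x : 0 <= wp f x by rewrite divr_ge0// ltW.
pose g x := f x + W * wU p K N0 x; pose w x := c * wp f x.
have wU0 x : 0 <= wU p K N0 x.
 by case: x => [|x]; [rewrite /wU /ind mul0r|have /andP[] := wU_bnd K kp N0 (ltn0Sn x)].
have g0 x : 0 <= g x by apply: addr_ge0 => //; exact: mulr_ge0.
have w0 x : 0 <= w x by apply: mulr_ge0 => //; exact: ltW.
have [] // := @occ_up _ p n K _ _ P X kp n0 mc g w g0 w0 _ N.
 move=> x Kx; have x0 : (0 < x)%N by exact: leq_ltn_trans Kx.
 have [Q0 [Q1 _]] := kern kp x0; have s1 := sf x Kx.
 have s2 : summ (p x) (wU p K N0) by exact: summ_wU.
 have s3 : summ (p x) (fun y => W * wU p K N0 y) by exact: summZ.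
 split; first exact: summD.
 rewrite EsumD// EsumZ// Esum_wU// /g /w.
 have [xK|Kx1] := leqP x K1.
  have := H2 x Kx xK; have := Hq Kx xK; have := f0 x; rewrite !mulrDr mulrN1 => u1 u2 u3.
  have : W * U p K N0 x <= W * (1 - q) by apply: ler_wpM2l => //; lra.
  rewrite mulrBr mulr1; lra.
 have := H1 x Kx Kx1; have /andP[_ u1] := U_bnd K kp N0 x0; rewrite !mulrDr mulrN1 => u2.
 have : W * U p K N0 x <= W * 1 by apply: ler_wpM2l.
 lra.
move=> i h.
have i1 : intg P (fun w => f (hd0 (hh N w))).
 apply: (intg_le _ _ i); first exact: (mh N (fun h => f (hd0 h))).
 move=> w'; rewrite ger0_norm// /g -addrA lerDl addr_ge0//; last exact: wsum_ge0.
 exact: mulr_ge0.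
have i2 : intg P (fun w' => c * wsum (wp f) (hh N w')).
 apply: (intg_le _ _ i); first exact: (mh N (fun h => c * wsum (wp f) h)).
 move=> w'; rewrite -wsumZ ger0_norm ?lerDr//; exact: wsum_ge0.
have i3 : intg P (fun w' => wsum (wp f) (hh N w')).
 have -> : (fun w' => wsum (wp f) (hh N w')) = fun w' => c^-1 * (c * wsum (wp f) (hh N w')).
  by apply/funext => w'; rewrite mulrA mulVf ?mul1r// gt_eqF.
 exact: intgZ.
split => //; rewrite -RintZ// -RintD//; apply: le_trans (le_trans h _).
 apply: Rint_le => //; first exact: intgD.
 move=> w'; rewrite -wsumZ lerD2r /g lerDl; exact: mulr_ge0.
by rewrite /g lerD2l ler_wpM2l//; have /andP[] := wU_bnd K kp N0 n0.
Qed.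

(** [wU] is at most N0 and loses at least q in mean at each visit to (K, K1]. *)
Lemma cntK1 N : intg P (fun w => wsum (fun x => ind (x <= K1)%N) (hh N w)) /\
 E (fun w => wsum (fun x => ind (x <= K1)%N) (hh N w)) <= N0%:R / q.
Proof.
have wU0 x : 0 <= wU p K N0 x.
 by case: x => [|x]; [rewrite /wU /ind mul0r|have /andP[] := wU_bnd K kp N0 (ltn0Sn x)].
have ind0 x : 0 <= ind (x <= K1)%N :> R by exact: ind_ge0.
have w0 x : 0 <= q * ind (x <= K1)%N by apply: mulr_ge0 => //; exact: ltW.
have [] // := @occ_up _ p n K _ _ P X kp n0 mc (wU p K N0) (fun x => q * ind (x <= K1)%N) wU0 w0 _ N.
 move=> x Kx; have x0 : (0 < x)%N by exact: leq_ltn_trans Kx.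
 split; first exact: summ_wU.
 rewrite Esum_wU//; have /andP[_ u1] := U_bnd K kp N0 x0; rewrite /ind.
 by case: leqP => xK; [have := Hq Kx xK|]; lra.
move=> i h.
have i2 : intg P (fun w' => q * wsum (fun x => ind (x <= K1)%N) (hh N w')).
 apply: (intg_le _ _ i); first exact: (mh N (fun h => q * wsum (fun x => ind (x <= K1)%N) h)).
 move=> w'; rewrite -wsumZ ger0_norm ?lerDr//; exact: wsum_ge0.
have i3 : intg P (fun w' => wsum (fun x => ind (x <= K1)%N) (hh N w')).
 have -> : (fun w' => wsum (fun x => ind (x <= K1)%N) (hh N w')) = fun w' => q^-1 * (q * wsum (fun x => ind (x <= K1)%N) (hh N w')).
  by apply/funext => w'; rewrite mulrA mulVf ?mul1r// gt_eqF.
 exact: intgZ.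
split => //; rewrite ler_pdivlMr// mulrC -RintZ//; apply: le_trans (le_trans h _).
 by apply: Rint_le => // w'; rewrite -wsumZ lerDr.
by have /andP[] := wU_bnd K kp N0 n0.
Qed.

Local Notation Occ f c W := (forall N, [/\ intg P (fun w => f (hd0 (hh N w))), intg P (fun w => wsum (wp f) (hh N w)) &
 E (fun w => f (hd0 (hh N w))) + c * E (fun w => wsum (wp f) (hh N w)) <= 1 + W * N0%:R]).
Context (f0 f1 f2 : nat -> R) (c0 c1 c2 c3 W0 W1 W2 Ks Kh eps : R).
Hypotheses (f00 : forall x, 0 <= f0 x) (f10 : forall x, 0 <= f1 x) (f20 : forall x, 0 <= f2 x) (eps0 : 0 <= eps)
 (Ks0 : 0 <= Ks) (c30 : 0 < c3) (sf0 : forall x, (K < x)%N -> summ (p x) f0) (fn0 : f0 n = 1)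
 (O0 : Occ f0 c0 W0)
 (O1 : Occ f1 c1 W1)
 (O2 : Occ f2 c2 W2)
 (c00 : 0 < c0) (c10 : 0 < c1) (c20 : 0 < c2)
 (Lo : forall x, (K < x)%N -> (K1 < x)%N -> f0 x <= Esum (p x) f0 + c3 * wp f0 x)
 (LoK : forall x, (K < x)%N -> (x <= K1)%N -> f0 x <= Ks) (LoH : forall x, (x <= K)%N -> f0 x <= Kh) (Kh0 : 0 <= Kh)
 (cmp : forall x, (K < x)%N -> `|a x / a n - f0 x| <= eps * (f1 x + f2 x))
 (tailf : forall eta, 0 < eta -> exists2 A, 0 <= A & forall x, (K < x)%N -> f0 x <= A * wp f0 x + eta * f2 x).

Local Notation C1 := ((1 + W1 * N0%:R) / c1).
Local Notation C2 := ((1 + W2 * N0%:R) / c2).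
Let m1 N := E (fun w => wsum (fun=> 1) (hh N w)).
Let s0 N := E (fun w => wsum (wp f0) (hh N w)).
Let wp0 f x : (forall x, 0 <= f x) -> 0 <= wp f x. Proof. by move=> h; rewrite divr_ge0// ltW. Qed.
Let E0 (f : T -> R) : intg P f -> (forall w, 0 <= f w) -> 0 <= E f.
Proof.
move=> i h; have i0 : intg P (fun=> 0 : R) by apply: (ibnd 0) => // w; rewrite normr0.
by have := Rint_le i0 i h; rewrite Ecst.
Qed.

(** In the application f0, f1, f2 are the powers gm, gm - de, gm + de of x/n. A step weighs 1/a_n =
    (a_x/a_n)(1/a_x), and replacing a_x/a_n by f0 costs eps times the occupation sums of f1 and
    f2. *)
Lemma m1_s0 N : `|m1 N / a n - s0 N| <= eps * (C1 + C2).
Proof.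
have [_ i0 _] := O0 N; have [j1 i1 e1] := O1 N; have [j2 i2 e2] := O2 N.
have C1P : E (fun w => wsum (wp f1) (hh N w)) <= C1.
 rewrite ler_pdivlMr// mulrC; apply: le_trans e1; rewrite lerDr; apply: E0 => // w; exact: f10.
have C2P : E (fun w => wsum (wp f2) (hh N w)) <= C2.
 rewrite ler_pdivlMr// mulrC; apply: le_trans e2; rewrite lerDr; apply: E0 => // w; exact: f20.
have ib : intg P (fun w => wsum (fun=> 1) (hh N w)).
 apply: (ibnd N%:R) => [|w]; first exact: (mh N (fun h => wsum (fun=> 1) h)).
 rewrite wsum1 ger0_norm// ler_nat; have [k [kN Ek _ _]] := @sth_pre (actK K) (X ^~ w) N.
 by rewrite /hK /Hk Ek size_hist.
have iz : intg P (fun w => (a n)^-1 * wsum (fun=> 1) (hh N w)) by exact: intgZ.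
have i12 : intg P (fun w => wsum (wp f1) (hh N w) + wsum (wp f2) (hh N w)) by exact: intgD.
have iz2 : intg P (fun w => eps * (wsum (wp f1) (hh N w) + wsum (wp f2) (hh N w))) by exact: intgZ.
rewrite [_ / _]mulrC -RintZ// -RintB//.
apply: (via (E (fun w => eps * (wsum (wp f1) (hh N w) + wsum (wp f2) (hh N w))))).
 apply: Rint_norm_le => //; first exact: intgB.
 move=> w; rewrite -wsumZ /wsum -sumrB -big_split/= mulr_sumr.
 have al : all (fun x => (K < x)%N) (behead (hh N w)) by exact: (@sth_all _ (fun x => (K < x)%N) (Hk X N w) (fun g h => h)).
 apply: (le_trans (ler_norm_sum _ _ _)); rewrite big_seq [leRHS]big_seq; apply: ler_sum => x xs.
 have Kx := allP al x xs; have := cmp Kx; rewrite mulr1 /wp -mulrDl mulrA.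
 have -> : (a n)^-1 - f0 x / a x = (a x / a n - f0 x) / a x by field; rewrite !gt_eqF.
 by rewrite normrM [`|_^-1|]gtr0_norm ?invr_gt0// => h; rewrite ler_wpM2r// invr_ge0 ltW.
rewrite RintZ// RintD// ler_wpM2l//; exact: lerD.
Qed.

Lemma fin_up : (\int[P]_w hit_time K (X ^~ w) <= (a n * ((1 + W0 * N0%:R) / c0 + eps * (C1 + C2)))%:E)%E.
Proof.
apply: (cvge_to_le (hit_int Kn mc)); apply: nearW => N; rewrite lee_fin.
have := m1_s0 N; rewrite ler_norml => /andP[_ h]; rewrite mulrC -ler_pdivrMr//.
have [j0 i0 e0] := O0 N; have : s0 N <= (1 + W0 * N0%:R) / c0.
 rewrite ler_pdivlMr// mulrC; apply: le_trans e0; rewrite lerDr; apply: E0 => // w; exact: f00.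
by move: h; rewrite /m1; lra.
Qed.

(** s0 is bounded, so one of its increments is small, and that increment is the mean of f0/a at the
    newest state while active. [tailf] bounds f0 by a multiple of f0/a plus a small multiple of f2;
    after absorption f0 is at most Kh. *)
Lemma head_small iota : 0 < iota -> exists N, E (fun w => f0 (hd0 (hh N w))) <= Kh + iota.
Proof.
move=> io; have C2p : 0 <= 1 + W2 * N0%:R.
 have [j2 i2 e2] := O2 0%N; apply: le_trans e2; apply: addr_ge0; first by apply: E0 => // w; exact: f20.
 by apply: mulr_ge0; [exact: ltW|apply: E0 => // w; apply: wsum_ge0 => x; exact: wp0].
pose eta := iota / 2 / (1 + W2 * N0%:R + 1).
have eta0 : 0 < eta by rewrite divr_gt0 ?divr_gt0//; lra.
have etaC : eta * (1 + W2 * N0%:R) <= iota / 2.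
 apply: (via (eta * (1 + W2 * N0%:R + 1))); first by rewrite ler_pM2l// lerDl.
 by rewrite /eta divfK// gt_eqF//; lra.
have [A A0 HA] := tailf eta0.
pose st := iota / 2 / (A + 1); have st0 : 0 < st by rewrite divr_gt0 ?divr_gt0//; lra.
have [N HN] : exists N, s0 N.+1 <= s0 N + st.
 apply: contrapT => /forallNP H.
 have L N : N%:R * st <= s0 N.
  elim: N => [|N IH].
   by rewrite mul0r; have [_ i0 _] := O0 0%N; apply: E0 => // w; apply: wsum_ge0 => x; exact: wp0.
  by have := H N => /negP; rewrite -ltNge -natr1 mulrDl mul1r; lra.
 have [N HN] := ev_ger ((1 + W0 * N0%:R) / c0 / st + 1).
 have [j0 i0 e0] := O0 N; have : s0 N <= (1 + W0 * N0%:R) / c0.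
  rewrite ler_pdivlMr// mulrC; apply: le_trans e0; rewrite lerDr; apply: E0 => // w; exact: f00.
 have := HN N (leqnn N); rewrite -lerBrDr ler_pdivrMr// mulrBl mul1r; have := L N; lra.
exists N; have [j0 i0 _] := O0 N; have [_ i0' _] := O0 N.+1; have [j2 i2 e2] := O2 N.
have iB : intg P (fun w => wsum (wp f0) (hh N.+1 w) - wsum (wp f0) (hh N w)) by exact: intgB.
have iZ : intg P (fun w => A * (wsum (wp f0) (hh N.+1 w) - wsum (wp f0) (hh N w))) by exact: intgZ.
have iK : intg P (fun=> Kh) by apply: (ibnd `|Kh|).
have iF : intg P (fun w => eta * f2 (hd0 (hh N w))) by exact: intgZ.
have iKZ : intg P (fun w => Kh + A * (wsum (wp f0) (hh N.+1 w) - wsum (wp f0) (hh N w))) by exact: intgD.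
apply: (via (E (fun w => Kh + A * (wsum (wp f0) (hh N.+1 w) - wsum (wp f0) (hh N w)) + eta * f2 (hd0 (hh N w))))).
 apply: Rint_le => //; first exact: intgD.
 move=> w; rewrite wsumS (addrAC (wsum _ _)) subrr add0r /actK /ind.
 have e0 : 0 <= eta * f2 (hd0 (hh N w)) by apply: mulr_ge0 => //; exact: ltW.
 have [Kx|xK] := ltnP K (hd0 (hh N w)); last by rewrite mul0r mulr0 addr0 ler_wpDr// LoH.
 by rewrite mul1r; have := HA _ Kx; have := Kh0; lra.
rewrite RintD// RintD// Ecst RintZ// RintZ// RintB// -addrA lerD2l.
have h1 : A * (s0 N.+1 - s0 N) <= iota / 2.
 apply: (via (A * st)); first by apply: ler_wpM2l => //; lra.
 apply: (via ((A + 1) * st)); first by rewrite ler_pM2r// lerDl.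
 by rewrite /st mulrC divfK// gt_eqF//; lra.
have h2 : eta * E (fun w => f2 (hd0 (hh N w))) <= iota / 2.
 apply: le_trans etaC; rewrite ler_pM2l//; apply: le_trans e2; rewrite lerDl.
 by apply: mulr_ge0; [exact: ltW|apply: E0 => // w; apply: wsum_ge0 => x; exact: wp0].
rewrite [leRHS](_ : iota = iota / 2 + iota / 2); last by field.
exact: lerD.
Qed.

(** f0 n = 1 is at most the mean of f0 at the newest state, plus c3 times the occupation sum, plus
    Ks for each visit to (K, K1]; [head_small] and [cntK1] bound the first and the last. *)
Lemma fin_lo iota : 0 < iota -> ((a n * ((1 - Kh - iota - Ks * (N0%:R / q)) / c3 - eps * (C1 + C2)))%:E <=
 \int[P]_w hit_time K (X ^~ w))%E.
Proof.
move=> io; have [N HN] := head_small io.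
have [j0 i0 e0] := O0 N; have [ic ec] := cntK1 N.
have iw : intg P (fun w => wsum (fun x => c3 * wp f0 x + Ks * ind (x <= K1)%N) (hh N w)).
 have -> : (fun w => wsum (fun x => c3 * wp f0 x + Ks * ind (x <= K1)%N) (hh N w)) =
   fun w => c3 * wsum (wp f0) (hh N w) + Ks * wsum (fun x => ind (x <= K1)%N) (hh N w).
  by apply/funext => w; rewrite -!wsumZ /wsum -big_split.
 by apply: intgD; exact: intgZ.
have := @occ_lo _ p n K _ _ P X kp n0 mc f0 (fun x => c3 * wp f0 x + Ks * ind (x <= K1)%N) f00 _ _ N j0 iw.
have -> : (fun w => wsum (fun x => c3 * wp f0 x + Ks * ind (x <= K1)%N) (hh N w)) =
   fun w => c3 * wsum (wp f0) (hh N w) + Ks * wsum (fun x => ind (x <= K1)%N) (hh N w).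
 by apply/funext => w; rewrite -!wsumZ /wsum -big_split.
have iz1 : intg P (fun w => c3 * wsum (wp f0) (hh N w)) by exact: intgZ.
have iz2 : intg P (fun w => Ks * wsum (fun x => ind (x <= K1)%N) (hh N w)) by exact: intgZ.
rewrite RintD// RintZ// RintZ// fn0 => H.
have {}H : 1 <= Kh + iota + (c3 * s0 N + Ks * (N0%:R / q)).
 apply: (le_trans (H _ _)).
 - by move=> x; rewrite addr_ge0// mulr_ge0 ?ind_ge0 ?wp0// ltW.
 - move=> x Kx; split; first exact: sf0.
  rewrite /ind; have [xK|Kx1] := leqP x K1; last by rewrite mulr0 addr0; exact: Lo.
  rewrite mulr1; apply: le_trans (LoK Kx xK) _; rewrite addrA lerDr addr_ge0//.
   have x0 : (0 < x)%N by exact: leq_ltn_trans Kx.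
   by apply: Esum_ge0 => //; [exact: kern|exact: sf0].
  by rewrite mulr_ge0 ?wp0// ltW.
 - by apply: lerD => //; rewrite lerD2l ler_wpM2l.
apply: (via (m1 N)%:E).
 rewrite lee_fin mulrC -ler_pdivlMr//; have := m1_s0 N; rewrite ler_norml => /andP[h _].
 have : (1 - Kh - iota - Ks * (N0%:R / q)) / c3 <= s0 N by rewrite ler_pdivrMr// mulrC; move: H; lra.
 by move: h; lra.
apply: (cvge_to_ge (hit_int Kn mc)); exists N => // N' /= NN; rewrite lee_fin.
have ib M : intg P (fun w => wsum (fun=> 1) (hh M w)).
 apply: (ibnd M%:R) => [|w]; first exact: (mh M (fun h => wsum (fun=> 1) h)).
 rewrite wsum1 ger0_norm// ler_nat; have [k [kN Ek _ _]] := @sth_pre (actK K) (X ^~ w) M.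
 by rewrite /hK /Hk Ek size_hist.
apply: Rint_le => // w; rewrite -(subnK NN); elim: (N' - N)%N => [|j IH]; first by rewrite add0n.
by apply: (le_trans IH); rewrite addSn wsumS lerDl mulr1 ind_ge0.
Qed.

End FinN.

(** * The chain and the Levy process *)

Section Main.
Unset Implicit Arguments.
Context {R : realType} (p : nat -> nat -> R) (a : nat -> R) (gm : R)
 (Pi : {measure set R -> \bar R}) (b sg2 : R)
 (dT : measure_display) (T : nat -> measurableType dT)
 (P : forall n, probability (T n) R) (X : forall n, nat -> T n -> nat).
Set Implicit Arguments.
Hypotheses (kp : is_kernel p) (ga0 : 0 < gm) (rv : reg_var a gm) (LP : levy_measure Pi)
 (mc : forall n, (1 <= n)%N -> markov_chain (P n) p n (X n)) (HA1 : A1 p a Pi) (HA2 : A2 p a Pi b sg2)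
 (HA3 : A3 p a).

Let a0 : forall n, 0 < a n. Proof. by have [] := rv. Qed.
Local Notation Ps := (Psi Pi b sg2).
(** Leaving the range before clock S, together with the null events of visiting 0 or not starting at
    n, so that its complement can be used pathwise. *)
Definition Bad n (B S : R) : set (T n) :=
 \bigcup_N [set w | ~~ `[< inr n B (hd0 (sth (act1 a n B S) (Hk (X n) N w))) >]] `|` (\bigcup_N [set w | X n N w = 0%N] `|` [set w | X n 0 w <> n]).

Arguments Bad : clear implicits.
Lemma mBad n B S : (0 < n)%N -> measurable (Bad n B S).
Proof.
move=> n0; apply: measurableU; last first.
 apply: measurableU; first by apply: bigcup_measurable => N _; exact: (mc n0).1.
 by apply: measurableC; exact: (mc n0).1.
apply: bigcup_measurable => N _.
exact: (mHkset (mc n0) N (fun h => ~~ `[< inr n B (hd0 (sth (act1 a n B S) h)) >])).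
Qed.

Lemma X_null n : (0 < n)%N -> P n (\bigcup_N [set w | X n N w = 0%N] `|` [set w | X n 0 w <> n]) = 0%E.
Proof.
move=> n0; have m0 : measurable [set w | X n 0 w <> n] by apply: measurableC; exact: (mc n0).1.
have mU : measurable (\bigcup_N [set w | X n N w = 0%N]) by apply: bigcup_measurable => N _; exact: (mc n0).1.
have P0 : P n [set w | X n 0 w <> n] = 0%E.
 have := (mc n0).2 0%N (fun=> n); rewrite big_geq// mulr1 eqxx /= => H.
 have mA : measurable [set w | X n 0 w = n] by exact: (mc n0).1.
 rewrite -[[set w | _]]/(~` [set w | X n 0 w = n]) probability_setC//.
 rewrite (_ : [set w | X n 0 w = n] = [set w | forall j, (j <= 0)%N -> X n j w = n]) ?H ?subee//.
 by apply/seteqP; split => w /= => [h j|/(_ 0%N (leqnn _)) //]; rewrite leqn0 => /eqP ->.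
rewrite measureU0//; apply/eqP; rewrite eq_le measure_ge0 andbT.
pose f (h : seq nat) : R := ind (hd0 h == 0%N).
have sid (h : seq nat) : sth predT h = h by elim: h => // y [|z h] IH //; rewrite sth_cons IH.
have := superE kp n0 (mc n0) (act := predT) (bad := fun h => hd0 h == 0%N) (f := f) (c := 1) ltr01.
rewrite /f /= (gtn_eqF n0) mul0r => H; apply: (le_trans _ (H _ _ _)).
- apply: le_measure; rewrite ?inE//.
 + by apply: bigcup_measurable => N _; exact: (mHkset (mc n0) N (fun h => hd0 (sth predT h) == 0%N)).
 + move=> w [N _ /= XN]; exists N => //=; rewrite sid; case: N XN => [|N] /= -> //.
- by move=> h; exact: ind_ge0.
- case=> // x h _ x0; have Q := kern kp x0.
 rewrite [leRHS](_ : _ = 0%:E); last by rewrite /= (gtn_eqF x0).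
 apply: (@Qe_le _ p kp f (fun=> 0)) => //.
 + by move=> g; exact: ind_ge0.
 + by move=> y y0; rewrite /f /= (gtn_eqF y0).
 + exact: summ_cst.
 + by rewrite Esum_cst.
- by move=> h ->.
Qed.

Lemma not_Bad n B S w : ~ Bad n B S w -> X n 0 w = n /\ (forall N, (0 < X n N w)%N) /\
 (forall N, inr n B (hd0 (sth (act1 a n B S) (hist (X n ^~ w) N)))).
Proof.
move=> nb; split; first by apply: contrapT => X0; apply: nb; right; right.
split=> N; first by rewrite lt0n; apply/negP => /eqP X0; apply: nb; right; left; exists N.
by apply: contrapT => H; apply: nb; left; exists N => //=; apply/asboolPn.
Qed.

(** At scale B the drift of [ps] is of order 1/B apart from very large jumps, which [factT_ev] makes
    rare; [eta] is chosen so that the initial value of [fB] is e. *)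
Lemma exit_small (S e : R) : 0 <= S -> 0 < e -> exists2 B0, 0 < B0 & forall B, B0 <= B ->
 ev (fun n => (P n (Bad n B S) <= e%:E)%E).
Proof.
move=> S0 e0.
pose eta := e / (2 * (S + 1)).
have et0 : 0 < eta by rewrite divr_gt0// mulr_gt0//; lra.
have [Cg Cg0 HCg] := factB_ev kp a0 HA1 HA2.
have et2 : 0 < eta / 2 by lra.
have [A A1' HA] := factT_ev kp a0 HA1 LP et2.
pose D := (1 + 2 + A) * Cg.
have D0 : 0 <= D by rewrite /D; pos; lra.
exists (1 + D / (eta / 2)) => [|B BB]; first by rewrite ltr_wpDr// divr_ge0// ltW.
have B1 : 1 <= B by apply: le_trans BB; rewrite lerDl divr_ge0// ltW.
have B0 : 0 < B by lra.
have DB : D / B <= eta / 2.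
 rewrite ler_pdivrMr// mulrC -ler_pdivrMr//; apply: le_trans BB; lra.
have Hev := ev_inr (B : R) (ev_and HCg (ev_and HA (a_inf a0 ga0 rv 1))).
apply: ev_imp Hev => n [n0 H].
have HB x : (0 < x)%N -> `|ld x n| <= B ->
 1 <= a x /\ forall l, `|mm p a x (fun u => ps ((l + u) / B) - ps (l / B))| <= eta.
 move=> x0 xB; have [fB' [fT' ax]] := H x x0 xB; split=> // l.
 apply: le_trans (ps_step kp a0 l fB' B0 A1') _.
 have h2 : 2 * Cg / B ^+ 2 <= 2 * Cg / B.
  by apply: ler_wpM2l; [pos|rewrite lef_pV2 ?posrE ?exprn_gt0// expr2 ler_peMl// ltW].
 have E : Cg / B + 2 * Cg / B + A / B * Cg = D / B by rewrite /D; ring.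
 lra.
rewrite measureU0//; last exact: X_null.
- have := superE kp n0 (mc n0) (act := act1 a n B S) (bad := fun h => ~~ `[< inr n B (hd0 h) >])
  (f := fB a n B S eta) (c := 1) ltr01.
 rewrite fB_init//.
 move=> H'; apply: (le_trans (H' _ _ _)).
 + by move=> h; apply: fB_ge0; exact: ltW.
 + by apply: fB_super => //; exact: ltW.
 + move=> h /asboolPn; rewrite /inr => /negP; rewrite -ltNge => hB.
  have h1 : 1 / 2 <= ps ((ld (hd0 h) n) / B).
   by apply: ps_half; rewrite normrM normfV (gtr0_norm B0) ler_pdivlMr// mul1r ltW.
  by rewrite /fB; have := remc_ge0 a S h => h2; have : 0 <= 2 * eta * remc a S h; [pos|lra].
 + by rewrite lee_fin divr1 le_eqVlt; apply/orP; left; apply/eqP; rewrite /eta; field; rewrite gt_eqF //; lra.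
- apply: bigcup_measurable => N _; exact: (mHkset (mc n0) N (fun h => ~~ `[< inr n B (hd0 (sth (act1 a n B S) h)) >])).
- apply: measurableU; first by apply: bigcup_measurable => N _; exact: (mc n0).1.
 by apply: measurableC; exact: (mc n0).1.
Qed.

Section FddTrig.
(** The iterated limit used for laws of the chain: range B large, then n large, then enough steps N
    for the clock to run out. *)
Definition tri (L : R -> nat -> nat -> R) (l : R) := forall e, 0 < e ->
 exists B0, forall B, B0 <= B -> ev (fun n => ev (fun N => `|L B n N - l| <= e)).

Lemma triD L1 L2 l1 l2 : tri L1 l1 -> tri L2 l2 -> tri (fun B n N => L1 B n N + L2 B n N) (l1 + l2).
Proof.
move=> H1 H2 e e0; have e2 : 0 < e / 2 by lra.
have [B1 HB1] := H1 _ e2; have [B2 HB2] := H2 _ e2; exists (Num.max B1 B2) => B; rewrite ge_max => /andP[b1 b2].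
apply: ev_imp (ev_and (HB1 B b1) (HB2 B b2)) => n [h1 h2].
apply: ev_imp (ev_and h1 h2) => N [k1 k2].
rewrite (_ : _ - _ = (L1 B n N - l1) + (L2 B n N - l2)); last by ring.
by apply: (le_trans leND); lra.
Qed.

Lemma triZ c L l : tri L l -> tri (fun B n N => c * L B n N) (c * l).
Proof.
move=> H e e0; have c1 : 0 < `|c| + 1 by rewrite ltr_wpDl.
have [B1 HB1] := H (e / (`|c| + 1)) ltac:(by rewrite divr_gt0); exists B1 => B bB.
apply: ev_imp (HB1 B bB) => n h; apply: ev_imp h => N; rewrite -mulrBr normrM ler_pdivlMr//.
by move=> h; apply: le_trans h; rewrite mulrC ler_wpM2l// lerDl.
Qed.

Lemma tri_eq L1 L2 l : (exists B0, forall B, B0 <= B -> ev (fun n => forall N, L1 B n N = L2 B n N)) -> tri L1 l -> tri L2 l.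
Proof.
move=> [B0 HB] H e e0; have [B1 HB1] := H _ e0; exists (Num.max B0 B1) => B; rewrite ge_max => /andP[b1 b2].
by apply: ev_imp (ev_and (HB B b1) (HB1 B b2)) => n [h1 h2]; apply: ev_imp h2 => N; rewrite h1.
Qed.

Lemma gen_cos (la : R) : (fun x => mm p a x (fun u => cos (la * u) - 1)) @ \oo --> RePhi Pi sg2 la.
Proof.
have [be be0 /(emb kp a0)[Cb [Cb0 HE]]] := HA3.
have H := @gen_lim R p a kp a0 Pi HA1 LP b sg2 be Cb HA2 be0 Cb0 HE
 (fun u => cos (la * u) - 1) 0 (- (la ^+ 2 / 2)) (2 * `|la| ^+ 3 + 2) 0.
have C0 : 0 <= 2 * `|la| ^+ 3 + 2 by pos.
rewrite /RePhi; have {}H := H _ _ _ (lexx _) be0 C0; move: H.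
rewrite mul0r add0r => H; have -> : - (sg2 * la ^+ 2 / 2) = - (la ^+ 2 / 2) * sg2 by ring.
rewrite (_ : Int Pi (fun x => cos (la * x) - 1) =
 Int Pi (fun u => cos (la * u) - 1 - 0 * u * ind (`|u| <= 1))); last first.
 by apply: eq_Rintegral => u _; rewrite mul0r mul0r subr0.
apply: H.
- apply: contB; last exact: cont_cst.
 by apply: contcos; apply: contM; [exact: cont_cst|exact: cont_id].
- move=> u _; rewrite mul0r subr0 mulNr opprK.
 have := cos_tay (la * u); rewrite exprMn normrM exprMn => h.
 rewrite (_ : cos (la * u) - 1 + la ^+ 2 / 2 * u ^+ 2 = cos (la * u) - 1 + la ^+ 2 * u ^+ 2 / 2); last by ring.
 apply: (le_trans h); rewrite mulrA ler_wpM2r ?exprn_ge0// lerDl//.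
- move=> u; rewrite mul0r expR0; apply: (via 2).
  by apply: le_trans (ler_normB _ _) _; rewrite normr1 -[leRHS]/(1 + 1) lerD2r ler_norml cos_geN1 cos_le1.
 by have : 0 <= `|la| ^+ 3 by []; rewrite exprn_ge0// => h; have := exprn_ge0 3 (normr_ge0 la); lra.
Qed.

Lemma gen_sin (la : R) : (fun x => mm p a x (fun u => sin (la * u))) @ \oo --> ImPhi Pi b la.
Proof.
have [be be0 /(emb kp a0)[Cb [Cb0 HE]]] := HA3.
have H := @gen_lim R p a kp a0 Pi HA1 LP b sg2 be Cb HA2 be0 Cb0 HE
 (fun u => sin (la * u)) la 0 (`|la| ^+ 3 + 1) 0.
have l3 : 0 <= `|la| ^+ 3 by exact: exprn_ge0.
have C0 : 0 <= `|la| ^+ 3 + 1 by lra.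
rewrite /ImPhi; have {}H := H _ _ _ (lexx _) be0 C0; move: H.
rewrite mul0r addr0 [la * b]mulrC; apply.
- by apply: contsin; apply: contM; [exact: cont_cst|exact: cont_id].
- move=> u _; rewrite mul0r subr0; have := sin_tay (la * u); rewrite normrM exprMn => h.
 by apply: (le_trans h); rewrite ler_wpM2r ?exprn_ge0// lerDl.
- move=> u; rewrite mul0r expR0; apply: (via 1); first by rewrite ler_norml sin_geN1 sin_le1.
 lra.
Qed.

Context (M : nat) (ep : R).
Hypothesis ep0 : 0 < ep.
Let S := M%:R * ep.
Let S0 : 0 <= S. Proof. by rewrite /S mulr_ge0// ltW. Qed.
Local Notation dv := (DV a ep).
Definition hB n B N (w : T n) := sth (act1 a n B S) (Hk (X n) N w).
Arguments hB : clear implicits.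
Lemma mhB n B N (g : seq nat -> R) : (0 < n)%N -> meas (fun w => g (hB n B N w)).
Proof. by move=> n0; exact: (mfHk (mc n0) N (fun h => g (sth (act1 a n B S) h))). Qed.
(** The supermartingale [fT] gives an upper bound only. It is stated for every phase phi, so that
    phi + pi later provides the lower bound. *)
Lemma trig_upper lam phi e : 0 < e -> exists B0, forall B, B0 <= B -> ev (fun n => ev (fun N =>
 Int (P n) (fun w => expR (- (ep * \sum_(0 <= j < M) RePhi Pi sg2 (lam j))) *
  cos (\sum_(0 <= j < M) lam j * dv (hB n B N w) j - ep * \sum_(0 <= j < M) ImPhi Pi b (lam j) + phi)) <= cos phi + e)).
Proof.
move=> e0; pose r j := if (j < M)%N then RePhi Pi sg2 (lam j) else 0.
pose i j := if (j < M)%N then ImPhi Pi b (lam j) else 0.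
pose Rm := 1 + \sum_(0 <= j < M) (`|RePhi Pi sg2 (lam j)| + `|ImPhi Pi b (lam j)|).
have Rm_ge j : (j < M)%N -> `|RePhi Pi sg2 (lam j)| + `|ImPhi Pi b (lam j)| <= Rm.
 move=> jM; rewrite /Rm (bigD1_seq j) ?iota_uniq ?mem_index_iota//= addrCA lerDl addr_ge0//.
 by apply: sumr_ge0 => k _; rewrite addr_ge0.
have Rm1 : 1 <= Rm by rewrite /Rm lerDl sumr_ge0// => k _; rewrite addr_ge0.
have rR j : `|r j| <= Rm.
 rewrite /r; case: ifP => [/Rm_ge h|_]; last by rewrite normr0; lra.
 by apply: le_trans h; rewrite lerDl.
have iR j : `|i j| <= Rm.
 rewrite /i; case: ifP => [/Rm_ge h|_]; last by rewrite normr0; lra.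
 by apply: le_trans h; rewrite lerDr.
have Er : \sum_(0 <= j < M) RePhi Pi sg2 (lam j) = \sum_(0 <= j < M) r j.
 by apply: eq_big_nat => j /andP[_ jM]; rewrite /r jM.
have Ei : \sum_(0 <= j < M) ImPhi Pi b (lam j) = \sum_(0 <= j < M) i j.
 by apply: eq_big_nat => j /andP[_ jM]; rewrite /i jM.
rewrite Er Ei; set rs := \sum_(0 <= j < M) r j; set is' := \sum_(0 <= j < M) i j.
pose C0 := expR (Rm * (S + 1)); have C00 : 0 < C0 by exact: expR_gt0.
(* The coefficients of eta in the three errors: drift, final replacement of the compensators, and
   bad event. *)
pose K := 90 * C0 * (S + 1) + 10 * C0 * (M%:R * Rm) + 2 * C0 + 1.
have K1 : 0 <= 90 * C0 * (S + 1) by have := S0; have := C00; move=> *; pos; lra.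
have K2 : 0 <= 10 * C0 * (M%:R * Rm) by pos; lra.
have K0 : 0 < K by rewrite /K; have := C00; lra.
have MR : 0 <= M%:R * Rm by pos; lra.
pose eta := Num.min (e / K) (Num.min 1 (M%:R * Rm + 1)^-1).
have et0 : 0 < eta by rewrite !lt_min divr_gt0//= ltr01 invr_gt0; lra.
have et1 : eta <= 1 by rewrite ge_min [X in _ || X]ge_min lexx orbT.
have etK : K * eta <= e by rewrite mulrC -ler_pdivlMr// ge_min lexx.
have etM : M%:R * Rm * eta <= 1.
 have : eta <= (M%:R * Rm + 1)^-1 by rewrite !ge_min lexx !orbT.
 rewrite -[X in _ <= X]mul1r ler_pdivlMr; last lra.
 by rewrite mulrDr mulr1 mulrC; lra.
have [B0 B00 HB0] := exit_small S0 et0.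
exists B0 => B BB; have B0' : 0 < B by lra.
have E1 : ev (fun x => (Rm ^+ 2 / a x <= eta) /\ forall j, (j < M)%N -> `|mm p a x (fun u => cos (lam j * u) - 1) - r j| <= eta /\
  `|mm p a x (fun u => sin (lam j * u)) - i j| <= eta).
 apply: ev_and.
  apply: ev_imp (a_inf a0 ga0 rv (Rm ^+ 2 / eta)) => x; rewrite ler_pdivrMr// => h.
  by rewrite ler_pdivrMr// mulrC.
 suff H k : ev (fun x => forall j, (j < k)%N -> (j < M)%N -> `|mm p a x (fun u => cos (lam j * u) - 1) - r j| <= eta /\
  `|mm p a x (fun u => sin (lam j * u)) - i j| <= eta).
  by apply: ev_imp (H M) => x h j jM; exact: h.
 elim: k => [|k IH]; first exact: ev_all.
 have h1 := (cvgnE _ _).1 (@gen_cos (lam k)) eta et0; have h2 := (cvgnE _ _).1 (@gen_sin (lam k)) eta et0.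
 apply: ev_imp (ev_and IH (ev_and h1 h2)) => x [g1 [g2 g3]] j; rewrite ltnS leq_eqVlt => /orP[/eqP ->|jk]; last exact: g1.
 by rewrite /r /i => ->.
have Hev := ev_inr (B : R) E1.
apply: ev_imp (ev_and (HB0 B BB) Hev) => n [PB [n0 Hx]].
have e01 : 0 <= eta <= 1 by rewrite et1 ltW.
have ax x : (0 < x)%N -> inr n B x -> (a x)^-1 <= eta.
 move=> x0 xB; have [h _] := Hx x x0 xB; apply: le_trans h.
 by rewrite ler_peMl ?invr_ge0 ?exprn_ege1// ltW.
have [N0 HN0] := act1_end a0 S B n0.
exists N0 => N NN.
set V := (X in Rintegral _ _ X).
have VC w : `|V w| <= C0.
 rewrite /V normrM ger0_norm ?expR_ge0//; apply: (via (expR (Rm * S))); last first.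
  by rewrite ler_expR; apply: ler_wpM2l; lra.
 rewrite -[leRHS]mulr1; apply: ler_pM => //; last by rewrite ler_norml cos_geN1 cos_le1.
 rewrite ler_expR; apply: le_trans (ler_norm _) _; rewrite normrN normrM gtr0_norm//.
 rewrite /S mulrCA mulrA [ep * _]mulrC; apply: ler_wpM2r; first exact: ltW.
 apply: le_trans (ler_norm_sum _ _ _) _; apply: (via (\sum_(0 <= j < M) Rm)); first exact: ler_sum.
 by rewrite big_const_nat iter_addr_0 subn0 mulr_natl.
pose f h : R := fT a M ep lam r i phi eta Rm h.
pose bd : T n -> R := fun w => \1_(Bad n B S) w.
have mbd : meas bd by apply: measurable_indic; exact: (mBad B S n0).
have mV : meas V.
 exact: (mhB B N (fun h => expR (- (ep * rs)) * cos (\sum_(0 <= j < M) lam j * dv h j - ep * is' + phi)) n0).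
have mf : meas (fun w => f (hB n B N w)) by exact: (mhB B N f n0).
(* Off the bad event this is [W_end]; on it the left side is nonpositive, since |V| <= C0. *)
have fge w : V w + (C0 - C0 * (10 * (M%:R * Rm * eta))) - 2 * C0 * bd w <= f (hB n B N w).
 have q0 : 0 <= C0 * (10 * (M%:R * Rm * eta)) by pos; lra.
 have V1 : V w <= C0 by apply: le_trans (ler_norm _) (VC w).
 have [nb|nb] := pselect (Bad n B S w).
  have -> : bd w = 1 by rewrite /bd indicE mem_set.
  by apply: (via 0); [lra|exact: fT_ge0].
 have -> : bd w = 0 by rewrite /bd indicE memNset.
 rewrite mulr0 subr0; have [_ [xp xr]] := not_Bad nb.
 have c1 : S <= clk a (hB n B N w) := HN0 _ xp xr _ NN.
 have c2 : clk a (hB n B N w) <= S + 1.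
  by apply: (le_trans (act1_clk (X n ^~ w) N (ltW et0) S0 ax)); rewrite lerD2l.
 have al := act1_all a S (Q := fun x : nat => (a x)^-1 <= eta) (Hk (X n) N w) ax.
 have W := W_end a0 lam phi ep0 Rm1 rR iR (@sth_neq0 (act1 a n B S) (X n ^~ w) N) al (ltW et0) c1 c2 etM.
 rewrite /f /fT ifT//.
 have h0 : 0 <= 90 * eta * C0 * remc a S (hB n B N w) by pos; exact: remc_ge0.
 move: W; rewrite ler_norml => /andP[W _]; move: h0 W.
 rewrite /V /Th /DV -/rs -/is' -/(hB n B N w) -/C0 -/S; lra.
have fle w : 0 <= f (hB n B N w) <= 2 * C0 + 90 * C0 * (S + 1).
 rewrite fT_ge0//=; rewrite /f /fT; case: ifP => [c1|_]; last by lra.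
 have /ler_normlP[_ W] := Wt_bnd a0 lam i phi ep0 Rm1 rR c1.
 have r1 : remc a S (hB n B N w) <= S + 1.
  have := clk_ge0 a0 (hB n B N w) => c0; rewrite /remc mxl; last by move: c1; rewrite -/S; lra.
  by lra.
 have h0 : 90 * eta * C0 * remc a S (hB n B N w) <= 90 * C0 * (S + 1).
  have -> : 90 * eta * C0 * remc a S (hB n B N w) = 90 * C0 * (eta * remc a S (hB n B N w)) by ring.
  apply: ler_wpM2l; first by lra.
  apply: le_trans r1; rewrite ler_piMl//; exact: remc_ge0.
 by move: W; rewrite -/C0 -/S; lra.
have if' : intg (P n) (fun w => f (hB n B N w)).
 apply: (ibnd (2 * C0 + 90 * C0 * (S + 1))) => // w; have /andP[h1 h2] := fle w.
 by rewrite ger0_norm.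
have iV : intg (P n) V by exact: intg_bnd VC.
have ib : intg (P n) bd by apply: (ibnd 1) => // w; rewrite /bd indicE; case: (_ \in _); rewrite ?normr1 ?normr0.
have ic : intg (P n) (fun=> C0 - C0 * (10 * (M%:R * Rm * eta))).
 by apply: (ibnd `|C0 - C0 * (10 * (M%:R * Rm * eta))|) => // w.
have Ef : Int (P n) (fun w => f (hB n B N w)) <= f [:: n].
 rewrite -lee_fin (Rint_fin if').
 apply: (supermart kp n0 (mc n0) (act := act1 a n B S) (f := f)).
 - by move=> h; exact: fT_ge0.
 - exact: (fT_super kp a0 phi ep0 Rm1 rR iR e01 Hx).
have Eb : Int (P n) bd <= eta.
 rewrite /bd /Rintegral integral_indic ?setIT//; last exact: (mBad B S n0).
 by rewrite -lee_fin fineK// fin_num_measure//; exact: (mBad B S n0).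
have := Rint_le (intgB (intgD iV ic) (intgZ (2 * C0) ib)) if' fge.
rewrite RintB//; [|exact: intgD|exact: intgZ].
rewrite RintD// Ecst RintZ// => H.
have h1 := le_trans H Ef; rewrite /f (fT_init a n M lam r i phi eta Rm ep0) -/S -/C0 in h1.
have h2 : 2 * C0 * Int (P n) bd <= 2 * C0 * eta by apply: ler_wpM2l => //; lra.
rewrite /K in etK; lra.
Qed.

Lemma trig_bound (g : (nat -> R) -> R) : trig M g -> exists C, forall v, `|g v| <= C.
Proof.
elim=> [lam phi|f1 f2 _ [C1 H1] _ [C2 H2]|c f _ [C H]].
- by exists 1 => v; rewrite ler_norml cos_geN1 cos_le1.
- by exists (C1 + C2) => v; apply: (le_trans leND); apply: lerD.
- by exists (`|c| * C) => v; rewrite normrM ler_wpM2l.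
Qed.

Lemma trig_meas (g : (nat -> R) -> R) d (U : measurableType d) (D : nat -> U -> R) : (forall j, meas (D j)) ->
 trig M g -> meas (fun w => g (fun j => D j w)).
Proof.
move=> mD; elim=> [lam phi|f1 f2 _ H1 _ H2|c f _ H].
- apply: measurableT_comp; first by apply: cmf; exact: continuous_cos.
 apply: measurable_funD; last exact: measurable_cst.
 by apply: measurable_sum => j; apply: measurable_funM => //; exact: measurable_cst.
- exact: measurable_funD.
- by apply: measurable_funM => //; exact: measurable_cst.
Qed.

Context (dO : measure_display) (O : measurableType dO) (PO : probability O R) (xi : R -> O -> R).
Hypothesis LV : levy_process PO Pi b sg2 xi.

Definition DX (j : nat) (w : O) := xi (j.+1%:R * ep) w - xi (j%:R * ep) w.
Lemma mDX j : meas (DX j).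
Proof. by apply: measurable_funB; exact: LV.1. Qed.
Definition En (g : (nat -> R) -> R) (B : R) n N := Int (P n) (fun w => g (dv (hB n B N w))).
Definition EX (g : (nat -> R) -> R) := Int PO (fun w => g (fun j => DX j w)).
Lemma tri_cos lam phi : tri (En (fun v => cos (\sum_(0 <= j < M) lam j * v j + phi)))
 (EX (fun v => cos (\sum_(0 <= j < M) lam j * v j + phi))).
Proof.
rewrite /EX /DX (levy_trig M lam phi LV (ltW ep0)).
set rs := ep * \sum_(0 <= j < M) RePhi Pi sg2 (lam j); set is' := ep * \sum_(0 <= j < M) ImPhi Pi b (lam j).
move=> e e0; have e1 : 0 < e * expR (- rs) by pos.
have [B1 H1] := trig_upper lam (is' + phi) e1; have [B2 H2] := trig_upper lam (is' + phi + pi) e1.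
exists (Num.max B1 B2) => B; rewrite ge_max => /andP[b1 b2].
apply: ev_imp (ev_and (ev_ge 1) (ev_and (H1 B b1) (H2 B b2))) => n [n0 [h1 h2]].
apply: ev_imp (ev_and h1 h2) => N []; rewrite /En.
set c := fun v : nat -> R => cos (\sum_(0 <= j < M) lam j * v j + phi).
set E := Int (P n) (fun w => c (dv (hB n B N w))).
have ic : intg (P n) (fun w => c (dv (hB n B N w))).
 apply: (ibnd 1); first exact: (mhB B N (fun h => c (dv h)) n0).
 by move=> w; rewrite /c ler_norml cos_geN1 cos_le1.
have -> : (fun w => expR (- rs) * cos (\sum_(0 <= j < M) lam j * dv (hB n B N w) j - is' + (is' + phi))) =
 fun w => expR (- rs) * c (dv (hB n B N w)).
 by apply/funext => w; rewrite /c addrA subrK.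
have -> : (fun w => expR (- rs) * cos (\sum_(0 <= j < M) lam j * dv (hB n B N w) j - is' + (is' + phi + pi))) =
 fun w => - expR (- rs) * c (dv (hB n B N w)).
 apply/funext => w; rewrite /c; set Y := \sum_(0 <= j < M) _.
 by rewrite (_ : Y - is' + (is' + phi + pi) = (Y + phi) + pi) ?cosDpi ?mulrN ?mulNr//; ring.
rewrite !RintZ// cosDpi -/E => k1 k2.
have er : expR rs * expR (- rs) = 1 by rewrite -expRD subrr expR0.
have r0 := expR_gt0 rs.
have j1 := ler_wpM2l (ltW r0) k1; have j2 := ler_wpM2l (ltW r0) k2.
rewrite mulrA er mul1r mulrDr in j1; rewrite mulrA mulrN er mulN1r mulrDr in j2.
have E1 : expR rs * (e * expR (- rs)) = e by rewrite mulrCA er mulr1.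
rewrite E1 in j1 j2; rewrite mulrN in j2.
by rewrite ler_norml; apply/andP; split; lra.
Qed.

Lemma intg_En g B n N C : (0 < n)%N -> (forall v, `|g v| <= C) -> intg (P n) (fun w => g (dv (hB n B N w))).
Proof. by move=> n0 gC; apply: (ibnd C) => //; exact: (mhB B N (fun h => g (dv h)) n0). Qed.
Lemma intg_EX g C : trig M g -> (forall v, `|g v| <= C) -> intg PO (fun w => g (fun j => DX j w)).
Proof. by move=> tg gC; apply: (ibnd C) => //; apply: (trig_meas mDX). Qed.
Lemma tri_trig g : trig M g -> tri (En g) (EX g).
Proof.
elim=> [lam phi|f1 f2 t1 H1 t2 H2|c f t1 H]; first exact: tri_cos.
- have [C1 b1] := trig_bound t1; have [C2 b2] := trig_bound t2.
 rewrite /EX RintD; [|exact: intg_EX b1|exact: intg_EX b2].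
 apply: tri_eq (triD H1 H2); exists 0 => B _; apply: ev_imp (ev_ge 1) => n n0 N.
 by rewrite /En RintD//; [exact: intg_En b1|exact: intg_En b2].
- have [C1 b1] := trig_bound t1; rewrite /EX RintZ; last exact: intg_EX b1.
 apply: tri_eq (triZ c H); exists 0 => B _; apply: ev_imp (ev_ge 1) => n n0 N.
 by rewrite /En RintZ//; exact: intg_En b1.
Qed.

(** Trigonometric approximations bounded everywhere by C + 1 and close to G on |v| <= k serve both
    sides: dominated convergence for xi, which also yields measurability, and for the chain the box
    k >= 2*B1, which its increments leave only on the bad event for the fixed range B1. *)
Lemma fdd G C : (forall v, `|G v| <= C) -> (forall W, blip M W G) ->
 meas (fun w => G (fun j => DX j w)) /\ tri (En G) (EX G).
Proof.
move=> GC lipG; have C0 : 0 <= C by apply: le_trans (GC (fun=> 0)).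
have HT k : exists T, trig M T /\ (forall v, `|T v| <= C + k.+1%:R^-1) /\
  forall v, (forall j, (j < M)%N -> `|v j| <= k%:R) -> `|G v - T v| <= k.+1%:R^-1.
 have [T' tT [h1 h2]] := trig_dense GC lipG (e := k.+1%:R^-1) (B := k%:R) ltac:(by pos) ltac:(by []).
 by exists T'.
have [Tk HTk] := choice HT.
have cvT v : Tk ^~ v @ \oo --> G v.
 pose V := \sum_(0 <= j < M) `|v j|.
 have vV j : (j < M)%N -> `|v j| <= V.
  by move=> jM; rewrite /V (bigD1_seq j) ?iota_uniq ?mem_index_iota//= lerDl sumr_ge0.
 apply/cvgnE => e e0; apply: ev_imp (ev_and (ev_ger V) (ev_ger e^-1)) => k [kV ke].
 have [_ [_ H]] := HTk k; rewrite distrC; apply: le_trans (H v _) _.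
  by move=> j jM; apply: le_trans (vV j jM) kV.
 rewrite -[leRHS]invrK lef_pV2 ?posrE ?invr_gt0 ?ltr0n//.
 by apply: (le_trans ke); rewrite ler_nat.
have Tb k v : `|Tk k v| <= C + 1.
 have [_ [H _]] := HTk k; apply: (le_trans (H v)); rewrite lerD2l invf_le1 ?ltr0n// ler1n.
 done.
have mTk k : meas (fun w => Tk k (fun j => DX j w)) by apply: (trig_meas mDX); case: (HTk k).
have mG : meas (fun w => G (fun j => DX j w)).
 by apply: (measurable_fun_cvg (h := fun k w => Tk k (fun j => DX j w))) => // w _; exact: cvT.
split=> // e e0; pose e' := e / (2 * C + 5).
have e'0 : 0 < e' by rewrite divr_gt0//; lra.
have i1 : intg PO (fun=> C + 1) by apply: (ibnd `|C + 1|).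
have [iG cG] := Rint_dctT mTk mG (fun w => cvT (fun j => DX j w)) i1 (fun k w => Tb k _).
have [B1 B10 HB1] := exit_small S0 e'0.
have [k Hk'] := ev_and ((cvgnE _ _).1 cG e' e'0) (ev_and (ev_ger (2 * B1)) (ev_ger (e'^-1))).
have [h1 [h2 h3]] := Hk' k (leqnn k).
have [tT [_ HT2]] := HTk k.
have [B2 HB2] := tri_trig tT e'0.
exists (Num.max B1 B2) => B; rewrite ge_max => /andP[b1 b2].
apply: ev_imp (ev_and (ev_ge 1) (ev_and (HB1 B1 (lexx _)) (HB2 B b2))) => n [n0 [PB]].
apply: ev_imp => N h4.
pose bd : T n -> R := fun w => \1_(Bad n B1 S) w.
have mbd : meas bd by apply: measurable_indic; exact: (mBad B1 S n0).
have ib : intg (P n) bd by apply: (ibnd 1) => // w; rewrite /bd indicE; case: (_ \in _); rewrite ?normr1 ?normr0.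
have Eb : Int (P n) bd <= e'.
 rewrite /bd /Rintegral integral_indic ?setIT//; last exact: (mBad B1 S n0).
 by rewrite -lee_fin fineK// fin_num_measure//; exact: (mBad B1 S n0).
have iGn := intg_En B N n0 GC; have iTn := intg_En B N n0 (Tb k).
have ke : k.+1%:R^-1 <= e'.
 rewrite -[leRHS]invrK lef_pV2 ?posrE ?invr_gt0 ?ltr0n//.
 by apply: (le_trans h3); rewrite ler_nat.
have D w : `|G (dv (hB n B N w)) - Tk k (dv (hB n B N w))| <= e' + (2 * C + 1) * bd w.
 have [nb|nb] := pselect (Bad n B1 S w).
  have -> : bd w = 1 by rewrite /bd indicE mem_set.
  apply: (le_trans (ler_normB _ _)); have := GC (dv (hB n B N w)); have := Tb k (dv (hB n B N w)); lra.
 have -> : bd w = 0 by rewrite /bd indicE memNset.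
 rewrite mulr0 addr0; have [_ [xp xr]] := not_Bad nb.
 apply: le_trans ke; apply: HT2 => j jM; apply: le_trans h2.
 by rewrite /hB (act1_mono b1 xr); exact: dl_bnd.
have h5 : `|En G B n N - En (Tk k) B n N| <= (2 * C + 2) * e'.
 rewrite /En -RintB//; apply: le_trans (Rint_norm_le (intgB iGn iTn) _ D) _.
  by apply: intgD; [apply: (ibnd `|e'|)|exact: intgZ].
 rewrite RintD; [|by apply: (ibnd `|e'|)|exact: intgZ].
 rewrite Ecst RintZ//; have : (2 * C + 1) * Int (P n) bd <= (2 * C + 1) * e' by apply: ler_wpM2l => //; lra.
 lra.
have -> : En G B n N - EX G = (En G B n N - En (Tk k) B n N) + ((En (Tk k) B n N - EX (Tk k)) + (EX (Tk k) - EX G)) by ring.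
apply: (le_trans leND); apply: (via ((2 * C + 2) * e' + (e' + e'))).
 by apply: lerD => //; apply: (le_trans leND); apply: lerD.
have : (2 * C + 5) * e' = e by rewrite /e'; field; rewrite gt_eqF//; lra.
lra.
Qed.

End FddTrig.

(** * Convergence in distribution of the path and the absorption time *)

Section Tail.
Context (K : nat) (th be : R).
Hypotheses (K0 : (0 < K)%N) (acc : forall n, (1 <= n)%N -> (0 < P n (\bigcup_i [set w | (X n i w <= K)%N]))%E)
 (th0 : 0 < th) (thbe : th < be) (Hbe : exp_moment_bound p a be) (thga : th < gm) (Psith : Psi Pi b sg2 th < 0).

(** Finitely many states, and [U] decreases with the horizon, so the largest N0 and the smallest q
    work for all. *)
Lemma access_unif K1 : exists N0 q, 0 < q /\ forall x, (K < x)%N -> (x <= K1)%N -> q <= 1 - U p K N0 x.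
Proof.
elim: K1 => [|k [N1 [q1 [q10 H1]]]].
 by exists 0%N, 1; split => // x Kx; rewrite leqn0 => /eqP x0; rewrite x0 in Kx.
have [Kk|kK] := ltnP K k.+1; last first.
 by exists 0%N, 1; split => // x Kx xk; have := leq_trans Kx (leq_trans xk kK); rewrite ltnn.
have [N2 HN2] := access_U kp (isT : (0 < k.+1)%N) (mc (isT : (1 <= k.+1)%N)) Kk (acc (isT : (1 <= k.+1)%N)).
exists (maxn N1 N2), (Num.min q1 (1 - U p K N2 k.+1)); split; first by rewrite lt_min q10 subr_gt0.
move=> x Kx; have x0 : (0 < x)%N by exact: leq_trans Kx.
rewrite leq_eqVlt => /orP[/eqP xk|xk].
 rewrite -xk ge_min; apply/orP; right; rewrite lerD2l lerN2.
 by apply: U_mono => //; exact: leq_maxr.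
rewrite ge_min; apply/orP; left; apply: le_trans (H1 x Kx xk) _; rewrite lerD2l lerN2.
by apply: U_mono => //; exact: leq_maxl.
Qed.

Lemma jump_unif K1 kR : 0 < kR -> exists Rb, (0 < Rb)%N /\
 forall x, (K < x)%N -> (x <= K1)%N -> Esum (p x) (fun y => ind (Rb < y)%N) <= kR.
Proof.
move=> kR0; have sI x r : (0 < x)%N -> summ (p x) (fun y => ind (r < y)%N : R).
 by move=> x0; apply: (@summ_bnd _ _ _ 1) => [|k _]; [exact: kern|rewrite ger0_norm ?ind_ge0 ?ind_le1].
elim: K1 => [|k [R1 [R10 H1]]].
 by exists 1%N; split => // x Kx; rewrite leqn0 => /eqP x0; rewrite x0 in Kx.
have [q0 [q1 q2]] := kern kp (isT : (0 < k.+1)%N).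
have [R2 HR2] := (cvgnE _ _).1 q2 _ kR0.
exists (maxn R1 R2); split; first by rewrite leq_max R10.
move=> x Kx; have x0 : (0 < x)%N by exact: leq_trans Kx.
have mono r : (r <= maxn R1 R2)%N -> Esum (p x) (fun y => ind (maxn R1 R2 < y)%N) <= Esum (p x) (fun y => ind (r < y)%N).
 move=> rr; have [s0 [s1 _]] := kern kp x0.
 apply: le_Esum => //; [exact: sI|exact: sI|].
 move=> y _; case: (ltnP (maxn R1 R2) y) => h /=; last exact: ind_ge0.
 by rewrite (leq_ltn_trans rr h).
rewrite leq_eqVlt => /orP[/eqP xk|xk]; last by apply: le_trans (mono R1 (leq_maxl _ _)) (H1 x Kx xk).
apply: (le_trans (mono R2 (leq_maxr _ _))); rewrite xk.
have Q := kern kp (isT : (0 < k.+1)%N).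
have sJ : summ (p k.+1) (fun y => ind (y <= R2)%N : R).
 by apply: (@summ_bnd _ _ _ 1) => // y _; rewrite ger0_norm ?ind_ge0 ?ind_le1.
have -> : Esum (p k.+1) (fun y => ind (R2 < y)%N) = 1 - Esum (p k.+1) (fun y => ind (y <= R2)%N).
 rewrite -(Esum_cst 1 Q) -EsumB//; last exact: summ_cst.
 by congr Esum; apply/funext => y; rewrite ltnNge; case: leqP => _ /=; rewrite ?subrr ?subr0.
have h1 := HR2 R2.+1 (leqnSn _); move: h1; rewrite ler_norml => /andP[h1 _].
suff h2 : series (p k.+1) R2.+1 <= Esum (p k.+1) (fun y => ind (y <= R2)%N) by lra.
have cv := summ_cvg q1 sJ; apply: le_trans (nondecreasing_cvgn_le _ cv R2.+1).
 rewrite /series /= !big_nat; apply: ler_sum => i /= iR.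
 by rewrite -ltnS iR mulr1.
by apply/nondecreasing_seqP => i; rewrite /series /= big_nat_recr//= lerDl mulr_ge0// ind_ge0.
Qed.

(** [superE] for [f2] at level m0. The initial value is split into three parts of size e*m0/3: the
    exponential weight (S' large), Dn*N0 (n large) and kR*N0/q (Rb large). K1 is fixed first,
    because N0 and q depend on it. *)
Lemma tail_small eta e : 0 < eta -> eta <= 1 -> 0 < e -> exists K1 Rb, exists2 S1, 0 < S1 & forall S', S1 <= S' ->
 ev (fun n => (P n (\bigcup_N [set w | badT a n K K1 Rb S' eta (sth (act2 a n K K1 Rb S' eta) (Hk (X n) N w))]) <= e%:E)%E).
Proof.
move=> et0 et1 e0; have [Cb [Cb0 HE]] := emb kp a0 Hbe.
have be0 : 0 < be by exact: lt_trans thbe.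
pose c' := - Psi Pi b sg2 th / 2; have c'0 : 0 < c' by have := Psith; rewrite /c'; lra.
pose c := Num.min (c' / 2) 1.
have c0 : 0 < c by rewrite lt_min ltr01 andbT; lra.
have cc' : 2 * c <= c' by have : c <= c' / 2 by [rewrite ge_min lexx]; lra.
have c1 : c <= 1 by rewrite ge_min lexx orbT.
have GE : (fun x => mm p a x (fun u => expR (th * u) - 1)) @ \oo --> Psi Pi b sg2 th.
 by apply: (gen_exp kp a0 LP HA1 HA2 be0 Cb0 HE) => //; exact: ltW.
have [K1 HK1] := ev_and (a_inf a0 ga0 rv 1) (ev_and (sm_exp kp HE (ltW th0) thbe) ((cvgnE _ _).1 GE _ c'0)).
have Hth x : (K1 < x)%N -> 1 <= a x /\ sm p x (fun u => expR (th * u)) /\ mm p a x (fun u => expR (th * u) - 1) <= - c'.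
 move=> /ltnW /HK1 [h1 [[_ h2] h3]]; split=> //; split=> //.
 by move: h3; rewrite ler_norml /c' => /andP[_]; lra.
have [C [C0 HC]] := potter_ge (PC_UC (reg_var_PC rv)) thga.
pose g := c' * expR (- C); have g0 : 0 < g by rewrite mulr_gt0// expR_gt0.
(* The least value of [f2] on the three kinds of bad history: a jump beyond Rb, a state above eta*n,
   more than eta*a_n steps. *)
pose m0 := Num.min 1 (Num.min (expR (th * ln eta)) (g * eta)).
have m00 : 0 < m0 by rewrite !lt_min ltr01 expR_gt0 mulr_gt0.
have [N0 [q [q0 Hq]]] := access_unif K1.
pose kR := e * m0 / 3 * q / (N0%:R + 1).
have N01 : 0 < N0%:R + 1 :> R by rewrite ltr_wpDl.
have kR0 : 0 < kR by rewrite divr_gt0// mulr_gt0// divr_gt0// mulr_gt0.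
have kRN : kR / q * N0%:R <= e * m0 / 3.
 have -> : kR / q = e * m0 / 3 / (N0%:R + 1) by rewrite /kR; field; rewrite !gt_eqF.
 rewrite -mulrA; apply: ler_piMr; first by pos.
 by rewrite mulrC ler_pdivrMr// mul1r lerDl.
have [Rb [Rb0 HR]] := jump_unif K1 kR0.
exists K1, Rb.
have em : 0 < e * m0 / 3 by pos.
have [j1 Hj1] := expNc_small c0 (ler01 : 0 <= 1 :> R) em.
exists j1.+1%:R; first by pos.
move=> S' SS'; have S'0 : 0 < S' by apply: lt_le_trans SS'; rewrite ltr0n.
have eS : expR (- (c * S')) <= e * m0 / 3.
 apply: le_trans (Hj1 j1.+1 (leqnSn _)); rewrite mul1r ler_expR lerN2.
 by apply: ler_wpM2l => //; exact: ltW.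
pose Dn n := (expR (th * (ld Rb n)) + g / a n) / q.
pose e1 := e * m0 / 3 * q / (2 * (N0%:R + 1)).
have e10 : 0 < e1 by rewrite divr_gt0 ?mulr_gt0//.
have D1 : ev (fun n => expR (th * (ld Rb n)) <= e1).
 apply: ev_imp (ev_and (ev_ge 1) (ev_ger (expR (ln Rb%:R - ln e1 / th)))) => n [n1 h].
 have nR : 0 < n%:R :> R by pos.
 rewrite -[n%:R]lnK ?posrE// ler_expR in h.
 rewrite -[leRHS]lnK ?posrE// ler_expR.
 have : th * (ln Rb%:R - ln e1 / th) <= th * ln n%:R by rewrite ler_pM2l.
 have -> : th * (ln Rb%:R - ln e1 / th) = th * ln Rb%:R - ln e1 by field; rewrite gt_eqF.
 by rewrite mulrBr; lra.
have D2 : ev (fun n => g / a n <= e1).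
 apply: ev_imp (a_inf a0 ga0 rv (g / e1)) => n; rewrite ler_pdivrMr// => h.
 by rewrite ler_pdivrMr// mulrC.
apply: ev_imp (ev_and (ev_ge 1) (ev_and D1 D2)) => n [n0 [d1 d2]].
have ga0' : 0 <= g by exact: ltW.
have Hg x : (K1 < x)%N -> (x <= n)%N -> g / a n <= c' * expR (th * (ld x n)) / a x.
 move=> K1x xn; have x0 : (0 < x)%N by exact: leq_trans K1x.
 rewrite (_ : g / a n = c' * (expR (- C) / a n)); last by rewrite /g mulrA.
 rewrite -[X in _ <= X]mulrA; apply: ler_wpM2l; first exact: ltW.
 have E y : 0 < a y -> (a y)^-1 = expR (- ln (a y)) by move=> y0; rewrite expRN lnK.
 rewrite (E n)// (E x)// -!expRD ler_expR.
 by have := HC x n x0 xn; rewrite mulrBr; lra.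
have HD : expR (th * (ld Rb n)) + g / a n <= Dn n * q.
 by rewrite /Dn mulfVK// gt_eqF.
have Dn0 : 0 <= Dn n by rewrite divr_ge0// ?ltW// addr_gt0 ?expR_gt0 ?divr_gt0.
have DnN : Dn n * N0%:R <= e * m0 / 3.
 have h1 : Dn n <= 2 * e1 / q by rewrite /Dn ler_pM2r ?invr_gt0//; lra.
 have h2 : 2 * e1 / q = e * m0 / 3 / (N0%:R + 1) by rewrite /e1; field; rewrite !gt_eqF.
 rewrite h2 ler_pdivlMr// in h1; apply: le_trans h1.
 by rewrite ler_wpM2l// lerDl.
have := superE kp n0 (mc n0) (act := act2 a n K K1 Rb S' eta) (bad := badT a n K K1 Rb S' eta)
 (f := f2 p a n K K1 N0 Rb th c S' q kR g (Dn n)) (c := m0) m00.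
move=> H; apply: (le_trans (H _ _ _)).
- by move=> h; exact: (f2_ge0 kp a0 n K K1 N0 Rb th c S' q0 (ltW kR0) ga0' Dn0 h).
- by move=> h ah h0; exact: (f2_super kp a0 Hth th0 c0 cc' q0 Hq (ltW kR0) HR ga0' Hg Dn0 HD et1 Rb0 ah h0).
- move=> h /andP[Sc bd]; rewrite /f2 ltNge Sc /=.
 have W0 : 0 <= (Dn n + kR / q) * (if (0 < hd0 h)%N then wU p K N0 (hd0 h) else 0).
  rewrite mulr_ge0//; first by pos.
  by case: ifP => // h0; have /andP[] := wU_bnd K kp N0 h0.
 have c00 : 0 <= g / a n * (cnt a S' h)%:R by rewrite mulr_ge0// divr_ge0// ltW.
 have p0 : 0 <= pw n th (hd0 h) by exact: expR_ge0.
 case: ifPn bd => [_ _|nb /=].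
  by apply: (via 1); [rewrite ge_min lexx|lra].
 move=> /orP[hn|hc].
  apply: (via (pw n th (hd0 h))); last by lra.
  apply: (via (expR (th * ln eta))); first by rewrite !ge_min lexx orbT.
  have nR : 0 < n%:R :> R by pos.
  have hR : 0 < (hd0 h)%:R :> R by apply: lt_trans hn; rewrite mulr_gt0.
  rewrite /pw ler_expR ler_pM2l// -ln_div ?posrE// ler_ln ?posrE ?divr_gt0//.
  by rewrite ler_pdivlMr// ltW.
 apply: (via (g / a n * (cnt a S' h)%:R)); last by lra.
 apply: (via (g * eta)); first by rewrite !ge_min lexx !orbT.
 rewrite -mulrA ler_pM2l// ler_pdivlMl// mulrC; exact: ltW.
- rewrite f2_init// lee_fin ler_pdivrMr// mulrDl; lra.
Qed.

Lemma a_ratio (B d : R) : 0 < d -> ev (fun n => forall y, (0 < y)%N -> inr n B y ->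
 `|a y / a n - expR (gm * (ld y n))| <= d).
Proof.
move=> d0; have U := PC_UC (reg_var_PC rv).
pose W := expR (gm * `|B| + 1); have W0 : 0 < W by exact: expR_gt0.
pose d1 := Num.min 1 (d / W); have d10 : 0 < d1 by rewrite lt_min ltr01 divr_gt0.
have e0 : 0 < expR (- `|B|) by exact: expR_gt0.
apply: ev_imp (ev_and (ev_ge 1) (U (expR (- `|B|)) (expR `|B|) e0 d1 d10)) => n [n0 H] y y0 iy.
have nR : 0 < n%:R :> R by pos.
have yR : 0 < y%:R :> R by pos.
have iy' : `|ld y n| <= `|B| := le_trans iy (ler_norm _).
have yE : y%:R / n%:R = expR (ld y n) :> R by rewrite expRB !lnK.
move: (iy'); rewrite ler_norml => /andP[i1 i2].
have {}H : `|ln (a y) - ln (a n) - gm * (ld y n)| <= d1.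
 by apply: H; [rewrite -ler_pdivlMr//|rewrite -ler_pdivrMr//]; rewrite yE ler_expR.
have -> : a y / a n = expR (ln (a y) - ln (a n)) by rewrite expRB !lnK// posrE.
have d1d : W * d1 <= d by rewrite mulrC -ler_pdivlMr// ge_min lexx orbT.
apply: le_trans d1d; apply: (le_trans (expR_lip (W := gm * `|B| + 1) _ _)).
- have h1 : d1 <= 1 by rewrite ge_min lexx.
 have h2 := le_trans (ler_norm _) H.
 have h3 : gm * (ld y n) <= gm * `|B| by rewrite ler_pM2l.
 by lra.
- have h3 : gm * (ld y n) <= gm * `|B| by rewrite ler_pM2l.
 by lra.
- by rewrite ler_pM2l.
Qed.

Lemma minbnd (l : seq R) : all (fun x => 0 < x) l -> exists2 m, 0 < m & all (fun x => m <= x) l.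
Proof.
elim: l => [|x l IH] /=; first by exists 1.
move=> /andP[x0 /IH[m m0 hm]]; exists (Num.min x m); first by rewrite lt_min x0.
rewrite ge_min lexx/=; apply: sub_all hm => y; apply: le_trans; by rewrite ge_min lexx orbT.
Qed.

Definition xpath n w : R -> R := fun t => (stopped K (X n ^~ w) (trunc (a n * t)))%:R / n%:R.
Definition rpath n w : \bar R := (hit_time K (X n ^~ w) * ((a n)^-1)%:E)%E.
Definition cl2 (e : R) x r y s := close e x r y s /\ close e y s x r.
Lemma chain_good S B de d2 eta e' : 0 < S -> 0 < de -> 0 < d2 -> 0 < eta -> eta <= 1 -> 0 < e' ->
 (ev (fun n => (P n (Bad n B S) <= e'%:E)%E)) ->
 exists J0, exists2 es, 0 < es & forall M' (K1 Rb : nat), (0 < M')%N -> S / M'.+1%:R <= es ->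
 let ep := S / M'.+1%:R in
 ev (fun n => (P n (\bigcup_N [set w | badT a n K K1 Rb (M'%:R * ep) eta (sth (act2 a n K K1 Rb (M'%:R * ep) eta) (Hk (X n) N w))]) <= e'%:E)%E) ->
 ev (fun n => (0 < n)%N /\ (exists E, [/\ measurable E, (P n E <= (e' + e' + e' + e')%:E)%E &
  forall w, ~ E w -> goodx a n K K1 Rb M' J0 ep B de eta (X n ^~ w)]) /\
  (forall y, (0 < y)%N -> inr n B y ->
   [/\ (a y)^-1 <= ep, `|a y / a n - expR (gm * (ld y n))| <= d2 & (maxn K K1 < y)%N])).
Proof.
move=> S0 de0 d20 eta0 eta1 e'0 HB.
have [Cg Cg0 HCg] := factB_ev kp a0 HA1 HA2.
have [A A1' HA] := factT_ev kp a0 HA1 LP (ltr01 : 0 < 1 :> R).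
pose Cd := Cg / de + 2 * Cg / de ^+ 2 + A / de * Cg + 1.
have Cd0 : 0 <= Cd by rewrite /Cd; pos; lra.
have SP : 0 <= S + 1 by lra.
(* From the initial value of [fJ], so that more than J0 exits have probability at most e'. Likewise
   kc*ep is the initial value of [fN], which is small for a fine grid. *)
pose J0 := trunc (2 * Cd * (S + 1) / e').
pose kc := 6 * Cd * (1 + 2 * Cd * (S + 1)).
have kc0 : 0 <= kc by rewrite /kc; pos.
exists J0, (Num.min 1 (e' / (kc + 1))).
 by rewrite lt_min ltr01 divr_gt0//; lra.
move=> M' K1 Rb M0 epm ep HT; rewrite -/ep in epm.
have ep0 : 0 < ep by rewrite divr_gt0.
have ep1 : ep <= 1 by apply: le_trans epm _; rewrite ge_min lexx.
have epe : kc * ep <= e'.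
 apply: (via ((kc + 1) * ep)); first by rewrite ler_pM2r//; lra.
 by rewrite mulrC -ler_pdivlMr; [apply: (le_trans epm); rewrite ge_min lexx orbT|lra].
have MS : M'.+1%:R * ep = S by rewrite /ep mulrC divfK// pnatr_eq0.
have Hev := ev_inr (B : R) (ev_and HCg (ev_and HA (ev_and (a_inf a0 ga0 rv ep^-1) (ev_ge (maxn K K1).+1)))).
apply: ev_imp (ev_and (ev_and Hev (a_ratio B d20)) (ev_and HB HT)) => n [[[n0 H] Hr] [HBn HTn]].
split=> //; split; last first.
 move=> y y0 iy; have [_ [_ [ay Ky]]] := H y y0 iy; split => //; last exact: Hr.
 by rewrite -[leRHS]invrK lef_pV2 ?posrE ?invr_gt0.
have Hps x : (0 < x)%N -> `|ld x n| <= B ->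
 (a x)^-1 <= ep /\ forall l, `|mm p a x (fun u => ps ((l + u) / de) - ps (l / de))| <= Cd.
 move=> x0 xB; have [fB' [fT' [ax _]]] := H x x0 xB; split.
  by rewrite -[leRHS]invrK lef_pV2 ?posrE ?invr_gt0.
 move=> l; apply: le_trans (ps_step kp a0 l fB' de0 A1') _.
 by rewrite /Cd lerD2l.
pose EJ := \bigcup_N [set w | (J0 < eJ de (sth (act1 a n B S) (Hk (X n) N w)))%N].
pose EN := \bigcup_N [set w | (0 < enb a de ep (sth (act1 a n B S) (Hk (X n) N w)))%N].
have PJ : (P n EJ <= e'%:E)%E.
 have := superE kp n0 (mc n0) (act := act1 a n B S) (bad := fun h => (J0 < eJ de h)%N)
  (f := fJ a S de Cd) (c := J0.+1%:R) (ltr0Sn _ _).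
 rewrite (fJ_init _ _ _ _ (ltW S0)) => H'; apply: (le_trans (H' _ _ _)).
 + by move=> h; exact: fJ_ge0.
 + by apply: (fJ_super kp a0 (ep := ep)) => //; exact: ltW.
 + move=> h hJ; rewrite /fJ; have h1 : 0 <= edev de h by exact: ps_ge0.
  have h2 := remc_ge0 a S h; have : J0.+1%:R <= (eJ de h)%:R :> R by rewrite ler_nat.
  have : 0 <= 2 * edev de h + 2 * Cd * remc a S h by pos.
  by lra.
 + by rewrite lee_fin ler_pdivrMr// -ler_pdivrMl// [_^-1 * _]mulrC; apply: ltW; exact: truncnS_gt.
have PN : (P n EN <= e'%:E)%E.
 have := superE kp n0 (mc n0) (act := act1 a n B S) (bad := fun h => (0 < enb a de ep h)%N)
  (f := fN a S de ep Cd) (c := 1) ltr01.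
 rewrite (fN_init _ _ _ _ (ltW S0) ep0) => H'; apply: (le_trans (H' _ _ _)).
 + by move=> h; apply: fN_ge0 => //.
 + by apply: (fN_super kp a0) => //; exact: ltW.
 + move=> h hJ; rewrite /fN; have h1 : 0 <= edev de h by exact: ps_ge0.
  have h2 := remc_ge0 a S h; have : 1 <= (enb a de ep h)%:R :> R by rewrite ler1n.
  have h3 : 0 <= bud a de ep h by exact: mx_ge.
  have h4 : 0 <= 2 * ind (early a de ep h) * edev de h by rewrite /ind; case: early; pos.
  have : 0 <= 2 * Cd * bud a de ep h by pos.
  have : 0 <= 2 * Cd * (3 * ep) * (2 * edev de h + 2 * Cd * remc a S h) by pos.
  by lra.
 + rewrite lee_fin divr1; apply: le_trans epe; rewrite /kc le_eqVlt; apply/orP; left; apply/eqP; ring.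
pose ET := \bigcup_N [set w | badT a n K K1 Rb (M'%:R * ep) eta (sth (act2 a n K K1 Rb (M'%:R * ep) eta) (Hk (X n) N w))].
have mk (Q : pred (seq nat)) act : measurable (\bigcup_N [set w | Q (sth act (Hk (X n) N w))]).
 by apply: bigcup_measurable => N _; exact: (mHkset (mc n0) N (fun h => Q (sth act h))).
have mJ : measurable EJ := mk (fun h => (J0 < eJ de h)%N) _.
have mN : measurable EN := mk (fun h => (0 < enb a de ep h)%N) _.
have mT : measurable ET := mk (badT a n K K1 Rb (M'%:R * ep) eta) _.
have mB : measurable (Bad n B S) by exact: (mBad B S n0).
exists ((Bad n B S) `|` EJ `|` EN `|` ET); split.
- by do 3!apply: measurableU => //.
- have U2 (A1 A2 : set (T n)) (x1 x2 : R) : measurable A1 -> measurable A2 -> (P n A1 <= x1%:E)%E -> (P n A2 <= x2%:E)%E ->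
   (P n (A1 `|` A2) <= (x1 + x2)%:E)%E.
  by move=> m1 m2 p1 p2; rewrite EFinD; apply: (le_trans (measureU2 _ m1 m2)); exact: leeD.
 have mBJ := measurableU _ _ mB mJ; have mBJN := measurableU _ _ mBJ mN.
 exact: (U2 _ _ _ _ mBJN mT (U2 _ _ _ _ mBJ mN (U2 _ _ _ _ mB mJ HBn PJ) PN) HTn).
move=> w nE.
have [X0 [Xp rg]] := not_Bad (fun h => nE (or_introl (or_introl (or_introl h)))).
split => //.
- by rewrite MS.
- move=> N; rewrite MS; split.
  rewrite leqNgt; apply/negP => h; apply: nE; left; left; right; by exists N.
 apply/eqP; rewrite -leqn0 leqNgt; apply/negP => h; apply: nE; left; right; by exists N.
- move=> N; apply/negP => h; apply: nE; right; by exists N.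
Qed.

(** The pathwise reconstruction holds off four events of probability e'/4 each: leaving the range,
    too many exits, an early exit, a bad tail. *)
Lemma chain_close e e' : 0 < e -> e <= 1 -> 0 < e' -> exists2 S0, 0 < S0 & forall S, S0 <= S ->
 exists Bc, exists M0, forall M', (M0 <= M')%N -> forall B, Bc <= B ->
 ev (fun n => (0 < n)%N /\ exists E, [/\ measurable E, (P n E <= e'%:E)%E & ev (fun N => forall w, ~ E w ->
  let ep := S / M'.+1%:R in let D := DV a ep (hB M'.+1 ep B N w) in
  cl2 e (xpath w) (rpath w) (recY ep gm M'.+1 (psum D)) (recT ep gm (psum D) M'.+1)%:E)]).
Proof.
move=> e0 e1 e'0; pose e4 := e' / 4; have e40 : 0 < e4 by rewrite divr_gt0.
pose eta := e / (4 * expR 1).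
have x1' : 1 < expR 1 :> R by rewrite expR_gt1.
have eta0 : 0 < eta by rewrite divr_gt0// mulr_gt0// expR_gt0.
have etae : eta * expR 1 = e / 4 by rewrite /eta invfM mulrA divfK// gt_eqF// expR_gt0.
have eta4 : eta <= e / 4 by rewrite -etae ler_peMr// ltW.
have eta1 : eta <= 1 by lra.
have [K1 [Rb [S1 S10 HS1]]] := tail_small eta0 eta1 e40.
exists (2 * S1) => [|S SS]; first by pos.
have S0 : 0 < S by lra.
have [Bc Bc0 HBc] := exit_small (ltW S0) e40.
pose Fm := expR (gm * Bc); have Fm0 : 0 < Fm by exact: expR_gt0.
pose d2 := e / (16 * S); have d20 : 0 < d2 by rewrite divr_gt0// mulr_gt0.
have [de de0 /= /and4P[de1 de2 de3 _]] := @minbnd [:: 1 / 2; e / (2 * expR Bc); d2 / (Fm * gm)]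
 ltac:(by rewrite /= !divr_gt0// ?mulr_gt0// expR_gt0).
have [J0 [es es0 HG]] := chain_good S0 de0 d20 eta0 eta1 e40 (HBc Bc (lexx _)).
pose D := d2 + Fm * (gm * de).
have DS : 2 * D * S <= e / 4.
 have : Fm * (gm * de) <= d2 by rewrite mulrA mulrC -ler_pdivlMr// mulr_gt0.
 have d2S : d2 * S = e / 16 by rewrite /d2; field; rewrite gt_eqF.
 move=> h; have : D * S <= (d2 + d2) * S by rewrite ler_pM2r// lerD2l.
 by lra.
have D0 : 0 < D by rewrite /D ltr_pwDl// !mulr_ge0// ltW.
pose kk := J0.+1%:R * (2 * Fm + D) + Fm.
have kk0 : 0 < kk by rewrite ltr_pwDr// mulr_ge0// addr_ge0 ?mulr_ge0// ltW.
have [es' es'0 /= /and3P[es1 es2 _]] := @minbnd [:: es; e / 4 / kk] ltac:(by rewrite /= es0 !divr_gt0).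
have [M0 HM0] := ev_ger (S / es').
exists Bc, M0.+1 => M' MM B BB; set ep := S / M'.+1%:R.
have M'0 : (0 < M')%N by exact: leq_trans MM.
have ep0 : 0 < ep by rewrite divr_gt0.
have epe : ep <= es'.
 rewrite /ep ler_pdivrMr// mulrC -ler_pdivrMr//; apply: HM0; apply: leqW; exact: ltnW.
have MS : M'.+1%:R * ep = S by rewrite /ep mulrC divfK// pnatr_eq0.
have epM : ep <= M'%:R * ep by rewrite ler_peMl ?(ltW ep0)// ler1n.
have MS' : M'%:R * ep <= S by rewrite -MS ler_pM2r// ler_nat.
have HT : ev (fun n => (P n (\bigcup_N [set w | badT a n K K1 Rb (M'%:R * ep) eta (sth (act2 a n K K1 Rb (M'%:R * ep) eta) (Hk (X n) N w))]) <= e4%:E)%E).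
 (* The tail starts at clock M'*ep = S - ep, which is at least S/2 >= S1 as M' >= 1. *)
 apply: HS1; have := MS; rewrite -natr1 mulrDl mul1r.
 have := epM; have := SS; set z := M'%:R * ep; lra.
have := HG M' K1 Rb M'0 (le_trans epe es1) HT.
apply: ev_imp => n [n0 [[E [mE PE HE]] HR]]; split => //; exists E; split => //.
 by apply: (le_trans PE); rewrite lee_fin /e4; lra.
have [N0 HN0] := act1_end a0 S Bc n0.
exists N0 => N NN w nE /=.
have gx := HE w nE; have [g1 g2 g3 g4 g5] := gx.
rewrite -/ep in gx g3 *.
have EN : hB M'.+1 ep B N w = sth (act1 a n Bc (M'.+1%:R * ep)) (hist (X n ^~ w) N).
 by rewrite /hB; exact: (act1_mono BB g3).
rewrite EN; apply: (@chain_recon R a gm n K K1 Rb M' J0 ep Bc de eta ep d2) => //; try exact: ltW.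
- by rewrite [leLHS]MS MS; apply: HN0 => //; rewrite -MS.
- by move: de2; rewrite ler_pdivlMr ?mulr_gt0 ?expR_gt0//; lra.
- apply: (via (eta * expR 1)); last by lra.
 by rewrite ler_pM2l// ler_expR; lra.
- rewrite /eT -/Fm -/D.
 have h1 : 2 * D * (M'%:R * ep) <= 2 * D * S by rewrite ler_pM2l// mulr_gt0.
 have h2 : kk * ep <= e / 4.
  by rewrite mulrC -ler_pdivlMr//; exact: le_trans es2.
 move: h2; rewrite /kk mulrDl -mulrA => h2; have : ep * Fm = Fm * ep by exact: mulrC.
 move=> ->; rewrite -(addrA (2 * D * _)); apply: (via (e / 4 + e / 4 + e / 4)); last by lra.
 by apply: lerD => //; apply: lerD => //; exact: le_trans DS.
Qed.

Context (dO : measure_display) (O : measurableType dO) (PO : probability O R) (xi : R -> O -> R).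
Hypotheses (LV : levy_process PO Pi b sg2 xi) (DR : drifts_to_minus_infty PO xi).

Lemma fdd' M ep G C : 0 < ep -> (forall v, `|G v| <= C) -> (forall W, blip M W G) ->
 meas (fun w => G (fun j => DX ep xi j w)) /\
 tri (fun B n N => Int (P n) (fun w => G (DV a ep (hB M ep B N w))))
  (Int PO (fun w => G (fun j => DX ep xi j w))).
Proof.
by move=> ep0 GC lip; exact: (@fdd M _ ep0 _ _ _ _ LV G C GC lip).
Qed.

Section OneF.
Context (F : (R -> R) -> \bar R -> R) (B : R).
Hypotheses (FB : forall x r, `|F x r| <= B) (FC : seqcont F).

Let B0 : 0 <= B. Proof. exact: le_trans (FB (fun=> 0) 0%E). Qed.
Definition PhiX w := F (Yproc gm (fun s => xi s w)) (I_infty gm (fun s => xi s w)).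
Definition PhiN n (w : T n) := Fx F K n (a n) (X n ^~ w).
Definition GS k S M' (D : nat -> R) := Grec (S / M'.+1%:R) gm F k M'.+1 D.
Lemma GS_bnd k S M' D : 0 < S -> `|GS k S M' D| <= B.
Proof. by move=> S0; apply: Grec_bnd => //; rewrite divr_gt0. Qed.
Lemma mPhiN n : (0 < n)%N -> meas (@PhiN n).
Proof.
move=> n0; apply: (@measurable_fun_cvg _ _ R _ (fun N w => Fx F K n (a n) (froz (Hk (X n) N w)))).
 by move=> N; exact: (mfHk (mc n0) N (fun h => Fx F K n (a n) (froz h))).
by move=> w _; exact: (@Fx_cvg R F K n (a n) FC (a0 n) (X n ^~ w)).
Qed.

Lemma mGX k S M' : 0 < S -> meas (fun w => GS k S M' (fun j => DX (S / M'.+1%:R) xi j w)).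
Proof.
move=> S0; have ep0 : 0 < S / M'.+1%:R by pos.
have [] := @fdd' M'.+1 _ (GS k S M') B ep0 (fun v => GS_bnd k M' v S0) => // W.
exact: (Grec_blip ep0 ga0 FB).
Qed.

(** Off the exceptional event the reconstructed value of [Fk] exceeds that at the chain's path by at
    most k*e, and [Fk] is below [F]; on it the bound 2B is used. [fdd'] then passes to the
    increments of xi. *)
Lemma chain_lower k e1 : 0 < e1 -> exists2 S0, 0 < S0 & forall S, S0 <= S -> exists M0, forall M', (M0 <= M')%N ->
 ev (fun n => Int PO (fun w => GS k S M' (fun j => DX (S / M'.+1%:R) xi j w)) - e1 <=
   Int (P n) (@PhiN n)).
Proof.
move=> e10; have e3 : 0 < e1 / 3 by pos.
pose e := Num.min 1 (e1 / 3 / k.+1%:R).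
have e0 : 0 < e by rewrite lt_min ltr01 divr_gt0.
have ele : e <= 1 by rewrite ge_min lexx.
have ke : k%:R * e <= e1 / 3.
 apply: (via (k.+1%:R * e)); first by rewrite ler_pM2r// ler_nat.
 by rewrite mulrC -ler_pdivlMr// ge_min lexx orbT.
pose e' := e1 / 3 / (2 * B + 1); have B1 : 0 < 2 * B + 1 by have := B0; lra.
have e'0 : 0 < e' by rewrite divr_gt0.
have Be' : 2 * B * e' <= e1 / 3.
 apply: (via ((2 * B + 1) * e')); first by rewrite ler_pM2r//; lra.
 by rewrite /e' mulrC divfK// gt_eqF.
have [S0 S00 HS] := chain_close e0 ele e'0.
exists S0 => // S SS; have Sp : 0 < S by exact: lt_le_trans SS.
have [Bc [M0 HM]] := HS S SS; exists M0 => M' MM.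
have ep0 : 0 < S / M'.+1%:R by pos.
have [_ /(_ _ e3) [B1' HB1]] := @fdd' M'.+1 _ (GS k S M') B ep0 (fun v => GS_bnd k M' v Sp) (fun W => Grec_blip ep0 ga0 FB k M'.+1 W).
pose Bm := Num.max Bc B1'.
have Bmc : Bc <= Bm by rewrite le_max lexx.
have Bm1 : B1' <= Bm by rewrite le_max lexx orbT.
apply: ev_imp (ev_and (HM M' MM Bm Bmc) (HB1 Bm Bm1)) => n [[n0 [E [mE PE HE]]] HN].
have [N /= HNN] := ev_and HE HN; have [H1 H2] := HNN N (leqnn N); clear HE HN HNN.
set g := fun w : T n => GS k S M' (DV a (S / M'.+1%:R) (hB M'.+1 (S / M'.+1%:R) Bm N w)).
rewrite -/g in H2.
have mg : meas g.
 exact: (mfHk (mc n0) N (fun h => GS k S M' (DV a (S / M'.+1%:R) (sth (act1 a n Bm (M'.+1%:R * (S / M'.+1%:R))) h)))).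
have gB w : `|g w| <= B by exact: GS_bnd.
have pB m (w : T m) : `|PhiN w| <= B by exact: FB.
have ig : intg (P n) g := intg_bnd _ mg gB.
have ip : intg (P n) (@PhiN n) := intg_bnd _ (mPhiN n0) (@pB n).
have mI : meas (\1_E : T n -> R) by exact: measurable_indic.
have iI : intg (P n) (\1_E : T n -> R).
 by apply: (ibnd (1)) => // w; rewrite indicE; case: (_ \in _); rewrite ?normr1 ?normr0.
have ic : intg (P n) (fun=> k%:R * e) by apply: (ibnd (`|k%:R * e|)).
have iz : intg (P n) (fun w => 2 * B * (\1_E w : R)) by exact: intgZ.
have icz : intg (P n) (fun w => k%:R * e + 2 * B * (\1_E w : R)) by exact: intgD.
have E1 : Int (P n) (\1_E : T n -> R) <= e'.
 rewrite -lee_fin Rint_fin// (_ : (\int[P n]_x (\1_E x)%:E)%E = P n E)//.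
 by rewrite integral_indic// setIT.
have key : Int (P n) g <= Int (P n) (fun w => PhiN w + (k%:R * e + 2 * B * (\1_E w : R))).
 apply: Rint_le => //.
  exact: intgD.
 move=> w; rewrite indicE; have [_|wE] := boolP (w \in E); last first.
  have wE' : ~ E w by move=> /mem_set; rewrite (negbTE wE).
  have [C1 C2] := H1 w wE'; rewrite mulr0 addr0.
  have ax := conj (@xpath_cadlag R K n (a n) (a0 n) (X n ^~ w)) (hit_ge0 K (a0 n) (X n ^~ w)).
  apply: (via (Fk F k (xpath w) (rpath w) + k%:R * e)).
   by apply: (Fk_lip FB) => //; exact: ltW.
  by rewrite lerD2r; exact: (Fk_le FB).
 have := gB w; have := pB _ w; rewrite !ler_norml mulr1 => /andP[h1 h2] /andP[h3 h4].
 have : 0 <= k%:R * e by pos.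
 lra.
rewrite RintD// RintD// Ecst RintZ// in key.
have h5 : 2 * B * Int (P n) (\1_E : T n -> R) <= e1 / 3.
 by apply: le_trans Be'; apply: ler_wpM2l => //; rewrite mulr_ge0.
move: H2; rewrite ler_norml => /andP[h6 h7].
by move: key h5 h6; rewrite /EX/=; lra.
Qed.

(** The thresholds of [xi_recon] depend on the path, so three dominated limits are taken in turn:
    the lower limit in the grid size, then the horizon, then the Lipschitz index. All functions
    integrated on the way are measurable. *)
Lemma xi_lower e1 : 0 < e1 -> exists k, ev (fun s => ev (fun M' =>
 Int PO PhiX - e1 <= Int PO (fun w => GS k s.+1%:R M' (fun j => DX (s.+1%:R / M'.+1%:R) xi j w)))).
Proof.
move=> e10; have e3 : 0 < e1 / 3 by pos.
have [N0 [mN PN DN]] := DR.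
have mD := measurableC mN.
pose Y w := Yproc gm (fun s => xi s w); pose I w := I_infty gm (fun s => xi s w).
have [_ [xi0 [xic _]]] := LV.
have dx w : ~ N0 w -> forall A, exists B', forall t, B' <= t -> xi t w <= A.
 move=> nw A; have xw : (fun t => xi t w) @ +oo --> -oo by apply: contrapT => nx; apply: nw; exact: DN.
 move: xw => /cvgrNyPle /(_ A) [B' [_ HB]]; exists (B' + 1) => t tB; apply: HB.
 by apply: lt_le_trans tB; rewrite ltrDl.
have REC w : ~ N0 w -> forall e, 0 < e -> exists2 S0, 0 < S0 & forall S, S0 <= S -> exists M0, forall M', (M0 <= M')%N ->
 let ep := S / M'.+1%:R in let v := psum (fun j => DX ep xi j w) in
 cl2 e (recY ep gm M'.+1 v) (recT ep gm v M'.+1)%:E (Y w) (I w).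
 move=> nw e e0; have [S0 S00 HS] := xi_recon ga0 (xic w) (dx w nw) e0.
 exists S0 => // S SS; have [M0 HM] := HS S SS; exists M0 => M' MM ep v.
 have -> : v = fun j : nat => xi (j%:R * ep) w; last exact: HM.
 by apply/funext => j; rewrite /v /psum /DX telescope_sumr// mul0r xi0 subr0.
have adY w : ~ N0 w -> adm (Y w) (I w).
 move=> nw; split; last by apply: integral_ge0 => s _; rewrite lee_fin expR_ge0.
 apply: tclose_cadlag => e e0; have [S0 S00 HS] := REC w nw e e0.
 have [M0 /(_ M0 (leqnn _)) [[h _] _]] := HS S0 (lexx _).
 by eexists; last exact: h; apply: recY_cadlag; rewrite divr_gt0.
pose gx k s M' w := GS k s.+1%:R M' (fun j => DX (s.+1%:R / M'.+1%:R) xi j w).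
have s0 (s : nat) : 0 < s.+1%:R :> R by [].
have mgx k s M' : meas (gx k s M') by exact: mGX.
have gxB k s M' w : `|gx k s M' w| <= B by exact: GS_bnd.
pose u k s w := fun M' => gx k s M' w.
have lb k s w : has_lbound (range (u k s w)).
 by exists (- B) => _ [M' _ <-]; have := gxB k s M' w; rewrite ler_norml => /andP[].
have ub k s w : has_ubound (range (u k s w)).
 by exists B => _ [M' _ <-]; have := gxB k s M' w; rewrite ler_norml => /andP[].
(* The lower limit of the grid functionals: measurable by construction, reached monotonically, and
   within k*e of [Fk] at the limit path whenever the reconstruction is e-close for all large
   grids. *)
pose l k s w := sup (range (infs (u k s w))).
have infB k s w j : - B <= infs (u k s w) j <= u k s w j.
 apply/andP; split.
  by apply: lb_le_inf; [exists (u k s w j), j => /=|move=> _ [M' _ <-]; have := gxB k s M' w; rewrite ler_norml => /andP[]].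
 by apply: ge_inf; [exists (- B) => _ [M' _ <-]; have := gxB k s M' w; rewrite ler_norml => /andP[]|exists j => /=].
have infB' k s w j : `|infs (u k s w) j| <= B.
 have /andP[h1 h2] := infB k s w j; have := gxB k s j w; rewrite !ler_norml => /andP[_ h3].
 by rewrite h1/= (le_trans h2).
have minf k s j : meas (fun w => infs (u k s w) j).
 by apply: (@measurable_fun_infs _ _ R setT (gx k s) j) => // w _; exact: lb.
have lcv k s w : infs (u k s w) @ \oo --> l k s w by exact: cvg_infs_sup.
have ml k s : meas (l k s) by apply: (@measurable_fun_cvg _ _ R _ (fun j w => infs (u k s w) j)).
have iB : intg PO (fun=> B) by apply: (ibnd (`|B|)).
have El k s : (fun j => Int PO (fun w => infs (u k s w) j)) @ \oo --> Int PO (l k s).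
 by have [_] := @Rint_dctT _ _ _ PO (fun j w => infs (u k s w) j) (l k s) (fun=> B) (minf k s) (ml k s) (lcv k s) iB (fun j w => infB' k s w j).
have lB k s w : `|l k s w| <= B.
 have := lcv k s w => c; rewrite ler_norml; apply/andP; split.
  rewrite lerNl; apply: (cvg_le_ev (u := fun j => - infs (u k s w) j)); first exact: cvgN.
  by apply: ev_all => j; rewrite lerNl; case/andP: (infB k s w j).
 by apply: (cvg_le_ev c); apply: ev_all => j; apply: le_trans (ler_norm _) (infB' k s w j).
pose Fw k : O -> R := (fun w => Fk F k (Y w) (I w)) \_ (~` N0).
have FwE k w : ~ N0 w -> Fw k w = Fk F k (Y w) (I w) by move=> nw; rewrite /Fw patchT// mem_set.
have FwB k w : `|Fw k w| <= B.
 rewrite /Fw /patch; case: ifPn => [/set_mem nw|_]; last by rewrite normr0.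
 by apply: (Fk_bnd FB); exact: adY.
have Fcv k w : ~ N0 w -> (fun s => l k s w) @ \oo --> Fk F k (Y w) (I w).
 move=> nw; apply/cvgnE => e e0; pose e2 := e / 2 / k.+1%:R.
 have e20 : 0 < e2 by rewrite !divr_gt0.
 have ke : k%:R * e2 < e.
  apply: (@le_lt_trans _ _ (k.+1%:R * e2)); first by rewrite ler_pM2r// ler_nat.
  by rewrite /e2 mulrC divfK// ?pnatr_eq0//; lra.
 have [S0 S00 HS] := REC w nw e2 e20.
 apply: ev_imp (ev_ger S0) => s sS; apply: le_trans (ltW ke).
 have [|M0 HM] := HS s.+1%:R; first by apply: (le_trans sS); rewrite ler_nat.
 have close' M' : (M0 <= M')%N -> `|u k s w M' - Fk F k (Y w) (I w)| <= k%:R * e2.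
  move=> MM; have [C1 C2] := HM M' MM.
  have ax := rec_adm gm (divr_gt0 (s0 s) (ltr0Sn R M')) (psum (fun j => DX (s.+1%:R / M'.+1%:R) xi j w)) M'.+1.
  rewrite ler_distl; apply/andP; split.
   by rewrite lerBlDr; apply: (Fk_lip FB) => //; exact: ltW.
  by apply: (Fk_lip FB) => //; [exact: adY|exact: ltW].
 have c := lcv k s w; rewrite ler_distl; apply/andP; split.
  rewrite -lerN2; apply: (cvg_le_ev (u := fun j => - infs (u k s w) j)); first exact: cvgN.
  exists M0 => j Mj; rewrite lerN2; apply: lb_le_inf; first by exists (u k s w j), j => /=.
  by move=> _ [M' /= jM <-]; have := close' M' (leq_trans Mj jM); rewrite ler_distl => /andP[].
 apply: (cvg_le_ev c); exists M0 => j Mj; case/andP: (infB k s w j) => _ h; apply: (le_trans h).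
 by have := close' j Mj; rewrite ler_distl => /andP[].
have mF k : meas (Fw k).
 apply/(measurable_restrictT _ mD); apply: (@measurable_fun_cvg _ _ R _ (fun s => l k s)).
  by move=> s; apply: measurable_funTS.
 exact: Fcv.
have EF k : (fun s => Int PO (l k s)) @ \oo --> Int PO (Fw k).
 have cw w : ~ N0 w -> (fun s => l k s w) @ \oo --> Fw k w by move=> nw; rewrite FwE//; exact: Fcv.
 by have [_] := @Rint_dct _ _ _ PO (l k) (Fw k) (fun=> B) N0 (ml k) (mF k) mN PN cw iB (fun s w _ => lB k s w).
pose Ph := PhiX \_ (~` N0).
have cvPh w : ~ N0 w -> (fun k => Fk F k (Y w) (I w)) @ \oo --> PhiX w.
 by move=> nw; apply: (Fk_cvg FB FC); exact: adY.
have mPh : meas Ph.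
 apply/(measurable_restrictT _ mD); apply: (@measurable_fun_cvg _ _ R _ (fun k w => Fk F k (Y w) (I w))) => //.
 by move=> k; apply/(measurable_restrictT _ mD); exact: mF.
have EPh : (fun k => Int PO (Fw k)) @ \oo --> Int PO Ph.
 have cw w : ~ N0 w -> (fun k => Fw k w) @ \oo --> Ph w.
  move=> nw; rewrite /Ph patchT ?mem_set//; apply: cvg_trans (cvPh w nw).
  by rewrite (_ : (fun k => _) = (fun k => Fw k w)) //; apply/funext => k; rewrite FwE.
 by have [_] := @Rint_dct _ _ _ PO Fw Ph (fun=> B) N0 mF mPh mN PN cw iB (fun s w _ => FwB s w).
have EE : Int PO PhiX = Int PO Ph.
 by apply: (Rint_null mN PN) => w nw; rewrite /Ph patchT// mem_set.
have [k Hk] := (cvgnE _ _).1 EPh _ e3; have := Hk k (leqnn _); rewrite -EE ; rewrite ler_distl => /andP[h1 _].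
exists k; apply: ev_imp ((cvgnE _ _).1 (EF k) _ e3) => s; rewrite ler_distl => /andP[h2 _].
apply: ev_imp ((cvgnE _ _).1 (El k s) _ e3) => j; rewrite ler_distl => /andP[h3 _].
apply: (via (Int PO (fun w => infs (u k s w) j))); first by lra.
apply: Rint_le => //.
- exact: (intg_bnd _ (minf k s j) (fun w => infB' k s w j)).
- exact: (intg_bnd _ (mgx k s j) (fun w => gxB k s j w)).
- by move=> w; case/andP: (infB k s w j).
Qed.

Lemma lower e0 : 0 < e0 -> ev (fun n => Int PO PhiX - e0 <= Int (P n) (@PhiN n)).
Proof.
move=> e00; have e2 : 0 < e0 / 2 by pos.
have [k Hk] := xi_lower e2; have [S0 S00 HS] := chain_lower k e2.
have [s /= Hs] := ev_and Hk (ev_ger S0).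
have [H1 H2] := Hs s (leqnn _).
have [|M0 HM] := HS s.+1%:R; first by apply: (le_trans H2); rewrite ler_nat.
have [M' /= HM'] := ev_and H1 (ev_ge M0); have [h1 h2] := HM' M' (leqnn _).
by apply: ev_imp (HM M' h2) => n; lra.
Qed.

End OneF.

Lemma part_i (F : (R -> R) -> \bar R -> R) : bcont_functional F ->
 (fun n => Int (P n) (@PhiN F n)) @ \oo --> Int PO (PhiX F).
Proof.
move=> [[B FB] FC]; apply/cvgnE => e e0; have e2 : 0 < e / 2 by pos.
have FB' x r : `|- F x r| <= B by rewrite normrN.
have FC' : seqcont (fun x r => - F x r) by move=> *; apply: cvgN; exact: FC.
(* Exchanging positive and negative parts proves this for an arbitrary function; [PhiX] is not known
   to be measurable. *)
have NN d (O' : measurableType d) (Q : probability O' R) (f : O' -> R) : Int Q (fun w => - f w) = - Int Q f.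
 rewrite /Rintegral (_ : (fun w => (- f w)%:E) = (\- (fun w => (f w)%:E))%E)//.
 rewrite integralE [in RHS]integralE funeposN funenegN.
 by case: integral => [r| |]; case: integral => [t| |] //=; rewrite ?opprB ?oppr0.
have L1 := lower FB FC e2; have L2 := lower FB' FC' e2.
apply: ev_imp (ev_and L1 L2) => n [h1].
rewrite (_ : PhiX (fun x r => - F x r) = fun w => - PhiX F w)// (_ : @PhiN (fun x r => - F x r) n = fun w => - PhiN F w)// !NN => h2.
by rewrite ler_distl; apply/andP; split; lra.
Qed.

End Tail.

(** * Drift to -oo forces Psi to be negative somewhere *)

Section Drift.
Hypothesis s20 : 0 <= sg2.
Context (dO : measure_display) (O : measurableType dO) (PO : probability O R) (xi : R -> O -> R).
Hypotheses (LV : levy_process PO Pi b sg2 xi) (DR : drifts_to_minus_infty PO xi).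
Context (be Cb : R).
Hypotheses (be0 : 0 < be) (Cb0 : 0 <= Cb) (HE : embd p a be Cb).

Lemma Rint_le_cst d (U : measurableType d) (Q : probability U R) (f : U -> R) c : meas f ->
 (forall w, 0 <= f w) -> (\int[Q]_w (f w)%:E <= c%:E)%E -> intg Q f /\ Int Q f <= c.
Proof.
move=> mf f0 H; have i : intg Q f.
 apply/integrableP; split; first exact/measurable_EFinP.
 apply: le_lt_trans (ltry c); apply: le_trans H.
 by apply: ge0_le_integral => //; [exact/measurable_EFinP/measurableT_comp|exact/measurable_EFinP|move=> w _; rewrite /= ger0_norm].
by split=> //; rewrite -lee_fin Rint_fin.
Qed.

Section PZ.
Context (t th : R).
Hypotheses (t0 : 0 < t) (th0 : 0 < th) (th2 : 2 * th < be) (P1 : 0 <= Ps th) (P2 : 0 <= Ps (2 * th)).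

Let M1t : 1%:R * t = t. Proof. by rewrite mul1r. Qed.
Lemma DV0 n B x N : x 0%N = n -> DV a t (sth (act1 a n B t) (hist x N)) 0 =
 ln (hd0 (sth (act1 a n B t) (hist x N)))%:R - ln n%:R.
Proof.
move=> x0; set h := sth _ _; rewrite /DV /dl.
have lastE : last 0%N h = n.
 rewrite /h; elim: N {h} => [|N IH]; [by rewrite /= x0|rewrite sthS /=; case: ifP => // _].
 by move: IH; case: (sth _ _) (@sth_neq0 (act1 a n B t) x N).
have g1 : gw a t (@lnh R) 1 h = lnh h.
 rewrite /h; elim: N {h lastE} => [|N IH] //; rewrite sthS /=; case: ifPn => // /and3P[c _ _].
 move: c IH; case: (sth _ _) => // y h c _; rewrite gw_cons ifT// mul1r.
 done.
have g0 : gw a t (@lnh R) 0 h = ln n%:R.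
 have hn : h <> [::] by exact: sth_neq0.
 by rewrite gw0//; case: (h) hn lastE => // y s _ <-.
by rewrite g1 g0.
Qed.

Definition gcut (c : R) (v : nat -> R) : R := cl (v 0%N - c + 1).
Lemma gcut_bnd c v : `|gcut c v| <= 1.
Proof. by have /andP[h1 h2] := cl_bnd (v 0%N - c + 1); rewrite /gcut ger0_norm. Qed.
Lemma cl_lip (x y : R) : `|cl x - cl y| <= `|x - y|.
Proof.
rewrite /cl (_ : _ - _ = ((`|x| - `|y|) + (`|y - 1| - `|x - 1|)) / 2); last by ring.
rewrite normrM [`|2^-1|]ger0_norm// ler_pdivrMr//; apply: (le_trans leND).
have h1 := ler_dist_dist x y; have h2 := ler_dist_dist (y - 1) (x - 1).
have E : y - 1 - (x - 1) = - (x - y) by ring.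
rewrite E normrN in h2; lra.
Qed.

Lemma gcut_lip c W : blip 1 W (gcut c).
Proof.
exists 1 => // u v d d0 H; have [_ _ h] := H 0%N isT; rewrite mul1r.
by apply: le_trans (cl_lip _ _) _; rewrite (_ : _ - _ = u 0%N - v 0%N) //; ring.
Qed.

Let EXg c := EX t PO xi (gcut c).
(** With Z = e^(th xi_t): Z <= c0 + 1(Z > c0)(de Z^2/2 + 1/(2 de)), divided by the mean e^(t
    Psi(th)). Exponential moments of xi are not computed from its characteristic function; the
    inequality is proved for the chain, by a submartingale for Z and a supermartingale for Z^2, and
    only the bounded cutoff passes to xi. *)
Lemma PZ c0 de : 0 < c0 -> 0 < de ->
 1 <= expR (- (Ps th * t)) * (c0 + de * expR (Ps (2 * th) * t) / 2 + EXg (ln c0 / th) / (2 * de)).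
Proof.
move=> c00 de0; set c := ln c0 / th.
pose A2 (eta : R) := expR ((Ps (2 * th) + eta) * (t + eta)).
(* The bound obtained for the chain with slack eta; the claim is its value at eta = 0, reached by
   continuity. *)
pose F (eta : R) := expR (eta * (t + 1)) * (expR (- (Ps th * t)) * (c0 + de * A2 eta / 2 + (EXg c + eta) / (2 * de))
  + (eta * A2 eta / 2 + eta / 2)).
have cF : continuous F.
 have ci := @cont_id R; have cc x := @cont_cst R x.
 have cA : continuous A2 by apply: contexp; apply: contM; apply: contD.
 apply: contM; first by apply: contexp; exact: contM.
 apply: contD; last by apply: contD; apply: contM => //; exact: contM.
 apply: contM => //; apply: contD; last by apply: contM => //; exact: contD.
 by apply: contD => //; apply: contM => //; exact: contM.
suff H eta : 0 < eta -> eta <= 1 -> 1 <= F eta.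
 have cv : (fun k : nat => F k.+1%:R^-1) @ \oo --> F 0.
  by apply: (@cvg_comp _ _ _ (fun k : nat => k.+1%:R^-1 : R) F _ _ _ (@cvg_harmonic R) (cF 0)).
 have F0 : F 0 = expR (- (Ps th * t)) * (c0 + de * expR (Ps (2 * th) * t) / 2 + EXg c / (2 * de)).
  by rewrite /F /A2 mul0r expR0 mul1r !addr0 !mul0r addr0 addr0.
 rewrite -F0 -lerN2; have cvN : (fun k : nat => - F k.+1%:R^-1) @ \oo --> - F 0 by exact: cvgN.
 apply: (cvg_le_ev cvN).
 by apply: ev_all => k /=; rewrite lerN2; apply: H; rewrite ?invr_gt0 ?ltr0n// invf_le1 ?ltr0n// ler1n.
move=> et0 et1.
have et2 : 0 < eta ^+ 2 by pos.
have [_ tri1] := @fdd 1 _ t0 _ _ _ _ LV (gcut c) 1 (gcut_bnd c) (@gcut_lip c).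
have [B1 HB1] := tri1 eta et0.
have t0' : 0 <= t by exact: ltW.
have [B2 B20 HB2] := exit_small t0' et2.
pose B := Num.max B1 B2.
have bb1 : B1 <= B by rewrite le_max lexx. have bb2 : B2 <= B by rewrite le_max lexx orbT.
have GE s : 0 <= s -> s < be -> (fun x => mm p a x (fun u => expR (s * u) - 1)) @ \oo --> Ps s.
 by move=> s0 sb; apply: (gen_exp kp a0 LP HA1 HA2 be0 Cb0 HE).
have tb : th < be by have := th2; have := th0; lra.
(* For steps of clock length q <= q0 the exponent z satisfies |z| <= 1, and the Taylor error 9 z^2
   is at most eta*q/2, which the slack covers. *)
pose q0 := eta / 2 / (9 * (Ps th + 1) ^+ 2 + 1) / (Ps th + 2).
have q00 : 0 < q0.
 have h1 : 0 <= 9 * (Ps th + 1) ^+ 2 by pos.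
 by rewrite !divr_gt0//; have := P1; lra.
have e4 : 0 < eta / 2 by lra.
have t2 : 0 <= 2 * th by have := th0; lra.
have ev1 := ev_inr B (ev_and (a_inf a0 ga0 rv (Num.max (eta^-1) (q0^-1)))
  (ev_and (ev_and ((cvgnE _ _).1 (GE th (ltW th0) tb) _ e4) ((cvgnE _ _).1 (GE (2 * th) t2 th2) _ et0))
  (ev_and (sm_exp kp HE (ltW th0) tb) (sm_exp kp HE (th := 2 * th) t2 th2)))).
have [n Hn] := ev_and (HB1 B bb1) (ev_and (HB2 B bb2) ev1).
have [h1 [PB [n0 Hx]]] := Hn n (leqnn n).
have [N1 HN1] := h1.
have [N2 HN2] := act1_end a0 t B n0.
pose N := maxn N1 N2.
have := HN1 N (leq_maxl _ _); rewrite /En /hB mul1r => g1.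
set hb := fun w => sth (act1 a n B t) (Hk (X n) N w).
have ax x : (0 < x)%N -> inr n B x -> eta^-1 <= a x /\ q0^-1 <= a x.
 by move=> x0 xB; have [] := Hx x x0 xB; rewrite ge_max => /andP[].
have iax x : (0 < x)%N -> inr n B x -> (a x)^-1 <= eta.
 by move=> x0 xB; have [h _] := ax x x0 xB; rewrite -[leRHS]invrK lef_pV2 ?posrE ?invr_gt0.
have clb w : clk a (hb w) <= t + eta := act1_clk (X n ^~ w) N (ltW et0) t0' iax.
pose f1 h := pw n th (hd0 h) * expR (- ((Ps th - eta) * clk a h)).
pose f2 h := pw n (2 * th) (hd0 h) * expR (- ((Ps (2 * th) + eta) * clk a h)).
have f10 h : 0 <= f1 h by rewrite mulr_ge0 ?expR_ge0.
have f20 h : 0 <= f2 h by rewrite mulr_ge0 ?expR_ge0.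
have stepE s r x h y : pw n s y * expR (- (r * clk a (y :: x :: h))) =
  (pw n s x * expR (- (r * clk a (x :: h))) * expR (- (r / a x))) * expR (s * lr x y).
 by rewrite /pw clk_cons /lr -!expRD; congr expR; ring.
have EsE s x : (0 < x)%N -> sm p x (fun u => expR (s * u)) -> Esum (p x) (fun y => expR (s * lr x y)) = 1 + mm p a x (fun u => expR (s * u) - 1) / a x.
 move=> x0 sx; have Q := kern kp x0; have [Q0 [Q1 _]] := Q.
 by rewrite -(Esum_mm p a0 x (fun u => expR (s * u) - 1)) EsumB ?Esum_cst//; [ring|exact: summ_cst].
have I1 : ((f1 [:: n])%:E <= \int[P n]_w (f1 (hb w))%:E)%E.
 apply: (submart kp n0 (mc n0) (act := act1 a n B t) f10).
 case=> // x h /and3P[_ x0 xB] _; have [_ [[m1 _] [[_ s1] _]]] := Hx x x0 xB.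
 have Q := kern kp x0; have [Q0 [Q1 _]] := Q.
 rewrite /Qe /=; under eq_eseriesr do rewrite -EFinM.
 have sg : summ (p x) (fun y => f1 (y :: x :: h)).
  rewrite /f1; under [X in summ _ X]funext do rewrite /= stepE.
  exact: summZ.
 rewrite (eEsum (q := p x) (g := fun y => f1 (y :: x :: h)))// lee_fin.
 rewrite /f1 (_ : (fun y => _) = fun y => (pw n th x * expR (- ((Ps th - eta) * clk a (x :: h))) * expR (- ((Ps th - eta) / a x))) * expR (th * lr x y)); last first.
  by apply/funext => y; rewrite /= -stepE.
 rewrite EsumZ// EsE// -mulrA; apply: ler_peMr; first by pos.
 set m := mm p a x _ in m1 *; set q := (a x)^-1.
 have q'0 : 0 < q by rewrite invr_gt0.
 have qq : q <= q0 by have [_ h2] := ax x x0 xB; rewrite -[leRHS]invrK lef_pV2 ?posrE ?invr_gt0.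
 have mP : Ps th - eta / 2 <= m by move: m1; rewrite ler_norml => /andP[]; lra.
 set z := (Ps th - eta) * q.
 have z1 : `|z| <= 1.
  have h9 : 0 <= 9 * (Ps th + 1) ^+ 2 by pos.
  have P12 : 0 < Ps th + 2 by have := P1; lra.
  have q1 : q * (Ps th + 2) <= 1.
   rewrite -ler_pdivlMr//; apply: (le_trans qq); rewrite /q0 ler_pM2r ?invr_gt0//.
   by rewrite ler_pdivrMr; lra.
  rewrite normrM (gtr0_norm q'0); apply: le_trans q1; rewrite mulrC ler_pM2l//.
  by rewrite ler_norml; apply/andP; split; have := P1; lra.
 have zz : 9 * z ^+ 2 <= eta / 2 * q.
  have h9 : 0 <= 9 * (Ps th + 1) ^+ 2 by pos.
  have P12 : 0 < Ps th + 2 by have := P1; lra.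
  have P11 : 1 <= Ps th + 2 by have := P1; lra.
  have h8 : (Ps th - eta) ^+ 2 <= (Ps th + 1) ^+ 2.
   rewrite -[leLHS]real_normK ?num_real//; apply: lerXn2r; rewrite ?nnegrE//; first by have := P1; lra.
   by rewrite ler_norml; apply/andP; split; have := P1; lra.
  have -> : 9 * z ^+ 2 = (9 * (Ps th - eta) ^+ 2 * q) * q by rewrite /z; ring.
  rewrite ler_pM2r//; apply: (via (9 * (Ps th + 1) ^+ 2 * q0)).
   by apply: ler_pM; [rewrite mulr_ge0 ?sqr_ge0|exact: ltW|rewrite ler_pM2l|exact: qq].
  set k9 := 9 * (Ps th + 1) ^+ 2 in h9 *.
  have k91 : 0 < k9 + 1 by rewrite ltr_wpDl.
  rewrite /q0 -/k9 (_ : k9 * (eta / 2 / (k9 + 1) / (Ps th + 2)) = eta / 2 * (k9 / (k9 + 1) / (Ps th + 2))); last by ring.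
  apply: ler_piMr; first exact: ltW.
  rewrite ler_pdivrMr// mul1r; apply: le_trans P11.
  by rewrite ler_pdivrMr// mul1r lerDl.
 have ez := exp_tay2 z1; have mq : (Ps th - eta / 2) * q <= m * q by rewrite ler_pM2r.
 have key : expR z <= 1 + m * q.
  move: ez; rewrite ler_norml => /andP[_ ez].
  have : z = (Ps th - eta / 2) * q - eta / 2 * q by rewrite /z; field.
  lra.
 apply: (via (expR (- z) * expR z)); first by rewrite -expRD addrC subrr expR0.
 by apply: ler_wpM2l => //; exact: expR_ge0.
have I2 : (\int[P n]_w (f2 (hb w))%:E <= (f2 [:: n])%:E)%E.
 apply: (supermart kp n0 (mc n0) (act := act1 a n B t) f20).
 case=> // x h /and3P[_ x0 xB] _; have [_ [[_ m2] [_ [_ s2]]]] := Hx x x0 xB.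
 have Q := kern kp x0; have [Q0 [Q1 _]] := Q.
 have sg : summ (p x) (fun y => (pw n (2 * th) x * expR (- ((Ps (2 * th) + eta) * clk a (x :: h))) * expR (- ((Ps (2 * th) + eta) / a x))) * expR (2 * th * lr x y)).
  exact: summZ.
 apply: (Qe_le kp (g := fun y => (pw n (2 * th) x * expR (- ((Ps (2 * th) + eta) * clk a (x :: h))) * expR (- ((Ps (2 * th) + eta) / a x))) * expR (2 * th * lr x y))) => //.
  by move=> y y0; rewrite /f2 [head _ _]/= -stepE.
 rewrite EsumZ// EsE// -mulrA /f2; apply: ler_piMr; first by pos.
 set m := mm p a x _ in m2 *; have q'0 : 0 < (a x)^-1 by pos.
 have h1' : 1 + m / a x <= expR ((Ps (2 * th) + eta) / a x).
  apply: le_trans (expR_ge1Dx _) _; rewrite ler_expR ler_pM2r//.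
  by move: m2; rewrite ler_norml => /andP[]; lra.
 apply: le_trans (ler_wpM2l (expR_ge0 _) h1') _.
 by rewrite -expRD addrC subrr expR0.
have f1n : f1 [:: n] = 1 by rewrite /f1 /pw /= subrr !mulr0 oppr0 expR0 mulr1.
have f2n : f2 [:: n] = 1 by rewrite /f2 /pw /= subrr !mulr0 oppr0 expR0 mulr1.
rewrite f1n in I1; rewrite f2n in I2.
have mhb (g : seq nat -> R) : meas (fun w => g (hb w)).
 exact: (mfHk (mc n0) N (fun h => g (sth (act1 a n B t) h))).
have [if2 E2] := Rint_le_cst (mhb f2) (fun w => f20 _) I2.
pose bd : T n -> R := fun w => \1_(Bad n B t) w.
have mbd : meas bd by apply: measurable_indic; exact: (mBad B t n0).
have ibd : intg (P n) bd by apply: (ibnd 1) => // w; rewrite /bd indicE; case: (_ \in _); rewrite ?normr1 ?normr0.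
have Eb : Int (P n) bd <= eta ^+ 2.
 rewrite /bd /Rintegral integral_indic ?setIT//; last exact: (mBad B t n0).
 by rewrite -lee_fin fineK// fin_num_measure//; exact: (mBad B t n0).
pose G w := gcut c (DV a t (hb w)).
have iG : intg (P n) G by apply: (ibnd 1); [exact: (mhb (fun h => gcut c (DV a t h)))|move=> w; exact: gcut_bnd].
have EG : Int (P n) G <= EXg c + eta by move: g1; rewrite ler_norml => /andP[_]; rewrite lerBlDl.
pose k1 := expR (eta * (t + 1)); pose k2 := expR (- (Ps th * t)).
pose RHS w := k1 * (k2 * (c0 + de * A2 eta / 2 * f2 (hb w) + (2 * de)^-1 * G w) + (eta * A2 eta / 2 * f2 (hb w) + (2 * eta)^-1 * bd w)).
have k10 : 0 < k1 by exact: expR_gt0. have k20 : 0 < k2 by exact: expR_gt0.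
have A20 : 0 < A2 eta by exact: expR_gt0.
have cl0 w : 0 <= clk a (hb w) := clk_ge0 a0 (hb w).
(* Off the bad event the clock has reached t and the two cases Z <= c0 and Z > c0 apply. On it the
   weight eta in place of de leaves 1/(2 eta) times a probability at most eta^2. *)
have ptw w : f1 (hb w) <= RHS w.
 set Z := pw n th (hd0 (hb w)); have Z0 : 0 <= Z by exact: expR_ge0.
 have Z2 : Z ^+ 2 <= A2 eta * f2 (hb w).
  have -> : Z ^+ 2 = pw n (2 * th) (hd0 (hb w)) by rewrite expr2 /Z /pw -expRD; congr expR; ring.
  rewrite /f2 mulrCA ler_peMr ?expR_ge0// /A2 -expRD -[X in X <= _]expR0 ler_expR subr_ge0.
  by apply: ler_wpM2l => //; have := P2; lra.
 have amgm d : 0 < d -> Z <= d * Z ^+ 2 / 2 + (2 * d)^-1.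
  move=> d0; rewrite -subr_ge0 (_ : _ - Z = (d * Z - 1) ^+ 2 / (2 * d)).
   by pos.
  by field; rewrite gt_eqF.
 have f2'0 := f20 (hb w).
 have G0 : 0 <= G w by rewrite /G /gcut; have /andP[] := cl_bnd (DV a t (hb w) 0 - c + 1).
 have c1' := clb w; have c0' := cl0 w.
 have dZ d : 0 < d -> d * Z ^+ 2 / 2 <= d * A2 eta / 2 * f2 (hb w).
  move=> d0; have h := ler_wpM2l (ltW d0) Z2.
  by rewrite (_ : d * A2 eta / 2 * f2 (hb w) = d * (A2 eta * f2 (hb w)) / 2) ?ler_pM2r//; ring.
 have dA d : 0 < d -> 0 <= d * A2 eta / 2 * f2 (hb w).
  by move=> d0; apply: mulr_ge0 => //; apply: divr_ge0 => //; apply: mulr_ge0; exact: ltW.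
 have q2p : 0 <= (2 * de)^-1 * G w by apply: mulr_ge0 => //; rewrite invr_ge0 mulr_ge0// ltW.
 have q1p := dA _ de0; have q3p := dA _ et0.
 have Sp : 0 <= k2 * (c0 + de * A2 eta / 2 * f2 (hb w) + (2 * de)^-1 * G w).
  by apply: mulr_ge0; [exact: ltW|apply: addr_ge0 => //; apply: addr_ge0 => //; exact: ltW].
 rewrite /f1 -/Z /RHS.
 have [nb|nb] := pselect (Bad n B t w).
  have -> : bd w = 1 by rewrite /bd indicE mem_set.
  apply: (via (k1 * Z)).
   rewrite mulrC; apply: ler_wpM2r => //; rewrite ler_expR -mulNr opprB mulrBl.
   have : 0 <= Ps th * clk a (hb w) by pos.
   have : eta * clk a (hb w) <= eta * (t + 1) by rewrite ler_pM2l//; lra.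
   lra.
  rewrite ler_pM2l//; have := amgm _ et0; have := dZ _ et0.
  rewrite mulr1 => h1' h2'; apply: (le_trans h2'); apply: (le_trans (lerD h1' (lexx _))).
  by rewrite lerDr.
 have -> : bd w = 0 by rewrite /bd indicE memNset.
 have [x0n [xp xr]] := not_Bad nb.
 have ct : t <= clk a (hb w) := HN2 _ xp xr N (leq_maxr _ _).
 apply: (via (k1 * (k2 * Z))).
  rewrite mulrA mulrC; apply: ler_wpM2r => //; rewrite /k1 /k2 -expRD ler_expR -mulNr opprB mulrBl.
  have : Ps th * t <= Ps th * clk a (hb w) by apply: ler_wpM2l.
  have : eta * clk a (hb w) <= eta * (t + 1) by rewrite ler_pM2l//; lra.
  lra.
 rewrite ler_pM2l// mulr0 addr0; apply: (via (k2 * (c0 + de * A2 eta / 2 * f2 (hb w) + (2 * de)^-1 * G w))); last first.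
  by rewrite lerDl.
 rewrite ler_pM2l//; have d1 := dZ _ de0; have d2 := amgm _ de0.
 have [Zc|Zc] := lerP Z c0.
  by apply: (le_trans Zc); rewrite -addrA lerDl addr_ge0.
 have -> : G w = 1.
  rewrite /G /gcut (@DV0 n B (X n ^~ w) N x0n) -/(hb w) cl_eq1//.
  have : ln c0 <= th * (ld (hd0 (hb w)) n).
   rewrite -ler_expR lnK ?posrE//; exact: ltW.
  by rewrite -ler_pdivrMl// mulrC -/c; lra.
 rewrite mulr1; apply: (le_trans d2); apply: (le_trans (lerD d1 (lexx _))).
 by rewrite -addrA lerDr ltW.
have iR : intg (P n) RHS.
 have icc x : intg (P n) (fun=> x) by apply: (ibnd `|x|).
 apply: intgZ; apply: intgD; last by apply: intgD; exact: intgZ.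
 by apply: intgZ; apply: intgD; last exact: intgZ; apply: intgD => //; exact: intgZ.
have h : 1 <= Int (P n) RHS.
 rewrite -lee_fin Rint_fin//; apply: (le_trans I1); apply: ge0_le_integral => //.
 - by move=> w _; rewrite lee_fin.
 - by apply/measurable_EFinP; exact: (mhb f1).
 - by apply/measurable_EFinP; exact: intg_mf iR.
 - by move=> w _; rewrite lee_fin.
apply: (le_trans h); rewrite /RHS /F -/k1 -/k2.
have icc x : intg (P n) (fun=> x) by apply: (ibnd `|x|).
rewrite RintZ; last first.
 apply: intgD; last by apply: intgD; exact: intgZ.
 by apply: intgZ; apply: intgD; last exact: intgZ; apply: intgD => //; exact: intgZ.
rewrite ler_pM2l// RintD; last 2 first.
 - by apply: intgZ; apply: intgD; last exact: intgZ; apply: intgD => //; exact: intgZ.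
 - by apply: intgD; exact: intgZ.
rewrite RintD; [|exact: intgZ|exact: intgZ].
rewrite RintZ; last by apply: intgD; last exact: intgZ; apply: intgD => //; exact: intgZ.
rewrite RintD; [|by apply: intgD => //; exact: intgZ|exact: intgZ].
rewrite RintD//; last exact: intgZ.
rewrite Ecst !RintZ//; apply: lerD.
 rewrite ler_pM2l//; apply: lerD; last by rewrite mulrC ler_pM2r// invr_gt0 mulr_gt0.
 by rewrite lerD2l ler_piMr// divr_ge0 ?mulr_ge0// ltW.
apply: lerD; first by rewrite ler_piMr// divr_ge0 ?mulr_ge0// ltW.
rewrite mulrC ler_pdivrMr ?mulr_gt0//; apply: (le_trans Eb).
by rewrite le_eqVlt; apply/orP; left; apply/eqP; field.
Qed.

End PZ.

Lemma drift_cut (c e : R) : 0 < e -> exists T0, 0 < T0 /\ forall t, T0 <= t -> EX t PO xi (gcut c) <= e.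
Proof.
move=> e0; apply: contrapT => /forallNP H.
have Hj (j : nat) : exists t, j.+1%:R <= t /\ e < EX t PO xi (gcut c).
 have := H j.+1%:R => /not_andP[|]; first by pos.
 by move=> /existsNP[t /not_implyP[jt /negP]]; rewrite -ltNge => et; exists t.
have [u Hu] := choice Hj.
have [N0 [mN PN DN]] := DR.
have mcl (j : nat) : meas (fun w => gcut c (fun i => DX (u j) xi i w)).
 apply: measurableT_comp; last first.
  apply: (measurable_funD (f := fun w => DX (u j) xi 0 w - c)); last exact: measurable_cst.
  by apply: measurable_funB; [exact: (mDX (u j) LV)|exact: measurable_cst].
 by apply: cmf; exact: (cont_cl (@cont_id R)).
have i1 : intg PO (fun=> 1) by apply: (ibnd 1) => // w; rewrite normr1.
have [_ cv] := @Rint_dct _ _ _ PO (fun j w => gcut c (fun i => DX (u j) xi i w)) (fun=> 0) (fun=> 1) N0 mcl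
 (measurable_cst _) mN PN ltac:(
 move=> w nw; have xw : (fun t => xi t w) @ +oo --> -oo by [apply: contrapT => nx; apply: nw; apply: DN];
 move: xw => /cvgrNyPle /(_ (c - 1)) [A [_ HA]];
 apply: (cvg_near_ev (u := fun=> 0)); [exact: cvg_cst|];
 apply: ev_imp (ev_ger A) => j Aj;
 have [ju _] := Hu j; rewrite /gcut /DX mul1r mul0r; have [_ [x0 _]] := LV; rewrite x0 subr0 cl_eq0//;
 have := HA (u j) (le_lt_trans Aj (lt_le_trans (ltac:(by rewrite ltr_nat) : j%:R < j.+1%:R :> R) ju)); lra) i1
 ltac:(by move=> j w _; exact: gcut_bnd).
have [J HJ] := (cvgnE _ _).1 cv _ e0.
have := HJ J (leqnn _); rewrite Ecst subr0 => h.
have [_ h2] := Hu J; have := le_lt_trans (ler_norm _) (le_lt_trans h h2).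
by rewrite ltxx.
Qed.

Let bb := Num.min be gm.
Let bb0 : 0 < bb. Proof. by rewrite lt_min be0 ga0. Qed.
Let bbe x : x < bb -> x < be. Proof. by move=> h; apply: lt_le_trans h _; rewrite ge_min lexx. Qed.
(** If Psi is linear, either it vanishes or small th work. Otherwise V > 0; were the ratio Psi(2
    th)/Psi(th) always above 5 along th0 * 2^-j, Psi would decay like 5^-j there, while [Vq_ge]
    keeps it above a multiple of 4^-j. *)
Lemma ratio : (forall th, 0 < th -> th < bb -> 0 <= Ps th) ->
 (exists th, [/\ 0 < th, 2 * th < bb, Ps th = 0 & Ps (2 * th) = 0]) \/
 (forall T0, 0 < T0 -> exists th, [/\ 0 < th, 2 * th < bb, 0 < Ps th <= T0 & Ps (2 * th) <= 5 * Ps th]).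
Proof.
move=> Pn; have [V V0 [HV V0P]] := Vq_ge b kp a0 LP s20 HA1 be0 HE.
have [Vz|Vn] := eqVneq V 0.
 have PE := V0P Vz.
 have bn : 0 <= b.
  have h4 : 0 < bb / 4 by pos.
  have h5 : bb / 4 < bb by have := bb0; lra.
  by have := Pn _ h4 h5; rewrite PE ?(ltW h4) ?(bbe h5)// pmulr_lge0.
 have [bz|bz] := eqVneq b 0.
  left; exists (bb / 4); have B := bb0; rewrite !PE ?bz ?mul0r//; try lra.
  - by split => //; lra.
  - by apply: bbe; lra.
  - by apply: bbe; lra.
 right => T0 T00; have b0 : 0 < b by rewrite lt_neqAle eq_sym bz.
 pose th := Num.min (bb / 4) (T0 / b).
 have th0 : 0 < th by rewrite lt_min !divr_gt0.
 have thb : 2 * th < bb by have : th <= bb / 4 by [rewrite ge_min lexx]; have := bb0; lra.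
 have tT : b * th <= T0 by rewrite mulrC -ler_pdivlMr// ge_min lexx orbT.
 exists th; rewrite !PE//; try (by lra); try (by apply: bbe; lra).
 split=> //; first by rewrite tT mulr_gt0.
 by have := mulr_gt0 b0 th0; lra.
have {Vn} V0' : 0 < V by rewrite lt_neqAle eq_sym Vn.
right => T0 T00.
pose th0 := Num.min 1 (bb / 4).
have t0 : 0 < th0 by rewrite lt_min ltr01 divr_gt0.
have t1 : th0 <= 1 by rewrite ge_min lexx.
have tb : 2 * th0 < bb by have : th0 <= bb / 4 by [rewrite ge_min lexx orbT]; have := bb0; lra.
pose h (j : nat) : R := 2^-1 ^+ j.
have h0 j : 0 < h j by rewrite exprn_gt0.
have h1 j : h j <= 1 by apply: exprn_ile1 => //; lra.
have hS j : 2 * h j.+1 = h j by rewrite /h exprS mulrA divff ?mul1r.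
have th_lt j : 0 < th0 * h j <= th0 by rewrite mulr_gt0//= ler_piMr// ltW.
have th_b j : 2 * (th0 * h j) < bb by apply: le_lt_trans tb; rewrite ler_pM2l//; case/andP: (th_lt j).
pose ps j := Ps (th0 * h j).
have psn j : 0 <= ps j by apply: Pn; case/andP: (th_lt j) => // u v; have := th_b j; lra.
have psS j : ps j = 2 * ps j.+1 + Vq Pi sg2 (th0 * h j.+1).
 rewrite /ps -(Psi_double b sg2 kp a0 LP HA1 be0 HE (th := th0 * h j.+1)).
 - by rewrite mulrCA hS.
 - by case/andP: (th_lt j.+1) => u _; exact: ltW.
 - by apply: bbe; exact: th_b.
have Vl j : (th0 * h j) ^+ 2 * V <= Vq Pi sg2 (th0 * h j).
 have /andP[u v] := th_lt j; apply: HV; first by rewrite ltW//=; exact: le_trans t1.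
 by apply: bbe; exact: th_b.
have Vp j : 0 < (th0 * h j) ^+ 2 * V by pos.
have psl j : (th0 * h j.+1) ^+ 2 * V <= ps j by rewrite psS; have := Vl j.+1; have := psn j.+1; lra.
have psp j : 0 < ps j by exact: lt_le_trans (Vp j.+1) (psl j).
have psc j : ps j <= h j * ps 0%N.
 rewrite /ps /h expr0 mulr1 mulrC -/(h j); apply: (Psi_conv b kp a0 LP s20 HA1 be0 HE).
 - by rewrite (ltW (h0 j)) h1.
 - exact: ltW.
 - by apply: bbe; lra.
have [J HJ] : exists J : nat, h J * ps 0%N <= T0.
 have [J HJ] := ev_ger (ps 0%N / T0); exists J.
 have hJ : h J * J%:R <= 1.
  rewrite /h exprVn mulrC ler_pdivrMr ?exprn_gt0// mul1r -natrX ler_nat.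
  by apply: ltnW; exact: ltn_expl.
 have := HJ J (leqnn J); rewrite ler_pdivrMr// => k.
 apply: (le_trans (ler_wpM2l (ltW (h0 J)) k)); rewrite mulrA.
 by rewrite ler_piMl// ltW.
apply: contrapT => /forallNP NE.
have rat j : (J <= j)%N -> 5 * ps j.+1 < ps j.
 move=> Jj; rewrite ltNge; apply/negP => le5; apply: (NE (th0 * h j.+1)); split.
 - by case/andP: (th_lt j.+1).
 - exact: th_b.
 - rewrite -/(ps j.+1) psp /=; apply: (le_trans (psc _)); apply: le_trans HJ.
  rewrite ler_pM2r// /h; apply: ler_wiXn2l => //; last exact: leqW.
  by lra.
 - by rewrite mulrCA hS.
have iter i : 5 ^+ i * ps (J + i)%N <= ps J.
 elim: i => [|i IH]; first by rewrite expr0 mul1r addn0.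
 apply: le_trans IH; rewrite exprSr -mulrA addnS ler_pM2l ?exprn_gt0//.
 by apply: ltW; apply: rat; exact: leq_addr.
pose c := (th0 * h J.+1) ^+ 2 * V.
have lowc i : c * (4^-1) ^+ i <= ps (J + i)%N.
 apply: le_trans (psl _); rewrite /c -addSn /h exprD mulrA [X in _ <= X * _]exprMn.
 rewrite -/(h J.+1) -exprM mulnC exprM (_ : (2^-1 ^+ 2 : R) = 4^-1); first by rewrite mulrAC.
 by rewrite expr2 -invfM; congr (_^-1); ring.
have c0 : 0 < c by exact: Vp.
have big i : c * (5 / 4) ^+ i <= ps J.
 by apply: le_trans (iter i); rewrite exprMn mulrCA ler_pM2l ?exprn_gt0//.
have bern (i : nat) : 1 + i%:R / 4 <= (5 / 4) ^+ i :> R.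
 elim: i => [|i IH]; first by rewrite mul0r addr0 expr0.
 rewrite exprS -natr1; have i0 : 0 <= i%:R :> R by [].
 apply: (via (5 / 4 * (1 + i%:R / 4))); first by lra.
 by rewrite ler_pM2l//; lra.
have [i Hi] := ev_ger (4 * (ps J / c)).
have k1 := Hi i (leqnn i); have k2 := big i.
have k3 : c * (1 + i%:R / 4) <= c * (5 / 4) ^+ i by rewrite ler_pM2l.
have k4 : ps J < c * (1 + i%:R / 4).
 rewrite mulrC -ltr_pdivrMr//; lra.
by have := lt_le_trans k4 (le_trans k3 k2); rewrite ltxx.
Qed.

Lemma drift_neg : exists th, [/\ 0 < th, th < be, th < gm & Ps th < 0].
Proof.
apply: contrapT => /forallNP NE.
have Pn th : 0 < th -> th < bb -> 0 <= Ps th.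
 move=> th0; rewrite lt_min => /andP[tb tg]; rewrite leNgt; apply/negP => P0; exact: (NE th).
have [[th [th0 thb P1 P2]]|H] := ratio Pn.
 (* With both exponents 0, the choice c0 = de = 1/2 makes the bound of [PZ] at most 1/2 + 1/4 +
    1/8. *)
 have [T0 [T00 HT]] := drift_cut (ln (1 / 2) / th) (ltac:(lra) : 0 < 1 / 8 :> R).
 have := PZ T00 th0 (bbe thb) ltac:(by rewrite P1) ltac:(by rewrite P2) (ltac:(lra) : 0 < 1 / 2 :> R) (ltac:(lra) : 0 < 1 / 2 :> R).
 rewrite P1 P2 !mul0r oppr0 expR0.
 by have := HT T0 (lexx _); lra.
have e5 := expR_gt0 (- 5 : R).
have [T0 [T00 HT]] := drift_cut 0 (ltac:(lra) : 0 < expR (- 5) / 2 :> R).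
have iT : 0 < T0^-1 by pos.
have [th [th0 thb /andP[P1 P1T] P2]] := H _ iT.
(* At t = 1/Psi(th) the first exponent is 1 and the second at most 5, whence de = e^-5; the bound of
   [PZ] is then at most e^-1 (1 + 1/2 + 1/4), which is below 1. *)
have t0 : 0 < (Ps th)^-1 by pos.
have Tt : T0 <= (Ps th)^-1 by rewrite -[leLHS]invrK lef_pV2 ?posrE.
have P20 : 0 <= Ps (2 * th) by apply: Pn => //; lra.
have := PZ t0 th0 (bbe thb) (ltW P1) P20 ltr01 e5.
rewrite ln1 mul0r divff ?gt_eqF//; have := HT _ Tt; set E := EX _ _ _ _ => h1 h2.
have h3 : expR (- 5) * expR (Ps (2 * th) / Ps th) <= 1.
 rewrite -expRD -[leRHS](expR0 R) ler_expR.
 have : Ps (2 * th) / Ps th <= 5 by rewrite ler_pdivrMr.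
 lra.
have h4 : E / (2 * expR (- 5)) <= 1 / 4 by rewrite ler_pdivrMr; lra.
have h5 := expR_ge1Dx (1 : R).
have h6 : expR 1 * expR (- 1) = 1 :> R by rewrite -expRD subrr expR0.
have h7 : expR (- 1) <= 1 / 2 :> R by have := expR_gt0 (- 1 : R); nra.
have h8 : 0 < expR (- 1) :> R by exact: expR_gt0.
move: h2; set Y := 1 + _ + _ => h2.
have : Y <= 7 / 4 by rewrite /Y; lra.
by nra.
Qed.

End Drift.

(** * Convergence of the mean absorption time *)

Section Mean.
Hypothesis s20 : 0 <= sg2.
Context (K : nat) (be : R).
Hypotheses (K0 : (0 < K)%N) (acc : forall n, (1 <= n)%N -> (0 < P n (\bigcup_i [set w | (X n i w <= K)%N]))%E)
 (gabe : gm < be) (Hbe : exp_moment_bound p a be) (Pf : Psi_finite Pi be) (Pneg : Psi Pi b sg2 be < 0)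
 (Hsum : forall n, (K.+1 <= n)%N -> (\sum_(1 <= k <oo) ((k%:R `^ be * p n k)%:E) < +oo)%E).

Let be0 : 0 < be. Proof. exact: lt_trans gabe. Qed.
Definition fth (th : R) n x : R := expR (th * (ld x n)).
(** Convexity with Psi(0) = 0. Finiteness at the end point [be] comes from the hypothesis, not from
    the generator limits, which only reach exponents below [be]. *)
Lemma Psi_neg th : 0 < th -> th < be -> Ps th < 0.
Proof.
move=> th0 thb; have [C [C0 HE]] := emb kp a0 Hbe.
pose s := th / be; have s0 : 0 < s by rewrite divr_gt0.
have s1 : s <= 1 by rewrite ler_pdivrMr// mul1r ltW.
have s01 : 0 <= s <= 1 by rewrite ltW.
have E : th = s * be by rewrite /s divfK// gt_eqF.
have i2 : intg Pi (psi_integrand (s * be)) by rewrite -E; apply: (int_psi kp a0 LP HA1 be0 HE) => //; exact: ltW.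
have h : Int Pi (psi_integrand (s * be)) <= s * Int Pi (psi_integrand be).
 rewrite -RintZ//; apply: Rint_le => //; first exact: intgZ.
 move=> x; rewrite /psi_integrand -mulrA; have := exp_conv (be * x) s01.
 by rewrite !mulrBr mulr1 !mulrA; lra.
have : s * Ps be < 0 by rewrite pmulr_rlt0.
rewrite E /Psi; have : sg2 * (s * be) ^+ 2 <= s * (sg2 * be ^+ 2).
 rewrite (_ : sg2 * (s * be) ^+ 2 = s * (s * (sg2 * be ^+ 2))); last by ring.
 by apply: ler_wpM2l; [exact: ltW|rewrite ler_piMl// mulr_ge0// sqr_ge0].
have -> : b * (s * be) = s * (b * be) by ring.
lra.
Qed.

(** For |ln(x/n)| <= B this is [a_ratio]. Beyond B, Potter's bounds are applied with exponents gm -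
    de/2 below n and gm + de/2 above n; compared with gm - de and gm + de they leave a spare factor
    e^(-B de/2), small for B large. *)
Lemma potter_eps de eps : 0 < de -> 0 < eps -> ev (fun n => forall x, (0 < x)%N ->
 `|a x / a n - fth gm n x| <= eps * (fth (gm - de) n x + fth (gm + de) n x)).
Proof.
move=> de0 eps0; have U := PC_UC (reg_var_PC rv).
have [C1 [C10 H1]] := potter_ge U (ltac:(lra) : gm - de / 2 < gm).
have [C2 [C20 H2]] := potter_le U (ltac:(lra) : gm < gm + de / 2).
pose C := expR (C1 + C2) + 1; have C0 : 0 < C by rewrite ltr_wpDl// expR_ge0.
have [B0 HB0] := ev_ger (ln (C / eps) / (de / 2)).
pose B : R := B0%:R.
have CB : C * expR (- (de / 2 * B)) <= eps.
 have : ln (C / eps) <= de / 2 * B by rewrite -ler_pdivrMl ?divr_gt0// [_^-1 * _]mulrC; exact: HB0.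
 rewrite -ler_expR lnK ?posrE ?divr_gt0// ler_pdivrMr// => h.
 by rewrite expRN ler_pdivrMr ?expR_gt0// mulrC.
have d0 : 0 < eps * expR (- ((gm + de) * B)) by pos.
apply: ev_imp (ev_and (ev_ge 1) (a_ratio B d0)) => n [n0 H] x x0.
rewrite /fth; set v := ln x%:R - ln n%:R.
have B00 : 0 <= B by [].
have e1 : 0 < expR ((gm - de) * v) by exact: expR_gt0.
have e2 : 0 < expR ((gm + de) * v) by exact: expR_gt0.
have aE : a x / a n = expR (ln (a x) - ln (a n)) by rewrite expRB !lnK// posrE.
have nR : 0 < n%:R :> R by pos.
have xR : 0 < x%:R :> R by pos.
have CC1 : expR C1 <= C - 1 by rewrite addrK ler_expR lerDl.
have CC2 : expR C2 <= C - 1 by rewrite addrK ler_expR lerDr.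
have [vB|] := boolP (inr n B x).
 apply: (le_trans (H x x0 vB)); rewrite ler_pM2l//.
 move: vB; rewrite /inr -/v ler_norml => /andP[v1 v2].
 apply: (via (expR ((gm + de) * v))); last by rewrite lerDr ltW.
 have gd : 0 < gm + de by pos.
 by rewrite ler_expR -mulrN ler_pM2l.
rewrite /inr -/v -ltNge => vB; rewrite aE.
have nn (u w : R) : 0 <= u -> 0 <= w -> `|u - w| <= u + w.
 by move=> u0 w0; apply: (le_trans (ler_normB _ _)); rewrite !ger0_norm.
apply: (le_trans (nn _ _ (expR_ge0 _) (expR_ge0 _))).
have [v0|v0] := leP v 0.
 have vB' : B < - v by move: vB; rewrite ler0_norm.
 have xn : (x <= n)%N by rewrite -(ler_nat R) -ler_ln ?posrE// -subr_le0.
 have h1 : expR (ln (a x) - ln (a n)) <= expR C1 * expR ((gm - de / 2) * v).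
  by rewrite -expRD ler_expR; have := H1 x n x0 xn; rewrite /v mulrBr; lra.
 have h2 : expR (gm * v) <= expR ((gm - de / 2) * v) by rewrite ler_expR ler_wnM2r//; lra.
 have h3 : expR ((gm - de / 2) * v) <= expR ((gm - de) * v) * expR (- (de / 2 * B)).
  rewrite -expRD ler_expR; have : de / 2 * B <= de / 2 * - v by rewrite ler_pM2l ?divr_gt0// ltW.
  by lra.
 apply: (via (C * expR ((gm - de / 2) * v))).
  apply: (via ((C - 1) * expR ((gm - de / 2) * v) + expR ((gm - de / 2) * v))); last by rewrite mulrBl mul1r subrK.
  by apply: lerD => //; apply: (le_trans h1); rewrite ler_pM2r// expR_gt0.
 apply: (via (C * (expR ((gm - de) * v) * expR (- (de / 2 * B))))); first by rewrite ler_pM2l.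
 rewrite mulrCA; apply: (via (expR ((gm - de) * v) * eps)); first by rewrite ler_pM2l.
 by rewrite mulrC ler_pM2l// lerDl ltW.
have vB' : B < v by move: vB; rewrite gtr0_norm.
have xn : (n <= x)%N by rewrite -(ler_nat R) -ler_ln ?posrE// -subr_ge0 ltW.
have h1 : expR (ln (a x) - ln (a n)) <= expR C2 * expR ((gm + de / 2) * v).
 by rewrite -expRD ler_expR; have := H2 n x n0 xn; rewrite /v mulrBr; lra.
have h2 : expR (gm * v) <= expR ((gm + de / 2) * v) by rewrite ler_expR ler_pM2r//; lra.
have h3 : expR ((gm + de / 2) * v) <= expR ((gm + de) * v) * expR (- (de / 2 * B)).
 rewrite -expRD ler_expR; have : de / 2 * B <= de / 2 * v by rewrite ler_pM2l ?divr_gt0// ltW.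
 by lra.
apply: (via (C * expR ((gm + de / 2) * v))).
 apply: (via ((C - 1) * expR ((gm + de / 2) * v) + expR ((gm + de / 2) * v))); last by rewrite mulrBl mul1r subrK.
 by apply: lerD => //; apply: (le_trans h1); rewrite ler_pM2r// expR_gt0.
apply: (via (C * (expR ((gm + de) * v) * expR (- (de / 2 * B))))); first by rewrite ler_pM2l.
rewrite mulrCA; apply: (via (expR ((gm + de) * v) * eps)); first by rewrite ler_pM2l.
by rewrite mulrC ler_pM2l// lerDr ltW.
Qed.

Lemma fthE th n x k : fth th n k = fth th n x * (expR (th * lr x k) - 1) + fth th n x.
Proof. by rewrite mulrBr mulr1 subrK /fth /lr -expRD; congr expR; ring. Qed.
Lemma Esum_fth th n x : (0 < x)%N -> sm p x (fun u => expR (th * u)) ->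
 summ (p x) (fth th n) /\ Esum (p x) (fth th n) = fth th n x + fth th n x * (mm p a x (fun u => expR (th * u) - 1) / a x).
Proof.
move=> x0 s; have Q := kern kp x0; have [q0' [q1 _]] := Q.
have sb : summ (p x) (fun k => expR (th * lr x k) - 1) by apply: summB => //; exact: summ_cst.
have sc : summ (p x) (fun=> fth th n x) by exact: summ_cst.
have sz : summ (p x) (fun k => fth th n x * (expR (th * lr x k) - 1)) by exact: summZ.
have E : fth th n = fun k => fth th n x * (expR (th * lr x k) - 1) + fth th n x.
 by apply/funext => k; exact: fthE.
split; first by rewrite E; exact: summD.
rewrite {1}E EsumD// EsumZ// (Esum_mm p a0 x (fun u => expR (th * u) - 1)) Esum_cst//; exact: addrC.
Qed.

Lemma drift_ev th e : 0 < th -> th < be -> 0 < e -> ev (fun x => (0 < x)%N /\ forall n,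
 [/\ summ (p x) (fth th n), Esum (p x) (fth th n) + (- Ps th - e) * (fth th n x / a x) <= fth th n x &
  fth th n x <= Esum (p x) (fth th n) + (- Ps th + e) * (fth th n x / a x)]).
Proof.
move=> th0 thb e0; have [C [C0 HE]] := emb kp a0 Hbe.
have G : (fun x => mm p a x (fun u => expR (th * u) - 1)) @ \oo --> Ps th.
 by apply: (gen_exp kp a0 LP HA1 HA2 be0 C0 HE) => //; exact: ltW.
have S := sm_exp kp HE (ltW th0) thb.
apply: ev_imp (ev_and S ((cvgnE _ _).1 G _ e0)) => x [[x0 sx] h]; split => // n.
have [s ->] := Esum_fth n x0 sx; move: h; set mE := mm _ _ _ _; rewrite ler_distl => /andP[h1 h2].
have f0 : 0 <= fth th n x / a x by rewrite divr_ge0 ?expR_ge0// ltW.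
have E c : fth th n x * (mE / a x) + c * (fth th n x / a x) = (mE + c) * (fth th n x / a x) by ring.
split => //; rewrite -addrA E.
 by rewrite gerDl; apply: mulr_le0_ge0 => //; lra.
by rewrite lerDl mulr_ge0//; lra.
Qed.

Lemma summK th n x : 0 < th -> th < be -> (K < x)%N -> summ (p x) (fth th n).
Proof.
move=> th0 thb Kx; have x0 : (0 < x)%N by exact: leq_ltn_trans Kx.
have [Q0 [Q1 _]] := kern kp x0.
have s : summ (p x) (fun k => expR (be * ln k%:R)).
 apply: eEsum_summ => //.
 rewrite nneseries_recl//; last by move=> k _; rewrite lee_fin mulr_ge0// expR_ge0.
 rewrite Q0 mul0r add0e; apply: le_lt_trans (Hsum Kx).
 rewrite le_eqVlt; apply/orP; left; apply/eqP; apply: eq_eseriesr => // k k1.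
 by case: k {k1} => [|k]; [rewrite Q0 mul0r mulr0|rewrite /powR pnatr_eq0/= mulrC].
apply: (summ_le Q1 Q0 _ (summZ (c := expR (- (th * ln n%:R))) s)) => k k0.
rewrite /fth gtr0_norm ?expR_gt0// -expRD ler_expR mulrBr addrC lerD2l.
by apply: ler_wpM2r; [apply: ln_ge0; rewrite ler1n|exact: ltW].
Qed.

(** n enters only through the factor n^-th, and x runs through a finite set; hence the weight of the
    correction [wU] vanishes as n grows. *)
Lemma Wex th c K1 (q : R) : 0 < th -> th < be -> 0 <= c -> 0 < q -> exists2 V, 0 <= V & forall n x, (0 < n)%N -> (K < x)%N -> (x <= K1)%N ->
 Esum (p x) (fth th n) + c * (fth th n x / a x) <= expR (- (th * ln n%:R)) * V * q.
Proof.
move=> th0 thb c0 q0.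
pose g x := Esum (p x) (fth th 1) + c * (fth th 1 x / a x).
have Sc n x : (0 < n)%N -> (K < x)%N -> Esum (p x) (fth th n) + c * (fth th n x / a x) = expR (- (th * ln n%:R)) * g x.
 move=> n0 Kx; have x0 : (0 < x)%N by exact: leq_ltn_trans Kx.
 have [Q0 [Q1 _]] := kern kp x0.
 have E k : fth th n k = expR (- (th * ln n%:R)) * fth th 1 k.
  by rewrite /fth -expRD ln1; congr expR; ring.
 rewrite (_ : fth th n = fun k => expR (- (th * ln n%:R)) * fth th 1 k); last by apply/funext => k; exact: E.
 rewrite EsumZ//; last exact: summK.
 by rewrite /g; ring.
exists ((\sum_(0 <= x < K1.+1) `|g x|) / q) => [|n x n0 Kx xK].
 by rewrite divr_ge0 ?sumr_ge0// ltW.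
rewrite Sc// -mulrA divfK ?gt_eqF// ler_pM2l ?expR_gt0//.
apply: le_trans (ler_norm _) _; rewrite (bigD1_seq x) ?iota_uniq ?mem_index_iota//= lerDl; exact: sumr_ge0.
Qed.

Lemma small_pow (th C e : R) : 0 < th -> 0 <= C -> 0 < e -> ev (fun n => expR (- (th * ln n%:R)) * C <= e).
Proof.
move=> th0 C0 e0; have [J HJ] := expNc_small th0 C0 e0.
apply: ev_imp (ev_ger (expR J%:R : R)) => n hn.
have nR : 0 < n%:R :> R by apply: lt_le_trans hn; exact: expR_gt0.
apply: le_trans (HJ J (leqnn _)); rewrite mulrC ler_wpM2l// ler_expR lerN2 ler_pM2l//.
have E : expR (ln n%:R) = n%:R :> R by rewrite lnK// posrE.
have h : expR J%:R <= expR (ln n%:R) :> R by rewrite E.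
by rewrite ler_expR in h.
Qed.

(** Below some R0, a is bounded by A, so f is at most A*f/a; from R0 on, (x/n)^de is at least
    1/eta. *)
Lemma fth_tail de n (eta : R) : 0 < de -> (0 < n)%N -> 0 < eta -> exists2 A, 0 <= A & forall x, (K < x)%N ->
 fth gm n x <= A * (fth gm n x / a x) + eta * fth (gm + de) n x.
Proof.
move=> de0 n0 eta0; have [R0 HR0] := ev_ger (expR (ln n%:R - ln eta / de)).
exists (\sum_(0 <= x < R0) a x); first by apply: sumr_ge0 => x _; exact: ltW.
move=> x Kx; have f0 : 0 < fth gm n x by exact: expR_gt0.
have [xR|Rx] := ltnP x R0.
 have aA : a x <= \sum_(0 <= x < R0) a x.
  rewrite (bigD1_seq x) ?iota_uniq ?mem_index_iota//= lerDl; apply: sumr_ge0 => i _; exact: ltW.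
 apply: ler_wpDr; first by pos.
 by rewrite mulrCA ler_peMr ?(ltW f0)// ler_pdivlMr// mul1r.
apply: ler_wpDl; first by rewrite mulr_ge0 ?sumr_ge0// => [i _|]; [exact: ltW|rewrite divr_ge0 ?ltW].
have xp : 0 < x%:R :> R by rewrite ltr0n; exact: leq_ltn_trans Kx.
have h : ln n%:R - ln eta / de <= ln x%:R by rewrite -ler_expR lnK//; exact: HR0.
have -> : fth (gm + de) n x = fth gm n x * expR (de * (ld x n)) by rewrite /fth -expRD; congr expR; ring.
rewrite mulrCA ler_peMr ?(ltW f0)//.
rewrite -[X in X * _](lnK (_ : eta \is Num.pos)) ?posrE// -expRD -[leLHS]expR0 ler_expR.
have : ln eta = de * (ln eta / de) by rewrite mulrC divfK// gt_eqF.
have : 0 <= de * (ln x%:R - (ln n%:R - ln eta / de)) by rewrite mulr_ge0 ?subr_ge0// ltW.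
by rewrite !mulrBr => u1 u2; lra.
Qed.

Lemma part_ii : (fun n => (\int[P n]_w hit_time K (X n ^~ w)) * ((a n)^-1)%:E)%E @ \oo --> ((`|Ps gm|)^-1)%:E.
Proof.
have Pg := Psi_neg ga0 gabe; set L := `|_|; have LE : L = - Ps gm by rewrite /L ltr0_norm.
have L0 : 0 < L by rewrite LE oppr_gt0.
pose de := Num.min gm (be - gm) / 2.
have de0 : 0 < de by rewrite divr_gt0// lt_min ga0 subr_gt0.
have deg : de < gm by have : Num.min gm (be - gm) <= gm by [rewrite ge_min lexx]; rewrite /de; have := ga0; lra.
have deb : gm + de < be.
 have : Num.min gm (be - gm) <= be - gm by rewrite ge_min lexx orbT.
 by move: de0; rewrite /de; lra.
have t10 : 0 < gm - de by lra.
have t1b : gm - de < be by have := gabe; lra.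
have t20 : 0 < gm + de by have := ga0; lra.
have P1 := Psi_neg t10 t1b; have P2 := Psi_neg t20 deb.
suff main e : 0 < e -> ev (fun n => ((L^-1 - e)%:E <= (\int[P n]_w hit_time K (X n ^~ w)) * ((a n)^-1)%:E <= (L^-1 + e)%:E)%E).
 apply/fine_cvgP; split.
  have [N HN] := main 1 ltr01; exists N => // n /= Nn; have /andP[h1 h2] := HN n Nn.
  by rewrite fin_numElt (lt_le_trans _ h1) ?ltNyr// (le_lt_trans h2) ?ltry.
 apply/cvgnE => e e0; apply: ev_imp (main e e0) => n /=.
 case: (_ * _)%E => [r| |]//=; rewrite ?lee_fin ?leNye ?leye_eq// ?andbF// ler_distl => /andP[-> ->] //.
(* Keeps both 1/(L - ed) and 1/(L + ed) within e/4 of 1/L. *)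
move=> e0; pose ed := Num.min (L / 2) (e * L ^+ 2 / 8).
have ed0 : 0 < ed by rewrite lt_min !divr_gt0// mulr_gt0// exprn_gt0.
have edL : ed <= L / 2 by rewrite ge_min lexx.
have edE : ed <= e * L ^+ 2 / 8 by rewrite ge_min lexx orbT.
pose c0 := L - ed; pose c3 := L + ed; pose c1 := - Ps (gm - de) / 2; pose c2 := - Ps (gm + de) / 2.
have c00 : 0 < c0 by rewrite /c0; lra.
have c30 : 0 < c3 by rewrite /c3; lra.
have c10 : 0 < c1 by rewrite /c1; lra.
have c20 : 0 < c2 by rewrite /c2; lra.
have [KK HKK] := ev_and (drift_ev ga0 gabe ed0) (ev_and (drift_ev t10 t1b c10) (drift_ev t20 deb c20)).
pose K1 := KK.
have D x : (K1 < x)%N -> _ := fun h => HKK x (ltnW h).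
have [N0 [q [q0 Hq]]] := access_unif acc K1.
have [V0 V00 HV0] := Wex K1 ga0 gabe (ltW c00) q0.
have [V1 V10 HV1] := Wex K1 t10 t1b (ltW c10) q0.
have [V2 V20 HV2] := Wex K1 t20 deb (ltW c20) q0.
(* For large n the two occupation sums are at most 2/c1 and 2/c2, so replacing a_x/a_n by (x/n)^gm
   costs at most e/8. *)
pose eps := e / (8 * (2 / c1 + 2 / c2)).
have cc : 0 < 2 / c1 + 2 / c2 by pos.
have eps0 : 0 < eps by rewrite divr_gt0// mulr_gt0.
have epsE : eps * (2 / c1 + 2 / c2) = e / 8 by rewrite /eps invfM mulrA divfK// gt_eqF.
have eL : 0 < e * L / 16 by pos.
have N00 : 0 <= N0%:R :> R by [].
pose KL := expR (gm * ln K%:R); pose KL1 := expR (gm * ln K1%:R) * (N0%:R / q).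
have KL0 : 0 <= KL by exact: expR_ge0.
have KL10 : 0 <= KL1 by rewrite mulr_ge0 ?expR_ge0// divr_ge0// ltW.
have Hev := ev_and (ev_ge K.+1) (ev_and (potter_eps de0 eps0) (ev_and (small_pow ga0 (mulr_ge0 V00 N00) eL)
 (ev_and (ev_and (small_pow t10 (mulr_ge0 V10 N00) ltr01) (small_pow t20 (mulr_ge0 V20 N00) ltr01))
  (ev_and (small_pow ga0 KL0 eL) (small_pow ga0 KL10 eL))))).
apply: ev_imp Hev => n [Kn [Pot [S0 [[S1 S2] [SK SK1]]]]].
have n0 : (0 < n)%N by exact: leq_ltn_trans Kn.
have fnn (th : R) : fth th n n = 1 by rewrite /fth subrr mulr0 expR0.
have f0 (th : R) x : 0 <= fth th n x by exact: expR_ge0.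
have e0' (th : R) : 0 <= expR (- (th * ln n%:R)) by exact: expR_ge0.
have O0 := @occW _ p a n K K1 N0 q _ _ (P n) (X n) kp a0 n0 (mc n0) Hq (fth gm n) c0 (expR (- (gm * ln n%:R)) * V0) (f0 _) c00
 (mulr_ge0 (e0' _) V00) (fun x Kx => @summK _ n x ga0 gabe Kx)
 ltac:(by move=> x Kx xK; have [[_ /(_ n)[_ h _]] _] := D x xK; rewrite /c0 LE) (fun x => HV0 n x n0).
have O1 := @occW _ p a n K K1 N0 q _ _ (P n) (X n) kp a0 n0 (mc n0) Hq (fth (gm - de) n) c1 (expR (- ((gm - de) * ln n%:R)) * V1) (f0 _) c10
 (mulr_ge0 (e0' _) V10) (fun x Kx => @summK _ n x t10 t1b Kx)
 ltac:(by move=> x Kx xK; have [_ [[_ /(_ n)[_ h _]] _]] := D x xK; move: h; rewrite (_ : - Ps (gm - de) - c1 = c1)//; rewrite /c1; field) (fun x => HV1 n x n0).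
have O2 := @occW _ p a n K K1 N0 q _ _ (P n) (X n) kp a0 n0 (mc n0) Hq (fth (gm + de) n) c2 (expR (- ((gm + de) * ln n%:R)) * V2) (f0 _) c20
 (mulr_ge0 (e0' _) V20) (fun x Kx => @summK _ n x t20 deb Kx)
 ltac:(by move=> x Kx xK; have [_ [_ [_ /(_ n)[_ h _]]]] := D x xK; move: h; rewrite (_ : - Ps (gm + de) - c2 = c2)//; rewrite /c2; field) (fun x => HV2 n x n0).
rewrite fnn in O0; rewrite fnn in O1; rewrite fnn in O2.
have cmp x : (K < x)%N -> `|a x / a n - fth gm n x| <= eps * (fth (gm - de) n x + fth (gm + de) n x).
 by move=> Kx; apply: Pot; exact: leq_ltn_trans Kx.
have CC : eps * ((1 + expR (- ((gm - de) * ln n%:R)) * V1 * N0%:R) / c1 + (1 + expR (- ((gm + de) * ln n%:R)) * V2 * N0%:R) / c2) <= e / 8.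
 rewrite -epsE ler_pM2l//; apply: lerD; rewrite ler_pM2r ?invr_gt0// -mulrA; lra.
have LL : L^-1 * L = 1 by rewrite mulVf// gt_eqF.
have an0 : 0 < a n by [].
have mulI (I : \bar R) (r s : R) : ((a n * r)%:E <= I)%E -> (I <= (a n * s)%:E)%E -> (r%:E <= I * ((a n)^-1)%:E <= s%:E)%E.
 case: I => [t| |]//=; rewrite ?lee_fin ?leye_eq// => u1 u2.
 by rewrite ler_pdivlMr// ler_pdivrMr// ![_ * a n]mulrC u1 u2.
have up := fin_up a0 Kn (mc n0) (f0 _) (f0 _) (f0 _) (ltW eps0) O0 O1 O2 c00 c10 c20 cmp.
have ln_mono x y : (x <= y)%N -> (0 < y)%N -> ln x%:R <= ln y%:R :> R.
 move=> xy y0; case: x xy => [_|x xy]; first by rewrite ln0// ln_ge0// ler1n.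
 by rewrite ler_ln ?posrE ?ltr0n// ler_nat.
pose Ks := fth gm n K1; pose Kh := fth gm n K.
have fm x y : (x <= y)%N -> (0 < y)%N -> fth gm n x <= fth gm n y.
 by move=> xy y0; rewrite /fth ler_expR ler_pM2l// lerD2r ln_mono.
have lo := fin_lo kp a0 n0 Kn (mc n0) q0 Hq (f0 _) (f0 _) (f0 _) (ltW eps0) (f0 gm K1) c30 (fun x Kx => @summK _ n x ga0 gabe Kx) (fnn gm) O0 O1 O2 c00 c10 c20
 ltac:(by move=> x Kx xK; have [[_ /(_ n)[_ _ h]] _] := D x xK; rewrite /c3 LE)
 ltac:(by move=> x Kx xK; apply: fm => //; apply: leq_trans xK; exact: leq_ltn_trans Kx)
 (fun x xK => fm x K xK K0) (f0 gm K) cmp (fun eta => @fth_tail de n eta de0 n0) eL.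
have KhE : Kh = expR (- (gm * ln n%:R)) * KL by rewrite /Kh /fth /KL -expRD; congr expR; ring.
have KsE : Ks * (N0%:R / q) = expR (- (gm * ln n%:R)) * KL1.
 by rewrite /Ks /fth /KL1 mulrA -expRD; congr (expR _ * _); ring.
have ILe : c0^-1 <= L^-1 + e / 4.
 rewrite -[leLHS]mul1r ler_pdivrMr//; have : ed * L^-1 <= e * L / 8.
  by rewrite ler_pdivrMr//; move: edE; rewrite expr2; lra.
 have : e * ed <= e * (L / 2) by rewrite ler_pM2l.
 rewrite /c0 mulrDl !mulrBr LL; set z := L^-1 * ed; rewrite [ed * _]mulrC -/z; lra.
have ILe3 : L^-1 - e / 4 <= c3^-1.
 rewrite -[leRHS]mul1r ler_pdivlMr//; have : ed * L^-1 <= e * L / 8.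
  by rewrite ler_pdivrMr//; move: edE; rewrite expr2; lra.
 have : 0 < e * ed by pos.
 have : 0 < e * L by pos.
 rewrite /c3 mulrDr !mulrBl LL; set z := L^-1 * ed; rewrite [ed * _]mulrC -/z; lra.
apply: mulI.
 apply: le_trans lo; rewrite lee_fin ler_pM2l// -/Ks -/Kh KhE KsE.
 move: CC SK SK1; set z1 := eps * _; set z2 := _ * KL; set z3 := _ * KL1 => h1 h2 h3.
 have : (1 - z2 - e * L / 16 - z3) / c3 >= c3^-1 - (3 * (e * L / 16)) / c3.
  by rewrite -[X in X - _]mul1r -mulrBl ler_pM2r ?invr_gt0//; lra.
 have : 3 * (e * L / 16) / c3 <= 3 * e / 16.
  rewrite ler_pdivrMr// /c3; have : 0 < e * ed by pos.
  by lra.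
 lra.
apply: (le_trans up); rewrite lee_fin ler_pM2l//.
move: CC S0; set z1 := eps * _; set W := _ * V0; rewrite mulrA -/W => h1 h2.
have : (1 + W * N0%:R) / c0 <= c0^-1 + e * L / 16 / c0.
 rewrite [leRHS](_ : _ = (1 + e * L / 16) / c0); last by rewrite mulrDl mul1r.
 by rewrite ler_pM2r ?invr_gt0// lerD2l.
have : e * L / 16 / c0 <= e / 8.
 rewrite ler_pdivrMr//; have : e * (L / 2) <= e * c0 by rewrite ler_pM2l// /c0; lra.
 by lra.
lra.
Qed.

End Mean.
End Main.

Theorem theorem3 (R : realType)
  (p : nat -> nat -> R) (a : nat -> R) (gamma : R)
  (Pi : {measure set R -> \bar R}) (b sigma2 : R)
  (* chains X_n, n >= 1, each on its own probability space *)
  (dT : measure_display) (T : nat -> measurableType dT)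
  (P : forall n, probability (T n) R) (X : forall n, nat -> T n -> nat)
  (* Levy process xi *)
  (dO : measure_display) (O : measurableType dO) (PO : probability O R)
  (xi : R -> O -> R)
  (K : nat) :
  is_kernel p ->
  0 < gamma -> reg_var a gamma ->
  levy_measure Pi -> 0 <= sigma2 ->
  (forall n, (1 <= n)%N -> markov_chain (P n) p n (X n)) ->
  A1 p a Pi -> A2 p a Pi b sigma2 -> A3 p a ->
  levy_process PO Pi b sigma2 xi -> drifts_to_minus_infty PO xi ->
  (1 <= K)%N ->
  (forall n, (1 <= n)%N ->
     (0 < P n (\bigcup_i [set w | (X n i w <= K)%N]))%E) ->
  (* (i) joint convergence in distribution in D(R_+,R) x [0,+oo] *)
  (forall F : (R -> R) -> \bar R -> R, bcont_functional F ->
     (fun n => Rintegral (P n) setT (fun w =>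
         F (fun t => (stopped K (X n ^~ w) (Num.truncn (a n * t)))%:R / n%:R)
           (hit_time K (X n ^~ w) * ((a n)^-1)%:E)%E))
     @ \oo -->
     Rintegral PO setT (fun w =>
         F (Yproc gamma (fun s => xi s w)) (I_infty gamma (fun s => xi s w))))
  /\
  (* (ii) convergence of the mean *)
  (forall beta0, A4 p a Pi b sigma2 gamma beta0 ->
     (forall n, (K.+1 <= n)%N ->
        (\sum_(1 <= k <oo) ((k%:R `^ beta0 * p n k)%:E) < +oo)%E) ->
     (fun n => (\int[P n]_w hit_time K (X n ^~ w)) * ((a n)^-1)%:E)%E
       @ \oo --> ((`|Psi Pi b sigma2 gamma|)^-1)%:E).
Proof.
move=> kp ga0 rv LP s20 mc HA1 HA2 HA3 LV DR K1 acc.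
have a0 : forall n, 0 < a n by case: rv.
split.
  move=> F bF; have [be be0 Hbe] := HA3; have [Cb [Cb0 HE]] := emb kp a0 Hbe.
  have [th [th0 thbe thga Psth]] := drift_neg kp ga0 rv LP mc HA1 HA2 HA3 s20 LV DR be0 Cb0 HE.
  exact: (part_i kp ga0 rv LP mc HA1 HA2 HA3 K1 acc th0 thbe Hbe thga Psth LV DR bF).
move=> be [gb [Hb [Pf Pn]]] Hs.
exact: (part_ii kp ga0 rv LP mc HA1 HA2 s20 K1 acc gb Hb Pf Pn Hs).
Qed.
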